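(* Suppose $\Omega\subset\mathbb{P}(\mathbb{R}^{n+1})$ is a proper convex open set and there exists a discrete group $\Gamma\leq\mathrm{Aut}(\Omega)$ which acts properly, freely, and cocompactly on $\Omega$. Then $h_{vol}(\Omega,H_\Omega,\mu_B)\le n-1$, with equality if and only if $\Omega$ is projectively isomorphic to the ball $\mathcal{B}$ (and in particular, in this case, $(\Omega,H_\Omega)$ is isometric to real hyperbolic space $\mathbb{H}^n$).
   Context: An open set $\Omega\subset\mathbb{P}(\mathbb{R}^{n+1})$ is proper convex if it is contained, as a bounded convex open set, in some affine chart. $\mathrm{Aut}(\Omega)=\{\varphi\in \mathrm{PGL}_{n+1}(\mathbb{R}) : \varphi\Omega=\Omega\}$. The Hilbert metric is $H_\Omega(x,y)=\frac12\log\frac{|x-b|\,|y-a|}{|x-a|\,|y-b|}$ for $x\ne y$ in $\Omega$, where $a,b\in\partial\Omega$ are the intersection points of the line through $x,y$ with $\partial\Omega$, in the order $a,x,y,b$ (computed in an affine chart in which $\Omega$ is bounded), and $H_\Omega(x,x)=0$; it is $\mathrm{Aut}(\Omega)$-invariant. $\mathcal{B}$ is the unit ball of an affine chart; $(\mathcal{B},H_{\mathcal{B}})$ is the Klein–Beltrami model of $\mathbb{H}^n$. $\Omega$ is projectively isomorphic to $\mathcal{B}$ if $\varphi\Omega=\mathcal{B}$ for some $\varphi\in\mathrm{PGL}_{n+1}(\mathbb{R})$. The Busemann–Hausdorff volume $\mu_B$ of $(\Omega,H_\Omega)$ is the $n$-dimensional Hausdorff measure of $H_\Omega$ (normalized as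 usual); equivalently, in an affine chart it has density $\omega_n/\mathrm{Leb}(B_x(1))$ with respect to Lebesgue measure, where $B_x(1)$ is the unit ball of the Finsler norm of $H_\Omega$ at $x$ and $\omega_n$ is the volume of the Euclidean unit ball. The volume growth entropy is $h_{vol}(\Omega,H_\Omega,\mu_B)=\limsup_{r\to\infty}\frac1r\log\mu_B(B_r(o))$, where $B_r(o)$ is the open $H_\Omega$-ball of radius $r$ about $o\in\Omega$ (independent of $o$). *)

(* Defs.v *)
From HB Require Import structures.
From mathcomp Require Import all_boot all_order all_algebra.
From mathcomp Require Import all_classical all_reals all_analysis.
Import Order.TTheory GRing.Theory Num.Theory.
Import numFieldNormedType.Exports.

Set Implicit Arguments.
Unset Strict Implicit.
Unset Printing Implicit Defensive.

Local Open Scope classical_set_scope.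
Local Open Scope ring_scope.
Local Open Scope quotient_scope.

Section scalar_quotient.
Context {R : realType} {V : normedModType R} (U : set V).

Definition proportional (v w : U) : bool :=
  `[< exists2 c : R, c != 0 & val w = c *: val v >].

Lemma proportional_refl : reflexive proportional.
Proof. by move=> v; apply/asboolP; exists 1; rewrite ?oner_neq0 ?scale1r. Qed.

Lemma proportional_sym : symmetric proportional.
Proof.
suff H v w : proportional v w -> proportional w v.
  by move=> v w; apply/idP/idP; exact: H.
move=> /asboolP[c c0 E]; apply/asboolP; exists c^-1; first by rewrite invr_neq0.
by rewrite E scalerA mulVf// scale1r.
Qed.

Lemma proportional_trans : transitive proportional.
Proof.
move=> v u w /asboolP[c c0 Ev] /asboolP[d d0 Ew]; apply/asboolP.
by exists (d * c); rewrite ?mulf_neq0// Ew Ev scalerA.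
Qed.

Definition proportional_equiv :=
  EquivRel proportional proportional_refl proportional_sym proportional_trans.

Definition scalar_quotient := {eq_quot proportional_equiv}.

HB.instance Definition _ :=
  Topological.copy scalar_quotient (quotient_topology scalar_quotient).
HB.instance Definition _ := Quotient.on scalar_quotient.

Definition sclass (v : V) (Uv : U v) : scalar_quotient :=
  \pi_scalar_quotient (exist _ v (mem_set Uv) : U).

Definition srepr (p : scalar_quotient) : V := val (repr p).

Lemma sreprP (p : scalar_quotient) : U (srepr p).
Proof. exact: set_valP. Qed.

Lemma sclassP (v w : V) (Uv : U v) (Uw : U w) :
  sclass Uv = sclass Uw <-> exists2 c : R, c != 0 & w = c *: v.
Proof.
split; first by move=> /eqmodP /asboolP.
by move=> H; apply/eqmodP/asboolP.
Qed.

Lemma sclassK (p : scalar_quotient) : sclass (sreprP p) = p.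
Proof.
rewrite -[RHS]reprK /sclass; congr (\pi _).
exact: val_inj.
Qed.

Lemma srepr_sclass (v : V) (Uv : U v) :
  exists2 c : R, c != 0 & srepr (sclass Uv) = c *: v.
Proof. by apply/(sclassP Uv (sreprP _)); rewrite sclassK. Qed.

End scalar_quotient.

Definition projective (R : realType) (n : nat) :=
  scalar_quotient [set v : 'cV[R]_n | v != 0].

Definition PGL (R : realType) (n : nat) :=
  scalar_quotient [set g : 'M[R]_n | g \in unitmx].

HB.instance Definition _ (R : realType) (n : nat) :=
  Topological.on (projective R n).
HB.instance Definition _ (R : realType) (n : nat) := Topological.on (PGL R n).

Section projective_linear_group.
Context {R : realType} {n : nat}.
Local Notation P := (projective R n).
Local Notation G := (PGL R n).

Lemma PGL_unit (g : G) : srepr g \in unitmx. Proof. exact: sreprP g. Qed.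

Lemma mulmx_unit (g h : 'M[R]_n) :
  g \in unitmx -> h \in unitmx -> g *m h \in unitmx.
Proof. by rewrite unitmx_mul => -> ->. Qed.

Lemma invmx_unit (g : 'M[R]_n) : g \in unitmx -> invmx g \in unitmx.
Proof. by rewrite unitmx_inv. Qed.

Lemma act_neq0 (g : 'M[R]_n) (v : 'cV[R]_n) :
  g \in unitmx -> v != 0 -> g *m v != 0.
Proof.
move=> gU; apply: contraNneq => gv0.
by rewrite -[v](mulKmx gU) gv0 mulmx0.
Qed.

Definition pgl_of (g : 'M[R]_n) (gU : g \in unitmx) : G :=
  @sclass R _ [set g : 'M[R]_n | g \in unitmx] g gU.

Definition pgl_one : G := pgl_of (unitmx1 R n).
Definition pgl_mul (g h : G) : G :=
  pgl_of (mulmx_unit (PGL_unit g) (PGL_unit h)).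
Definition pgl_inv (g : G) : G := pgl_of (invmx_unit (PGL_unit g)).

Definition pgl_act (g : G) (p : P) : P :=
  sclass (U := [set v : 'cV[R]_n | v != 0]) (act_neq0 (PGL_unit g) (sreprP p)).

Lemma pgl_mul1 : left_id pgl_one pgl_mul.
Proof.
move=> g; rewrite -[RHS]sclassK; apply/sclassP.
have [c c0 ->] := srepr_sclass (U := [set g : 'M[R]_n | g \in unitmx])
  (unitmx1 R n).
exists c^-1; rewrite ?invr_neq0// -scalemxAl mul1mx scalerA mulVf//.
by rewrite scale1r.
Qed.

Lemma pgl_1mul : right_id pgl_one pgl_mul.
Proof.
move=> g; rewrite -[RHS]sclassK; apply/sclassP.
have [c c0 ->] := srepr_sclass (U := [set g : 'M[R]_n | g \in unitmx])
  (unitmx1 R n).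
exists c^-1; rewrite ?invr_neq0// -scalemxAr mulmx1 scalerA mulVf//.
by rewrite scale1r.
Qed.

Lemma pgl_mulA : associative pgl_mul.
Proof.
move=> g h k; apply/sclassP.
have [c c0 ->] := srepr_sclass (U := [set g : 'M[R]_n | g \in unitmx])
  (mulmx_unit (PGL_unit g) (PGL_unit h)).
have [d d0 ->] := srepr_sclass (U := [set g : 'M[R]_n | g \in unitmx])
  (mulmx_unit (PGL_unit h) (PGL_unit k)).
exists (c / d); first by rewrite mulf_neq0// invr_neq0.
by rewrite -scalemxAl -scalemxAr scalerA -mulrA mulVf// mulr1 mulmxA.
Qed.

Lemma pgl_mulV : left_inverse pgl_one pgl_inv pgl_mul.
Proof.
move=> g; apply/sclassP.
have [c c0 ->] := srepr_sclass (U := [set g : 'M[R]_n | g \in unitmx])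
  (invmx_unit (PGL_unit g)).
exists c^-1; rewrite ?invr_neq0//.
by rewrite -scalemxAl scalerA mulVf// scale1r mulVmx// PGL_unit.
Qed.

Lemma pgl_Vmul : right_inverse pgl_one pgl_inv pgl_mul.
Proof.
move=> g; apply/sclassP.
have [c c0 ->] := srepr_sclass (U := [set g : 'M[R]_n | g \in unitmx])
  (invmx_unit (PGL_unit g)).
exists c^-1; rewrite ?invr_neq0//.
by rewrite -scalemxAr scalerA mulVf// scale1r mulmxV// PGL_unit.
Qed.

HB.instance Definition _ :=
  isGroup.Build G pgl_mulA pgl_mul1 pgl_1mul pgl_mulV pgl_Vmul.

Lemma pgl_act1 (p : P) : pgl_act 1%g p = p.
Proof.
rewrite -[RHS]sclassK; apply/sclassP.
have [c c0 ->] := srepr_sclass (U := [set g : 'M[R]_n | g \in unitmx])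
  (unitmx1 R n).
exists c^-1; rewrite ?invr_neq0// -scalemxAl mul1mx scalerA mulVf//.
by rewrite scale1r.
Qed.

Lemma pgl_actM (g h : G) (p : P) :
  pgl_act (g * h)%g p = pgl_act g (pgl_act h p).
Proof.
apply/sclassP.
have [c c0 ->] := srepr_sclass (U := [set g : 'M[R]_n | g \in unitmx])
  (mulmx_unit (PGL_unit g) (PGL_unit h)).
have [d d0 ->] := srepr_sclass (U := [set v : 'cV[R]_n | v != 0])
  (act_neq0 (PGL_unit h) (sreprP p)).
exists (d / c); first by rewrite mulf_neq0// invr_neq0.
by rewrite -scalemxAl -scalemxAr scalerA -mulrA mulVf// mulr1 mulmxA.
Qed.

End projective_linear_group.

Section convex_projective.
Context {R : realType} {n : nat}.
Local Notation P := (projective R n.+1).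
Local Notation G := (PGL R n.+1).

Lemma homogeneous_neq0 (x : 'cV[R]_n) :
  (col_mx (1 : 'M[R]_1) x : 'cV[R]_n.+1) != 0.
Proof.
apply/eqP => /matrixP/(_ 0 0).
have -> : 0 = lshift n (0 : 'I_1) :> 'I_(1 + n) by exact: val_inj.
by rewrite (@col_mxEu _ 1) !mxE => /eqP; rewrite oner_eq0.
Qed.

(** The affine charts of P(R^(n+1)) are the images under projective
    transformations of the standard one, x |-> [1 : x_1 : ... : x_n]. *)
Definition affine_chart (g : G) (x : 'cV[R]_n) : P :=
  pgl_act g (sclass (U := [set v : 'cV[R]_n.+1 | v != 0]) (homogeneous_neq0 x)).

Definition bounded_convex_in_chart (Omega : set P) (g : G) :=
  exists C : set 'cV[R]_n,
    [/\ open C, bounded_set C, convex_set (C : set (convex_lmodType 'cV[R]_n))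
      & Omega = affine_chart g @` C].

Definition proper_convex (Omega : set P) :=
  open Omega /\ exists g : G, bounded_convex_in_chart Omega g.

Definition Aut (Omega : set P) : set G :=
  [set phi | pgl_act phi @` Omega = Omega].

Definition projectively_isomorphic (Omega Omega' : set P) :=
  exists phi : G, pgl_act phi @` Omega = Omega'.

(** The norm `|x| of the library is the sup norm. *)
Definition euclidean_norm (x : 'cV[R]_n) : R :=
  Num.sqrt (\sum_(i < n) x i 0 ^+ 2).

(** With its Hilbert metric, this is the Klein-Beltrami model of hyperbolic
    n-space. *)
Definition projective_ball : set P :=
  affine_chart 1%g @` [set x | euclidean_norm x < 1].

(** The points a, x, y, b lie on a line in this order. *)
Definition hilbert_endpoints (C : set 'cV[R]_n) (x y a b : 'cV[R]_n) :=
  [/\ (closure C `\` interior C) a, (closure C `\` interior C) b,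
      exists2 s : R, s < 0 & a = x + s *: (y - x)
    & exists2 t : R, 1 < t & b = x + t *: (y - x)].

(** d is the Hilbert distance of p and q computed in some affine chart in which
    Omega is bounded. *)
Definition is_hilbert_distance (Omega : set P) (p q : P) (d : R) :=
  (p = q /\ d = 0) \/
  (p <> q /\ exists g x y a b,
    [/\ bounded_convex_in_chart Omega g,
        p = affine_chart g x, q = affine_chart g y,
        hilbert_endpoints (affine_chart g @^-1` Omega) x y a b
      & d = 2^-1 * ln ((euclidean_norm (x - b) * euclidean_norm (y - a)) /
                       (euclidean_norm (x - a) * euclidean_norm (y - b)))]).

(** For p, q in a proper convex set, exactly one d satisfies
    [is_hilbert_distance], by projective invariance of the cross-ratio. *)
Definition hilbert_metric (Omega : set P) (p q : P) : R :=
  xget 0 [set d | is_hilbert_distance Omega p q d].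

Definition is_subgroup (Gamma : set G) := group_closed (mem Gamma).

Definition discrete_subset (Gamma : set G) := Gamma `<=` isolated Gamma.

(** Properness for a discrete group: only finitely many elements move a given
    compact set to one that meets it. *)
Definition acts_properly (Gamma : set G) (Omega : set P) :=
  forall K : set P, compact K -> K `<=` Omega ->
    finite_set [set gamma | Gamma gamma /\ pgl_act gamma @` K `&` K !=set0].

Definition acts_freely (Gamma : set G) (Omega : set P) :=
  forall gamma p, Gamma gamma -> Omega p -> pgl_act gamma p = p -> gamma = 1%g.

Definition acts_cocompactly (Gamma : set G) (Omega : set P) :=
  exists K : set P, [/\ compact K, K `<=` Omega
    & \bigcup_(gamma in Gamma) (pgl_act gamma @` K) = Omega].

End convex_projective.

Arguments projective_ball : clear implicits.

Section metric_geometry.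
Context {R : realType} {T : Type}.
Local Open Scope ereal_scope.

(** Volume of the Euclidean unit ball of R^n, through
    omega_(n+2) = 2 pi / (n+2) * omega_n. *)
Fixpoint unit_ball_volume (n : nat) : R :=
  match n with
  | 0%N => 1
  | 1%N => 2
  | m.+2 => (2 * pi / m.+2%:R * unit_ball_volume m)%R
  end.

(** Joining with 0 makes the diameter of the empty set 0. *)
Definition diameter (d : T -> T -> R) (A : set T) : \bar R :=
  ereal_sup ([set 0] `|` [set (d z.1 z.2)%:E | z in A `*` A]).

(** The n-dimensional Hausdorff (outer) measure, n > 0, of the metric space
    (X, d), normalized so as to agree with Lebesgue measure on R^n. *)
Definition hausdorff_premeasure (n : nat) (X : set T) (d : T -> T -> R)
    (delta : R) (A : set T) : \bar R :=
  ereal_inf [set \sum_(0 <= k <oo)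
                   (unit_ball_volume n / 2 ^+ n)%:E * diameter d (F k) ^+ n
    | F in [set F : (set T)^nat |
        [/\ forall k, F k `<=` X, A `<=` \bigcup_k F k
          & forall k, diameter d (F k) <= delta%:E]]].

Definition hausdorff_measure (n : nat) (X : set T) (d : T -> T -> R)
    (A : set T) : \bar R :=
  ereal_sup [set hausdorff_premeasure n X d delta A
    | delta in [set delta : R | (0 < delta)%R]].

Definition metric_ball (X : set T) (d : T -> T -> R) (o : T) (r : R) : set T :=
  [set x | X x /\ (d o x < r)%R].

Definition volume_entropy (X : set T) (d : T -> T -> R) (mu : set T -> \bar R)
    (o : T) : \bar R :=
  limf_esup (fun r : R => (r^-1)%:E * lne (mu (metric_ball X d o r)))
            (pinfty_nbhs R).

End metric_geometry.

Definition isometric {R : realType} {T T' : Type} (X : set T)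
    (d : T -> T -> R) (X' : set T') (d' : T' -> T' -> R) :=
  exists2 f : T -> T', set_bij X X' f
    & forall x y, X x -> X y -> d' (f x) (f y) = d x y.

Definition busemann_volume {R : realType} {n : nat}
    (Omega : set (projective R n.+1)) : set (projective R n.+1) -> \bar R :=
  hausdorff_measure n Omega (hilbert_metric Omega).

(* Submission.v *)
(** Lift Omega to an open convex cone C in R^(n+1) and the group to matrices g_i
    preserving C.  Fix x1 in C and y1 in the dual cone with y1(x1) = 1, and put
    l_i = y1 g_i^-1, v_i = g_i x1.  Up to bounded factors, l_i(x1) y1(v_i) is
    exp(2 d(x1, v_i)), so the Poincare series
      H_k(x, y) = sum_i (l_i(x) y(v_i))^-k    (y(x) = 1)
    converges for 2k above a critical exponent 2 kc, it diverges at kc, and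
    covering balls by translates of a compact set gives h_vol <= 2 kc.

    For k > kc, minimizing H_k over y and then maximizing over x, which is
    possible by cocompactness, yields a point (x, y).  Let z_i, lam_i be v_i, l_i
    normalized by y(z_i) = lam_i(x) = 1, and E the mean with weights
    (l_i(x) y(v_i))^-k.  The first variation gives E z = x and E lam = y.  With
    S = E z z^T, W = S^-1 and q = (n + 1) y^T y - W, the second variation bounds
    the mean square of r_i = lam_i - z_i^T q / n in the norm S by a quantity
    that, as k tends to kc, becomes proportional to n - 1 - 2 kc.  Hence
    2 kc <= n - 1; in case of equality the residuals r_i tend to 0, and the
    forms q subconverge to a form of signature (1, n) which every g_i preserves
    up to a positive factor.  By cocompactness the boundary of C lies on its null
    cone, so Omega is a ball.

    Conversely, for the ball, in a box of points at distance about r from the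
    center the Hilbert metric dominates suitably rescaled coordinates, and
    counting grid points of the box shows that any cover by sets of bounded
    diameter has mass at least a multiple of exp((n - 1) r). *)
Require Import Defs.
From mathcomp Require Import all_boot all_order all_algebra.
From mathcomp Require Import all_classical all_reals all_analysis.
From mathcomp Require Import ring lra.
Import Order.TTheory GRing.Theory Num.Theory.
Import numFieldNormedType.Exports.

Set Implicit Arguments.
Unset Strict Implicit.
Unset Printing Implicit Defensive.

Local Open Scope classical_set_scope.
Local Open Scope ring_scope.

(** * Weighted means and the minimax principle *)

(* lra slows down with the number of hypotheses in the context. *)
Ltac drop := repeat match goal with H : is_true _ |- _ => clear H end.
Ltac clra := drop; lra.

(** Nothing guarantees that the minimizing y depends smoothly on x, so the second variation is never
    a second derivative. Instead a competitor y' at x + tX, known only to give H at most the saddle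
    value, is fed into second-order Taylor bounds of u^-k, and a completed square eliminates y'.
    Testing with X = z_i - x and averaging turns the result into an inequality between traces, where
    the dimension enters through tr(W S) = n + 1. The remaining unknown is the mean of lam_i(z_i) =
    1 / (l_i(x) y(v_i)). It tends to 0 as k decreases to kc because the series diverges at kc, so
    that the mass escapes to distant group elements. Divergence at kc holds because convergence is
    an open condition on the exponent, which follows from factoring a long group element through a
    shell of moderately long ones. In the equality case compactness needs bounds on W that do not
    deteriorate as k tends to kc. They come from the small residuals: up to r_i, the covector z_i^T
    W is a combination of y and the positive functional lam_i. *)

Section second_order_bounds.
Context {R : realType}.
Implicit Types k u U r m : R.

(* A function whose second derivative is at least m between 0 and u lies above
   its second-order Taylor polynomial with quadratic coefficient m / 2. *)
Lemma taylor2_ge (f f1 f2 : R -> R) (u m a : R) : a < 0 -> a < u ->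
  (forall v, a < v -> is_derive v 1 f (f1 v)) ->
  (forall v, a < v -> is_derive v 1 f1 (f2 v)) ->
  (forall v, (0 <= v <= u) || (u <= v <= 0) -> m <= f2 v) ->
  f 0 + f1 0 * u + m / 2 * u ^+ 2 <= f u.
Proof.
move=> a0 au df df1 mf2.
pose h v := f v - f1 0 * v - m / 2 * v ^+ 2.
have dh v : a < v -> is_derive v 1 h (f1 v - f1 0 - m * v).
  move=> av; have := df _ av => dfv.
  rewrite /h; apply: is_derive_eq.
  rewrite /GRing.scale/=; by lra.
suff : h 0 <= h u by rewrite /h; lra.
have ineq v : (0 <= v <= u) || (u <= v <= 0) -> 0 <= (f1 v - f1 0 - m * v) * v.
  move=> vu; have av : a < v by case/orP: vu => /andP[? ?]; lra.
  have [->|v0] := eqVneq v 0; first by rewrite mulr0.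
  have [c cv E] : exists2 c, (0 <= c <= u) || (u <= c <= 0) &
      f1 v - f1 0 = f2 c * v.
    have [vpos|vneg|v00] := ltrgt0P v; last by rewrite v00 eqxx in v0.
      have [||c] := @MVT R f1 f2 0 v vpos.
      - by move=> x; rewrite in_itv/= => /andP[x0 _]; apply: df1; lra.
      - apply: derivable_within_continuous => x; rewrite in_itv/= => /andP[x0 _].
        by apply: ex_derive; apply: df1; lra.
      rewrite in_itv/= => /andP[c0 cv] E; exists c; last by rewrite E subr0.
      by apply/orP; left; case/orP: vu => /andP[? ?]; apply/andP; split; lra.
    have [||c] := @MVT R f1 f2 v 0 vneg.
    - by move=> x; rewrite in_itv/= => /andP[x0 _]; apply: df1; lra.
    - apply: derivable_within_continuous => x; rewrite in_itv/= => /andP[x0 _].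
      by apply: ex_derive; apply: df1; lra.
    rewrite in_itv/= => /andP[c0 cv] E; exists c; last by lra.
    by apply/orP; right; case/orP: vu => /andP[? ?]; apply/andP; split; lra.
  rewrite E; have -> : (f2 c * v - m * v) * v = (f2 c - m) * v ^+ 2 by ring.
  by rewrite mulr_ge0 ?sqr_ge0// subr_ge0 mf2.
have [upos|uneg|->//] := ltrgt0P u.
  have [||c] := @MVT R h (fun v => f1 v - f1 0 - m * v) 0 u upos.
  - by move=> x; rewrite in_itv/= => /andP[x0 _]; apply: dh; lra.
  - apply: derivable_within_continuous => x; rewrite in_itv/= => /andP[x0 _].
    by apply: ex_derive; apply: dh; lra.
  rewrite in_itv/= => /andP[c0 cu] E.
  have : 0 <= (f1 c - f1 0 - m * c) * c 
    by apply: ineq; rewrite (ltW c0) (ltW cu).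
  by rewrite pmulr_lge0// => H; rewrite -subr_ge0 E mulr_ge0// subr0 ltW.
have [||c] := @MVT R h (fun v => f1 v - f1 0 - m * v) u 0 uneg.
- by move=> x; rewrite in_itv/= => /andP[x0 _]; apply: dh; lra.
- apply: derivable_within_continuous => x; rewrite in_itv/= => /andP[x0 _].
  by apply: ex_derive; apply: dh; lra.
rewrite in_itv/= => /andP[c0 cu] E.
have : 0 <= (f1 c - f1 0 - m * c) * c.
  by apply: ineq; rewrite (ltW c0) (ltW cu) orbT.
rewrite nmulr_lge0// => H; rewrite -subr_le0 E sub0r.
by rewrite mulr_le0_ge0// oppr_ge0 ltW.
Qed.

Let dpow k (v : R) : -1 < v ->
  is_derive v 1 (fun u => (1 + u) `^ (- k)) (- k * (1 + v) `^ (- k - 1)).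
Proof.
move=> v1; have H : is_derive (1 + v) 1 (@powR R ^~ (- k)) (- k * (1 + v) `^ (- k - 1)).
  by apply: is_derive1_powR; lra.
have H2 : is_derive v 1 (fun u : R => 1 + u) 1.
  by apply: is_derive_eq; rewrite add0r mulr1.
have := @is_derive1_comp _ (@powR R ^~ (- k)) (fun u : R => 1 + u) v _ _ H H2.
by rewrite mulr1.
Qed.

Let dpow1 k (v : R) : -1 < v ->
  is_derive v 1 (fun u => - k * (1 + u) `^ (- k - 1))
    (k * (k + 1) * (1 + v) `^ (- (k + 2))).
Proof.
move=> v1; have := dpow (k + 1) v1 => H.
have -> : (fun u => - k * (1 + u) `^ (- k - 1)) =
    (- k) \*: (fun u : R => (1 + u) `^ (- (k + 1))).
  by apply/funext => u /=; rewrite /GRing.scale/=; congr (_ * _ `^ _); ring.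
apply: is_derive_eq.
rewrite /GRing.scale/= mulrA; congr (_ * _ `^ _); ring.
Qed.

Lemma powRN_le (a b p : R) : 0 <= p -> 0 < a -> a <= b -> b `^ (- p) <= a `^ (- p).
Proof.
move=> p0 a0 ab; rewrite !powRN lef_pV2 ?posrE ?powR_gt0 ?(lt_le_trans a0 ab)//.
by apply: ge0_ler_powR => //; rewrite nnegrE; lra.
Qed.

Lemma powRN_ge_quad k u U : 0 <= k -> -1 < u -> u <= U -> 0 <= U ->
  1 - k * u + k * (k + 1) * (1 + U) `^ (- (k + 2)) / 2 * u ^+ 2
    <= (1 + u) `^ (- k).
Proof.
move=> k0 u1 uU U0.
have := @taylor2_ge (fun u => (1 + u) `^ (- k)) _ _ u
  (k * (k + 1) * (1 + U) `^ (- (k + 2))) (-1) _ u1 (@dpow k) (@dpow1 k).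
rewrite !addr0 !powR1 mulr1 mulNr; apply; first by lra.
move=> v vu; rewrite ler_wpM2l ?mulr_ge0 ?addr_ge0//.
by apply: powRN_le; [lra|case/orP: vu => /andP[? ?]; lra|
  case/orP: vu => /andP[? ?]; lra].
Qed.

(** The same monotonicity, applied to the negated function: the second derivative is largest at the
    lower bound - r. *)
Lemma powRN_le_quad k u r : 0 <= k -> 0 <= r < 1 -> - r <= u ->
  (1 + u) `^ (- k)
    <= 1 - k * u + k * (k + 1) * (1 - r) `^ (- (k + 2)) / 2 * u ^+ 2.
Proof.
move=> k0 /andP[r0 r1] ru.
have df (v : R) : -1 < v ->
    is_derive v 1 (fun u => - (1 + u) `^ (- k)) (k * (1 + v) `^ (- k - 1)).
  move=> v1; have := dpow k v1 => H; apply: is_derive_eq.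
  by rewrite mulNr opprK.
have df1 (v : R) : -1 < v -> is_derive v 1 (fun u => k * (1 + u) `^ (- k - 1))
    (- (k * (k + 1) * (1 + v) `^ (- (k + 2)))).
  move=> v1; have := dpow1 k v1 => H.
  have -> : (fun u => k * (1 + u) `^ (- k - 1)) =
      - (fun u => - k * (1 + u) `^ (- k - 1)).
    by apply/funext => w; rewrite fctE mulNr opprK.
  exact: is_derive_eq.
have := @taylor2_ge _ _ _ u (- (k * (k + 1) * (1 - r) `^ (- (k + 2)))) (-1)
  _ _ df df1.
rewrite !addr0 !powR1 mulr1 => H.
suff : - 1 + k * u + - (k * (k + 1) * (1 - r) `^ (- (k + 2))) / 2 * u ^+ 2 <=
    - (1 + u) `^ (- k) by lra.
apply: H; [lra|lra|move=> v vu].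
rewrite lerN2 ler_wpM2l ?mulr_ge0 ?addr_ge0//.
by apply: powRN_le; [lra|lra|case/orP: vu => /andP[? ?]; lra].
Qed.
End second_order_bounds.

Lemma powRN_ge_lin {R : realType} (k u : R) : 0 <= k -> 0 <= u ->
  1 - k * u <= (1 + u) `^ (- k).
Proof.
move=> k0 u0; have u1 : -1 < u by lra.
apply: le_trans (powRN_ge_quad k0 u1 (lexx u) u0).
rewrite lerDl mulr_ge0 ?sqr_ge0// divr_ge0// mulr_ge0 ?powR_ge0// mulr_ge0//.
lra.
Qed.

(** * Bounded sequences and weighted means *)

Section bounded.
Context {R : realType}.
Implicit Types f h : nat -> R.

Definition bdd f := exists M, forall i, `|f i| <= M.

Lemma bddD f h : bdd f -> bdd h -> bdd (fun i => f i + h i).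
Proof.
move=> [M fM] [M' hM]; exists (M + M') => i.
by rewrite (le_trans (ler_normD _ _))// lerD.
Qed.

Lemma bddM f h : bdd f -> bdd h -> bdd (fun i => f i * h i).
Proof.
move=> [M fM] [M' hM]; exists (M * M') => i; rewrite normrM.
by rewrite ler_pM.
Qed.

Lemma bdd_cst (c : R) : bdd (fun=> c). Proof. by exists `|c|. Qed.

Lemma bddN f : bdd f -> bdd (fun i => - f i).
Proof. by move=> [M fM]; exists M => i; rewrite normrN. Qed.

Lemma bdd_norm f : bdd f -> bdd (fun i => `|f i|).
Proof. by move=> [M fM]; exists M => i; rewrite normr_id. Qed.

Lemma bddX f n : bdd f -> bdd (fun i => f i ^+ n).
Proof.
move=> bf; elim: n => [|n IH].
  by exists 1 => i; rewrite expr0 normr1.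
have [M H] := bddM bf IH; exists M => i; rewrite exprS; exact: H.
Qed.

Lemma bdd_sum (I : Type) (r : seq I) (F : I -> nat -> R) :
  (forall a, bdd (F a)) -> bdd (fun i => \sum_(a <- r) F a i).
Proof.
move=> bF; elim: r => [|a r IH].
  by exists 0 => i; rewrite big_nil normr0.
have [M H] := bddD (bF a) IH; exists M => i; rewrite big_cons; exact: H.
Qed.

End bounded.

Ltac bdd := solve [repeat first [assumption | apply: bdd_cst | apply: bddX
  | apply: bddN | apply: bddD | apply: bddM | apply: bdd_norm]].

Section weighted_mean.
Context {R : realType} (p : nat -> R).
Implicit Types f h : nat -> R.

Definition mean f : R :=
  limn (series (fun i => p i * f i)) / limn (series p).

Hypothesis p_gt0 : forall i, 0 < p i.
Hypothesis p_cvg : cvgn (series p).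

Lemma mean_cvg f : bdd f -> cvgn (series (fun i => p i * f i)).
Proof.
move=> [M fM]; apply: normed_cvg.
apply: (series_le_cvg (v_ := fun i => M * p i)) => [i|i|i|].
- exact: normr_ge0.
- by rewrite mulr_ge0 ?(ltW (p_gt0 _))// (le_trans _ (fM i)).
- by rewrite /= normrM (gtr0_norm (p_gt0 i)) mulrC ler_wpM2r ?(ltW (p_gt0 _)).
- exact: (is_cvg_seriesZ (k := M)).
Qed.

Lemma mass_gt0 : 0 < limn (series p).
Proof.
have nd : nondecreasing_seq (series p).
  by apply: nondecreasing_series => n _ _; exact: ltW.
apply: lt_le_trans (nondecreasing_cvgn_le nd p_cvg 1).
by rewrite seriesEnat /= big_nat1.
Qed.

Lemma mean_cst (c : R) : mean (fun=> c) = c.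
Proof.
rewrite /mean.
have -> : (fun i => p i * c) = c *: p.
  by apply/funext => i /=; rewrite mulrC.
by rewrite lim_seriesZ// mulfK// gt_eqF// mass_gt0.
Qed.

Lemma meanD f h : bdd f -> bdd h ->
  mean (fun i => f i + h i) = mean f + mean h.
Proof.
move=> bf bh; rewrite /mean -mulrDl; congr (_ / _).
rewrite -lim_seriesD; [|exact: mean_cvg|exact: mean_cvg].
by congr (limn (series _)); apply/funext => i /=; rewrite mulrDr.
Qed.

Lemma meanZ (c : R) f : bdd f -> mean (fun i => c * f i) = c * mean f.
Proof.
move=> bf; rewrite /mean mulrA; congr (_ / _).
have -> : (fun i => p i * (c * f i)) = c *: (fun i => p i * f i).
  by apply/funext => i /=; rewrite mulrCA.
by rewrite lim_seriesZ//; exact: mean_cvg.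
Qed.

Lemma eq_mean f h : f =1 h -> mean f = mean h.
Proof. by move=> /funext ->. Qed.

Lemma meanN f : bdd f -> mean (fun i => - f i) = - mean f.
Proof.
move=> bf; rewrite -mulN1r -meanZ//; apply: eq_mean => i.
by rewrite mulN1r.
Qed.

Lemma meanB f h : bdd f -> bdd h ->
  mean (fun i => f i - h i) = mean f - mean h.
Proof. by move=> bf bh; rewrite meanD ?meanN//; exact: bddN. Qed.

Lemma mean_sum (I : Type) (r : seq I) (F : I -> nat -> R) :
  (forall a, bdd (F a)) ->
  mean (fun i => \sum_(a <- r) F a i) = \sum_(a <- r) mean (F a).
Proof.
move=> bF; elim: r => [|a r IH].
  rewrite big_nil -[RHS](mean_cst 0); apply: eq_mean => i; exact: big_nil.
rewrite big_cons -IH -meanD//; last exact: bdd_sum.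
by apply: eq_mean => i; rewrite big_cons.
Qed.

Lemma ler_mean f h : bdd f -> bdd h -> (forall i, f i <= h i) ->
  mean f <= mean h.
Proof.
move=> bf bh fh; rewrite ler_pM2r ?invr_gt0 ?mass_gt0//.
apply: lim_series_le; [exact: mean_cvg|exact: mean_cvg|move=> i].
by rewrite ler_wpM2l// ltW.
Qed.

Lemma mean_ge0 f : bdd f -> (forall i, 0 <= f i) -> 0 <= mean f.
Proof. by move=> bf f0; rewrite -(mean_cst 0) ler_mean//; exact: bdd_cst. Qed.

Lemma ler_norm_mean f : bdd f -> `|mean f| <= mean (fun i => `|f i|).
Proof.
move=> bf; have bn := bdd_norm bf; rewrite ler_norml -meanN//.
by rewrite !ler_mean//; [move=> i; exact: ler_norm|exact: bddN|move=> i;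
  rewrite lerNl -normrN; exact: ler_norm].
Qed.

Lemma mean_eq0 f : bdd f -> (forall i, 0 <= f i) -> mean f = 0 ->
  forall i, f i = 0.
Proof.
move=> bf f0 mf i; have nd : nondecreasing_seq (series (fun i => p i * f i)).
  by apply: nondecreasing_series => n _ _; rewrite mulr_ge0// ltW.
have := nondecreasing_cvgn_le nd (mean_cvg bf) i.+1.
have -> : limn (series (fun i => p i * f i)) = 0.
  move/eqP: mf; rewrite mulf_eq0 invr_eq0 (gt_eqF mass_gt0) orbF.
  by move/eqP.
rewrite seriesEnat /= big_nat_recr//= => H.
have S0 : 0 <= \sum_(0 <= j < i) p j * f j.
  by apply: sumr_ge0 => j _; rewrite mulr_ge0// ltW.
have : p i * f i <= 0 by lra.
by rewrite pmulr_rle0// => fi; apply/eqP; rewrite eq_le fi f0.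
Qed.

Lemma mean_CS f h : bdd f -> bdd h ->
  mean (fun i => f i * h i) ^+ 2 <=
  mean (fun i => f i ^+ 2) * mean (fun i => h i ^+ 2).
Proof.
move=> bf bh; have bfh := bddM bf bh.
have bf2 := bddX 2 bf; have bh2 := bddX 2 bh.
set A := mean (fun i => f i * h i); set B := mean (fun i => f i ^+ 2).
set C := mean (fun i => h i ^+ 2).
have B0 : 0 <= B by apply: mean_ge0 => // i; exact: sqr_ge0.
have C0 : 0 <= C by apply: mean_ge0 => // i; exact: sqr_ge0.
have key s t : 0 <= s ^+ 2 * B + 2 * (s * t) * A + t ^+ 2 * C.
  have -> : s ^+ 2 * B + 2 * (s * t) * A + t ^+ 2 * C =
      mean (fun i => (s * f i + t * h i) ^+ 2).
    rewrite /A /B /C -(meanZ _ bf2) -(meanZ _ bfh) -(meanZ _ bh2).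
    rewrite -meanD; [|bdd|bdd].
    rewrite -meanD; [|bdd|bdd].
    by apply: eq_mean => i; ring.
  by apply: mean_ge0 => [|i]; [bdd|exact: sqr_ge0].
have [B1|] := ltP 0 B.
  have := key (- A) B; have -> : (- A) ^+ 2 * B + 2 * (- A * B) * A + B ^+ 2 * C
    = B * (B * C - A ^+ 2) by ring.
  by rewrite pmulr_rge0// subr_ge0.
move=> B1; have B2 : B = 0 by apply/eqP; rewrite eq_le B1 B0.
have [->|A0] := eqVneq A 0; first by rewrite expr0n mulr_ge0.
(* With B = 0 the form is affine in s; this s would give it the value - 1. *)
have := key (- (C + 1) / (2 * A)) 1; rewrite B2 mulr0 add0r mulr1 expr1n mul1r.
have -> : 2 * (- (C + 1) / (2 * A)) * A + C = - 1 by field.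
by rewrite ler0N1.
Qed.

(** Meant for the reindexing s given by left multiplication by a group element, which changes each
    weight by at most the factor c. Partial sums of the left side run over distinct indices, so they
    are bounded by partial sums of the right series. *)
Lemma mean_shift (s : nat -> nat) (c : R) f : injective s ->
  (forall i, p i <= c * p (s i)) -> bdd f -> (forall i, 0 <= f i) ->
  mean (fun i => f (s i)) <= c * mean f.
Proof.
move=> s_inj pc bf f0; rewrite /mean mulrA ler_pM2r ?invr_gt0 ?mass_gt0//.
have c0 : 0 <= c.
  have := pc 0; have := p_gt0 0%N; have := p_gt0 (s 0%N) => h1 h2 h3.
  by rewrite -(pmulr_lge0 _ h1) (le_trans (ltW h2)).
have bfs : bdd (fun i => f (s i)) by case: bf => M fM; exists M => i.
apply: limr_le; first exact: mean_cvg.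
near=> m; rewrite seriesEnat /=.
apply: (@le_trans _ _ (\sum_(0 <= i < m) c * (p (s i) * f (s i)))).
  by apply: ler_sum => i _; rewrite mulrA ler_wpM2r.
rewrite -mulr_sumr ler_wpM2l//.
pose K := (\max_(i < m) s i).+1.
have nd : nondecreasing_seq (series (fun i => p i * f i)).
  by apply: nondecreasing_series => n _ _; rewrite mulr_ge0// ltW.
apply: le_trans (nondecreasing_cvgn_le nd (mean_cvg bf) K).
rewrite seriesEnat /= -(big_map s predT (fun i => p i * f i)).
rewrite [leRHS](bigID (fun j => j \in [seq s i | i <- index_iota 0 m]))/=.
rewrite -[leLHS]addr0 lerD//; last first.
  by apply: sumr_ge0 => i _; rewrite mulr_ge0// ltW.
rewrite -[leRHS]big_filter le_eqVlt; apply/orP; left; apply/eqP.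
apply: perm_big.
have U k : uniq (index_iota 0 k) by exact: iota_uniq.
apply: uniq_perm; rewrite ?filter_uniq ?map_inj_uniq//.
move=> i; rewrite mem_filter mem_index_iota andb_idr// => /mapP[j].
rewrite mem_index_iota => /andP[_ jm] ->; rewrite ltnS.
by rewrite (@leq_bigmax _ (fun i : 'I_m => s i) (Ordinal jm)).
Unshelve. all: by end_near.
Qed.

End weighted_mean.

(** Replaces the passage to the limit t -> 0 in the estimates below. *)
Lemma ler_small_slack {R : realFieldType} (a b K t0 : R) : 0 < t0 ->
  (forall t, 0 < t -> t < t0 -> a <= b + K * t) -> a <= b.
Proof.
move=> t00 H; rewrite leNgt; apply/negP => ba.
pose t := Num.min (t0 / 2) ((a - b) / (2 * (`|K| + 1))).
have K0 : 0 < `|K| + 1 by rewrite ltr_wpDl.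
have t_gt0 : 0 < t by rewrite lt_min !divr_gt0 ?mulr_gt0 ?subr_gt0.
have tt0 : t < t0.
  by rewrite gt_min; apply/orP; left; lra.
have tK : t * (2 * (`|K| + 1)) <= a - b.
  by rewrite -ler_pdivlMr ?mulr_gt0// ge_min lexx orbT.
have := H t t_gt0 tt0.
have : K * t <= `|K| * t by rewrite ler_wpM2r ?ler_norm// ltW.
lra.
Qed.

(** * First variation *)

Section variation.
Context {R : realType} (p : nat -> R).
Hypothesis p_gt0 : forall i, 0 < p i.
Hypothesis p_cvg : cvgn (series p).
Notation E := (mean p).
Implicit Types (al be g f h : nat -> R).

Lemma mean_CS_sqrt f h : bdd f -> bdd h ->
  `|E (fun i => f i * h i)| <=
  Num.sqrt (E (fun i => f i ^+ 2)) * Num.sqrt (E (fun i => h i ^+ 2)).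
Proof.
move=> bf bh; rewrite -sqrtr_sqr -sqrtrM; last first.
  by apply: mean_ge0 => // [|i]; [bdd|exact: sqr_ge0].
by rewrite ler_wsqrtr// mean_CS.
Qed.

Lemma bdd_powRN f k m : 0 <= k -> 0 < m -> (forall i, m <= f i) ->
  bdd (fun i => f i `^ (- k)).
Proof.
move=> k0 m0 mf; exists (m `^ (- k)) => i.
by rewrite ger0_norm ?powR_ge0// powRN_le.
Qed.

(** The quadratic upper bound for (1 + t f)^-k gives 1 <= 1 - k t E f + O(t^2), so E f <= 0; the
    same for - f gives equality. No differentiation under the mean is involved. *)
Lemma mean_powRN_critical f k r : 0 < k -> bdd f -> 0 < r ->
  (forall t, `|t| < r -> 1 <= E (fun i => (1 + t * f i) `^ (- k))) ->
  E f = 0.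
Proof.
move=> k0 bf r0 H.
wlog suff : f bf H / E f <= 0.
  move=> WL; apply/eqP; rewrite eq_le WL//=.
  rewrite -oppr_le0 -(meanN p_gt0 p_cvg bf) WL//; first by bdd.
  move=> t tr; rewrite (le_trans (H (- t) _)) ?normrN//.
  by rewrite le_eqVlt; apply/orP; left; apply/eqP/eq_mean => i; rewrite mulNr mulrN.
have [M fM] := bf; have M0 : 0 <= M by exact: le_trans (fM 0%N).
pose C := k * (k + 1) * (1 - 2^-1) `^ (- (k + 2)) / 2.
have C0 : 0 <= C.
  by rewrite mulr_ge0 ?invr_ge0// mulr_ge0 ?powR_ge0// mulr_ge0 ?addr_ge0 ?ltW.
rewrite -(pmulr_rle0 _ k0).
pose t1 := Num.min r (2 * (M + 1))^-1.
have t10 : 0 < t1 by rewrite lt_min r0 invr_gt0; lra.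
apply: (@ler_small_slack _ _ _ (C * M ^+ 2) t1 t10) => t t0 tt1.
have tr : t < r by move: tt1; rewrite lt_min => /andP[].
have tM : t * (2 * (M + 1)) < 1.
  by rewrite -ltr_pdivlMr ?div1r; [move: tt1; rewrite lt_min => /andP[]|lra].
have small i : `|t * f i| <= 2^-1.
  rewrite normrM (gtr0_norm t0).
  have := ler_wpM2l (ltW t0) (fM i); lra.
have low i : 2^-1 <= 1 + t * f i.
  have := small i; rewrite ler_norml => /andP[]; lra.
have b2 : bdd (fun i => 1 - k * (t * f i) + C * (t * f i) ^+ 2) by bdd.
have := H t; rewrite gtr0_norm// => /(_ tr) H1.
have H2 : 1 <= E (fun i => 1 - k * (t * f i) + C * (t * f i) ^+ 2).
  apply: le_trans H1 (ler_mean p_gt0 p_cvg (bdd_powRN (ltW k0) _ low) b2 _).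
    lra.
  move=> i; rewrite /C; apply: powRN_le_quad; [exact: ltW| lra|].
  by have := small i; rewrite ler_norml => /andP[].
move: H2.
have -> : E (fun i => 1 - k * (t * f i) + C * (t * f i) ^+ 2) =
    1 - k * t * E f + C * t ^+ 2 * E (fun i => f i ^+ 2).
  rewrite -(meanZ p_gt0 p_cvg _ bf) -(meanZ p_gt0 p_cvg); last by bdd.
  rewrite -{2}(mean_cst p_gt0 p_cvg 1) -(meanB p_gt0 p_cvg); [|bdd|bdd].
  rewrite -(meanD p_gt0 p_cvg); [|bdd|bdd].
  by apply: eq_mean => i; ring.
have Ef2 : E (fun i => f i ^+ 2) <= M ^+ 2.
  rewrite -(mean_cst p_gt0 p_cvg (M ^+ 2)) ler_mean//; [bdd|bdd|move=> i].
  by rewrite -[leLHS]real_normK ?num_real// ler_sqr ?nnegrE.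
move=> H2.
have : k * t * E f <= C * t ^+ 2 * M ^+ 2.
  have : C * t ^+ 2 * E (fun i => f i ^+ 2) <= C * t ^+ 2 * M ^+ 2.
    by rewrite ler_wpM2l// mulr_ge0// sqr_ge0.
  lra.
have -> : k * t * E f = t * (k * E f) by ring.
have -> : C * t ^+ 2 * M ^+ 2 = t * (C * M ^+ 2 * t) by ring.
by rewrite ler_pM2l// add0r.
Qed.

End variation.

(** * Second variation at a minimax point *)

Section saddle.
Context {R : realType} (p : nat -> R).
Hypothesis p_gt0 : forall i, 0 < p i.
Hypothesis p_cvg : cvgn (series p).
Notation E := (mean p).
Implicit Types (al be g f h : nat -> R).

Let ED := meanD p_gt0 p_cvg.
Let EZ := meanZ p_gt0 p_cvg.
Let EB := meanB p_gt0 p_cvg.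
Let EC := mean_cst p_gt0 p_cvg.
Let Ele := ler_mean p_gt0 p_cvg.
Let Ege0 := mean_ge0 p_gt0 p_cvg.

(** The increment t al + be + t al be is u for 1 + u = (1 + t al)(1 + be); its part be drops out of
    the linear term because E be = 0. *)
Lemma mean_powRN_ge al be (k t c : R) : 0 <= k -> 0 <= c ->
  bdd al -> bdd be -> E be = 0 ->
  (exists2 e, 0 < e & forall i, e <= (1 + t * al i) * (1 + be i)) ->
  (forall i, 1 - k * (t * al i + be i + t * al i * be i) +
     c * (t * al i + be i + t * al i * be i) ^+ 2 <=
     ((1 + t * al i) * (1 + be i)) `^ (- k)) ->
  1 - k * (t * E al + t * E (fun i => al i * be i)) +
    c * E (fun i => (t * al i + be i + t * al i * be i) ^+ 2) <=
  E (fun i => ((1 + t * al i) * (1 + be i)) `^ (- k)).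
Proof.
move=> k0 c0 ba bb Eb [e e0 He] H.
have bab : bdd (fun i => al i * be i) by bdd.
have bq : bdd (fun i => (t * al i + be i + t * al i * be i) ^+ 2) by bdd.
have bq2 : bdd (fun i => 1 - k * (t * al i + be i + t * al i * be i) +
     c * (t * al i + be i + t * al i * be i) ^+ 2) by bdd.
apply: le_trans (Ele bq2 (bdd_powRN k0 e0 He) H).
rewrite -(EZ t ba) -(EZ t bab) -(EZ c bq) -[X in _ * (X + _)]addr0 -{1}Eb.
rewrite -{1}(EC 1) -ED; [|bdd|bdd].
rewrite -ED; [|bdd|bdd].
rewrite -EZ; last by bdd.
rewrite -EB; [|bdd|bdd].
rewrite -ED; [|bdd|bdd].
by rewrite le_eqVlt; apply/orP; left; apply/eqP/eq_mean => i; ring.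
Qed.

(** In the application al i = lam_i(X), be i = w(z_i) for a change w of y, and g represents the map
    from w to w(X), so that (1 + t E(g be))^-k accounts for renormalizing y at x + tX. There are two
    rounds. A crude quadratic lower bound shows that be = O(t), first in mean square and then
    uniformly, thanks to the pointwise bound with Mw. After that the sharp coefficient k (k + 1) / 2
    is available up to O(t). *)
Lemma saddle_second_order al g (k U Mw t0 : R) : 0 < k -> bdd al -> bdd g ->
  0 < t0 -> 0 <= U -> 0 <= Mw ->
  (forall t, `|t| < t0 -> exists be, [/\
      exists2 e, 0 < e & forall i, e <= 1 + be i,
      forall i, `|be i| <= U,
      E be = 0,
      forall i, be i ^+ 2 <= Mw * E (fun i => be i ^+ 2)
    & E (fun i => ((1 + t * al i) * (1 + be i)) `^ (- k)) <=
      (1 + t * E (fun i => g i * be i)) `^ (- k)]) ->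
  E al = 0 /\
  (2 * k + 1) * E (fun i => al i ^+ 2) <=
    E (fun i => g i ^+ 2) + 2 * k * E (fun i => g i * al i).
Proof.
move=> k0 ba bg t00 U0 Mw0 Hsad.
have [A aA] := ba; have A0 : 0 <= A by exact: le_trans (aA 0%N).
have k00 := ltW k0.
pose sA := Num.sqrt (E (fun i => al i ^+ 2)).
pose sG := Num.sqrt (E (fun i => g i ^+ 2)).
have sA0 : 0 <= sA by exact: sqrtr_ge0.
have sG0 : 0 <= sG by exact: sqrtr_ge0.
(* An upper bound for (1 + t al)(1 + be) - 1 once t al is at most 1/2; [c0] is the quadratic
   coefficient that it allows. *)
pose Ur := 3 / 2 * (1 + U) - 1.
have Ur0 : 0 <= Ur by rewrite /Ur; lra.
pose c0 := k * (k + 1) * (1 + Ur) `^ (- (k + 2)) / 2.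
have c00 : 0 < c0.
  by rewrite divr_gt0// mulr_gt0 ?powR_gt0//; [rewrite mulr_gt0//; lra|lra].
pose C0 := k * (k + 1) * (1 - 2^-1) `^ (- (k + 2)) / 2.
have C00 : 0 <= C0.
  by rewrite divr_ge0// mulr_ge0 ?powR_ge0// mulr_ge0//; lra.
pose B := sA + sG.
pose K1 := c0 * (A * (1 + U)) ^+ 2 + C0 * (sG * U) ^+ 2.
pose K2 := K1 + (k * B) ^+ 2 / c0.
have K10 : 0 <= K1 by rewrite addr_ge0// mulr_ge0 ?sqr_ge0// ltW.
have K20 : 0 <= K2 by rewrite addr_ge0// divr_ge0 ?sqr_ge0// ltW.
(* Small enough that t al and t E(g be) stay within 1/2 in absolute value. *)
pose t1 := Num.min t0 (Num.min (2 * (A + 1))^-1 (Num.min (2 * (sG * U + 1))^-1 1)).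
have t10 : 0 < t1.
  by rewrite !lt_min t00 ?ltr01 !invr_gt0 !mulr_gt0// ltr_wpDl// mulr_ge0.
have t1P (t : R) : `|t| < t1 -> [/\ `|t| < t0, `|t| * A <= 2^-1,
    `|t| * (sG * U) <= 2^-1 & `|t| <= 1].
  rewrite !lt_min => /andP[-> /andP[tA /andP[tG t_1]]]; split => //.
  - have : `|t| * (2 * (A + 1)) < 1 by rewrite -ltr_pdivlMr ?div1r//; lra.
    have := normr_ge0 t; lra.
  - have h : 0 < 2 * (sG * U + 1) by rewrite mulr_gt0// ltr_wpDl// mulr_ge0.
    have : `|t| * (2 * (sG * U + 1)) < 1 by rewrite -ltr_pdivlMr ?div1r.
    have := normr_ge0 t; lra.
  - exact: ltW.
have tal (t : R) i : `|t| < t1 -> `|t * al i| <= 2^-1.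
  by move=> /t1P[_ H _ _]; rewrite normrM (le_trans _ H)// ler_wpM2l.
have common (t : R) be (c : R) : `|t| < t1 -> 0 <= c ->
    (exists2 e, 0 < e & forall i, e <= 1 + be i) -> (forall i, `|be i| <= U) ->
    E be = 0 ->
    E (fun i => ((1 + t * al i) * (1 + be i)) `^ (- k)) <=
      (1 + t * E (fun i => g i * be i)) `^ (- k) ->
    (forall i, 1 - k * (t * al i + be i + t * al i * be i) +
     c * (t * al i + be i + t * al i * be i) ^+ 2 <=
     ((1 + t * al i) * (1 + be i)) `^ (- k)) ->
    let s := Num.sqrt (E (fun i => be i ^+ 2)) in
    [/\ 0 <= s, s <= U, `|E (fun i => al i * be i)| <= sA * s,
      `|E (fun i => g i * be i)| <= sG * s &
      c * E (fun i => (t * al i + be i + t * al i * be i) ^+ 2) <=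
      k * (t * E al + t * E (fun i => al i * be i))
       - k * (t * E (fun i => g i * be i))
       + C0 * (t * E (fun i => g i * be i)) ^+ 2].
  move=> tt1 c_ge0 [e e0 He] bU Eb Hle Hc s.
  have bb : bdd be by exists U.
  have s0 : 0 <= s by exact: sqrtr_ge0.
  have sU : s <= U.
    rewrite -(ger0_norm U0) -sqrtr_sqr ler_wsqrtr// -(EC (U ^+ 2)).
    apply: Ele; [bdd|bdd|move=> i].
    by rewrite -[leLHS]real_normK ?num_real// ler_sqr ?nnegrE.
  have cs1 : `|E (fun i => al i * be i)| <= sA * s by exact: mean_CS_sqrt.
  have cs2 : `|E (fun i => g i * be i)| <= sG * s by exact: mean_CS_sqrt.
  split => //.
  have low : 1 - k * (t * E al + t * E (fun i => al i * be i)) +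
      c * E (fun i => (t * al i + be i + t * al i * be i) ^+ 2) <=
      (1 + t * E (fun i => g i * be i)) `^ (- k).
    apply: le_trans Hle; apply: mean_powRN_ge => //.
    exists (2^-1 * e) => [|i]; first by rewrite mulr_gt0// invr_gt0.
    apply: ler_pM; [by []|exact: ltW| |exact: He].
    have := tal t i tt1; rewrite ler_norml => /andP[]; lra.
  have small : `|t * E (fun i => g i * be i)| <= 2^-1.
    have [_ _ H _] := t1P _ tt1.
    rewrite normrM (le_trans _ H)// ler_wpM2l// (le_trans cs2)//.
    by rewrite ler_wpM2l.
  have up : (1 + t * E (fun i => g i * be i)) `^ (- k) <=
      1 - k * (t * E (fun i => g i * be i)) +
      C0 * (t * E (fun i => g i * be i)) ^+ 2.
    apply: powRN_le_quad => //; first by lra.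
    by move: small; rewrite ler_norml => /andP[].
  lra.
have mono (t : R) be i : `|t| < t1 -> (exists2 e, 0 < e & forall i, e <= 1 + be i) ->
    -1 < t * al i + be i + t * al i * be i.
  move=> tt1 [e e0 He].
  have : 0 < (1 + t * al i) * (1 + be i).
    rewrite mulr_gt0//; last exact: lt_le_trans (He i).
    have := tal t i tt1; rewrite ler_norml => /andP[]; lra.
  lra.
have ring1 (t : R) be i : (1 + t * al i) * (1 + be i) =
    1 + (t * al i + be i + t * al i * be i) by ring.
(* The crude round. Once E al = 0 is known, it says that E be^2 is at most a constant times t^2. *)
have first (t : R) : `|t| < t1 -> exists be, [/\
      exists2 e, 0 < e & forall i, e <= 1 + be i,
      forall i, `|be i| <= U,
      E be = 0,
      forall i, be i ^+ 2 <= Mw * E (fun i => be i ^+ 2)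
    & E (fun i => ((1 + t * al i) * (1 + be i)) `^ (- k)) <=
      (1 + t * E (fun i => g i * be i)) `^ (- k)] /\
     - k * t * E al + c0 / 4 * E (fun i => be i ^+ 2) <= K2 * t ^+ 2.
  move=> tt1; have [tt0 _ _ _] := t1P _ tt1.
  have [be [H1 H2 H3 H4 H5]] := Hsad t tt0; exists be; split => //.
  have bb : bdd be by exists U.
  have [||s0 sU cs1 cs2 Hc'] := common t be c0 tt1 _ H1 H2 H3 H5.
  - exact: ltW.
  - move=> i; rewrite ring1; apply: powRN_ge_quad => //; first exact: mono.
    rewrite -(lerD2l 1) -ring1.
    have -> : 1 + Ur = 3 / 2 * (1 + U) by rewrite /Ur; ring.
    apply: ler_pM.
    + have := tal t i tt1; rewrite ler_norml => /andP[]; lra.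
    + by case: H1 => e e0 /(_ i); apply: le_trans; exact: ltW.
    + have := tal t i tt1; rewrite ler_norml => /andP[]; lra.
    + by rewrite lerD2l (le_trans (ler_norm _)).
  set s := Num.sqrt _ in s0 sU cs1 cs2 Hc' *.
  have sE : E (fun i => be i ^+ 2) = s ^+ 2.
    by rewrite sqr_sqrtr// Ege0//; [bdd|move=> i; exact: sqr_ge0].
  rewrite sE.
  have r2 : s ^+ 2 / 2 - (t * (A * (1 + U))) ^+ 2 <=
      E (fun i => (t * al i + be i + t * al i * be i) ^+ 2).
    rewrite -sE mulrC -(EC ((t * (A * (1 + U))) ^+ 2)) -EZ; last by bdd.
    rewrite -EB; [|bdd|bdd].
    apply: Ele; [bdd|bdd|move=> i].
    have : (t * al i * (1 + be i)) ^+ 2 <= (t * (A * (1 + U))) ^+ 2.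
      rewrite -[leLHS]real_normK ?num_real// -[leRHS]real_normK ?num_real//.
      rewrite ler_sqr ?nnegrE// -mulrA !(normrM t) ler_wpM2l//.
      rewrite !normrM (ger0_norm A0) (ger0_norm (addr_ge0 ler01 U0)).
      by rewrite ler_pM// (le_trans (ler_normD _ _))// normr1 lerD2l.
    by move: (sqr_ge0 (be i + 2 * (t * al i * (1 + be i)))); clra.
  have th2 : (t * E (fun i => g i * be i)) ^+ 2 <= t ^+ 2 * (sG * U) ^+ 2.
    rewrite exprMn ler_wpM2l ?sqr_ge0// -[leLHS]real_normK ?num_real//.
    rewrite ler_sqr ?nnegrE ?mulr_ge0// (le_trans cs2)// ler_wpM2l//.
  have t2 : t ^+ 2 = `|t| ^+ 2 by rewrite real_normK ?num_real.
  have e1 : k * (t * E (fun i => al i * be i)) <= k * (`|t| * (sA * s)).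
    by rewrite ler_wpM2l// (le_trans (ler_norm _))// normrM ler_wpM2l.
  have e2 : - (k * (t * E (fun i => g i * be i))) <= k * (`|t| * (sG * s)).
    rewrite -mulrN ler_wpM2l// (le_trans (ler_norm _))// normrN normrM.
    by rewrite ler_wpM2l.
  have am : k * (`|t| * (B * s)) <= c0 / 4 * s ^+ 2 + (k * B) ^+ 2 / c0 * t ^+ 2.
    have : 0 <= (c0 / 2 * s - k * B * `|t|) ^+ 2 / c0.
      by rewrite divr_ge0 ?sqr_ge0// ltW.
    have -> : (c0 / 2 * s - k * B * `|t|) ^+ 2 / c0 = c0 / 4 * s ^+ 2
       + (k * B) ^+ 2 / c0 * `|t| ^+ 2 - k * (`|t| * (B * s)).
      by field; rewrite gt_eqF.
    by rewrite t2; clra.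
  have := ler_wpM2l (ltW c00) r2; have := ler_wpM2l C00 th2.
  have amE : k * (`|t| * (B * s)) = k * (`|t| * (sA * s)) + k * (`|t| * (sG * s)).
    by rewrite /B; ring.
  rewrite amE in am.
  by rewrite /K2 /K1; move: Hc' e1 e2 am; clra.
have sq0 be : (forall i, `|be i| <= U) -> 0 <= E (fun i => be i ^+ 2).
  move=> bU; apply: Ege0 => [|i]; last exact: sqr_ge0.
  by apply: bddX; exists U.
have Ea : E al = 0.
  apply/eqP; rewrite eq_le -(pmulr_rle0 _ k0) -[X in _ && X](pmulr_rge0 _ k0).
  apply/andP; split.
    apply: (@ler_small_slack _ _ _ K2 t1 t10) => t t0' tt1.
    have [|be [[_ bU _ _ _]]] := first (- t); first by rewrite normrN gtr0_norm.
    have : 0 <= c0 / 4 * E (fun i => be i ^+ 2).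
      by apply: mulr_ge0; [rewrite divr_ge0// ltW|exact: sq0 bU].
    have -> : - k * - t * E al = t * (k * E al) by ring.
    rewrite sqrrN expr2 => h1 h2.
    have : t * (k * E al) <= t * (K2 * t) by lra.
    by rewrite ler_pM2l// add0r.
  rewrite -oppr_le0.
  apply: (@ler_small_slack _ _ _ K2 t1 t10) => t t0' tt1.
  have [|be [[_ bU _ _ _]]] := first t; first by rewrite gtr0_norm.
  have : 0 <= c0 / 4 * E (fun i => be i ^+ 2).
    by apply: mulr_ge0; [rewrite divr_ge0// ltW|exact: sq0 bU].
  rewrite expr2 => h1 h2.
  have : t * (- (k * E al)) <= t * (K2 * t) by lra.
  by rewrite ler_pM2l// add0r.
split => //.
(* [L] t bounds be in mean square and [L1] t bounds it uniformly. *)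
pose L := Num.sqrt (4 * K2 / c0); pose L1 := Num.sqrt Mw * L.
have L0 : 0 <= L by exact: sqrtr_ge0.
have L10 : 0 <= L1 by rewrite mulr_ge0// sqrtr_ge0.
pose L2 := A + L1 + A * L1.
have L20 : 0 <= L2 by rewrite !addr_ge0// mulr_ge0.
pose D := k * (k + 1) / 2.
have D0 : 0 < D by rewrite divr_gt0// mulr_gt0//; lra.
pose K3 := D * (k + 2) * L2 * L2 ^+ 2 + D * (2 * (A + L1) * (A * L1)) + C0 * (sG * L) ^+ 2.
suff H t : 0 < t -> t < t1 ->
    (2 * k + 1) * (t ^+ 2 * E (fun i => al i ^+ 2)) <=
    t ^+ 2 * (E (fun i => g i ^+ 2) + 2 * k * E (fun i => g i * al i)) +
    2 * (k + 1) / k * K3 * t ^+ 3.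
  apply: (@ler_small_slack _ _ _ (2 * (k + 1) / k * K3) t1 t10) => t t_gt0 tt1.
  rewrite -(ler_pM2l (exprn_gt0 2 t_gt0)).
  by have := H t t_gt0 tt1; lra.
move=> t_gt0 tt1.
have nt : `|t| < t1 by rewrite gtr0_norm.
have [be [[H1 H2 H3 H4 H5] Hs]] := first t nt.
have bb : bdd be by exists U.
have [_ _ _ tle1] := t1P _ nt; rewrite gtr0_norm// in tle1.
have sE : E (fun i => be i ^+ 2) <= (L * t) ^+ 2.
  rewrite exprMn sqr_sqrtr; last by rewrite divr_ge0 ?(ltW c00)// mulr_ge0.
  rewrite Ea mulr0 add0r in Hs.
  rewrite -(ler_pM2l (_ : 0 < c0 / 4)); last by rewrite divr_gt0.
  apply: le_trans Hs _; rewrite le_eqVlt; apply/orP; left; apply/eqP.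
  by field; rewrite gt_eqF.
have bes i : `|be i| <= L1 * t.
  have -> : L1 * t = Num.sqrt (Mw * (L * t) ^+ 2).
    by rewrite sqrtrM// sqrtr_sqr ger0_norm ?mulrA// mulr_ge0// ltW.
  rewrite -sqrtr_sqr ler_wsqrtr// (le_trans (H4 i))// ler_wpM2l//.
have absr i : `|t * al i + be i + t * al i * be i| <= L2 * t.
  have tA : `|t * al i| <= t * A by rewrite normrM gtr0_norm// ler_wpM2l// ltW.
  rewrite (le_trans (ler_normD _ _))// /L2.
  have : `|t * al i + be i| <= t * A + L1 * t.
    by rewrite (le_trans (ler_normD _ _))// lerD.
  have : `|t * al i * be i| <= A * L1 * t.
    rewrite normrM (le_trans (ler_pM _ _ tA (bes i)))//.
    have -> : t * A * (L1 * t) = A * L1 * t * t by ring.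
    by rewrite ler_piMr// mulr_ge0 ?mulr_ge0// ltW.
  by clra.
(* The sharp round: every increment is now at most ep = O(t), so the coefficient [c] is k (k + 1) /
   2 up to O(t). *)
pose ep := L2 * t.
have ep0 : 0 <= ep by rewrite mulr_ge0// ltW.
have epow : 1 - (k + 2) * ep <= (1 + ep) `^ (- (k + 2)).
  by apply: powRN_ge_lin => //; rewrite addr_ge0.
pose c := D * (1 + ep) `^ (- (k + 2)).
have [||s0 sU cs1 cs2 main0] := common t be c nt _ H1 H2 H3 H5.
- by rewrite mulr_ge0 ?powR_ge0// ltW.
- move=> i; rewrite ring1 /c /D.
  have -> : k * (k + 1) / 2 * (1 + ep) `^ (- (k + 2)) =
    k * (k + 1) * (1 + ep) `^ (- (k + 2)) / 2 by ring.
  apply: powRN_ge_quad => //; first exact: mono.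
  by rewrite (le_trans (ler_norm _)).
set s := Num.sqrt _ in s0 sU cs1 cs2 main0 *.
have sE2 : E (fun i => be i ^+ 2) = s ^+ 2 by rewrite sqr_sqrtr// sq0.
have sLt : s <= L * t.
  rewrite -(@ler_sqr _ s) ?nnegrE//; last by rewrite mulr_ge0// ltW.
  by rewrite -sE2.
move: main0; set Y := E (fun i => (_ + _ + _) ^+ 2) => main.
have Y0 : 0 <= Y by apply: Ege0 => [|i]; [bdd|exact: sqr_ge0].
have YL : Y <= (L2 * t) ^+ 2.
  rewrite -(EC ((L2 * t) ^+ 2)); apply: Ele; [bdd|bdd|move=> i].
  rewrite -[leLHS]real_normK ?num_real// ler_sqr ?nnegrE//.
set m := E (fun i => al i * be i) in cs1 main.
set th := E (fun i => g i * be i) in cs2 main.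
have Yge : t ^+ 2 * E (fun i => al i ^+ 2) + 2 * t * m + s ^+ 2
    - 2 * (A + L1) * (A * L1) * t ^+ 3 <= Y.
  rewrite -sE2 /m -EZ; last by bdd.
  rewrite -EZ; last by bdd.
  rewrite -ED; [|bdd|bdd].
  rewrite -ED; [|bdd|bdd].
  rewrite -(EC (2 * (A + L1) * (A * L1) * t ^+ 3)) -EB; [|bdd|bdd].
  apply: Ele; [bdd|bdd|move=> i].
  have h1 : `|t * al i + be i| <= (A + L1) * t.
    rewrite (le_trans (ler_normD _ _))// mulrDl lerD//.
    by rewrite normrM gtr0_norm// mulrC ler_wpM2r// ltW.
  have h2 : `|t * al i * be i| <= A * L1 * t ^+ 2.
    rewrite normrM.
    have -> : A * L1 * t ^+ 2 = (A * t) * (L1 * t) by ring.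
    apply: ler_pM => //; rewrite normrM gtr0_norm// mulrC ler_wpM2r// ltW//.
  have : `|(t * al i + be i) * (t * al i * be i)| <= (A + L1) * (A * L1) * t ^+ 3.
    rewrite normrM; have -> : (A + L1) * (A * L1) * t ^+ 3 =
      (A + L1) * t * (A * L1 * t ^+ 2) by ring.
    exact: ler_pM.
  rewrite ler_norml => /andP[h3 _].
  by move: h3 (sqr_ge0 (t * al i * be i)); clra.
have t2 : 0 <= t ^+ 2 by exact: sqr_ge0.
have th2 : (t * th) ^+ 2 <= (sG * L) ^+ 2 * t ^+ 3.
  have h : `|th| <= sG * L * t.
    by rewrite (le_trans cs2)// -mulrA ler_wpM2l.
  have : th ^+ 2 <= (sG * L * t) ^+ 2.
    rewrite -[leLHS]real_normK ?num_real// ler_sqr ?nnegrE//.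
    by rewrite mulr_ge0 ?mulr_ge0// ltW.
  move=> /(ler_wpM2l t2).
  have h4 : (sG * L) ^+ 2 * t ^+ 3 * t <= (sG * L) ^+ 2 * t ^+ 3.
    by rewrite ler_piMr// mulr_ge0 ?sqr_ge0// exprn_ge0// ltW.
  by rewrite !exprMn; rewrite exprMn in h4; move: h4; clra.
have cY : D * Y - D * (k + 2) * L2 * L2 ^+ 2 * t ^+ 3 <= c * Y.
  have : D * (1 - (k + 2) * ep) * Y <= c * Y.
    by rewrite ler_wpM2r// ler_wpM2l// ltW.
  have : D * (k + 2) * ep * Y <= D * (k + 2) * ep * (L2 * t) ^+ 2.
    by rewrite ler_wpM2l// mulr_ge0// mulr_ge0 ?(ltW D0) ?addr_ge0.
  by rewrite /ep; clra.
(* The mean square of t g + k t al + (k + 1) be. It cancels all terms with be, leaving (k + 1)^2 -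
   k^2 = 2 k + 1 in front of E al^2. *)
have sq : 0 <= t ^+ 2 * E (fun i => g i ^+ 2) + k ^+ 2 * t ^+ 2 * E (fun i => al i ^+ 2)
   + (k + 1) ^+ 2 * s ^+ 2 + 2 * k * t ^+ 2 * E (fun i => g i * al i)
   + 2 * (k + 1) * t * th + 2 * k * (k + 1) * t * m.
  rewrite -sE2 /th /m -!EZ; [|bdd|bdd|bdd|bdd|bdd|bdd].
  rewrite -ED; [|bdd|bdd].
  rewrite -ED; [|bdd|bdd].
  rewrite -ED; [|bdd|bdd].
  rewrite -ED; [|bdd|bdd].
  rewrite -ED; [|bdd|bdd].
  apply: Ege0 => [|i]; first by bdd.
  have -> : t ^+ 2 * g i ^+ 2 + k ^+ 2 * t ^+ 2 * al i ^+ 2 +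
   (k + 1) ^+ 2 * be i ^+ 2 + 2 * k * t ^+ 2 * (g i * al i) +
   2 * (k + 1) * t * (g i * be i) + 2 * k * (k + 1) * t * (al i * be i) =
   (t * g i + k * t * al i + (k + 1) * be i) ^+ 2 by ring.
  exact: sqr_ge0.
rewrite Ea mulr0 add0r in main.
have := ler_wpM2l (ltW D0) Yge; have := ler_wpM2l C00 th2 => h1 h2.
set EA := E (fun i => al i ^+ 2) in Yge sq h2 *.
set EG := E (fun i => g i ^+ 2) in sq *.
set EGA := E (fun i => g i * al i) in sq *.
have h5 : D * (t ^+ 2 * EA + 2 * t * m + s ^+ 2) <=
    k * (t * m) - k * (t * th) + K3 * t ^+ 3.
  by rewrite /K3; move: main cY h1 h2; clra.
have k1 : 0 <= 2 * (k + 1) / k by rewrite divr_ge0// mulr_ge0 ?addr_ge0.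
have := ler_wpM2l k1 h5.
have -> : 2 * (k + 1) / k * (D * (t ^+ 2 * EA + 2 * t * m + s ^+ 2)) =
   (k + 1) ^+ 2 * (t ^+ 2 * EA + 2 * t * m + s ^+ 2).
  by rewrite /D; move: k0; drop => k0; field; rewrite gt_eqF.
have -> : 2 * (k + 1) / k * (k * (t * m) - k * (t * th) + K3 * t ^+ 3) =
   2 * (k + 1) * (t * m) - 2 * (k + 1) * (t * th) + 2 * (k + 1) / k * K3 * t ^+ 3.
  by move: k0; drop => k0; field; rewrite gt_eqF.
by move: sq; set Z := _ * K3 * _; clra.
Qed.

End saddle.

(** * Pairings and moments *)

Section pairing.
Context {R : realType} {m : nat}.
Implicit Types (y w : 'rV[R]_m) (u v : 'cV[R]_m).

Definition pr y u : R := (y *m u) 0 0.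

Lemma prE y u : pr y u = \sum_a y 0 a * u a 0.
Proof. by rewrite /pr mxE. Qed.
Lemma prDl y w u : pr (y + w) u = pr y u + pr w u.
Proof. by rewrite /pr mulmxDl mxE. Qed.
Lemma prDr y u v : pr y (u + v) = pr y u + pr y v.
Proof. by rewrite /pr mulmxDr mxE. Qed.
Lemma prNl y u : pr (- y) u = - pr y u.
Proof. by rewrite /pr mulNmx mxE. Qed.
Lemma prNr y u : pr y (- u) = - pr y u.
Proof. by rewrite /pr mulmxN mxE. Qed.
Lemma prBl y w u : pr (y - w) u = pr y u - pr w u.
Proof. by rewrite prDl prNl. Qed.
Lemma prBr y u v : pr y (u - v) = pr y u - pr y v.
Proof. by rewrite prDr prNr. Qed.
Lemma prZl c y u : pr (c *: y) u = c * pr y u.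
Proof. by rewrite /pr -scalemxAl mxE. Qed.
Lemma prZr c y u : pr y (c *: u) = c * pr y u.
Proof. by rewrite /pr -scalemxAr mxE. Qed.
Lemma prT y u : pr u^T y^T = pr y u.
Proof. by rewrite /pr -trmx_mul mxE. Qed.
Lemma prM y (A : 'M[R]_m) u : pr (y *m A) u = pr y (A *m u).
Proof. by rewrite /pr mulmxA. Qed.
Lemma pr0r y : pr y 0 = 0. Proof. by rewrite /pr mulmx0 mxE. Qed.
Lemma pr0l u : pr 0 u = 0. Proof. by rewrite /pr mul0mx mxE. Qed.

Lemma pr_sym (A : 'M[R]_m) u v : A^T = A -> pr (u^T *m A) v = pr (v^T *m A) u.
Proof. by move=> sA; rewrite -prT trmx_mul sA trmxK -prM. Qed.

Lemma pr_eq y w : (forall u, pr y u = pr w u) -> y = w.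
Proof.
move=> H; apply/rowP => a; have := H (delta_mx a 0).
have E (v : 'rV[R]_m) : pr v (delta_mx a 0) = v 0 a.
  by rewrite prE (bigD1 a)//= mxE !eqxx mulr1 big1 ?addr0// => b ba;
     rewrite mxE (negbTE ba) mulr0.
by rewrite !E.
Qed.

End pairing.

Section moments.
Context {R : realType} (p : nat -> R) {m : nat}.
Hypothesis p_gt0 : forall i, 0 < p i.
Hypothesis p_cvg : cvgn (series p).
Notation E := (mean p).

Definition bddc (z : nat -> 'cV[R]_m) := forall a, bdd (fun i => z i a 0).
Definition bddr (l : nat -> 'rV[R]_m) := forall a, bdd (fun i => l i 0 a).

Lemma bdd_pr l z : bddr l -> bddc z -> bdd (fun i => pr (l i) (z i)).
Proof.
move=> bl bz.
have [M H] := bdd_sum (index_enum 'I_m) (fun a => bddM (bl a) (bz a)).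
by exists M => i; rewrite prE.
Qed.

Lemma bddr_cst w : bddr (fun=> w). Proof. by move=> a; exact: bdd_cst. Qed.
Lemma bddc_cst u : bddc (fun=> u). Proof. by move=> a; exact: bdd_cst. Qed.

Definition Mzz (z : nat -> 'cV[R]_m) : 'M[R]_m :=
  \matrix_(a, b) E (fun i => z i a 0 * z i b 0).
Definition Mll (l : nat -> 'rV[R]_m) : 'M[R]_m :=
  \matrix_(a, b) E (fun i => l i 0 a * l i 0 b).
Definition Mzl (z : nat -> 'cV[R]_m) (l : nat -> 'rV[R]_m) : 'M[R]_m :=
  \matrix_(a, b) E (fun i => z i a 0 * l i 0 b).

Lemma mean_pr2 (f h : nat -> 'I_m -> R) (A : 'M[R]_m) :
  (forall a, bdd (fun i => f i a)) -> (forall a, bdd (fun i => h i a)) ->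
  E (fun i => \sum_a \sum_b A a b * (f i a * h i b)) =
  \sum_a \sum_b A a b * E (fun i => f i a * h i b).
Proof.
move=> bf bh; have bb a b : bdd (fun i => A a b * (f i a * h i b)).
  by apply: bddM; [exact: bdd_cst|apply: bddM].
rewrite (mean_sum p_gt0 p_cvg); last by move=> a; exact: bdd_sum.
apply: eq_bigr => a _; rewrite (mean_sum p_gt0 p_cvg)//.
by apply: eq_bigr => b _; rewrite (meanZ p_gt0 p_cvg)//; exact: bddM.
Qed.

Lemma mean_zz z w v : bddc z ->
  E (fun i => pr w (z i) * pr v (z i)) = pr (w *m Mzz z) v^T.
Proof.
move=> bz; transitivity (E (fun i => \sum_a \sum_b (w 0 a * v 0 b) *
   (z i a 0 * z i b 0))).
  apply: eq_mean => i; rewrite !prE mulr_suml; apply: eq_bigr => a _.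
  by rewrite mulr_sumr; apply: eq_bigr => b _; ring.
have := @mean_pr2 (fun i a => z i a 0) (fun i a => z i a 0)
  (\matrix_(a, b) (w 0 a * v 0 b)) bz bz.
under eq_mean do under eq_bigr do under eq_bigr do rewrite mxE.
move=> ->; rewrite prE.
under [RHS]eq_bigr do rewrite mxE mulr_suml.
rewrite exchange_big/=; apply: eq_bigr => a _; apply: eq_bigr => b _.
by rewrite !mxE; ring.
Qed.

Lemma mean_ll l u v : bddr l ->
  E (fun i => pr (l i) u * pr (l i) v) = pr (u^T *m Mll l) v.
Proof.
move=> bl; transitivity (E (fun i => \sum_a \sum_b (u a 0 * v b 0) *
   (l i 0 a * l i 0 b))).
  apply: eq_mean => i; rewrite !prE mulr_suml; apply: eq_bigr => a _.
  by rewrite mulr_sumr; apply: eq_bigr => b _; ring.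
have := @mean_pr2 (fun i a => l i 0 a) (fun i a => l i 0 a)
  (\matrix_(a, b) (u a 0 * v b 0)) bl bl.
under eq_mean do under eq_bigr do under eq_bigr do rewrite mxE.
move=> ->; rewrite prE.
under [RHS]eq_bigr do rewrite mxE mulr_suml.
rewrite exchange_big/=; apply: eq_bigr => a _; apply: eq_bigr => b _.
by rewrite !mxE; ring.
Qed.

Lemma mean_zl z l w v : bddc z -> bddr l ->
  E (fun i => pr w (z i) * pr (l i) v) = pr (w *m Mzl z l) v.
Proof.
move=> bz bl; transitivity (E (fun i => \sum_a \sum_b (w 0 a * v b 0) *
   (z i a 0 * l i 0 b))).
  apply: eq_mean => i; rewrite !prE mulr_suml; apply: eq_bigr => a _.
  by rewrite mulr_sumr; apply: eq_bigr => b _; ring.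
have := @mean_pr2 (fun i a => z i a 0) (fun i a => l i 0 a)
  (\matrix_(a, b) (w 0 a * v b 0)) bz bl.
under eq_mean do under eq_bigr do under eq_bigr do rewrite mxE.
move=> ->; rewrite prE.
under [RHS]eq_bigr do rewrite mxE mulr_suml.
rewrite exchange_big/=; apply: eq_bigr => a _; apply: eq_bigr => b _.
by rewrite !mxE; ring.
Qed.

Lemma mean_qf_z z (A : 'M[R]_m) : bddc z ->
  E (fun i => pr ((z i)^T *m A) (z i)) = \tr (A *m Mzz z).
Proof.
move=> bz; transitivity (E (fun i => \sum_a \sum_b A a b *
   (z i a 0 * z i b 0))).
  apply: eq_mean => i; rewrite prM prE; apply: eq_bigr => a _.
  rewrite !mxE mulr_sumr; apply: eq_bigr => b _; ring.
rewrite mean_pr2//; apply: eq_bigr => a _; rewrite mxE; apply: eq_bigr => b _.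
by rewrite !mxE; congr (_ * _); apply: eq_mean => i; rewrite mulrC.
Qed.

Lemma mean_qf_l l (A : 'M[R]_m) : bddr l ->
  E (fun i => pr (l i *m A) (l i)^T) = \tr (A *m Mll l).
Proof.
move=> bl; transitivity (E (fun i => \sum_a \sum_b A a b *
   (l i 0 a * l i 0 b))).
  apply: eq_mean => i; rewrite prM prE; apply: eq_bigr => a _.
  rewrite !mxE mulr_sumr; apply: eq_bigr => b _; rewrite !mxE; ring.
rewrite mean_pr2//; apply: eq_bigr => a _; rewrite mxE; apply: eq_bigr => b _.
by rewrite !mxE; congr (_ * _); apply: eq_mean => i; rewrite mulrC.
Qed.

Lemma Mzz_sym z : (Mzz z)^T = Mzz z.
Proof.
by apply/matrixP => a b; rewrite !mxE; apply: eq_mean => i; rewrite mulrC.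
Qed.

Variables (z : nat -> 'cV[R]_m) (l : nat -> 'rV[R]_m) (x : 'cV[R]_m)
  (y : 'rV[R]_m) (W : 'M[R]_m) (k : R).
Hypotheses (bz : bddc z) (bl : bddr l).
Hypothesis yz : forall i, pr y (z i) = 1.
Hypothesis lx : forall i, pr (l i) x = 1.
Hypothesis Ez : forall w, E (fun i => pr w (z i)) = pr w x.
Local Notation S := (Mzz z).
Hypothesis SW : S *m W = 1%:M.
Hypothesis k0 : 0 <= k.
Local Notation dbar := (E (fun i => pr (l i) (z i))).

Let WS : W *m S = 1%:M. Proof. exact: mulmx1C. Qed.

Lemma W_sym : W^T = W.
Proof.
rewrite -[LHS]mulmx1 -SW mulmxA -[X in W^T *m X](Mzz_sym z) -trmx_mul SW.
by rewrite trmx1 mul1mx.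
Qed.

Lemma yx1 : pr y x = 1.
Proof.
by rewrite -(Ez y) -[RHS](mean_cst p_gt0 p_cvg); apply: eq_mean => i; rewrite yz.
Qed.

(** Since y(z i) = 1, the second moment applied to y is the first moment. *)
Lemma Sy : S *m y^T = x.
Proof.
apply: trmx_inj; apply: pr_eq => u.
rewrite trmx_mul trmxK Mzz_sym -[u]trmxK -mean_zz//.
transitivity (E (fun i => pr u^T (z i))).
  by apply: eq_mean => i; rewrite yz mul1r.
by rewrite Ez prT.
Qed.

Lemma Wx : W *m x = y^T.
Proof. by rewrite -Sy mulmxA WS mul1mx. Qed.

Lemma xW : x^T *m W = y.
Proof. by rewrite -[W]W_sym -trmx_mul Wx trmxK. Qed.

Hypothesis saddle : forall X, pr y X = 0 ->
  (2 * k + 1) * E (fun i => pr (l i) X ^+ 2) <=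
  pr (X^T *m W) X + 2 * k * E (fun i => pr (X^T *m W) (z i) * pr (l i) X).

Lemma mean_qf_zx (A : 'M[R]_m) :
  E (fun i => pr ((z i - x)^T *m A) (z i - x)) =
  \tr (A *m S) - pr (x^T *m A) x.
Proof.
have bp w : bdd (fun i => pr w (z i)) by apply: bdd_pr => //; exact: bddr_cst.
have bq : bdd (fun i => pr ((z i)^T *m A) (z i)).
  have [M H] := bdd_sum (index_enum 'I_m) (fun a => bdd_sum (index_enum 'I_m)
    (fun b => bddM (bdd_cst (A a b)) (bddM (bz a) (bz b)))).
  exists M => i; apply: le_trans (H i); rewrite le_eqVlt; apply/orP; left.
  apply/eqP; congr `|_|; rewrite prM prE; apply: eq_bigr => a _.
  rewrite !mxE mulr_sumr; apply: eq_bigr => b _; ring.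
transitivity (E (fun i => pr ((z i)^T *m A) (z i) -
   (pr (x^T *m A^T) (z i) + pr (x^T *m A) (z i) - pr (x^T *m A) x))).
  apply: eq_mean => i; rewrite linearB mulmxBl !prBl !prBr.
  have -> : pr ((z i)^T *m A) x = pr (x^T *m A^T) (z i).
    by rewrite -prT trmx_mul trmxK -prM.
  ring.
rewrite (meanB p_gt0 p_cvg)//; last by bdd || by apply: bddD; [apply: bddD|exact: bdd_cst].
rewrite (meanB p_gt0 p_cvg)//; [|exact: bddD|exact: bdd_cst].
rewrite (meanD p_gt0 p_cvg)// !Ez (mean_cst p_gt0 p_cvg) mean_qf_z//.
have -> : pr (x^T *m A^T) x = pr (x^T *m A) x by rewrite -prT trmx_mul !trmxK prM.
ring.
Qed.

(** The directions X = z i - x are admissible because y(z i) = y(x) = 1. Averaging the saddle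
    inequality over them turns its quadratic forms into traces, with tr(W S) = m and tr(W Mzl S) =
    [dbar]. *)
Lemma moment_ineq : (2 * k + 1) * (\tr (Mll l *m S) - 1) <=
  m%:R - 1 + 2 * k * (dbar - 1).
Proof.
have bZ (A : 'M[R]_m) : bdd (fun i => pr ((z i - x)^T *m A) (z i - x)).
  apply: bdd_pr => a; last first.
    have [M H] := bddD (bz a) (bdd_cst (- x a 0)).
    by exists M => i; rewrite !mxE.
  have [M H] := bdd_sum (index_enum 'I_m) (fun b => bddM (bddD (bz b)
    (bdd_cst (- x b 0))) (bdd_cst (A b a))).
  by exists M => i; rewrite !mxE; under eq_bigr do rewrite !mxE.
have H i : (2 * k + 1) * pr ((z i - x)^T *m Mll l) (z i - x) <=
    pr ((z i - x)^T *m W) (z i - x) +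
    2 * k * pr ((z i - x)^T *m (W *m Mzl z l)) (z i - x).
  have := @saddle (z i - x); rewrite prBr yz yx1 subrr => /(_ erefl).
  have E2 X : E (fun j => pr (l j) X ^+ 2) = pr (X^T *m Mll l) X.
    by rewrite -mean_ll//; apply: eq_mean => j; rewrite expr2.
  by rewrite E2 mean_zl// -mulmxA.
have := ler_mean p_gt0 p_cvg (bddM (bdd_cst (2 * k + 1)) (bZ _))
  (bddD (bZ _) (bddM (bdd_cst (2 * k)) (bZ _))) H.
rewrite (meanZ p_gt0 p_cvg)// (meanD p_gt0 p_cvg)//; last first.
  by apply: bddM => //; exact: bdd_cst.
rewrite (meanZ p_gt0 p_cvg)// !mean_qf_zx xW WS mxtrace1 yx1.
have -> : pr (x^T *m Mll l) x = 1.
  rewrite -mean_ll// -[RHS](mean_cst p_gt0 p_cvg).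
  by apply: eq_mean => i; rewrite lx mulr1.
have -> : pr (x^T *m (W *m Mzl z l)) x = 1.
  rewrite mulmxA xW -mean_zl// -[RHS](mean_cst p_gt0 p_cvg).
  by apply: eq_mean => i; rewrite lx yz mulr1.
have -> // : \tr (W *m Mzl z l *m S) = dbar.
rewrite mxtrace_mulC mulmxA SW mul1mx /mxtrace.
under eq_bigr do rewrite mxE.
rewrite -(mean_sum p_gt0 p_cvg); last by move=> a; exact: bddM.
by apply: eq_mean => i; rewrite prE; apply: eq_bigr => a _; rewrite mulrC.
Qed.

(** For rho = 1 / n this is l i - (z i)^T q / n with q = (n + 1) y^T y - W, because y(z i) = 1. *)
Definition residual (rho : R) i : 'rV[R]_m :=
  l i + rho *: ((z i)^T *m W) - (1 + rho) *: y.

Lemma bdd_residual rho : bddr (residual rho).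
Proof.
move=> a.
have [M H] := bddD (bddD (bl a) (bddM (bdd_cst rho)
   (bdd_sum (index_enum 'I_m) (fun b => bddM (bz b) (bdd_cst (W b a))))))
   (bdd_cst (- ((1 + rho) * y 0 a))).
exists M => i; rewrite !mxE; under eq_bigr do rewrite !mxE.
exact: H.
Qed.

Lemma mean_residual rho :
  E (fun i => pr (residual rho i *m S) (residual rho i)^T) =
  \tr (Mll l *m S) + rho ^+ 2 * m%:R - (1 + rho) ^+ 2 + 2 * rho * dbar.
Proof.
have bW : bddr (fun i => (z i)^T *m W).
  move=> a; have [M H] := bdd_sum (index_enum 'I_m)
    (fun b => bddM (bz b) (bdd_cst (W b a))).
  by exists M => i; rewrite !mxE; under eq_bigr do rewrite !mxE.
have bqz : bdd (fun i => pr ((z i)^T *m W) (z i)) by exact: bdd_pr.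
have bT (h : nat -> 'rV[R]_m) : bddr h -> bddc (fun i => (h i)^T).
  by move=> bh a; have [M H] := bh a; exists M => i; rewrite mxE.
have bS : bddr (fun i => l i *m S).
  move=> a; have [M H] := bdd_sum (index_enum 'I_m)
    (fun b => bddM (bl b) (bdd_cst (S b a))).
  by exists M => i; rewrite mxE.
have bql : bdd (fun i => pr (l i *m S) (l i)^T).
  by apply: bdd_pr => //; exact: bT.
have bd : bdd (fun i => pr (l i) (z i)) by exact: bdd_pr.
transitivity (E (fun i => pr (l i *m S) (l i)^T +
   rho ^+ 2 * pr ((z i)^T *m W) (z i) + 2 * rho * pr (l i) (z i) -
   (1 + rho) ^+ 2)).
  apply: eq_mean => i; rewrite /residual.
  have lSy : pr (l i *m S) y^T = 1 by rewrite prM Sy lx.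
  have ySy : pr (y *m S) y^T = 1 by rewrite prM Sy yx1.
  have zWSy : pr ((z i)^T *m W *m S) y^T = 1.
    by rewrite -mulmxA WS mulmx1 -[z i]trmxK prT trmxK yz.
  have lSWz : pr (l i *m S) (W^T *m z i) = pr (l i) (z i).
    by rewrite W_sym -prM -mulmxA SW mulmx1.
  have ySl : pr (y *m S) (l i)^T = 1.
    by rewrite -prT trmx_mul trmxK Mzz_sym -prM.
  have ySWz : pr (y *m S) (W^T *m z i) = 1.
    by rewrite W_sym -prM -mulmxA SW mulmx1 yz.
  have zWSl : pr ((z i)^T *m W *m S) (l i)^T = pr (l i) (z i).
    by rewrite -mulmxA WS mulmx1 prT.
  have zWSWz : pr ((z i)^T *m W *m S) (W^T *m z i) = pr ((z i)^T *m W) (z i).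
    by rewrite -mulmxA WS mulmx1 W_sym -prM.
  have -> : (l i + rho *: ((z i)^T *m W) - (1 + rho) *: y)^T =
      (l i)^T + rho *: (W^T *m z i) - (1 + rho) *: y^T.
    by apply/matrixP => a b; rewrite -[W^T *m z i]trmxK trmx_mul trmxK !mxE.
  rewrite !mulmxBl !mulmxDl -!scalemxAl.
  rewrite !prBl !prBr !prDl !prDr !prZl !prZr.
  rewrite lSy ySy zWSy lSWz ySl ySWz zWSl zWSWz; ring.
rewrite (meanB p_gt0 p_cvg); [|bdd|bdd].
rewrite (meanD p_gt0 p_cvg); [|bdd|bdd].
rewrite (meanD p_gt0 p_cvg); [|bdd|bdd].
rewrite (mean_cst p_gt0 p_cvg) !(meanZ p_gt0 p_cvg)//.
by rewrite mean_qf_l// mean_qf_z// WS mxtrace1 mxtrace_mulC; ring.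
Qed.

(* The saddle inequality forces the covectors l i to be close to the polars of
   the points z i for the quadratic form (n + 1) y^2 - W, n = m - 1. *)
Lemma residual_le (n : R) : 0 < n -> n = m%:R - 1 ->
  E (fun i => pr (residual n^-1 i *m S) (residual n^-1 i)^T) <=
  (n - 2 * k * (1 - dbar)) / (2 * k + 1) - 2 / n * (1 - dbar) + n^-1.
Proof.
move=> n0 nE.
rewrite mean_residual.
have k1 : 0 < 2 * k + 1 by rewrite ltr_wpDl// mulr_ge0.
have := moment_ineq; rewrite -nE mulrC -ler_pdivlMr// => H.
have -> : m%:R = n + 1 by rewrite nE subrK.
have -> : (n - 2 * k * (1 - dbar)) / (2 * k + 1) =
   (n + 2 * k * (dbar - 1)) / (2 * k + 1) by congr (_ / _); ring.
have : n^-1 ^+ 2 * (n + 1) - (1 + n^-1) ^+ 2 + 2 * n^-1 * dbar =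
   - 1 - 2 / n * (1 - dbar) + n^-1 by field; rewrite gt_eqF.
move: H; clra.
Qed.

End moments.

(** * Cones and cocompact families *)

Section matrix_norm.
Context {R : realType}.

Lemma mx_norm_coord m n (A : 'M[R]_(m, n)) i j : `|A i j| <= `|A|.
Proof.
rewrite [leRHS]/Num.Def.normr/= mx_normrE.
by apply/bigmax_geP; right => /=; exists (i, j).
Qed.

Lemma mx_norm_le m n (A : 'M[R]_(m, n)) e : 0 <= e ->
  (forall i j, `|A i j| <= e) -> `|A| <= e.
Proof.
by move=> e0 H; rewrite /Num.Def.normr/= mx_normrE (bigmax_le _ e0).
Qed.

Lemma mx_norm_mul m n q (A : 'M[R]_(m, n)) (B : 'M[R]_(n, q)) :
  `|A *m B| <= n%:R * (`|A| * `|B|).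
Proof.
apply: mx_norm_le => [|i j]; first by rewrite !mulr_ge0.
rewrite mxE (le_trans (ler_norm_sum _ _ _))//.
apply: (@le_trans _ _ (\sum_(k < n) `|A| * `|B|)).
  by apply: ler_sum => k _; rewrite normrM ler_pM// mx_norm_coord.
by rewrite sumr_const card_ord mulr_natl.
Qed.

Lemma mx_norm_tr m n (A : 'M[R]_(m, n)) : `|A^T| = `|A|.
Proof.
apply/le_anti/andP; split; apply: mx_norm_le => // i j.
  by rewrite mxE mx_norm_coord.
by have := mx_norm_coord A^T j i; rewrite mxE.
Qed.

Lemma pr_norm m (y : 'rV[R]_m) u : `|pr y u| <= m%:R * (`|y| * `|u|).
Proof. by rewrite (le_trans _ (mx_norm_mul y u))// /pr mx_norm_coord. Qed.

(** Bolzano-Weierstrass in the form used below: the limit is approached arbitrarily late, with no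
    subsequence named. *)
Lemma bounded_seq_cluster (I : finType) (u : nat -> I -> R) (M : R) :
  (forall j a, `|u j a| <= M) ->
  exists l : I -> R, forall e, 0 < e -> forall n0,
    exists2 j, (n0 <= j)%N & forall a, `|u j a - l a| < e.
Proof.
move=> uM; pose d := #|I|.
pose v j : 'rV[R]_d := \row_b u j (enum_val b).
pose A := [set w : 'rV[R]_d | forall b, w 0 b \in `[- M, M]%R].
have cA : compact A.
  by apply: (@rV_compact R d (fun=> `[- M, M]%classic)) => _;
    exact: segment_compact.
have FA : nbhs (v @ \oo) A.
  exists 0%N => // j _ b; rewrite /v mxE in_itv/= -ler_norml; exact: uM.
have [w [_ cl]] := cA (v @ \oo) _ FA.
exists (fun a => w 0 (enum_rank a)) => e e0 n0.
have Fn : nbhs (v @ \oo) [set v j | j in [set j | (n0 <= j)%N]].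
  by exists n0 => // j n0j; exists j.
have [q [[j /= n0j <-]]] := cl _ _ Fn (nbhsx_ballx w e e0).
move=> [_ H]; exists j => // a.
by have := H 0 (enum_rank a); rewrite /ball/= mxE enum_rankK distrC.
Qed.

Lemma mx_seq_cluster m n (u : nat -> 'M[R]_(m, n)) (M : R) :
  (forall j, `|u j| <= M) -> exists z, forall e, 0 < e -> forall n0,
    exists2 j, (n0 <= j)%N & `|u j - z| <= e.
Proof.
move=> uM; have [|L HL] := @bounded_seq_cluster ('I_m * 'I_n)%type
   (fun j ab => u j ab.1 ab.2) M.
  by move=> j ab; rewrite (le_trans (mx_norm_coord _ _ _)).
exists (\matrix_(a, b) L (a, b)) => e e0 n0.
have [j nj Hj] := HL e e0 n0; exists j => //.
apply: mx_norm_le => [|a b]; first exact: ltW.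
by rewrite !mxE ltW// (Hj (a, b)).
Qed.

Lemma pr_cluster m (u : nat -> 'cV[R]_m) z (w : 'rV[R]_m) :
  (forall e, 0 < e -> forall n0, exists2 j, (n0 <= j)%N & `|u j - z| <= e) ->
  forall e, 0 < e -> forall n0, exists2 j, (n0 <= j)%N &
    `|u j - z| <= e /\ `|pr w (u j) - pr w z| <= e.
Proof.
move=> Hz e e0 n0; have d0 : 0 < m%:R * `|w| + 1 :> R.
  by rewrite ltr_wpDl// mulr_ge0.
have [j nj hj] := Hz (e / (m%:R * `|w| + 1)) (divr_gt0 e0 d0) n0.
exists j => //; split.
  by rewrite (le_trans hj)// ler_pdivrMr// ler_peMr ?(ltW e0)// lerDr mulr_ge0.
rewrite -prBr (le_trans (pr_norm _ _))// mulrA.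
apply: (@le_trans _ _ ((m%:R * `|w| + 1) * `|u j - z|)).
  by rewrite ler_wpM2r// lerDl.
by rewrite -ler_pdivlMl// mulrC.
Qed.

End matrix_norm.

(** * Open convex cones and their duals *)

Section cone.
Context {R : realType} {m : nat} (C : set 'cV[R]_m) (y1 : 'rV[R]_m)
  (x1 : 'cV[R]_m).
Implicit Types (u v w x : 'cV[R]_m) (y : 'rV[R]_m).

(* C is an open convex cone, and y1 is positive on its closure minus 0. *)
Record based_cone := BasedCone {
  cone_open : forall u, C u -> exists2 r, 0 < r & forall w, `|w| <= r -> C (u + w);
  cone_add : forall u v, C u -> C v -> C (u + v);
  cone_scale : forall c u, 0 < c -> C u -> C (c *: u);
  cone_pos : forall u, C u -> 0 < pr y1 u;
  cone_bound : exists2 c, 0 < c & forall u, C u -> `|u| <= c * pr y1 u;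
  cone_base : C x1;
  cone_base1 : pr y1 x1 = 1 }.

(** The closure of C, tested along the single interior direction x1. *)
Definition clC u := forall d, 0 < d -> C (u + d *: x1).

(* Functionals positive on the closure of the cone minus 0. *)
Definition dual_pos y := exists2 e, 0 < e & forall u, C u -> e * pr y1 u <= pr y u.

Hypothesis HC : based_cone.

Lemma clC_sub u : C u -> clC u.
Proof.
by move=> Cu d d0; apply: cone_add => //; apply: cone_scale => //; case: HC.
Qed.

(** A small multiple of x1 is moved from u, which has room for it, to v. *)
Lemma clC_add u v : C u -> clC v -> C (u + v).
Proof.
move=> Cu cv; have [r r0 H] := cone_open HC Cu.
have x0 : 0 < `|x1| + 1 by rewrite ltr_wpDl.
pose d := r / (`|x1| + 1).
have d0 : 0 < d by rewrite divr_gt0.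
have -> : u + v = (u + - (d *: x1)) + (v + d *: x1).
  by rewrite addrACA addNr addr0.
apply: cone_add => //; last exact: cv.
apply: H; rewrite normrN normrZ gtr0_norm// /d mulrAC -mulrA.
by rewrite ler_piMr ?(ltW r0)// ler_pdivrMr// mul1r lerDl.
Qed.

Lemma clC_ge0 u : clC u -> 0 <= pr y1 u.
Proof.
move=> cu; apply: (@ler_small_slack _ _ _ 1 1) => // d d0 _; rewrite mul1r.
by have := cone_pos HC (cu d d0); rewrite prDr prZr cone_base1// mulr1 => /ltW.
Qed.

Lemma cone_dom u : C u -> exists2 c, 0 < c &
  forall v, C v -> C ((c * pr y1 v) *: u - v).
Proof.
move=> Cu; have [r r0 H] := cone_open HC Cu; have [b b0 Hb] := cone_bound HC.
exists (b / r); first by rewrite divr_gt0.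
move=> v Cv; have pv := cone_pos HC Cv.
have c0 : 0 < b / r * pr y1 v by rewrite mulr_gt0// divr_gt0.
have -> : (b / r * pr y1 v) *: u - v =
   (b / r * pr y1 v) *: (u + - ((b / r * pr y1 v)^-1 *: v)).
  by rewrite scalerDr scalerN scalerA divff ?scale1r// gt_eqF.
apply: cone_scale => //; apply: H.
rewrite normrN normrZ gtr0_norm ?invr_gt0// ler_pdivrMl//.
by rewrite (le_trans (Hb _ Cv))// mulrAC divfK ?gt_eqF.
Qed.

Lemma dual_pos_gt0 y u : dual_pos y -> C u -> 0 < pr y u.
Proof.
by move=> [e e0 H] Cu; rewrite (lt_le_trans _ (H u Cu))// mulr_gt0// cone_pos.
Qed.

Lemma y1_dual_pos : dual_pos y1.
Proof. by exists 1 => // u _; rewrite mul1r. Qed.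

Lemma dual_pos_scale c y : 0 < c -> dual_pos y -> dual_pos (c *: y).
Proof.
move=> c0 [e e0 H]; exists (c * e) => [|u Cu]; first by rewrite mulr_gt0.
by rewrite prZl -mulrA ler_pM2l// H.
Qed.

Lemma nonneg_clC y u : (forall v, C v -> 0 <= pr y v) -> clC u -> 0 <= pr y u.
Proof.
move=> H cu; apply: (@ler_small_slack _ _ _ (pr y x1) 1) => // d d0 _.
by have := H _ (cu d d0); rewrite prDr prZr mulrC.
Qed.

Lemma nonneg_le y u v : (forall v, C v -> 0 <= pr y v) -> clC (v - u) ->
  pr y u <= pr y v.
Proof. by move=> H /(nonneg_clC H); rewrite prBr subr_ge0. Qed.

(** If y vanished at the interior point u, nonnegativity on both sides of u in every direction would
    force y = 0. *)
Lemma nonneg_pos y u : (forall v, C v -> 0 <= pr y v) -> y != 0 -> C u ->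
  0 < pr y u.
Proof.
move=> H y0 Cu; rewrite lt_neqAle H// andbT eq_sym.
apply: contraNneq y0 => yu; apply/eqP/pr_eq => w; rewrite pr0l.
have [r r0 Hr] := cone_open HC Cu.
have w1 : 0 < `|w| + 1 by rewrite ltr_wpDl.
have c0 : 0 < r / (`|w| + 1) by rewrite divr_gt0.
have small s : `|s| = 1 -> C (u + (s * (r / (`|w| + 1))) *: w).
  move=> s1; apply: Hr; rewrite normrZ normrM s1 mul1r gtr0_norm//.
  by rewrite mulrAC -mulrA ler_piMr ?(ltW r0)// ler_pdivrMr// mul1r lerDl.
have := H _ (small 1 (normr1 _)); have := H _ (small (-1) (normrN1 _)).
rewrite !prDr !prZr yu !add0r mul1r mulN1r mulNr oppr_ge0.
rewrite pmulr_rle0// pmulr_rge0// => h1 h2.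
by apply/eqP; rewrite eq_le h1 h2.
Qed.

End cone.

Lemma ler_sum_sub {R : realDomainType} (I : eqType) (s t : seq I) (F : I -> R) :
  uniq s -> uniq t -> {subset s <= t} -> (forall i, 0 <= F i) ->
  \sum_(i <- s) F i <= \sum_(i <- t) F i.
Proof.
move=> us ut st F0; rewrite [leRHS](bigID (fun j => j \in s))/=.
rewrite -[leLHS]addr0 lerD//; last by apply: sumr_ge0 => i _.
rewrite -[leRHS]big_filter le_eqVlt; apply/orP; left; apply/eqP.
apply: perm_big; apply: uniq_perm; rewrite ?filter_uniq//.
by move=> i; rewrite mem_filter andb_idr//; exact: st.
Qed.

(** * Cocompact families and the size of their elements *)

Section family.
Context {R : realType} {m : nat} (C : set 'cV[R]_m) (y1 : 'rV[R]_m)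
  (x1 : 'cV[R]_m) (g : nat -> 'M[R]_m).

(* Up to positive scalars, the g i enumerate a discrete group of matrices that
   preserve C and act cocompactly on its projectivization. *)
Record cocompact_family := CocompactFamily {
  fam_unit : forall i, g i \in unitmx;
  fam_C : forall i u, C u -> C (g i *m u);
  fam_invC : forall i u, C u -> C (invmx (g i) *m u);
  fam_div : forall i j, exists kc : nat * R,
    0 < kc.2 /\ invmx (g i) *m g j = kc.2 *: g kc.1;
  fam_mul : forall i j, exists kc : nat * R,
    0 < kc.2 /\ g i *m g j = kc.2 *: g kc.1;
  fam_discr : exists2 e, 0 < e & forall i j c,
    `|c *: (invmx (g i) *m g j) - 1%:M| < e -> i = j;
  fam_cocpt : exists2 K, 0 < K & forall u, C u -> exists ic : nat * R,
    [/\ 0 < ic.2, pr y1 (ic.2 *: (invmx (g ic.1) *m u)) = 1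
      & C (K *: (ic.2 *: (invmx (g ic.1) *m u)) - x1)] }.

Definition lf i : 'rV[R]_m := y1 *m invmx (g i).
Definition vf i : 'cV[R]_m := g i *m x1.
Definition tau i : R := pr (lf i) x1 * pr y1 (vf i).

Hypothesis HC : based_cone C y1 x1.
Hypothesis Hg : cocompact_family.

Lemma Cv i : C (vf i). Proof. by apply: fam_C => //; case: HC. Qed.

Lemma lf_pos i u : C u -> 0 < pr (lf i) u.
Proof. by move=> Cu; rewrite prM (cone_pos HC)//; exact: fam_invC. Qed.

Lemma lv1 i : pr (lf i) (vf i) = 1.
Proof. by rewrite prM mulKmx ?(cone_base1 HC)//; exact: fam_unit. Qed.

Lemma tau_gt0 i : 0 < tau i.
Proof.
rewrite mulr_gt0 ?lf_pos ?(cone_pos HC)//; last exact: Cv.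
by case: HC.
Qed.

(** v_i is dominated by a y1(v_i) x1; applying l_i, which is 1 at v_i, gives 1 < a tau_i. *)
Lemma tau_ge : exists2 c, 0 < c & forall i, c <= tau i.
Proof.
have [a a0 Ha] := cone_dom HC (cone_base HC).
exists a^-1 => [|i]; first by rewrite invr_gt0.
rewrite -div1r ler_pdivrMr//.
have := lf_pos i (Ha _ (Cv i)); rewrite prBr prZr lv1 subr_gt0 /tau.
by clra.
Qed.

(** A coordinate vector e is a difference of points x1 + r e and x1 of C up to the factor r, and A
    maps these to points of C whose norm is controlled by y1, hence by the order unit x1. *)
Lemma preserving_bound : exists2 B, 0 < B &
  forall A : 'M[R]_m, (forall u, C u -> C (A *m u)) -> `|A| <= B * pr y1 (A *m x1).
Proof.
have [r r0 Hr] := cone_open HC (cone_base HC); have [b b0 Hb] := cone_bound HC.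
have [a a0 Ha] := cone_dom HC (cone_base HC).
have q0 : 0 <= m%:R * (`|y1| * r) :> R by rewrite !mulr_ge0// ltW.
have aq : 0 <= a * (1 + m%:R * (`|y1| * r)) by rewrite mulr_ge0 ?addr_ge0// ltW.
exists (b / r * (a * (1 + m%:R * (`|y1| * r)) + 1)).
  by apply: mulr_gt0; [rewrite divr_gt0|rewrite ltr_wpDl].
move=> A AC; have CA := AC _ (cone_base HC).
have pA := cone_pos HC CA.
apply: mx_norm_le => [|i j].
  apply: mulr_ge0; last exact: ltW.
  by apply: mulr_ge0; [rewrite divr_ge0// ltW|rewrite addr_ge0].
pose e : 'cV[R]_m := delta_mx j 0.
have en : `|e| <= 1.
  apply: mx_norm_le => // p q; rewrite mxE; case: (_ && _); by rewrite ?normr1 ?normr0.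
have Ce : C (x1 + r *: e).
  by apply: Hr; rewrite normrZ gtr0_norm// ler_piMr// ltW.
have E : A *m e = r^-1 *: (A *m (x1 + r *: e) - A *m x1).
  rewrite mulmxDr addrC addKr -scalemxAr scalerA mulVf ?scale1r ?gt_eqF//.
have -> : A i j = (A *m e) i 0.
  by rewrite /e -colE mxE.
rewrite (le_trans (mx_norm_coord _ _ _))// E normrZ gtr0_norm ?invr_gt0//.
have -> : b / r * (a * (1 + m%:R * (`|y1| * r)) + 1) * pr y1 (A *m x1) =
   r^-1 * (b * (a * (1 + m%:R * (`|y1| * r)) * pr y1 (A *m x1)) +
     b * pr y1 (A *m x1)) by ring.
rewrite ler_pM2l ?invr_gt0// (le_trans (ler_normB _ _))// lerD//; last exact: Hb.
rewrite (le_trans (Hb _ (AC _ Ce)))// ler_pM2l//.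
have := cone_pos HC (AC _ (Ha _ Ce)).
rewrite mulmxBr prBr -scalemxAr prZr subr_gt0 => /ltW /le_trans; apply.
rewrite ler_pM2r// ler_pM2l// prDr (cone_base1 HC) lerD2l prZr.
have ye : pr y1 e <= m%:R * `|y1|.
  rewrite (le_trans (ler_norm _))// (le_trans (pr_norm _ _))// ler_wpM2l//.
  by rewrite ler_piMr.
by rewrite mulrA [leRHS]mulrC ler_pM2l.
Qed.

(** Scaled to y1(v_i) = 1, the matrices with tau_i <= T are bounded together with their inverses.
    Infinitely many of them would cluster, and two close ones have a quotient near the identity,
    against discreteness. *)
Lemma tau_finite T : exists M, forall i, tau i <= T -> (i < M)%N.
Proof.
apply: contrapT => /forallNP H.
have {}H M : exists i, (M <= i)%N && (tau i <= T).
  have := H M => /existsNP[i /not_implyP[iT /negP]]; rewrite -leqNgt => Mi.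
  by exists i; rewrite Mi.
have {H}[f Hf] := choice H.
have [B B0 HB] := preserving_bound; have [e e0 He] := fam_discr Hg.
have T0 : 0 < T.
  by have /andP[_] := Hf 0%N; apply: lt_le_trans; exact: tau_gt0.
pose h j : 'M[R]_m := (pr y1 (vf (f j)))^-1 *: g (f j).
have hb j : `|h j| <= B.
  rewrite normrZ gtr0_norm ?invr_gt0 ?(cone_pos HC (Cv _))//.
  rewrite ler_pdivrMl ?(cone_pos HC (Cv _))// mulrC.
  by apply: HB => u; exact: fam_C.
have [|L HL] := @bounded_seq_cluster R ('I_m * 'I_m)%type
   (fun j ab => h j ab.1 ab.2) B.
  by move=> j ab; rewrite (le_trans (mx_norm_coord _ _ _)).
have md : 0 < m%:R * (B * T) + 1 :> R.
  by rewrite ltr_wpDl// mulr_ge0// mulr_ge0// ltW.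
pose eta := e / (m%:R * (B * T) + 1) / 4.
have eta0 : 0 < eta by rewrite !divr_gt0.
have [j1 _ H1] := HL _ eta0 0%N.
(* f j2 >= j2 > f j1, so the two indices differ. *)
have [j2 j12 H2] := HL _ eta0 (f j1).+1.
suff : f j1 = f j2.
  have /andP[] := Hf j2; move: j12; move: (f j1) (f j2) => a b ab jb _ E.
  by move: ab; rewrite E ltnNge jb.
apply: (He _ _ (pr y1 (vf (f j1)) / pr y1 (vf (f j2)))).
have p1 := cone_pos HC (Cv (f j1)); have p2 := cone_pos HC (Cv (f j2)).
have -> : (pr y1 (vf (f j1)) / pr y1 (vf (f j2))) *: (invmx (g (f j1)) *m g (f j2)) - 1%:M =
   (pr y1 (vf (f j1)) *: invmx (g (f j1))) *m (h j2 - h j1).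
  rewrite mulmxBr /h -!scalemxAl -!scalemxAr !scalerA mulVmx ?(fam_unit Hg)//.
  by rewrite divff ?scale1r ?gt_eqF.
rewrite (le_lt_trans (mx_norm_mul _ _))//.
have hh : `|h j2 - h j1| <= 2 * eta.
  apply: mx_norm_le => [|a b]; first by rewrite mulr_ge0 ?ltW.
  have -> : (h j2 - h j1) a b = (h j2 a b - L (a, b)) - (h j1 a b - L (a, b)).
    by rewrite !mxE; ring.
  rewrite (le_trans (ler_normB _ _))//; have := H1 (a, b); have := H2 (a, b).
  by move=> /= h1 h2; lra.
have hi : `|pr y1 (vf (f j1)) *: invmx (g (f j1))| <= B * T.
  rewrite normrZ gtr0_norm//.
  have /andP[_ Tj] := Hf j1.
  have := HB _ (fam_invC Hg (f j1)); rewrite -(ler_pM2l p1) => /le_trans; apply.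
  by rewrite mulrCA ler_pM2l// -prM mulrC.
have := ler_pM (normr_ge0 _) (normr_ge0 _) hi hh => h3.
rewrite (le_lt_trans (ler_wpM2l (ler0n _ _) h3))//.
have : (m%:R * (B * T) + 1) * (4 * eta) = e.
  by rewrite /eta; field; rewrite gt_eqF.
have : 0 <= m%:R * (B * T) by rewrite mulr_ge0// mulr_ge0// ltW.
move=> h4 h5; have := mulr_ge0 h4 (ltW eta0); lra.
Qed.

Lemma fam_inj i j c : 0 < c -> g i = c *: g j -> i = j.
Proof.
move=> c0 E; have [e e0 He] := fam_discr Hg; apply: (He i j c).
by rewrite scalemxAr -E mulVmx ?(fam_unit Hg)// subrr normr0.
Qed.

End family.

(** * Factorization of group elements and the critical exponent *)

Section factorization.
Context {R : realType} {m : nat} (C : set 'cV[R]_m) (y1 : 'rV[R]_m)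
  (x1 : 'cV[R]_m) (g : nat -> 'M[R]_m).
Hypothesis HC : based_cone C y1 x1.
Hypothesis Hg : cocompact_family C y1 x1 g.
Notation tau := (tau y1 x1 g).
Notation lf := (lf y1 g).
Notation vf := (vf x1 g).

(* Moving along the segment from x1 to vf i until it leaves the ball of radius
   (ln rho) / 2 factors g i into an element of size about rho and a remainder,
   with almost multiplicative sizes. *)
Lemma tau_factor : exists2 D, 1 <= D & forall rho i, 1 < rho -> rho < tau i ->
  exists jk : nat * nat, [/\ exists2 c, 0 < c & g i = c *: (g jk.1 *m g jk.2),
    rho / D <= tau jk.1 <= D * rho, tau jk.2 <= D / rho * tau i
    & tau jk.1 * tau jk.2 <= D * tau i].
Proof.
have [a0 a00 Ha0] := cone_dom HC (cone_base HC).
have [K0 K00 HK0] := fam_cocpt Hg.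
pose a := a0 + 1; pose K := K0 + 1.
have a1 : 1 <= a by rewrite lerDr ltW.
have K1 : 1 <= K by rewrite lerDr ltW.
have ag0 : 0 < a by exact: lt_le_trans a1.
have Kg0 : 0 < K by exact: lt_le_trans K1.
have Cx1 := cone_base HC.
have py u : C u -> 0 < pr y1 u by exact: cone_pos HC u.
have pl i u : C u -> 0 < pr (lf i) u by move=> Cu; exact: (lf_pos HC Hg).
have pv i u : C u -> 0 < pr (y1 *m g i) u.
  by move=> Cu; rewrite prM py//; exact: (fam_C Hg).
have gU i : g i \in unitmx by exact: (fam_unit Hg).
have Cvi i : C (vf i) by exact: (Cv HC Hg).
pose pos (f : 'rV[R]_m) := forall u, C u -> 0 < pr f u.
have dom (f : 'rV[R]_m) v : pos f -> C v -> pr f v <= a * pr y1 v * pr f x1.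
  move=> Hf Cv; have := Hf _ (Ha0 _ Cv); rewrite prBr prZr subr_gt0.
  have := mulr_gt0 (py _ Cv) (Hf _ Cx1); rewrite /a; clra.
have HK u : C u -> exists ic : nat * R,
    [/\ 0 < ic.2, ic.2 * pr (lf ic.1) u = 1 &
      forall f, pos f -> pr f x1 <= K * (ic.2 * pr f (invmx (g ic.1) *m u))].
  move=> Cu; have [ic [c0 H1 H2]] := HK0 u Cu.
  exists ic; split => //; first by rewrite prM -prZr.
  move=> f Hf; have := Hf _ H2; rewrite prBr !prZr subr_gt0.
  have := mulr_gt0 c0 (Hf _ (fam_invC Hg ic.1 Cu)).
  rewrite /K; clra.
exists (K * a * (K * a ^+ 2)).
  by rewrite !mulr_ege1 ?exprn_ege1// !mulr_ege1.
move=> rho i rho1 rhoi.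
pose u := pr y1 (vf i); pose w := pr (lf i) x1.
have u0 : 0 < u by exact: py.
have w0 : 0 < w by exact: pl.
have tE : tau i = w * u by [].
have r0 : 0 < rho by exact: lt_trans rho1.
have trho : 0 < w * u - rho by rewrite subr_gt0 -tE.
(* The point x1 + be v_i dominates x1 with factor about 1 + be / w and is dominated by x1 with
   factor about 1 + be u; be makes the ratio of these factors equal to rho. *)
pose be := w * (rho - 1) / (w * u - rho).
have be0 : 0 < be by rewrite divr_gt0 ?mulr_gt0 ?subr_gt0.
have s0 : 0 < 1 + be / w by rewrite addr_gt0// divr_gt0.
have s1 : 0 < 1 + be * u by rewrite addr_gt0// mulr_gt0.
have bee : 1 + be * u = rho * (1 + be / w).
  by rewrite /be; field; rewrite (gt_eqF w0) (gt_eqF trho).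
have Cp : C (x1 + be *: vf i).
  by apply: (cone_add HC) => //; exact: (cone_scale HC).
(* g j is the first factor: its inverse brings the point back to the compact part. The second one
   will be g j^-1 g i. *)
have [[j c] /= [c0 lpp HKj]] := HK _ Cp.
have pE f : pr f (x1 + be *: vf i) = pr f x1 + be * pr f (vf i).
  by rewrite prDr prZr.
(* the point of the segment dominates both endpoints *)
have x1vi f : pos f -> pr f x1 <= a * w * pr f (vf i).
  move=> Hf; have Hfg : pos (f *m g i).
    by move=> z Cz; rewrite prM Hf//; exact: (fam_C Hg).
  have := dom _ _ Hfg (fam_invC Hg i Cx1).
  by rewrite !(prM f) mulKVmx// -(prM y1).
have P1 f : pos f -> (1 + be / w) * pr f x1 <= a * (pr f x1 + be * pr f (vf i)).
  move=> Hf; have := x1vi f Hf => h.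
  have : be / w * pr f x1 <= be / w * (a * w * pr f (vf i)).
    by rewrite ler_wpM2l// divr_ge0// ltW.
  have -> : be / w * (a * w * pr f (vf i)) = a * (be * pr f (vf i)).
    by field; rewrite ?gt_eqF.
  have := ler_wpM2r (ltW (Hf _ Cx1)) a1.
  by move: h; clra.
have P2 f : pos f -> (1 + be * u) * pr f (vf i) <= a * u * (pr f x1 + be * pr f (vf i)).
  move=> Hf; have := @dom f (vf i) Hf (Cvi i); rewrite -/u => h.
  have : 1 * (be * u * pr f (vf i)) <= a * (be * u * pr f (vf i)).
    exact: (ler_wpM2r (ltW (mulr_gt0 (mulr_gt0 be0 u0) (Hf _ (Cvi i)))) a1).
  by move: h; clra.
have [[k c'] /= [c'0 Ek]] := fam_div Hg j i.
have gi : g i = c' *: (g j *m g k) by rewrite scalemxAr -Ek mulKVmx.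
have gki : invmx (g k) = c' *: (invmx (g i) *m g j).
  apply: (can_inj (mulKmx (gU k))); rewrite mulmxV// -scalemxAr.
  by rewrite mulmxA !scalemxAl -Ek mulmxK// mulVmx.
have lkE z : pr (lf k) z = c' * pr (lf i) (g j *m z).
  by rewrite /lf gki -scalemxAr prZl !prM !mulmxA.
have vkE f : pr f (vf k) = c'^-1 * pr f (invmx (g j) *m vf i).
  rewrite /vf mulmxA Ek -scalemxAl prZr mulKf// gt_eqF//.
have tk : tau k = pr (lf i) (vf j) * pr (lf j) (vf i).
  rewrite /tau lkE vkE mulrACA divff ?mul1r ?gt_eqF//.
  by rewrite (prM y1 (invmx (g j))).
have E1 : pr y1 (vf j) <= K * c * (1 + be * u).
  have := HKj _ (pv j); rewrite prM => /le_trans; apply.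
  by rewrite prM mulKVmx// pE (cone_base1 HC) -/u mulrA.
have lpp' : pr (lf j) (x1 + be *: vf i) = c^-1.
  by apply: (@mulfI _ c); rewrite ?gt_eqF// lpp mulfV// gt_eqF.
have E2 : (1 + be / w) * pr (lf j) x1 <= a / c.
  by rewrite (le_trans (P1 _ (pl j)))// -pE lpp'.
have E3 : (1 + be * u) * pr (lf j) (vf i) <= a * u / c.
  by rewrite (le_trans (P2 _ (pl j)))// -pE lpp'.
have E4 : pr (lf i) (vf j) <= K * c * (w * (1 + be / w)).
  have pf : pos (lf i *m g j) by move=> z Cz; rewrite prM pl//; exact: (fam_C Hg).
  have := HKj _ pf; rewrite prM => /le_trans; apply.
  have -> : w * (1 + be / w) = w + be * 1 by field; rewrite ?gt_eqF.
  by rewrite prM mulKVmx// pE (lv1 HC Hg) -/w mulrA.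
have ljx := pl j _ Cx1; have yvj := py _ (Cvi j).
have ljv := pl j _ (Cvi i); have liv := pl i _ (Cvi j).
have B1 : tau j <= K * a * rho.
  have -> : tau j = pr (lf j) x1 * pr y1 (vf j) by [].
  rewrite -(ler_pM2l s0) mulrA.
  have := ler_pM (ltW (mulr_gt0 s0 ljx)) (ltW yvj) E2 E1 => /le_trans; apply.
  rewrite bee le_eqVlt; apply/orP; left; apply/eqP.
  by field; rewrite ?gt_eqF.
have B2 : tau k <= K * a / rho * tau i.
  rewrite -(ler_pM2l s1) tk mulrCA.
  have := ler_pM (ltW liv) (ltW (mulr_gt0 s1 ljv)) E4 E3 => /le_trans; apply.
  rewrite bee tE le_eqVlt; apply/orP; left; apply/eqP.
  by field; rewrite ?gt_eqF.
have B3 : tau i <= a ^+ 2 * (tau j * tau k).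
  have h1 : pr y1 (vf i) <= c' * (a * pr y1 (vf k) * pr y1 (vf j)).
    rewrite /vf {1}gi -scalemxAl prZr ler_pM2l// -mulmxA -prM.
    by have := dom _ _ (pv j) (Cvi k); rewrite !(prM y1).
  have h2 : pr (lf i) x1 <= c'^-1 * (a * pr (lf j) x1 * pr (lf k) x1).
    have -> : lf i = c'^-1 *: (lf k *m invmx (g j)).
      by rewrite /lf gki -scalemxAr -!scalemxAl scalerA mulVf ?gt_eqF// scale1r
        -!mulmxA mulmxV// mulmx1.
    rewrite prZl ler_pM2l ?invr_gt0// prM.
    by have := dom _ _ (pl k) (fam_invC Hg j Cx1); rewrite -(prM y1).
  have := ler_pM (ltW w0) (ltW u0) h2 h1 => /le_trans; apply.
  rewrite /tau le_eqVlt; apply/orP; left; apply/eqP.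
  by field; rewrite ?gt_eqF.
have tj0 : 0 < tau j by exact: (tau_gt0 HC Hg).
have tk0 : 0 < tau k by exact: (tau_gt0 HC Hg).
have ti0 : 0 < tau i by exact: (tau_gt0 HC Hg).
have Ka1 : 1 <= K * a by rewrite mulr_ege1.
have Ka2 : 1 <= K * a ^+ 2 by rewrite mulr_ege1// exprn_ege1.
have Ka0 : 0 < K * a by rewrite mulr_gt0.
have KD : K * a <= K * a * (K * a ^+ 2) by rewrite ler_peMr// ltW.
have D0 : 0 < K * a * (K * a ^+ 2) by rewrite !mulr_gt0// exprn_gt0.
exists (j, k); split => /=.
- by exists c'.
- apply/andP; split; last by rewrite (le_trans B1)// ler_wpM2r// ltW.
  rewrite ler_pdivrMr// -(ler_pM2r ti0).
  have : rho * tau i <= rho * (a ^+ 2 * (tau j * (K * a / rho * tau i))).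
    rewrite ler_pM2l// (le_trans B3)// ler_wpM2l ?sqr_ge0//.
    by rewrite ler_wpM2l// ltW.
  have -> : rho * (a ^+ 2 * (tau j * (K * a / rho * tau i))) =
    tau j * (K * a * a ^+ 2) * tau i by field; rewrite ?gt_eqF.
  move=> /le_trans; apply; rewrite ler_pM2r// ler_pM2l// ler_pM2l//.
  by rewrite ler_peMl ?sqr_ge0.
- rewrite (le_trans B2)// ler_wpM2r ?(ltW ti0)//.
  by rewrite ler_wpM2r// invr_ge0 ltW.
- rewrite (le_trans (ler_pM (ltW tj0) (ltW tk0) B1 B2))//.
  have -> : K * a * rho * (K * a / rho * tau i) = K * a * (K * a) * tau i.
    by field; rewrite ?gt_eqF.
  rewrite ler_pM2r// ler_pM2l// ler_pM2l// expr2 ler_peMl// ltW//.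
Qed.

End factorization.

Section summability.
Context {R : realType} {m : nat} (C : set 'cV[R]_m) (y1 : 'rV[R]_m)
  (x1 : 'cV[R]_m) (g : nat -> 'M[R]_m).
Hypothesis HC : based_cone C y1 x1.
Hypothesis Hg : cocompact_family C y1 x1 g.
Notation tau := (tau y1 x1 g).

Definition tau_summable (k : R) :=
  exists M, forall N, \sum_(0 <= i < N) tau i `^ (- k) <= M.

Let t0 i : 0 < tau i. Proof. exact: (tau_gt0 HC Hg). Qed.

Lemma tau_summable_seq k : tau_summable k -> exists M, forall s, uniq s ->
  \sum_(i <- s) tau i `^ (- k) <= M.
Proof.
move=> [M HM]; exists M => s us; apply: le_trans (HM (\max_(i <- s) i).+1).
apply: ler_sum_sub => //; first exact: iota_uniq.
  by move=> i si; rewrite mem_index_iota ltnS; exact: leq_bigmax_seq.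
by move=> i; exact: powR_ge0.
Qed.

Lemma tau_powRM_le (k D a b c : R) : 0 <= k -> 0 < D -> 0 < a -> 0 < b -> 0 < c ->
  a * b <= D * c -> c `^ (- k) <= D `^ k * (a `^ (- k) * b `^ (- k)).
Proof.
move=> k0 D0 a0 b0 c0 H.
rewrite -powRM ?(ltW a0) ?(ltW b0)//.
have -> : D `^ k = (D `^ (- k))^-1 by rewrite powRN invrK.
rewrite ler_pdivlMl ?powR_gt0// -powRM ?(ltW D0) ?(ltW c0)//.
by apply: powRN_le => //; rewrite mulr_gt0.
Qed.

(** Each i with tau i > rho is sent to a pair of a shell element and a shorter element. Summing
    tau^-k over a set closed under this shortening gives S <= B + (D^k times the shell sum) S <= B +
    S / 2. *)
Lemma shell_criterion : exists2 D, 1 <= D & forall (k rho : R) (sh : seq nat), 0 <= k ->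
  1 < rho -> D <= rho -> uniq sh ->
  (forall j, rho / D <= tau j <= D * rho -> j \in sh) ->
  D `^ k * \sum_(j <- sh) tau j `^ (- k) <= 2^-1 -> tau_summable k.
Proof.
have [D D1 HD] := tau_factor HC Hg; exists D => // k rho sh k0 rho1 Drho ush Hsh H2.
have D0 : 0 < D by exact: lt_le_trans D1.
have [M HM] := tau_finite HC Hg rho.
pose B := \sum_(0 <= i < M) tau i `^ (- k).
exists (2 * B) => N.
(* Truncating by tau <= T instead of i < N keeps the sum finite, so that half of it can be absorbed,
   and makes the index set stable under passing to the second factor. *)
pose T := \big[Num.max/0]_(0 <= i < N) tau i.
have [MT HMT] := tau_finite HC Hg T.
pose s := [seq i <- index_iota 0 MT | tau i <= T].
have us : uniq s by rewrite filter_uniq// iota_uniq.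
have sP i : (i \in s) = (tau i <= T).
  by rewrite mem_filter mem_index_iota andb_idr// => /HMT.
have f0 i : 0 <= tau i `^ (- k) by exact: powR_ge0.
apply: (@le_trans _ _ (\sum_(i <- s) tau i `^ (- k))).
  apply: ler_sum_sub => //; first exact: iota_uniq.
  move=> i; rewrite mem_index_iota => /andP[_ iN]; rewrite sP /T big_mkord.
  exact: (@le_bigmax _ _ _ _ (fun i : 'I_N => tau i) (Ordinal iN)).
suff : \sum_(i <- s) tau i `^ (- k) <=
   B + 2^-1 * \sum_(i <- s) tau i `^ (- k) by clra.
rewrite [leLHS](bigID (fun i => tau i <= rho))/= lerD//.
  rewrite -big_filter; apply: ler_sum_sub => //; rewrite ?filter_uniq ?iota_uniq//.
  move=> i; rewrite mem_filter mem_index_iota => /andP[ir _]; exact: HM.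
have /choice[phi Hphi] i : exists jk : nat * nat, rho < tau i ->
   [/\ exists2 c, 0 < c & g i = c *: (g jk.1 *m g jk.2),
    rho / D <= tau jk.1 <= D * rho, tau jk.2 <= D / rho * tau i
    & tau jk.1 * tau jk.2 <= D * tau i].
  have [h|h] := ltP rho (tau i); last by exists (0, 0)%N.
  by have [jk H] := HD rho i rho1 h; exists jk.
rewrite -big_filter; set s' := [seq i <- s | _].
have s'P i : i \in s' -> (i \in s) /\ rho < tau i.
  by rewrite mem_filter -ltNge => /andP[].
apply: (@le_trans _ _ (\sum_(i <- s') D `^ k *
   (tau (phi i).1 `^ (- k) * tau (phi i).2 `^ (- k)))).
  rewrite [leLHS]big_seq [leRHS]big_seq; apply: ler_sum => i /s'P[_ /Hphi[_ _ _]].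
  exact: tau_powRM_le.
rewrite -mulr_sumr -(big_map phi predT (fun p => tau p.1 `^ (- k) * tau p.2 `^ (- k))).
apply: (@le_trans _ _ (D `^ k * ((\sum_(j <- sh) tau j `^ (- k)) *
   \sum_(i <- s) tau i `^ (- k)))); last first.
  by rewrite mulrA ler_wpM2r// sumr_ge0.
rewrite ler_wpM2l ?powR_ge0// mulr_suml.
under [leRHS]eq_bigr do rewrite mulr_sumr.
rewrite -(@big_allpairs _ _ _ _ _ sh s
  (fun p => tau p.1 `^ (- k) * tau p.2 `^ (- k))).
apply: ler_sum_sub.
(* The two factors determine g i up to a positive scalar, hence i. *)
- rewrite map_inj_in_uniq; first exact: filter_uniq.
  move=> i j /s'P[_ /Hphi[[c c0 Ei] _ _ _]].
  move=> /s'P[_ /Hphi[[d d0 Ej] _ _ _]] E; rewrite E in Ei.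
  apply: (@fam_inj _ _ _ _ _ _ Hg i j (c / d)); first by rewrite divr_gt0.
  by rewrite Ei Ej scalerA divfK// gt_eqF.
- by apply: allpairs_uniq => // -[a b] [a' b'] _ _ [-> ->].
- move=> p /mapP[i /s'P[si /Hphi[_ h1 h2 _]] ->].
  case: (phi i) h1 h2 => a b /= h1 h2; apply: allpairs_f => //.
    exact: Hsh.
  move: si; rewrite !sP; apply: le_trans; rewrite (le_trans h2)//.
  by rewrite ler_piMl ?(ltW (t0 _))// ler_pdivrMr ?mul1r// (lt_trans ltr01).
- by move=> p; rewrite mulr_ge0.
Qed.

Lemma tau_summable_le k k' : k <= k' -> tau_summable k -> tau_summable k'.
Proof.
move=> kk' [M HM]; have [c c0 Hc] := tau_ge HC Hg.
exists (c `^ (- (k' - k)) * M) => N.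
apply: le_trans (ler_wpM2l (powR_ge0 _ _) (HM N)); rewrite mulr_sumr.
apply: ler_sum => i _.
have -> : - k' = - (k' - k) + - k by ring.
rewrite powRD; last by rewrite (gt_eqF (t0 i)) implybT.
by rewrite ler_wpM2r ?powR_ge0//; apply: powRN_le; rewrite ?subr_ge0.
Qed.

Lemma tau_shell T : exists2 s : seq nat, uniq s & forall i, (i \in s) = (tau i <= T).
Proof.
have [M HM] := tau_finite HC Hg T.
exists [seq i <- index_iota 0 M | tau i <= T]; first by rewrite filter_uniq// iota_uniq.
by move=> i; rewrite mem_filter mem_index_iota andb_idr// => /HM.
Qed.

Lemma tau_summable_exists : exists2 k, 0 <= k & tau_summable k.
Proof.
have [D D1 HD] := shell_criterion.
have D0 : 0 < D by exact: lt_le_trans D1.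
(* On the shell tau >= rho / D = 2 D, so each term D^k tau^-k is at most 2^-k, and a large k beats
   the number of terms. *)
pose rho := 2 * D ^+ 2.
have rho1 : 1 < rho by rewrite (@lt_le_trans _ _ 2) ?ltr1n// ler_peMr// exprn_ege1.
have [s us sP] := tau_shell (D * rho).
pose sh := [seq i <- s | rho / D <= tau i].
have [k Hk] : exists k : nat, (size sh)%:R * 2^-1 ^+ k <= 2^-1 :> R.
  exists (2 * size sh).
  have : ((2 * size sh)%:R : R) <= 2 ^+ (2 * size sh).
    by rewrite -natrX ler_nat ltnW// ltn_expl.
  rewrite exprVn ler_pdivrMr ?exprn_gt0// natrM.
  by move: (2 ^+ _) (size sh)%:R => Q z; clra.
exists k%:R => //; apply: (HD _ rho sh) => //.
- have DD : D <= D ^+ 2 by rewrite expr2 ler_peMr// ltW.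
  by rewrite /rho; move: D0 DD; clra.
- by rewrite filter_uniq.
- by move=> j /andP[h1 h2]; rewrite mem_filter h1 sP.
rewrite mulr_sumr; apply: le_trans Hk.
have -> : (size sh)%:R * 2^-1 ^+ k = \sum_(j <- sh) 2^-1 ^+ k :> R.
  by rewrite big_const_seq count_predT iter_addr_0 mulr_natl.
rewrite [leLHS]big_seq [leRHS]big_seq.
apply: ler_sum => j; rewrite mem_filter => /andP[h _].
rewrite powRN !powR_mulrn ?(ltW D0) ?(ltW (t0 _))// -exprVn -exprMn.
rewrite lerXn2r ?nnegrE ?mulr_ge0 ?invr_ge0 ?(ltW D0) ?(ltW (t0 _))//.
rewrite ler_pdivrMr//; apply: (@le_trans _ _ (2^-1 * (rho / D))).
  rewrite le_eqVlt; apply/orP; left; apply/eqP.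
  by rewrite /rho; field; rewrite gt_eqF.
by rewrite ler_wpM2l.
Qed.

(** The shell condition for k holds at a far shell with room to spare, as the tail of a convergent
    series. It concerns finitely many terms, so it persists for slightly smaller exponents. *)
Lemma tau_summable_open k : 0 < k -> tau_summable k ->
  exists2 k', k' < k & tau_summable k'.
Proof.
move=> k0 ks; have [D D1 HD] := shell_criterion.
have D0 : 0 < D by exact: lt_le_trans D1.
have [M HM] := ks; have f0 i : 0 <= tau i `^ (- k) by exact: powR_ge0.
have nd : nondecreasing_seq (fun N => \sum_(0 <= i < N) tau i `^ (- k)).
  by apply: nondecreasing_series => n _ _; exact: f0.
(* Half of what the criterion allows; the other factor 2 pays for lowering the exponent. *)
pose ep := D `^ (- k) / 4.
have ep0 : 0 < ep by rewrite divr_gt0// powR_gt0.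
have [n Hn] : exists n, forall s, uniq s -> (forall i, i \in s -> (n <= i)%N) ->
    \sum_(i <- s) tau i `^ (- k) <= ep.
  pose A := [set \sum_(0 <= i < N) tau i `^ (- k) | N in [set: nat]].
  have sA : has_sup A.
    by split; [exists (\sum_(0 <= i < 0) tau i `^ (- k)), 0%N|
       exists M => _ [N _ <-]].
  have [_ [n _ <-] Hn] := sup_adherent ep0 sA.
  exists n => s us sn.
  pose N := (\max_(i <- s) i).+1.
  have : \sum_(i <- s ++ index_iota 0 n) tau i `^ (- k) <= sup A.
    apply: (@le_trans _ _ (\sum_(0 <= i < maxn N n) tau i `^ (- k))).
      apply: ler_sum_sub => //.
      - rewrite cat_uniq us iota_uniq andbT; apply/hasPn => i.
        rewrite mem_index_iota => /andP[_ i_n]; apply/negP => /sn.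
        by rewrite leqNgt i_n.
      - exact: iota_uniq.
      - move=> i; rewrite mem_cat !mem_index_iota => /orP[si|/andP[_ h]].
          by rewrite /= leq_max ltnS leq_bigmax_seq.
        by rewrite /= leq_max h orbT.
    by apply: sup_upper_bound => //; exists (maxn N n).
  rewrite big_cat/=; move: Hn; rewrite /A; clra.
(* rho / D exceeds tau i for all i < n, so the shell lies in the tail. *)
pose rho := D * (2 + \sum_(0 <= i < n) tau i).
have St0 : 0 <= \sum_(0 <= i < n) tau i by apply: sumr_ge0 => i _; exact: ltW.
have Drho : D <= rho by rewrite ler_peMr ?(ltW D0)//; move: St0; clra.
have rho1 : 1 < rho.
  by rewrite (le_lt_trans D1)// ltr_pMr//; move: St0; clra.
have [s us sP] := tau_shell (D * rho).
pose sh := [seq i <- s | rho / D <= tau i].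
have ush : uniq sh by rewrite filter_uniq.
have sum_sh : \sum_(j <- sh) tau j `^ (- k) <= ep.
  apply: Hn => // i; rewrite mem_filter => /andP[h _].
  rewrite leqNgt; apply/negP => i_n.
  have : tau i <= \sum_(0 <= i < n) tau i.
    rewrite big_mkord (bigD1 (Ordinal i_n))//= lerDl.
    by apply: sumr_ge0 => j _; exact: ltW.
  move: h; rewrite /rho mulrAC divff ?gt_eqF// mul1r; clra.
have L1 : 1 < D * rho by rewrite (lt_le_trans rho1)// ler_peMl// (le_trans ler01)// ltW.
have lnL : 0 < ln (D * rho) by rewrite ln_gt0.
(* Since tau <= D rho on the shell, lowering the exponent by h costs at most the factor (D rho)^h <=
   2. *)
pose h := Num.min (k / 2) (ln 2 / ln (D * rho)).
have h0 : 0 < h by rewrite lt_min !divr_gt0// ln_gt0// ltr1n.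
have Lh : (D * rho) `^ h <= 2.
  rewrite -[leRHS]lnK ?posrE// /powR gt_eqF ?(lt_trans _ L1)// ler_expR.
  by rewrite -ler_pdivlMr// ge_min lexx orbT.
exists (k - h); first by rewrite ltrBlDr ltrDl.
have kh : 0 <= k - h.
  by rewrite subr_ge0 (le_trans (_ : h <= k / 2))// ?ge_min ?lexx//; move: k0; clra.
apply: (HD _ rho sh) => //.
  by move=> j /andP[h1 h2]; rewrite mem_filter h1 sP.
apply: (@le_trans _ _ (D `^ k * (2 * ep))); last first.
  rewrite /ep powRN; have : D `^ k * (D `^ k)^-1 = 1.
    by rewrite mulfV// gt_eqF// powR_gt0.
  by move: (D `^ k)^-1 => X E; move: E; clra.
apply: ler_pM; [exact: powR_ge0| |by apply: ler_powR => //; move: h0; clra|].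
  by apply: sumr_ge0 => i _; exact: powR_ge0.
apply: le_trans (ler_wpM2l _ sum_sh); last by [].
rewrite mulr_sumr [leLHS]big_seq [leRHS]big_seq; apply: ler_sum => j.
rewrite mem_filter sP => /andP[_ h2].
have -> : - (k - h) = h + - k by ring.
rewrite powRD; last by rewrite (gt_eqF (t0 j)) implybT.
rewrite ler_wpM2r// (le_trans _ Lh)//.
apply: ge0_ler_powR; rewrite ?nnegrE ?(ltW h0) ?(ltW (t0 _))//.
by rewrite (le_trans _ (ltW L1)).
Qed.

(** The infimum of the summable exponents is not attained, because summability is open at positive
    exponents and fails at 0, where all the infinitely many terms are 1. *)
Lemma critical_exponent : exists h, [/\ 0 <= h, ~ tau_summable h &
  forall k, h < k -> tau_summable k].
Proof.
have not0 : ~ tau_summable 0.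
  move=> [M HM]; have := HM (Num.bound M).
  rewrite (eq_bigr (fun=> 1)); last by move=> i _; rewrite oppr0 powRr0.
  rewrite big_mkord sumr_const card_ord leNgt => /negP; apply.
  have := HM 0%N; rewrite big_geq// => M0; exact: archi_boundP.
have [k0 k00 sk0] := tau_summable_exists.
pose A := [set k | 0 <= k /\ tau_summable k].
have iA : has_inf A.
  by split; [exists k0; split|exists 0 => k []].
exists (inf A); split.
- by apply: lb_le_inf => [|k []//]; exists k0; split.
- move=> si; have [h0|h0] := ltP 0 (inf A); last first.
    by apply: not0; exact: tau_summable_le si.
  have [k' k'h sk'] := tau_summable_open h0 si.
  have [k'0|k'0] := leP 0 k'.
    by have := inf_lbound (proj2 iA) (conj k'0 sk'); rewrite leNgt k'h.
  by apply: not0; apply: tau_summable_le sk'; exact: ltW.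
- move=> k hk; have e0 : 0 < k - inf A by rewrite subr_gt0.
  have [k' [_ sk'] k'k] := inf_adherent e0 iA.
  by apply: tau_summable_le sk'; move: k'k; clra.
Qed.

End summability.

(** * Minimax points of the Poincare series *)

Section nonneg_series.
Context {R : realType}.
Implicit Types f : nat -> R.

Lemma nonneg_series_cvg f M : (forall i, 0 <= f i) ->
  (forall N, \sum_(0 <= i < N) f i <= M) ->
  cvgn (series f) /\ limn (series f) <= M.
Proof.
move=> f0 HM.
have c : cvgn (series f).
  apply: nondecreasing_is_cvgn; first by apply: nondecreasing_series => n _ _.
  by exists M => _ [N _ <-]; rewrite seriesEnat; exact: HM.
by split => //; apply: limr_le => //; near=> N; rewrite seriesEnat; exact: HM.
Unshelve. all: by end_near.
Qed.

Lemma nonneg_series_ge f N : (forall i, 0 <= f i) -> cvgn (series f) ->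
  \sum_(0 <= i < N) f i <= limn (series f).
Proof.
move=> f0 c; have := @nondecreasing_cvgn_le _ (series f) _ c N.
by rewrite seriesEnat; apply; apply: nondecreasing_series => n _ _.
Qed.

Lemma nonneg_series_le f h : (forall i, 0 <= f i <= h i) -> cvgn (series h) ->
  cvgn (series f) /\ limn (series f) <= limn (series h).
Proof.
move=> fh c; apply: nonneg_series_cvg => [i|N]; first by case/andP: (fh i).
apply: (@le_trans _ _ (\sum_(0 <= i < N) h i)).
  by apply: ler_sum => i _; case/andP: (fh i).
by apply: nonneg_series_ge => // i; case/andP: (fh i) => ? /(le_trans _); apply.
Qed.

Lemma nonneg_series_inj f (s : nat -> nat) : (forall i, 0 <= f i) ->
  injective s -> cvgn (series f) ->
  cvgn (series (f \o s)) /\ limn (series (f \o s)) <= limn (series f).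
Proof.
move=> f0 si c; apply: nonneg_series_cvg => [i|N]; first exact: f0.
apply: le_trans (nonneg_series_ge (\max_(i < N) s i).+1 f0 c).
rewrite -(big_map s predT f); apply: ler_sum_sub => //.
- by rewrite map_inj_uniq// iota_uniq.
- exact: iota_uniq.
move=> _ /mapP[j jN ->]; move: jN; rewrite !mem_index_iota /= => jN.
by rewrite ltnS (@leq_bigmax _ (fun i : 'I_N => s i) (Ordinal jN)).
Qed.

Lemma nonneg_series_to0 f e : cvgn (series f) -> 0 < e ->
  exists N, forall i, (N <= i)%N -> f i < e.
Proof.
move=> /cvg_series_cvg_0/cvgrPdist_lt H e0; have [N _ HN] := H e e0.
exists N => i Ni; have := HN i Ni; rewrite /= sub0r normrN.
by apply: le_lt_trans; exact: ler_norm.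
Qed.

End nonneg_series.

(** * The series as a function of a point and a functional *)

Section saddle_point.
Context {R : realType} {m : nat} (C : set 'cV[R]_m) (y1 : 'rV[R]_m)
  (x1 : 'cV[R]_m) (g : nat -> 'M[R]_m).
Hypothesis HC : based_cone C y1 x1.
Hypothesis Hg : cocompact_family C y1 x1 g.
Notation tau := (tau y1 x1 g).
Notation lf := (lf y1 g).
Notation vf := (vf x1 g).
Notation pos := (dual_pos C y1).
Variable k : R.
Hypothesis k0 : 0 < k.
Hypothesis ks : tau_summable y1 x1 g k.

Definition term x y i : R := (pr (lf i) x * pr y (vf i)) `^ (- k).
Definition H x y : R := limn (series (term x y)).

Let Cx1 := cone_base HC.
Let py u : C u -> 0 < pr y1 u := @cone_pos _ _ _ _ _ HC u.
Let Cvi i : C (vf i) := Cv HC Hg i.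
Let pl i u : C u -> 0 < pr (lf i) u := @lf_pos _ _ _ _ _ _ HC Hg i u.

Lemma term_ge0 x y i : 0 <= term x y i. Proof. exact: powR_ge0. Qed.

Lemma term_le x x' y y' i c : 0 < c -> C x -> C x' -> pos y -> pos y' ->
  c * (pr (lf i) x' * pr y' (vf i)) <= pr (lf i) x * pr y (vf i) ->
  term x y i <= c `^ (- k) * term x' y' i.
Proof.
move=> c0 Cx Cx' py_ py'_ h.
have p' : 0 < pr (lf i) x' * pr y' (vf i).
  by rewrite mulr_gt0 ?pl// (dual_pos_gt0 HC py'_).
rewrite -powRM ?(ltW c0) ?(ltW p')//; apply: powRN_le => //.
  exact: ltW.
by rewrite mulr_gt0.
Qed.

Lemma tau_term_cvg : cvgn (series (term x1 y1)).
Proof.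
have [M HM] := ks.
exact: (proj1 (nonneg_series_cvg (term_ge0 x1 y1) HM)).
Qed.

Lemma H_le x x' y y' c : 0 < c -> C x -> C x' -> pos y -> pos y' ->
  (forall i, c * (pr (lf i) x' * pr y' (vf i)) <= pr (lf i) x * pr y (vf i)) ->
  cvgn (series (term x' y')) ->
  cvgn (series (term x y)) /\ H x y <= c `^ (- k) * H x' y'.
Proof.
move=> c0 Cx Cx' pos1 pos2 h cv.
have cz : cvgn (series (c `^ (- k) *: term x' y')) by exact: is_cvg_seriesZ.
have hh i : 0 <= term x y i <= (c `^ (- k) *: term x' y') i.
  by rewrite term_ge0 /=; exact: term_le.
have [c1 c2] := nonneg_series_le hh cz; split => //.
have e : limn (series (c `^ (- k) *: term x' y')) = c `^ (- k) * H x' y'.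
  rewrite [LHS](lim_seriesZ _ cv).
  by [].
by rewrite -e.
Qed.

Lemma term_cvg x y : C x -> pos y -> cvgn (series (term x y)).
Proof.
move=> Cx posy; have [e e0 He] := posy; have [a a0 Ha] := cone_dom HC Cx.
have c0 : 0 < e / a by rewrite divr_gt0.
apply: (proj1 (@H_le x x1 y y1 (e / a) c0 Cx Cx1 posy (y1_dual_pos _ _) _ tau_term_cvg)).
move=> i; have := pl i (Ha _ Cx1); rewrite (cone_base1 HC) mulr1 prBr prZr subr_gt0.
move=> h; have -> : e / a * (pr (lf i) x1 * pr y1 (vf i)) =
  (pr (lf i) x1 / a) * (e * pr y1 (vf i)) by ring.
apply: ler_pM => //; last exact: He.
- by rewrite divr_ge0// ltW// pl.
- by rewrite mulr_ge0// ltW// py.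
- by rewrite ler_pdivrMr// mulrC ltW.
Qed.

Lemma H_ge0 x y : C x -> pos y -> 0 <= H x y.
Proof.
move=> Cx posy; have := nonneg_series_ge 0 (term_ge0 x y) (term_cvg Cx posy).
by rewrite big_geq.
Qed.

Lemma H_cvg x y M : (forall N, \sum_(0 <= i < N) term x y i <= M) -> H x y <= M.
Proof. by move=> /(nonneg_series_cvg (term_ge0 x y))[]. Qed.

(* At a boundary point y of the dual cone infinitely many terms stay bounded
   below. *)
Lemma boundary_diverges x y M : C x -> pr y x = 1 ->
  (forall u, C u -> 0 <= pr y u) ->
  (forall N, \sum_(0 <= i < N) term x y i <= M) -> pos y.
Proof.
move=> Cx yx yC HM; apply: contrapT => npos.
have y0 : y != 0 by apply: contra_eq_neq yx => ->; rewrite pr0l eq_sym oner_neq0.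
have ypos u : C u -> 0 < pr y u by move=> Cu; exact: (nonneg_pos HC yC y0 Cu).
have [cb cb0 Hcb] := cone_bound HC.
(* If y is not in the open dual cone, there are points of the section y1 = 1 at which y tends to 0.
   They cluster at [zz], a zero of y on the boundary of C. *)
have /choice[u Hu] j : exists u, [/\ C u, pr y1 u = 1 & pr y u < j.+1%:R^-1].
  apply: contrapT => /forallNP h; apply: npos.
  exists j.+1%:R^-1; first by rewrite invr_gt0 ltr0n.
  move=> u Cu; have pu := py Cu; rewrite leNgt; apply/negP => hu.
  apply: (h ((pr y1 u)^-1 *: u)); split.
  - by apply: (cone_scale HC) => //; rewrite invr_gt0.
  - by rewrite prZr mulVf// gt_eqF.
  - by rewrite prZr ltr_pdivrMl// mulrC.
have [|z Hz] := @bounded_seq_cluster R 'I_m (fun j a => u j a 0) cb.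
  move=> j a; rewrite (le_trans (mx_norm_coord _ _ _))//.
  by have [Cu E _] := Hu j; rewrite (le_trans (Hcb _ Cu))// E mulr1.
pose zz : 'cV[R]_m := \col_a z a.
have {}Hz e n0 : 0 < e -> exists2 j, (n0 <= j)%N & `|u j - zz| <= e.
  move=> e0; have [j nj hj] := Hz e e0 n0; exists j => //.
  by apply: mx_norm_le => [|a b]; [exact: ltW|rewrite !mxE ord1 ltW].
have small (w : 'rV[R]_m) e n0 : 0 < e ->
    exists2 j, (n0 <= j)%N & `|pr w (u j) - pr w zz| <= e.
  move=> e0; have d0 : 0 < m%:R * `|w| + 1 :> R.
    by rewrite ltr_wpDl// mulr_ge0.
  have [j nj hj] := Hz (e / (m%:R * `|w| + 1)) n0 (divr_gt0 e0 d0).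
  exists j => //; rewrite -prBr (le_trans (pr_norm _ _))// mulrA.
  apply: (@le_trans _ _ ((m%:R * `|w| + 1) * `|u j - zz|)).
    by rewrite ler_wpM2r// lerDl.
  by rewrite -ler_pdivlMl// mulrC.
have y1z : pr y1 zz = 1.
  apply/eqP; rewrite -subr_eq0 -normr_le0.
  apply: (@ler_small_slack _ _ _ 1 1) => // t t0 _; rewrite add0r mul1r.
  have [j _] := small y1 t 0%N t0; have [_ -> _] := Hu j.
  by rewrite distrC.
have clz : clC C x1 zz.
  move=> d d0; have [r r0 Hr] := cone_open HC (cone_scale HC d0 Cx1).
  have [j _ hj] := Hz r 0%N r0.
  have -> : zz + d *: x1 = u j + (d *: x1 + (zz - u j)).
    by apply/matrixP => p q; rewrite !mxE; ring.
  apply: (cone_add HC); first by case: (Hu j).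
  by apply: Hr; rewrite distrC.
have yz : pr y zz = 0.
  apply/le_anti/andP; split; last exact: (nonneg_clC yC clz).
  apply: (@ler_small_slack _ _ _ 2 1) => // t t0 _; rewrite add0r.
  have [j nj hj] := small y t (Num.bound t^-1) t0.
  have [_ _ h] := Hu j.
  have : j.+1%:R^-1 <= t.
    rewrite -[leRHS]invrK lef_pV2 ?posrE ?invr_gt0 ?ltr0n//.
    rewrite ltW// (lt_le_trans (archi_boundP _)) ?invr_ge0 ?(ltW t0)//.
    by rewrite ler_nat ltnW// ltnS.
  move: hj; rewrite ler_norml => /andP[h1 _] /(lt_le_trans h).
  by move: h1; clra.
(* the points zz + t x1 and the group elements that bring them back *)
have [a a0 Ha] := cone_dom HC Cx1; have [K K0 HK] := fam_cocpt Hg.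
(* An upper bound for l_j(x) y(v_j) at the index j found below, whose term is therefore at least
   P^-k; only the indices below N can have such large terms. *)
pose P := a * pr y1 x * K * pr y x1.
have P0 : 0 < P by rewrite !mulr_gt0 ?py ?ypos.
have [cvT _] := nonneg_series_cvg (term_ge0 x y) HM.
have [N HN] := nonneg_series_to0 cvT (powR_gt0 (- k) P0).
have [ep ep0 Hep] : exists2 ep, 0 < ep &
    forall i, (i < N)%N -> ep * pr y1 (vf i) <= pr y (vf i).
  elim: N {HN} => [|N [ep ep0 IH]]; first by exists 1.
  exists (Num.min ep (pr y (vf N) / pr y1 (vf N))).
    by rewrite lt_min ep0 divr_gt0 ?ypos ?py.
  move=> i; rewrite ltnS leq_eqVlt => /orP[/eqP ->|iN].
    by rewrite -ler_pdivlMr ?py// ge_min lexx orbT.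
  apply: le_trans (IH i iN); rewrite ler_pM2r ?py//.
  by rewrite ge_min lexx.
(* So small that y(v_j) <= K c t y(x1) contradicts y(v_j) >= ep y1(v_j), which holds for j < N. *)
pose t := ep / (2 * (K * a * pr y x1)).
have Ka0 : 0 < K * a * pr y x1 by rewrite !mulr_gt0 ?ypos.
have t0 : 0 < t by rewrite divr_gt0// mulr_gt0.
have Cp : C (zz + t *: x1) by exact: clz.
have [[j c] /= [c0 y1k Ck]] := HK _ Cp.
set p := zz + t *: x1 in Cp y1k Ck.
have gU i : g i \in unitmx by exact: (fam_unit Hg).
have yp : pr y p = t * pr y x1 by rewrite prDr prZr yz add0r.
have y1p : 1 <= pr y1 p.
  by rewrite prDr prZr y1z (cone_base1 HC) mulr1 lerDl ltW.
have lp : pr (lf j) p = c^-1.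
  by apply: (@mulfI _ c); rewrite ?gt_eqF// mulfV ?gt_eqF//
    prM -prZr.
have lx1 : pr (lf j) x1 <= (c * t)^-1.
  rewrite -[X in X^-1]mulrC invfM ler_pdivlMl// -lp prDr prZr lerDr.
  exact: (nonneg_clC (fun u Cu => ltW (pl j Cu)) clz).
have yv : pr y (vf j) <= K * (c * t * pr y x1).
  have := ypos _ (fam_C Hg j Ck); rewrite mulmxBr prBr -!scalemxAr !prZr.
  by rewrite mulKVmx// yp subr_gt0 => /ltW; rewrite !mulrA.
have cv' : c <= a * pr y1 (vf j).
  have Ckap : C (c *: (invmx (g j) *m p)).
    by apply: (cone_scale HC) => //; exact: (fam_invC Hg).
  have := py (fam_C Hg j (Ha _ Ckap)); rewrite y1k mulr1.
  rewrite mulmxBr prBr -!scalemxAr !prZr mulKVmx// subr_gt0 => /ltW h.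
  by rewrite (le_trans _ h)// ler_peMr// ltW.
have lx : pr (lf j) x <= a * pr y1 x * pr (lf j) x1.
  by have := pl j (Ha _ Cx); rewrite prBr prZr subr_gt0 => /ltW.
have [jN|Nj] := ltnP j N.
  have := Hep j jN; have py1v := py (Cvi j).
  have : K * (c * t * pr y x1) <= K * (a * pr y1 (vf j) * t * pr y x1).
    by rewrite ler_pM2l// ler_pM2r ?ypos// ler_pM2r.
  have -> : K * (a * pr y1 (vf j) * t * pr y x1) = ep / 2 * pr y1 (vf j).
    by rewrite /t; field; rewrite !gt_eqF// ypos.
  have := mulr_gt0 ep0 py1v; move: yv; clra.
have := HN j Nj; rewrite ltNge => /negP; apply.
apply: powRN_le; [exact: ltW|by rewrite mulr_gt0 ?pl ?ypos|].
have := ler_pM (ltW (pl j Cx)) (ltW (ypos _ (Cvi j))) (le_trans lx (ler_wpM2l _ lx1)) yv.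
rewrite mulr_ge0 ?(ltW a0) ?(ltW (py Cx))// => /(_ isT) /le_trans; apply.
rewrite /P le_eqVlt; apply/orP; left; apply/eqP.
by field; rewrite !gt_eqF.
Qed.

End saddle_point.

(** * Existence of the minimax point *)

Section saddle_existence.
Context {R : realType} {m : nat} (C : set 'cV[R]_m) (y1 : 'rV[R]_m)
  (x1 : 'cV[R]_m) (g : nat -> 'M[R]_m).
Hypothesis HC : based_cone C y1 x1.
Hypothesis Hg : cocompact_family C y1 x1 g.
Notation tau := (tau y1 x1 g).
Notation lf := (lf y1 g).
Notation vf := (vf x1 g).
Notation pos := (dual_pos C y1).
Variable k : R.
Hypothesis k0 : 0 < k.
Hypothesis ks : tau_summable y1 x1 g k.
Notation term := (term y1 x1 g k).
Notation H := (H y1 x1 g k).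

Let Cx1 := cone_base HC.
Let py u : C u -> 0 < pr y1 u := @cone_pos _ _ _ _ _ HC u.
Let Cvi i : C (vf i) := Cv HC Hg i.
Let pl i u : C u -> 0 < pr (lf i) u := @lf_pos _ _ _ _ _ _ HC Hg i u.
Let gU i : g i \in unitmx := fam_unit Hg i.
Let cvt x y : C x -> pos y -> cvgn (series (term x y)) :=
  @term_cvg _ _ _ _ _ _ HC Hg k k0 ks x y.

Lemma normalized_pos x : C x -> pos ((pr y1 x)^-1 *: y1) /\
  pr ((pr y1 x)^-1 *: y1) x = 1.
Proof.
move=> Cx; split; last by rewrite prZl mulVf// gt_eqF// py.
by apply: dual_pos_scale; [rewrite invr_gt0 py|exact: y1_dual_pos].
Qed.

(** A minimizing sequence is bounded, since y(x) = 1 and C contains a ball about x. Partial sums at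
    a cluster point z stay below the infimum, and a bounded series forces z into the open dual cone
    by [boundary_diverges]. *)
Lemma inner_min x : C x -> exists2 y, pos y /\ pr y x = 1 &
  forall y', pos y' -> pr y' x = 1 -> H x y <= H x y'.
Proof.
move=> Cx.
pose A := [set H x y | y in [set y | pos y /\ pr y x = 1]].
have iA : has_inf A.
  split; first by exists (H x ((pr y1 x)^-1 *: y1)); exists ((pr y1 x)^-1 *: y1) => //;
    exact: normalized_pos.
  by exists 0 => _ [y [posy _] <-]; exact: (H_ge0 HC Hg k0 ks).
have /choice[y Hy] j : exists y, [/\ pos y, pr y x = 1 & H x y < inf A + j.+1%:R^-1].
  have j0 : 0 < j.+1%:R^-1 :> R by rewrite invr_gt0 ltr0n.
  by have [_ [y [p1 p2] <-] h] := inf_adherent j0 iA; exists y.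
have [r r0 Hr] := cone_open HC Cx.
have ybound j : `|y j| <= r^-1.
  have [posy yx _] := Hy j.
  apply: mx_norm_le => [|i a]; first by rewrite invr_ge0 ltW.
  rewrite ord1 {i}.
  pose e : 'cV[R]_m := delta_mx a 0.
  have en : `|e| <= 1.
    by apply: mx_norm_le => // p q; rewrite mxE; case: (_ && _);
      rewrite ?normr1 ?normr0.
  have ye : pr (y j) e = y j 0 a by rewrite /pr -colE mxE.
  have C' s : `|s| = 1 -> C (x + (s * r) *: e).
    by move=> s1; apply: Hr; rewrite normrZ normrM s1 mul1r gtr0_norm// ler_piMr// ltW.
  have := dual_pos_gt0 HC posy (C' 1 (normr1 _)).
  have := dual_pos_gt0 HC posy (C' (-1) (normrN1 _)).
  rewrite !prDr !prZr ye yx => h1 h2.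
  rewrite -div1r ler_pdivlMr// mulrC -[X in X * _](gtr0_norm r0) -normrM ler_norml.
  by apply/andP; split; move: h1 h2; clra.
have [z Hz] := mx_seq_cluster ybound.
have near (v : 'cV[R]_m) e n0 : 0 < e -> exists2 j, (n0 <= j)%N &
    `|y j - z| <= e /\ `|pr (y j) v - pr z v| <= e.
  have Hz' e' : 0 < e' -> forall n0, exists2 j, (n0 <= j)%N & `|(y j)^T - z^T| <= e'.
    by move=> e'0 n1; have [j nj] := Hz e' e'0 n1; exists j; rewrite // -linearB mx_norm_tr.
  move=> e0; have [j nj [h1 h2]] := pr_cluster v^T Hz' e0 n0.
  by exists j => //; rewrite -!(prT _ v) -mx_norm_tr linearB.
have zx : pr z x = 1.
  apply/eqP; rewrite -subr_eq0 -normr_le0.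
  apply: (@ler_small_slack _ _ _ 1 1) => // t t0 _; rewrite add0r mul1r.
  by have [j _ [_]] := near x t 0%N t0; have [_ -> _] := Hy j; rewrite distrC.
have zC u : C u -> 0 <= pr z u.
  move=> Cu; apply: (@ler_small_slack _ _ _ 1 1) => // t t0 _; rewrite mul1r.
  have [j _ [_]] := near u t 0%N t0; have [posy _ _] := Hy j.
  have := dual_pos_gt0 HC posy Cu; rewrite ler_norml => h /andP[_].
  by move: h; clra.
have z0 : z != 0 by apply: contra_eq_neq zx => ->; rewrite pr0l eq_sym oner_neq0.
have zpos u : C u -> 0 < pr z u by move=> Cu; exact: (nonneg_pos HC zC z0 Cu).
have Sle N : \sum_(0 <= i < N) term x z i <= inf A.
  set S := \sum_(_ <= _ < _) _.
  have S0 : 0 <= S by apply: sumr_ge0 => i _; exact: term_ge0.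
  apply: (@ler_small_slack _ _ _ (1 + k * S) 1) => // t t0 t1.
  (* a uniform relative approximation of the finitely many values z (vf i) *)
  have [d d0 Hd] : exists2 d, 0 < d & forall i, (i < N)%N ->
      forall j, `|y j - z| <= d -> pr (y j) (vf i) <= (1 + t) * pr z (vf i).
    elim: N {S S0} => [|N [d d0 IH]]; first by exists 1.
    have zv := zpos _ (Cvi N).
    have q0 : 0 < m%:R * `|vf N| + 1 :> R by rewrite ltr_wpDl// mulr_ge0.
    exists (Num.min d (t * pr z (vf N) / (m%:R * `|vf N| + 1))).
      by rewrite lt_min d0 divr_gt0// mulr_gt0.
    move=> i; rewrite ltnS leq_eqVlt => /orP[/eqP ->|iN] j; last first.
      by rewrite le_min => /andP[h _]; exact: IH.
    rewrite le_min => /andP[_]; rewrite ler_pdivlMr// => h.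
    have := pr_norm (y j - z) (vf N); rewrite prBl => h'.
    have := le_trans (ler_norm _) h' => h2.
    have : `|y j - z| * (m%:R * `|vf N|) <= `|y j - z| * (m%:R * `|vf N| + 1).
      by rewrite ler_wpM2l// lerDl.
    rewrite mulrCA in h2; move: h h2; clra.
  have [j nj [hj _]] := near x d (Num.bound t^-1) d0.
  have [posy yx hH] := Hy j.
  have jt : j.+1%:R^-1 <= t.
    rewrite -[leRHS]invrK lef_pV2 ?posrE ?invr_gt0 ?ltr0n//.
    rewrite ltW// (lt_le_trans (archi_boundP _)) ?invr_ge0 ?(ltW t0)//.
    by rewrite ler_nat ltnW// ltnS.
  have t10 : 0 < 1 + t by rewrite addr_gt0.
  have h1 : (1 + t) `^ (- k) * S <= H x (y j).
    apply: le_trans (nonneg_series_ge N (term_ge0 _ _ _ _ _ _) (cvt Cx posy)).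
    rewrite mulr_sumr big_nat [leRHS]big_nat; apply: ler_sum => i /andP[_ iN].
    have p0 : 0 < pr (lf i) x * pr z (vf i) by rewrite mulr_gt0 ?pl ?zpos.
    rewrite -powRM ?(ltW t10) ?(ltW p0)//; apply: powRN_le; first exact: ltW.
      by rewrite mulr_gt0 ?pl// (dual_pos_gt0 HC posy).
    by rewrite mulrCA ler_pM2l ?pl// Hd.
  have h2 := ler_wpM2r S0 (powRN_ge_lin (ltW k0) (ltW t0)).
  have h3 := lt_le_trans hH (lerD (lexx (inf A)) jt).
  by move: h1 h2 h3; clra.
have posz : pos z by exact: (boundary_diverges HC Hg k0 Cx zx zC Sle).
exists z; [exact: (conj posz zx)|move=> y' posy' y'x].
apply: le_trans (H_cvg Sle) _; apply: (inf_lbound (proj2 iA)).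
by exists y'.
Qed.

Lemma fam_div_inv i j l c : 0 < c -> invmx (g i) *m g j = c *: g l ->
  invmx (g l) = c *: (invmx (g j) *m g i).
Proof.
move=> c0 E; apply: (can_inj (mulKmx (gU l))); rewrite mulmxV// -scalemxAr.
by rewrite mulmxA !scalemxAl -E mulmxK// mulVmx.
Qed.

(** Replacing g i by g j^-1 g i reindexes the series, and the scalars of l and v cancel. The
    reindexing is injective, which gives the inequality. *)
Lemma H_transport j c x y' : C x -> pos y' -> 0 < c ->
  let x' := c *: (invmx (g j) *m x) in
  let y := c *: (y' *m invmx (g j)) in
  [/\ pos y, pr y x = pr y' x' & H x y <= H x' y'].
Proof.
move=> Cx posy c0 x' y.
have Cx' : C x' by apply: (cone_scale HC) => //; exact: (fam_invC Hg).
have posy2 : pos y.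
  have [e e0 He] := posy; have [a a0 Ha] := cone_dom HC Cx1.
  have q0 : 0 < a * pr y1 (vf j) by rewrite mulr_gt0// py.
  exists (c * (e / (a * pr y1 (vf j)))) => [|u Cu].
    by rewrite mulr_gt0// divr_gt0.
  rewrite prZl -mulrA ler_pM2l// prM.
  have Cw := fam_invC Hg j Cu.
  apply: le_trans (He _ Cw); rewrite -mulrA ler_pM2l// ler_pdivrMl//.
  have := py (fam_C Hg j (Ha _ Cw)); rewrite mulmxBr prBr mulKVmx//.
  by rewrite -scalemxAr prZr subr_gt0 => /ltW; rewrite -/(vf j); clra.
split; [exact: posy2|by rewrite prZl prM prZr|].
have /choice[sd Hsd] i := fam_div Hg j i.
have E i : term x y i = (term x' y' \o (fun i => (sd i).1)) i.
  have [d0 Ed] := Hsd i; rewrite /= /Submission.term; congr (_ `^ _).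
  have lE : lf (sd i).1 = (sd i).2 *: (lf i *m g j).
    by rewrite /Submission.lf (fam_div_inv d0 Ed) -scalemxAr mulmxA.
  have vE : invmx (g j) *m vf i = (sd i).2 *: vf (sd i).1.
    by rewrite /Submission.vf mulmxA Ed -scalemxAl.
  have -> : pr y (vf i) = c * ((sd i).2 * pr y' (vf (sd i).1)).
    by rewrite prZl prM vE prZr.
  have -> : pr (lf (sd i).1) x' = (sd i).2 * (c * pr (lf i) x).
    by rewrite lE prZl prM -scalemxAr prZr mulKVmx.
  ring.
rewrite /Submission.H (_ : term x y = term x' y' \o (fun i => (sd i).1)); last exact/funext.
apply: (proj2 (nonneg_series_inj _ _ (cvt Cx' posy))).
- by move=> i; exact: term_ge0.
- move=> a b /= ab; have [da Ea] := Hsd a; have [db Eb] := Hsd b.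
  apply: (@fam_inj _ _ _ _ _ _ Hg a b ((sd a).2 / (sd b).2)); first by rewrite divr_gt0.
  apply: (can_inj (mulKmx (_ : invmx (g j) \in unitmx))); first by rewrite unitmx_inv.
  by rewrite Ea -scalemxAr Eb ab scalerA divfK// gt_eqF.
Qed.

Variable K : R.
Hypothesis K0 : 0 < K.
Hypothesis HK : forall u, C u -> exists ic : nat * R,
    [/\ 0 < ic.2, pr y1 (ic.2 *: (invmx (g ic.1) *m u)) = 1
      & C (K *: (ic.2 *: (invmx (g ic.1) *m u)) - x1)].

(* A compact set of representatives for the action. *)
Definition core x := [/\ C x, pr y1 x = 1 & clC C x1 (K *: x - x1)].

Lemma core_lf x i : core x -> pr (lf i) x1 <= K * pr (lf i) x.
Proof.
move=> [_ _ cK]; rewrite -prZr; apply: (nonneg_le _ cK).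
by move=> u Cu; exact: ltW (pl i Cu).
Qed.

Lemma core_nonempty : exists x, core x.
Proof.
have [[i c] /= [c0 E Ck]] := HK Cx1.
exists (c *: (invmx (g i) *m x1)); split => //; last exact: (clC_sub HC).
by apply: (cone_scale HC) => //; exact: (fam_invC Hg).
Qed.

Lemma core_closed (x : nat -> 'cV[R]_m) z : (forall j, core (x j)) ->
  (forall e, 0 < e -> forall n0, exists2 j, (n0 <= j)%N & `|x j - z| <= e) ->
  core z.
Proof.
move=> cx Hz.
have y1z : pr y1 z = 1.
  apply/eqP; rewrite -subr_eq0 -normr_le0.
  apply: (@ler_small_slack _ _ _ 1 1) => // t t0 _; rewrite add0r mul1r.
  have [j _ [_]] := pr_cluster y1 Hz t0 0%N; have [_ -> _] := cx j.
  by rewrite distrC.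
have ck : clC C x1 (K *: z - x1).
  move=> d d0; have d2 : 0 < d / 2 by rewrite divr_gt0.
  have [r r0 Hr] := cone_open HC (cone_scale HC d2 Cx1).
  have [j _ hj] := Hz _ (divr_gt0 r0 K0) 0%N.
  have -> : K *: z - x1 + d *: x1 =
     (K *: x j - x1 + (d / 2) *: x1) + ((d / 2) *: x1 + K *: (z - x j)).
    by apply/matrixP => p q; rewrite !mxE; field.
  apply: (cone_add HC); first by have [_ _] := cx j; exact.
  by apply: Hr; rewrite normrZ gtr0_norm// -ler_pdivlMl// mulrC distrC.
split => //.
have -> : z = K^-1 *: (x1 + (K *: z - x1)).
  by rewrite addrC subrK scalerA mulVf ?scale1r// gt_eqF.
apply: (cone_scale HC); first by rewrite invr_gt0.
exact: (clC_add HC).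
Qed.

(* The maximum over the compact core is a maximum over the cone because H is
   invariant under the family. *)
Lemma saddle_exists : exists xy : 'cV[R]_m * 'rV[R]_m, [/\ core xy.1, pos xy.2,
  pr xy.2 xy.1 = 1,
  forall y, pos y -> pr y xy.1 = 1 -> H xy.1 xy.2 <= H xy.1 y &
  forall x, C x -> exists y, [/\ pos y, pr y x = 1 & H x y <= H xy.1 xy.2]].
Proof.
have /choice[Y HY] x : exists y, C x -> [/\ pos y, pr y x = 1 &
   forall y', pos y' -> pr y' x = 1 -> H x y <= H x y'].
  have [Cx|nCx] := pselect (C x); last by exists y1.
  by have [y [h1 h2] h3] := inner_min Cx; exists y.
pose A := [set H x (Y x) | x in core].
have sA : has_sup A.
  split; first by have [x cx] := core_nonempty; exists (H x (Y x)), x.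
  exists ((K^-1) `^ (- k) * H x1 y1) => _ [x cx <-].
  have [Cx y1x ck] := cx; have [_ _ Hmin] := HY x Cx.
  apply: (le_trans (Hmin y1 (y1_dual_pos _ _) y1x)).
  have Ki : 0 < K^-1 by rewrite invr_gt0.
  apply: (proj2 (H_le HC Hg k0 Ki Cx Cx1 (y1_dual_pos _ _) (y1_dual_pos _ _) _
    (cvt Cx1 (y1_dual_pos _ _)))) => i.
  rewrite mulrA ler_pM2r ?py// ler_pdivrMl//; exact: core_lf.
have /choice[x Hx] j : exists x, core x /\ sup A - j.+1%:R^-1 < H x (Y x).
  have j0 : 0 < j.+1%:R^-1 :> R by rewrite invr_gt0 ltr0n.
  by have [_ [x cx <-] h] := sup_adherent j0 sA; exists x.
have [cb cb0 Hcb] := cone_bound HC.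
have [z Hz] : exists z, forall e, 0 < e -> forall n0,
    exists2 j, (n0 <= j)%N & `|x j - z| <= e.
  apply: (@mx_seq_cluster _ _ _ _ cb) => j.
  by have [[Cx y1x _] _] := Hx j; rewrite (le_trans (Hcb _ Cx))// y1x mulr1.
have cz : core z by apply: (core_closed _ Hz) => j; case: (Hx j).
have [Cz _ _] := cz; have [posY Yz HYmin] := HY z Cz.
have H0 : 0 <= H z (Y z) by exact: (H_ge0 HC Hg k0 ks).
(* Upper semicontinuity of the inner minimum: the minimizer at z, rescaled, competes at the nearby
   points x j, and l_i(x j) is close to l_i(z) uniformly in i. *)
have supH : sup A <= H z (Y z).
  pose c2 := k * (k + 1) * (1 - 2^-1) `^ (- (k + 2)) / 2.
  have c20 : 0 <= c2.
    by rewrite divr_ge0// mulr_ge0 ?powR_ge0// mulr_ge0 ?addr_ge0 ?(ltW k0).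
  apply: (@ler_small_slack _ _ _ (1 + (2 * k + 4 * c2) * H z (Y z)) (1 / 4)) => //.
  move=> t t0 t4.
  have [r r0 Hr] := cone_open HC (cone_scale HC t0 Cz).
  have d0 : 0 < Num.min r t by rewrite lt_min r0.
  have [j nj [h1 h2]] := pr_cluster (Y z) Hz d0 (Num.bound t^-1).
  have [[Cx y1x _] hx] := Hx j.
  have jt : j.+1%:R^-1 <= t.
    rewrite -[leRHS]invrK lef_pV2 ?posrE ?invr_gt0 ?ltr0n//.
    rewrite ltW// (lt_le_trans (archi_boundP _)) ?invr_ge0 ?(ltW t0)//.
    by rewrite ler_nat ltnW// ltnS.
  have hr : `|x j - z| <= r by move: h1; rewrite le_min => /andP[].
  have ht : pr (Y z) (x j) <= 1 + t.
    move: h2; rewrite Yz le_min => /andP[_]; rewrite ler_norml => /andP[_].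
    by clra.
  have p0 : 0 < pr (Y z) (x j) by exact: (dual_pos_gt0 HC posY Cx).
  have pi0 : 0 < (pr (Y z) (x j))^-1 by rewrite invr_gt0.
  have [_ _ Hmin] := HY (x j) Cx.
  have posY' := dual_pos_scale pi0 posY.
  have h3 : H (x j) (Y (x j)) <= H (x j) ((pr (Y z) (x j))^-1 *: Y z).
    by apply: Hmin => //; rewrite prZl mulVf// gt_eqF.
  have lfx i : (1 - t) * pr (lf i) z <= pr (lf i) (x j).
    have := pl i (Hr _ hr); rewrite prDr prZr prBr; clra.
  have t2 : 0 < 1 - 2 * t by move: t4; clra.
  have h4 : H (x j) ((pr (Y z) (x j))^-1 *: Y z) <= (1 - 2 * t) `^ (- k) * H z (Y z).
    apply: (proj2 (H_le HC Hg k0 t2 Cx Cz posY' posY _ (cvt Cz posY))) => i.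
    have v0 := dual_pos_gt0 HC posY (Cvi i); have lz := pl i Cz.
    have : (1 - 2 * t) * pr (lf i) z <= pr (lf i) (x j) / pr (Y z) (x j).
      rewrite ler_pdivlMr//.
      have : (1 - 2 * t) * pr (lf i) z * pr (Y z) (x j) <=
          (1 - 2 * t) * pr (lf i) z * (1 + t).
        by rewrite ler_pM2l// mulr_gt0.
      have : 0 <= t ^+ 2 * pr (lf i) z by rewrite mulr_ge0 ?sqr_ge0// ltW.
      by have := lfx i; have := mulr_gt0 t0 lz; clra.
    move=> /(ler_wpM2r (ltW v0)); rewrite prZl -mulrA => /le_trans; apply.
    by rewrite -mulrA.
  have h5 : (1 - 2 * t) `^ (- k) <= 1 + (2 * k + 4 * c2) * t.
    have := @powRN_le_quad R k (- (2 * t)) 2^-1 (ltW k0).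
    have -> : 1 + - (2 * t) = 1 - 2 * t by [].
    rewrite -/c2 => h; apply: le_trans (h _ _) _; [clra|move: t4; clra|].
    have : c2 * (t * t) <= c2 * (t * 1).
      by rewrite ler_wpM2l// ler_wpM2l ?(ltW t0)//; move: t4; clra.
    by clra.
  have h6 := ler_wpM2r H0 h5.
  have := lt_le_trans hx (le_trans h3 (le_trans h4 h6)).
  rewrite ltrBlDr => h7; have := lt_le_trans h7 (lerD (lexx _) jt).
  by clra.
exists (z, Y z); split => //= u Cu.
have [[j c] /= [c0 E Ck]] := HK Cu.
pose u' := c *: (invmx (g j) *m u).
have Cu' : C u' by apply: (cone_scale HC) => //; exact: (fam_invC Hg).
have cu' : core u' by split => //; exact: (clC_sub HC).
have [posY' Yu' _] := HY u' Cu'.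
have [h1 h2 h3] := H_transport j Cu posY' c0.
exists (c *: (Y u' *m invmx (g j))); split; [exact: h1|by rewrite h2|].
apply: le_trans h3 (le_trans _ supH); apply: sup_upper_bound => //.
by exists u'.
Qed.

End saddle_existence.

(** * Both variations at the minimax point *)

Section at_saddle.
Context {R : realType} {m : nat} (C : set 'cV[R]_m) (y1 : 'rV[R]_m)
  (x1 : 'cV[R]_m) (g : nat -> 'M[R]_m).
Hypothesis HC : based_cone C y1 x1.
Hypothesis Hg : cocompact_family C y1 x1 g.
Notation tau := (tau y1 x1 g).
Notation lf := (lf y1 g).
Notation vf := (vf x1 g).
Notation pos := (dual_pos C y1).

Let Cx1 := cone_base HC.
Let py u : C u -> 0 < pr y1 u := @cone_pos _ _ _ _ _ HC u.
Let Cvi i : C (vf i) := Cv HC Hg i.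
Let pl i u : C u -> 0 < pr (lf i) u := @lf_pos _ _ _ _ _ _ HC Hg i u.

(** Let s be the supremum of w on the section y1 = 1. By cocompactness each u there satisfies K c u
    - v_j in C for some j, with y1(v_j) at least c / a. As w vanishes at v_j, this improves w(u) <=
    s to w(u) <= s (1 - th) for a fixed th > 0. Hence s <= 0, and - w is a nonnegative functional
    vanishing at an interior point. *)
Lemma orbit_spans (w : 'rV[R]_m) : (forall i, pr w (vf i) = 0) -> w = 0.
Proof.
move=> wv; have [K K0 HK] := fam_cocpt Hg.
have [cb cb0 Hcb] := cone_bound HC; have [a a0 Ha] := cone_dom HC Cx1.
pose A := [set pr w u | u in [set u | C u /\ pr y1 u = 1]].
have sA : has_sup A.
  split; first by exists (pr w x1), x1 => //; split => //; exact: (cone_base1 HC).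
  exists (m%:R * (`|w| * cb)) => _ [u [Cu y1u] <-].
  rewrite (le_trans (ler_norm _))// (le_trans (pr_norm _ _))// ler_wpM2l//.
  by rewrite ler_wpM2l// (le_trans (Hcb _ Cu))// y1u mulr1.
have wle u : C u -> pr w u <= sup A * pr y1 u.
  move=> Cu; have p0 := py Cu; rewrite -ler_pdivrMr//.
  apply: sup_upper_bound => //; exists ((pr y1 u)^-1 *: u); last by rewrite prZr mulrC.
  split; first by apply: (cone_scale HC) => //; rewrite invr_gt0.
  by rewrite prZr mulVf// gt_eqF.
pose th := (a * K)^-1.
have th0 : 0 < th by rewrite invr_gt0 mulr_gt0.
have wle2 u : C u -> pr y1 u = 1 -> pr w u <= sup A * (1 - th).
  move=> Cu y1u; have [[j c] /= [c0 y1k Ck]] := HK u Cu.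
  have gk : g j *m (c *: (invmx (g j) *m u)) = c *: u.
    by rewrite -scalemxAr mulKVmx//; exact: (fam_unit Hg).
  have Ckap : C (c *: (invmx (g j) *m u)).
    by apply: (cone_scale HC) => //; exact: (fam_invC Hg).
  have cv' : c <= a * pr y1 (vf j).
    have := py (fam_C Hg j (Ha _ Ckap)); rewrite y1k mulr1.
    by rewrite mulmxBr prBr -scalemxAr prZr gk prZr y1u mulr1 subr_gt0 => /ltW.
  have s0 : 0 <= sup A.
    by have := wle _ (Cvi 0%N); rewrite wv pmulr_lge0// py.
  have := wle _ (fam_C Hg j Ck).
  rewrite mulmxBr -scalemxAr gk !prBr !prZr wv subr0 y1u mulr1 => h.
  have : sup A * (c / a) <= sup A * pr y1 (vf j).
    by rewrite ler_wpM2l// ler_pdivrMr// mulrC.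
  move=> h2; rewrite -(ler_pM2l (mulr_gt0 K0 c0)) -mulrA (le_trans h)//.
  have -> : K * c * (sup A * (1 - th)) = sup A * (K * c) - sup A * (c / a).
    by rewrite /th; field; rewrite !gt_eqF.
  by move: h2; clra.
have s1 : sup A <= sup A * (1 - th).
  by apply: ge_sup => [|_ [u [Cu y1u] <-]]; [case: sA|exact: wle2].
have s0 : sup A <= 0.
  by rewrite -(pmulr_rle0 _ th0); move: s1; clra.
apply/eqP; apply: contraT => w0.
have : 0 < pr (- w) (vf 0).
  apply: (nonneg_pos HC) => // [u Cu|]; last by rewrite oppr_eq0.
  rewrite prNl oppr_ge0 (le_trans (wle u Cu))// mulr_le0_ge0// ltW// py//.
by rewrite prNl wv oppr0 ltxx.
Qed.

Variables (k : R) (x : 'cV[R]_m) (y : 'rV[R]_m).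
Hypothesis k0 : 0 < k.
Hypothesis ks : tau_summable y1 x1 g k.
Hypothesis Cx : C x.
Hypothesis posy : pos y.
Hypothesis yx : pr y x = 1.
Notation term := (term y1 x1 g k).
Notation H := (H y1 x1 g k).
Hypothesis min_y : forall y', pos y' -> pr y' x = 1 -> H x y <= H x y'.
Hypothesis max_x : forall x', C x' ->
  exists y', [/\ pos y', pr y' x' = 1 & H x' y' <= H x y].

Definition zeta i : 'cV[R]_m := (pr y (vf i))^-1 *: vf i.
Definition lam i : 'rV[R]_m := (pr (lf i) x)^-1 *: lf i.
Local Notation p := (term x y).
Local Notation E := (mean p).

Let yv i : 0 < pr y (vf i). Proof. exact: (dual_pos_gt0 HC posy). Qed.

Lemma weight_gt0 i : 0 < p i.
Proof. by rewrite powR_gt0// mulr_gt0 ?pl. Qed.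

Lemma weight_cvg : cvgn (series p).
Proof. exact: (term_cvg HC Hg k0 ks). Qed.

Let p0 := weight_gt0.
Let pc := weight_cvg.

Lemma Czeta i : C (zeta i).
Proof. by apply: (cone_scale HC); rewrite ?invr_gt0. Qed.

Lemma y_zeta i : pr y (zeta i) = 1.
Proof. by rewrite prZr mulVf// gt_eqF. Qed.

Lemma lam_x i : pr (lam i) x = 1.
Proof. by rewrite prZl mulVf// gt_eqF// pl. Qed.

Lemma lam_pos i u : C u -> 0 < pr (lam i) u.
Proof. by move=> Cu; rewrite prZl mulr_gt0 ?invr_gt0 ?pl. Qed.

Lemma bdd_zeta : bddc zeta.
Proof.
have [cb cb0 Hcb] := cone_bound HC; have [e e0 He] := posy.
move=> a; exists (cb / e) => i.
rewrite (le_trans (mx_norm_coord _ _ _))// (le_trans (Hcb _ (Czeta i)))//.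
rewrite ler_pM2l// -div1r ler_pdivlMr// mulrC -(y_zeta i).
exact: He (Czeta i).
Qed.

Lemma bdd_lam : bddr lam.
Proof.
have [r r0 Hr] := cone_open HC Cx.
move=> a; exists r^-1 => i.
pose e : 'cV[R]_m := delta_mx a 0.
have en : `|e| <= 1.
  by apply: mx_norm_le => // q q'; rewrite mxE; case: (_ && _);
    rewrite ?normr1 ?normr0.
have ye : pr (lam i) e = lam i 0 a by rewrite /pr -colE mxE.
have C' s : `|s| = 1 -> C (x + (s * r) *: e).
  by move=> s1; apply: Hr; rewrite normrZ normrM s1 mul1r gtr0_norm// ler_piMr// ltW.
have := lam_pos i (C' 1 (normr1 _)).
have := lam_pos i (C' (-1) (normrN1 _)).
rewrite !prDr !prZr ye lam_x => h1 h2.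
rewrite -div1r ler_pdivlMr// mulrC -[X in X * _](gtr0_norm r0) -normrM ler_norml.
by apply/andP; split; move: h1 h2; clra.
Qed.

Let bz := bdd_zeta.
Let bl := bdd_lam.
Let blX X : bdd (fun i => pr (lam i) X).
Proof. by apply: bdd_pr => //; exact: bddc_cst. Qed.
Let bwz w : bdd (fun i => pr w (zeta i)).
Proof. by apply: bdd_pr => //; exact: bddr_cst. Qed.
Lemma dual_pos_open w : exists2 r, 0 < r &
  forall t, `|t| < r -> pos (y + t *: w).
Proof.
have [cb cb0 Hcb] := cone_bound HC; have [e e0 He] := posy.
have q0 : 0 < 2 * (m%:R * `|w| * cb + 1) :> R.
  by rewrite mulr_gt0// ltr_wpDl// !mulr_ge0// ltW.
exists (e / (2 * (m%:R * `|w| * cb + 1))); first by rewrite divr_gt0.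
move=> t; rewrite ltr_pdivlMr// => ht; exists (e / 2); first by rewrite divr_gt0.
move=> u Cu; rewrite prDl prZl.
have h1 := pr_norm w u; have p1 := py Cu.
have h2 : m%:R * (`|w| * `|u|) <= m%:R * `|w| * cb * pr y1 u.
  by rewrite -mulrA -mulrA ler_wpM2l// ler_wpM2l// Hcb.
have h3 : `|t * pr w u| <= e / 2 * pr y1 u.
  rewrite normrM (le_trans (ler_wpM2l (normr_ge0 _) (le_trans h1 h2)))//.
  rewrite mulrA ler_pM2r//.
  have : 0 <= `|t| by []; move: ht; clra.
move: h3; rewrite ler_norml => /andP[h3 _].
by have := He u Cu; move: h3; clra.
Qed.

Lemma H_mean x' y' (f : nat -> R) : C x' -> pos y' ->
  (forall i, pr (lf i) x' * pr y' (vf i) = pr (lf i) x * pr y (vf i) * f i) ->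
  H x' y' = E (fun i => f i `^ (- k)) * H x y.
Proof.
move=> Cx' posy' Hf; rewrite /mean -/(Submission.H _ _ _ _ _ _) divfK; last first.
  by rewrite gt_eqF// (mass_gt0 p0 pc).
congr (limn (series _)); apply/funext => i; rewrite /Submission.term Hf.
have q0 : 0 < pr (lf i) x * pr y (vf i) by rewrite mulr_gt0 ?pl.
rewrite powRM ?(ltW q0)// ltW// -(pmulr_rgt0 _ q0) -Hf.
by rewrite mulr_gt0 ?pl// (dual_pos_gt0 HC posy').
Qed.

Let H0 : 0 < H x y. Proof. exact: (mass_gt0 p0 pc). Qed.

(** First variation in y. Subtracting a multiple of y reduces to w(x) = 0, when y + t w remains
    normalized at x. *)
Lemma mean_zeta w : E (fun i => pr w (zeta i)) = pr w x.
Proof.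
wlog wx : w / pr w x = 0.
  move=> W; have := W (w - pr w x *: y).
  rewrite prBl prZl yx mulr1 subrr => /(_ erefl) EW.
  transitivity (E (fun i => pr (w - pr w x *: y) (zeta i) + pr w x)).
    by apply: eq_mean => i; rewrite prBl prZl y_zeta mulr1 subrK.
  rewrite (meanD p0 pc) ?(mean_cst p0 pc)//; last exact: bdd_cst.
  by rewrite EW add0r.
rewrite wx; have [r r0 Hr] := dual_pos_open w.
apply: (mean_powRN_critical p0 pc k0 (bwz w) r0) => t tr.
have posyt := Hr t tr.
have := min_y posyt; rewrite prDl prZl wx mulr0 addr0 => /(_ yx).
rewrite (@H_mean x (y + t *: w) (fun i => 1 + t * pr w (zeta i)))//.
  by rewrite -{1}[H x y]mul1r ler_pM2r.
move=> i; rewrite prDl prZl prZr; field; rewrite gt_eqF//.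
Qed.

Local Notation S := (Mzz p zeta).

Lemma S_unit : S \in unitmx.
Proof.
rewrite -row_free_unit; apply: inj_row_free => w wS.
apply: orbit_spans => i; have := mean_zz p0 pc w w bz; rewrite wS pr0l => E0.
have bw2 : bdd (fun i => pr w (zeta i) * pr w (zeta i)) by apply: bddM.
have := mean_eq0 p0 pc bw2 _ E0 i.
move=> /(_ (fun i => sqr_ge0 (pr w (zeta i))))/eqP; rewrite mulf_eq0 orbb prZr.
by rewrite mulf_eq0 invr_eq0 (gt_eqF (yv i)) => /eqP.
Qed.

Definition W := invmx S.
Lemma SW : S *m W = 1%:M. Proof. exact: mulmxV S_unit. Qed.
Let WS : W *m S = 1%:M. Proof. exact: mulVmx S_unit. Qed.
Let Wsym : W^T = W. Proof. exact: W_sym SW. Qed.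

(** S and W define dual norms, since w(u) is the mean of w(z) times (W u)(z). *)
Lemma pr_CS w u : pr w u ^+ 2 <= pr (w *m S) w^T * pr (u^T *m W) u.
Proof.
have -> : pr w u = E (fun i => pr w (zeta i) * pr (u^T *m W) (zeta i)).
  by rewrite mean_zz// trmx_mul trmxK Wsym -prM -mulmxA SW mulmx1.
apply: le_trans (mean_CS p0 pc (bwz w) (bwz _)) _.
rewrite le_eqVlt; apply/orP; left; apply/eqP; congr (_ * _).
  by rewrite -mean_zz//; apply: eq_mean => i; rewrite expr2.
transitivity (E (fun i => pr (u^T *m W) (zeta i) * pr (u^T *m W) (zeta i))).
  by apply: eq_mean => i; rewrite expr2.
by rewrite mean_zz// trmx_mul trmxK Wsym -prM -!mulmxA SW mulmx1.
Qed.

Lemma bdd_zWz : bdd (fun i => pr ((zeta i)^T *m W) (zeta i)).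
Proof.
apply: bdd_pr => // a; have [M HM] := bdd_sum (index_enum 'I_m)
  (fun b => bddM (bz b) (bdd_cst (W b a))).
by exists M => i; rewrite mxE; under eq_bigr do rewrite mxE; exact: HM.
Qed.

(** [saddle_second_order] with g i = (X^T W)(z_i). As W inverts the second moment, the mean of g
    against w(z) is w(X). *)
Lemma saddle_ineq X : pr y X = 0 -> E (fun i => pr (lam i) X) = 0 /\
  (2 * k + 1) * E (fun i => pr (lam i) X ^+ 2) <=
  pr (X^T *m W) X + 2 * k * E (fun i => pr (X^T *m W) (zeta i) * pr (lam i) X).
Proof.
move=> yX; have [Mw HMw] := bdd_zWz.
have Mw0 : 0 <= Mw by exact: le_trans (HMw 0%N).
have [e0 e00 He0] := posy; have [a a0 Ha] := cone_dom HC Cx.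
have [r r0 Hr] := cone_open HC Cx.
have X1 : 0 < `|X| + 1 by rewrite ltr_wpDl.
have -> : pr (X^T *m W) X = E (fun i => pr (X^T *m W) (zeta i) ^+ 2).
  transitivity (E (fun i => pr (X^T *m W) (zeta i) * pr (X^T *m W) (zeta i))).
    by rewrite mean_zz// trmx_mul trmxK Wsym -prM -!mulmxA SW mulmx1.
  by apply: eq_mean => i; rewrite expr2.
have U0 : 0 <= a / e0 + 1 by rewrite addr_ge0// divr_ge0// ltW.
apply: (@saddle_second_order R p p0 pc (fun i => pr (lam i) X)
  (fun i => pr (X^T *m W) (zeta i)) k (a / e0 + 1) Mw (r / (`|X| + 1))) => //.
  by rewrite divr_gt0.
move=> t ht.
have CX : C (x + t *: X).
  apply: Hr; rewrite normrZ; move: ht; rewrite ltr_pdivlMr// => /ltW; apply: le_trans.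
  by rewrite ler_wpM2l// lerDl.
have [y' [posy' y'X Hle]] := max_x CX.
have y'x : 0 < pr y' x by exact: (dual_pos_gt0 HC posy').
(* The competitor y' is normalized at x + t X; rescaled to be 1 at x it is y + w with w(x) = 0, so
   that w(z_i) has mean 0. *)
pose w := (pr y' x)^-1 *: y' - y.
have wx : pr w x = 0 by rewrite prBl prZl mulVf ?gt_eqF// yx subrr.
have posw : pos (y + w).
  by rewrite addrC subrK; apply: dual_pos_scale => //; rewrite invr_gt0.
have wz i : 1 + pr w (zeta i) = pr (y + w) (zeta i) by rewrite prDl y_zeta.
(* The rescaling factor, which produces the right-hand side (1 + t E(g be))^-k. *)
have wX : 1 + t * pr w X = (pr y' x)^-1.
  rewrite /w prBl prZl yX subr0.
  have : pr y' x + t * pr y' X = 1 by rewrite -prZr -prDr.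
  by move=> h; rewrite -{1}(mulVf (_ : pr y' x != 0)) ?gt_eqF// mulrCA -mulrDr h mulr1.
have Hbe : exists2 e, 0 < e & forall i, e <= 1 + pr w (zeta i).
  have [e' e'0 He'] := posw; have [cb cb0 Hcb] := cone_bound HC.
  exists (e' / (m%:R * (`|y| * cb) + 1)).
    by rewrite divr_gt0// ltr_wpDl// !mulr_ge0// ltW.
  move=> i; rewrite wz (le_trans _ (He' _ (Czeta i)))// ler_pM2l//.
  rewrite -div1r ler_pdivrMr; last by rewrite ltr_wpDl// !mulr_ge0// ltW.
  rewrite -{1}(y_zeta i) (le_trans (ler_norm _))// (le_trans (pr_norm _ _))//.
  have p1 := py (Czeta i).
  have := Hcb _ (Czeta i) => h.
  have := ler_wpM2l (normr_ge0 y) h => h2.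
  by have := ler_wpM2l (ler0n R m) h2; move: p1; clra.
exists (fun i => pr w (zeta i)); split => //.
- move=> i; have h1 : 0 < 1 + pr w (zeta i) by rewrite wz (dual_pos_gt0 HC posw (Czeta i)).
  have h2 : 1 + pr w (zeta i) <= a / e0.
    rewrite wz ler_pdivlMr//.
    have := dual_pos_gt0 HC posw (Ha _ (Czeta i)).
    rewrite prBr prZr prDl yx wx addr0 mulr1 subr_gt0 => h.
    have p1 : e0 * pr y1 (zeta i) <= 1 by rewrite -(y_zeta i); exact: He0 (Czeta i).
    have := ler_wpM2l (ltW e00) (ltW h); rewrite mulrC => /le_trans; apply.
    by rewrite mulrCA -[leRHS]mulr1 ler_pM2l.
  by rewrite ler_norml; apply/andP; split; move: h1 h2; clra.
- by rewrite mean_zeta.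
- move=> i; rewrite (le_trans (pr_CS _ _))// mulrC.
  have -> : pr (w *m S) w^T = E (fun i => pr w (zeta i) ^+ 2).
    by rewrite -mean_zz//; apply: eq_mean => j; rewrite expr2.
  rewrite ler_wpM2r//; first by apply: (mean_ge0 p0 pc) => [|j];
    [apply: bddX; exact: bwz|exact: sqr_ge0].
  by rewrite (le_trans (ler_norm _)).
- have -> : E (fun i => pr (X^T *m W) (zeta i) * pr w (zeta i)) = pr w X.
    by rewrite mean_zz// -mulmxA WS mulmx1 prT.
  rewrite wX.
  have Heq := @H_mean (x + t *: X) y' (fun i => pr y' x *
     ((1 + t * pr (lam i) X) * (1 + pr w (zeta i)))) CX posy'.
  have fpos i : 0 < (1 + t * pr (lam i) X) * (1 + pr w (zeta i)).
    rewrite wz mulr_gt0//; last by rewrite (dual_pos_gt0 HC posw (Czeta i)).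
    by have := lam_pos i CX; rewrite prDr prZr lam_x.
  move: Hle; rewrite Heq; last first.
    move=> i; rewrite prDr prZr /w prBl !prZl !prZr.
    by field; rewrite !gt_eqF//= pl.
  rewrite -[leRHS]mul1r ler_pM2r// => Hle1.
  have -> : ((pr y' x)^-1) `^ (- k) = pr y' x `^ k.
    by rewrite -powR_inv1 ?(ltW y'x)// -powRrM mulN1r opprK.
  rewrite -[leRHS]mulr1 -ler_pdivrMl ?powR_gt0// -powRN -(meanZ p0 pc).
    apply: le_trans Hle1; rewrite le_eqVlt; apply/orP; left; apply/eqP.
    by apply: eq_mean => i; rewrite powRM// ltW.
  have [e1 e10 He1] := Hbe; have [c c0 Hc] := cone_dom HC CX.
  have q0 : 0 < c * pr y1 x by rewrite mulr_gt0// py.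
  apply: (bdd_powRN (ltW k0) (_ : 0 < (c * pr y1 x)^-1 * e1)) => [|i].
    by rewrite mulr_gt0// invr_gt0.
  apply: ler_pM => //; [by rewrite invr_ge0 ltW|exact: ltW|].
  rewrite -div1r ler_pdivrMr// mulrC -(lam_x i).
  have := lam_pos i (Hc _ Cx); rewrite prBr prZr subr_gt0 prDr prZr.
  by rewrite lam_x => /ltW.
Qed.

Lemma mean_lam u : E (fun i => pr (lam i) u) = pr y u.
Proof.
have h : pr y (u - pr y u *: x) = 0 by rewrite prBr prZr yx mulr1 subrr.
have [h1 _] := saddle_ineq h.
transitivity (E (fun i => pr (lam i) (u - pr y u *: x) + pr y u)).
  by apply: eq_mean => i; rewrite prBr prZr lam_x mulr1 subrK.
rewrite (meanD p0 pc) ?(mean_cst p0 pc)//; last exact: bdd_cst.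
by rewrite h1 add0r.
Qed.

Local Notation dbar := (E (fun i => pr (lam i) (zeta i))).

Lemma saddle_residual (n : R) : 0 < n -> n = m%:R - 1 ->
  E (fun i => pr (residual zeta lam y W n^-1 i *m S)
               (residual zeta lam y W n^-1 i)^T) <=
  (n - 2 * k * (1 - dbar)) / (2 * k + 1) - 2 / n * (1 - dbar) + n^-1.
Proof.
move=> n0 nE.
exact: (residual_le p0 pc bz bl y_zeta lam_x mean_zeta SW (ltW k0)
  (fun X h => proj2 (saddle_ineq h)) n0 nE).
Qed.

Lemma pr_lam_zeta i : pr (lam i) (zeta i) = (pr (lf i) x * pr y (vf i))^-1.
Proof. by rewrite prZl prZr (lv1 HC Hg) mulr1 invfM. Qed.

End at_saddle.

(** * The critical exponent *)

Section near_critical.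
Context {R : realType} {m : nat} (C : set 'cV[R]_m) (y1 : 'rV[R]_m)
  (x1 : 'cV[R]_m) (g : nat -> 'M[R]_m).
Hypothesis HC : based_cone C y1 x1.
Hypothesis Hg : cocompact_family C y1 x1 g.
Notation tau := (tau y1 x1 g).
Notation lf := (lf y1 g).
Notation vf := (vf x1 g).
Notation pos := (dual_pos C y1).
Notation term := (term y1 x1 g).
Notation H := (H y1 x1 g).
Variable K : R.
Hypothesis K0 : 0 < K.
Notation core := (core C y1 x1 K).

Let Cx1 := cone_base HC.
Let py u : C u -> 0 < pr y1 u := @cone_pos _ _ _ _ _ HC u.
Let Cvi i : C (vf i) := Cv HC Hg i.
Let pl i u : C u -> 0 < pr (lf i) u := @lf_pos _ _ _ _ _ _ HC Hg i u.

(** A maximum over x of a minimum over y: at another x' only some y' with a value at most H k x y is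
    provided, and that value may be much smaller. *)
Record saddle (k : R) (x : 'cV[R]_m) (y : 'rV[R]_m) := Saddle {
  saddle_core : core x;
  saddle_pos : pos y;
  saddle_yx : pr y x = 1;
  saddle_min : forall y', pos y' -> pr y' x = 1 -> H k x y <= H k x y';
  saddle_max : forall x', C x' ->
    exists y', [/\ pos y', pr y' x' = 1 & H k x' y' <= H k x y] }.

(** A partial sum exceeding 2 |M| at kc loses at most half of its value when the exponent grows
    slightly, because its finitely many tau are bounded by T. *)
Lemma tau_mass_large kc M : ~ tau_summable y1 x1 g kc -> exists2 k1, kc < k1 &
  forall k, kc < k -> k < k1 -> exists N, M <= \sum_(0 <= i < N) tau i `^ (- k).
Proof.
move=> nk; have [N HN] : exists N, 2 * `|M| < \sum_(0 <= i < N) tau i `^ (- kc).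
  apply: contrapT => /forallNP h; apply: nk; exists (2 * `|M|) => N.
  by rewrite leNgt; apply/negP; exact: h.
pose T := \sum_(0 <= i < N) tau i.
have T0 : 0 <= T by apply: sumr_ge0 => i _; exact: ltW (tau_gt0 HC Hg i).
exists (kc + (2 * (T + 1))^-1); first by rewrite ltrDl invr_gt0 mulr_gt0// ltr_wpDl.
move=> k k1 k2; exists N.
have e0 : 0 <= k - kc by rewrite subr_ge0 ltW.
have eT : (k - kc) * T <= 2^-1.
  have : (k - kc) * (2 * (T + 1)) <= 1.
    by rewrite -ler_pdivlMr ?mulr_gt0 ?ltr_wpDl// div1r lerBlDl ltW.
  by move: e0; clra.
apply: (@le_trans _ _ (2^-1 * \sum_(0 <= i < N) tau i `^ (- kc))).
  by have := ler_norm M; move: HN; clra.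
rewrite mulr_sumr big_nat [leRHS]big_nat; apply: ler_sum => i /andP[_ iN].
have ti := tau_gt0 HC Hg i.
have -> : - k = - (k - kc) + - kc by ring.
rewrite powRD ?(gt_eqF ti) ?implybT// ler_wpM2r ?powR_ge0//.
apply: (@le_trans _ _ ((1 + T) `^ (- (k - kc)))); last first.
  apply: powRN_le => //; apply: (@le_trans _ _ T); last by rewrite lerDr.
  rewrite /T big_mkord (bigD1 (Ordinal iN))//= lerDl.
  by apply: sumr_ge0 => j _; exact: ltW (tau_gt0 HC Hg j).
by apply: le_trans (powRN_ge_lin e0 T0); move: eT; clra.
Qed.

Lemma core_dom : exists2 a, 1 <= a & forall x y, core x -> pos y -> pr y x = 1 ->
  [/\ forall i, pr (lf i) x <= a * pr (lf i) x1,
      forall u, C u -> pr y u <= a * pr y1 u &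
      forall i, pr (lf i) x1 <= a * pr (lf i) x].
Proof.
have [a a0 Ha] := cone_dom HC Cx1.
have aK : 0 <= a * K by rewrite mulr_ge0// ltW.
exists (1 + a + K + a * K).
  by move: a0 K0 aK; clra.
move=> x y cx posy yx; have [Cx y1x ck] := cx.
have [e e0 He] := posy.
have yC u : C u -> 0 <= pr y u by move=> Cu; exact: ltW (dual_pos_gt0 HC posy Cu).
have yx1 : pr y x1 <= K by rewrite -[K]mulr1 -yx -prZr; exact: nonneg_le yC ck.
split=> [i|u Cu|i].
- have := pl i (Ha _ Cx); rewrite y1x mulr1 prBr prZr subr_gt0 => /ltW h.
  rewrite (le_trans h)// ler_wpM2r ?(ltW (pl i Cx1))//.
  by move: K0 aK; clra.
- have := dual_pos_gt0 HC posy (Ha _ Cu); rewrite prBr prZr subr_gt0 => /ltW h.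
  have pu := py Cu.
  apply: (@le_trans _ _ (a * pr y1 u * K)).
    by rewrite (le_trans h)// ler_wpM2l// mulr_ge0// ltW.
  by rewrite mulrAC ler_wpM2r ?(ltW pu)//; move: a0 K0; clra.
- rewrite (le_trans (core_lf HC Hg _ cx))// ler_wpM2r ?(ltW (pl i Cx))//.
  by move: a0 aK; clra.
Qed.

Section fixed_saddle.
Variables (k : R) (x : 'cV[R]_m) (y : 'rV[R]_m).
Hypothesis k0 : 0 < k.
Hypothesis ks : tau_summable y1 x1 g k.
Hypothesis Hs : saddle k x y.
Local Notation E := (mean (term k x y)).
Local Notation zeta := (zeta x1 g y).
Local Notation lam := (lam y1 g x).

Let Cx : C x. Proof. by case: Hs => -[]. Qed.
Let y1x : pr y1 x = 1. Proof. by case: Hs => -[]. Qed.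
Let posy := saddle_pos Hs.
Let yx := saddle_yx Hs.
Let p0 := @weight_gt0 _ _ _ _ _ _ HC Hg k x y Cx posy.
Let pc := @weight_cvg _ _ _ _ _ _ HC Hg k x y k0 ks Cx posy.
Let bz := @bdd_zeta _ _ _ _ _ _ HC Hg y posy.
Let bl := @bdd_lam _ _ _ _ _ _ HC Hg x Cx.

Lemma mean_prefix N : E (fun i => (i < N)%:R) = (\sum_(0 <= i < N) term k x y i) / H k x y.
Proof.
rewrite /mean; congr (_ / _); apply: lim_near_cst => //; near=> M.
have NM : (N <= M)%N by near: M; exact: nbhs_infty_ge.
rewrite seriesEnat /= (big_cat_nat (n := N))//= big_nat.
rewrite (eq_bigr (term k x y)); last by move=> i /andP[_ ->]; rewrite mulr1.
rewrite -big_nat [X in _ + X]big_nat [X in _ + X]big1 ?addr0// => i /andP[].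
by rewrite leqNgt => /negbTE ->; rewrite mulr0.
Unshelve. all: by end_near.
Qed.

(** For i >= N one has lam_i(z_i) <= (a / T) y1(z_i), and y1(z_i) has mean y1(x) = 1. The first N
    indices carry weight at most N b^-k out of H. *)
Lemma dbar_le (T b a : R) N : 0 < T -> 0 < b -> 1 <= a ->
  (forall x y, core x -> pos y -> pr y x = 1 ->
  [/\ forall i, pr (lf i) x <= a * pr (lf i) x1,
      forall u, C u -> pr y u <= a * pr y1 u &
      forall i, pr (lf i) x1 <= a * pr (lf i) x]) ->
  (forall i, (i < N)%N -> b <= pr (lf i) x * pr y (vf i)) ->
  (forall i, (N <= i)%N -> T <= tau i) ->
  E (fun i => pr (lam i) (zeta i)) <=
    a / T + b^-1 * (N%:R * b `^ (- k)) / H k x y.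
Proof.
move=> T0 b0 a1 Ha Hb HT.
have a0 : 0 < a by exact: lt_le_trans a1.
have [_ _ Ha3] := Ha _ _ (saddle_core Hs) posy yx.
have H0 : 0 < H k x y by exact: (mass_gt0 p0 pc).
have bw : bdd (fun i => pr y1 (zeta i)) by apply: bdd_pr => //; exact: bddr_cst.
have bi : bdd (fun i => (i < N)%:R : R).
  by exists 1 => i; case: (i < N)%N; rewrite ?normr1 ?normr0.
have h i : pr (lam i) (zeta i) <= a / T * pr y1 (zeta i) + b^-1 * (i < N)%:R.
  have yv := dual_pos_gt0 HC posy (Cvi i); have lx := pl i Cx.
  have y1z : 0 < pr y1 (zeta i) by rewrite py//; exact: (Czeta HC Hg posy).
  rewrite (pr_lam_zeta HC Hg) ?(Cx, posy)//.
  have [iN|Ni] := ltnP i N.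
    rewrite mulr1; apply: (@le_trans _ _ b^-1); last first.
      by rewrite lerDr mulr_ge0 ?divr_ge0// ltW.
    by rewrite lef_pV2 ?posrE ?mulr_gt0// Hb.
  rewrite mulr0 addr0 prZr.
  have -> : (pr (lf i) x * pr y (vf i))^-1 =
      (pr (lf i) x)^-1 * (pr y1 (vf i))^-1 * ((pr y (vf i))^-1 * pr y1 (vf i)).
    by field; rewrite !gt_eqF// py.
  rewrite ler_wpM2r//; first by rewrite mulr_ge0 ?invr_ge0 ?(ltW yv)// ltW// py.
  have lx1 := pl i Cx1; have y1v := py (Cvi i).
  apply: (@le_trans _ _ (a / tau i)).
    rewrite /Submission.tau invfM mulrA ler_wpM2r ?invr_ge0 ?(ltW y1v)//.
    by rewrite ler_pdivlMr// mulrC ler_pdivrMr.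
  rewrite ler_wpM2l ?(ltW a0)// lef_pV2 ?posrE ?(tau_gt0 HC Hg)//; exact: HT.
apply: (le_trans (ler_mean p0 pc (bdd_pr bl bz) _ h)).
  by apply: bddD; apply: bddM => //; exact: bdd_cst.
rewrite (meanD p0 pc); [|by apply: bddM => //; exact: bdd_cst|
  by apply: bddM => //; exact: bdd_cst].
rewrite !(meanZ p0 pc)// (mean_zeta HC Hg k0 ks Cx posy yx (saddle_min Hs)).
rewrite y1x mulr1 lerD2l mean_prefix mulrA ler_wpM2r ?invr_ge0 ?(ltW H0)//.
rewrite ler_wpM2l ?invr_ge0 ?(ltW b0)//.
apply: (@le_trans _ _ (\sum_(0 <= i < N) b `^ (- k))).
  rewrite big_nat [leRHS]big_nat; apply: ler_sum => i /andP[_ iN].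
  by apply: powRN_le => //; [exact: ltW|exact: Hb].
by rewrite big_mkord sumr_const card_ord mulr_natl.
Qed.

Lemma H_ge (a M : R) N : 1 <= a ->
  (forall i, pr (lf i) x <= a * pr (lf i) x1) ->
  (forall u, C u -> pr y u <= a * pr y1 u) ->
  M <= \sum_(0 <= i < N) tau i `^ (- k) ->
  (a ^+ 2) `^ (- k) * M <= H k x y.
Proof.
move=> a1 h1 h2 hM; have a0 : 0 < a by exact: lt_le_trans a1.
apply: le_trans (nonneg_series_ge N (fun i => ltW (p0 i)) pc).
apply: (le_trans (ler_wpM2l (powR_ge0 _ _) hM)).
rewrite mulr_sumr; apply: ler_sum => i _.
have ti := tau_gt0 HC Hg i; have yv := dual_pos_gt0 HC posy (Cvi i).
rewrite -powRM ?sqr_ge0 ?(ltW ti)//; apply: powRN_le; first exact: ltW.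
  by rewrite mulr_gt0 ?pl.
have := ler_pM (ltW (pl i Cx)) (ltW yv) (h1 i) (h2 _ (Cvi i)) => /le_trans; apply.
by rewrite /Submission.tau le_eqVlt; apply/orP; left; apply/eqP; ring.
Qed.

Lemma dbar_ge0 : 0 <= E (fun i => pr (lam i) (zeta i)).
Proof.
apply: (mean_ge0 p0 pc) => [|i]; first exact: bdd_pr.
by rewrite ltW// (lam_pos HC Hg)//; exact: (Czeta HC Hg posy).
Qed.

End fixed_saddle.

(** T is chosen to make the part of large tau at most ep / 2; then N and b are fixed, and the other
    part vanishes because H tends to infinity as k decreases to kc. *)
Lemma dbar_small kc ep : 0 <= kc -> ~ tau_summable y1 x1 g kc ->
  (forall k, kc < k -> tau_summable y1 x1 g k) -> 0 < ep ->
  exists2 k1, kc < k1 & forall k, kc < k -> k < k1 -> forall x y, saddle k x y ->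
    mean (term k x y) (fun i => pr (lam y1 g x i) (zeta x1 g y i)) <= ep.
Proof.
move=> kc0 nkc ks ep0; have [a a1 Ha] := core_dom.
have a0 : 0 < a by exact: lt_le_trans a1.
pose T := 2 * a / ep.
have T0 : 0 < T by rewrite divr_gt0// mulr_gt0.
have [N HN] := tau_finite HC Hg T.
have [b b0 Hb] : exists2 b, 0 < b & forall i, (i < N)%N -> forall x y, core x ->
    pos y -> pr y x = 1 -> b <= pr (lf i) x * pr y (vf i).
  elim: N {HN} => [|N [b b0 IH]]; first by exists 1.
  have [c c0 Hc] := cone_dom HC (Cvi N).
  have l0 := pl N Cx1; have q0 : 0 < pr (lf N) x1 / (a * c) by rewrite divr_gt0// mulr_gt0.
  exists (Num.min b (pr (lf N) x1 / (a * c))); first by rewrite lt_min b0 q0.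
  move=> i; rewrite ltnS leq_eqVlt => /orP[/eqP ->|iN] x y cx posy yx; last first.
    by apply: (le_trans _ (IH i iN x y cx posy yx)); rewrite ge_min lexx.
  have [Cx y1x _] := cx; have [_ _ h3] := Ha x y cx posy yx.
  apply: (@le_trans _ _ (pr (lf N) x1 / (a * c))); first by rewrite ge_min lexx orbT.
  rewrite invfM mulrA; apply: ler_pM.
  - by rewrite divr_ge0// ltW.
  - by rewrite invr_ge0 ltW.
  - by rewrite ler_pdivrMr// mulrC.
  - have := dual_pos_gt0 HC posy (Hc _ Cx); rewrite y1x mulr1 prBr prZr yx subr_gt0.
    by move=> /ltW; rewrite -ler_pdivrMl// mulr1.
pose B := b^-1 * (N%:R * (1 + b^-1) `^ (kc + 1)).
have B0 : 0 <= B by rewrite mulr_ge0 ?invr_ge0 ?(ltW b0)// mulr_ge0// powR_ge0.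
pose A := (a ^+ 2) `^ (- (kc + 1)).
have a20 : 0 < a ^+ 2 by rewrite exprn_gt0.
have A0 : 0 < A by rewrite powR_gt0.
(* A M will be a lower bound for H, and with this M the quotient B / (A M) is below ep / 2. *)
pose M := 2 * (B + 1) / (A * ep).
have M0 : 0 < M by rewrite divr_gt0 ?mulr_gt0// ltr_wpDl.
have [k1 kk1 Hk1] := tau_mass_large M nkc.
exists (Num.min k1 (kc + 1)); first by rewrite lt_min kk1 ltrDl ltr01.
move=> k kck; rewrite lt_min => /andP[kk kk'] x y Hs.
have k0 : 0 < k by exact: le_lt_trans kck.
have posy := saddle_pos Hs; have yx := saddle_yx Hs; have cx := saddle_core Hs.
have [h1 h2 _] := Ha _ _ cx posy yx.
have [N' HN'] := Hk1 k kck kk.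
have HH := H_ge k0 (ks k kck) Hs a1 h1 h2 HN'.
have AA : A <= (a ^+ 2) `^ (- k).
  by rewrite /A ler_powR ?exprn_ege1// lerN2 ltW.
have HM : A * M <= H k x y by rewrite (le_trans _ HH)// ler_wpM2r// ltW.
have AM : 0 < A * M by rewrite mulr_gt0.
have HbN i : (i < N)%N -> b <= pr (lf i) x * pr y (vf i).
  by move=> iN; exact: Hb.
have HT i : (N <= i)%N -> T <= tau i.
  move=> Ni; rewrite leNgt; apply/negP => /ltW/HN; by rewrite ltnNge Ni.
apply: (le_trans (dbar_le k0 (ks k kck) Hs T0 b0 a1 Ha HbN HT)).
have e1 : a / T = ep / 2 by rewrite /T; field; rewrite !gt_eqF.
have e2 : b^-1 * (N%:R * b `^ (- k)) <= B.
  rewrite ler_wpM2l ?invr_ge0 ?(ltW b0)// ler_wpM2l//.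
  have -> : b `^ (- k) = b^-1 `^ k.
    by rewrite -(powR_inv1 (ltW b0)) -powRrM mulN1r.
  have b1 : 0 <= b^-1 by rewrite invr_ge0 ltW.
  apply: (@le_trans _ _ ((1 + b^-1) `^ k)).
    by apply: ge0_ler_powR; rewrite ?nnegrE ?(ltW k0) ?addr_ge0 ?lerDr.
  by rewrite ler_powR ?lerDl// ltW.
have H0 : 0 < H k x y by exact: lt_le_trans HM.
have : b^-1 * (N%:R * b `^ (- k)) / H k x y <= ep / 2.
  rewrite ler_pdivrMr// (le_trans e2)//.
  apply: (@le_trans _ _ (ep / 2 * (A * M))); last by rewrite ler_pM2l// divr_gt0.
  have -> : ep / 2 * (A * M) = B + 1 by rewrite /M; field; rewrite !gt_eqF.
  by rewrite lerDl.
by rewrite e1; clra.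
Qed.

Hypothesis HK : forall u, C u -> exists ic : nat * R,
    [/\ 0 < ic.2, pr y1 (ic.2 *: (invmx (g ic.1) *m u)) = 1
      & C (K *: (ic.2 *: (invmx (g ic.1) *m u)) - x1)].

Lemma saddle_of k : 0 < k -> tau_summable y1 x1 g k ->
  exists xy : 'cV[R]_m * 'rV[R]_m, saddle k xy.1 xy.2.
Proof.
move=> k0 ks; have [xy [h1 h2 h3 h4 h5]] := saddle_exists HC Hg k0 ks K0 HK.
by exists xy; split.
Qed.

Variables (kc n : R).
Hypothesis kc0 : 0 <= kc.
Hypothesis nkc : ~ tau_summable y1 x1 g kc.
Hypothesis ks : forall k, kc < k -> tau_summable y1 x1 g k.
Hypothesis n0 : 0 < n.
Hypothesis nE : n = m%:R - 1.

Definition res k x y i := residual (zeta x1 g y) (lam y1 g x) y (W y1 x1 g k x y) n^-1 i.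
Definition res_mean k x y := mean (term k x y)
  (fun i => pr (res k x y i *m Mzz (term k x y) (zeta x1 g y)) (res k x y i)^T).

Lemma res_mean_ge0 k x y : 0 < k -> tau_summable y1 x1 g k -> saddle k x y ->
  0 <= res_mean k x y.
Proof.
move=> k0 sk Hs; have [[Cx _ _] posy] := (saddle_core Hs, saddle_pos Hs).
have p0 := @weight_gt0 _ _ _ _ _ _ HC Hg k x y Cx posy.
have pc := @weight_cvg _ _ _ _ _ _ HC Hg k x y k0 sk Cx posy.
have bz := @bdd_zeta _ _ _ _ _ _ HC Hg y posy.
have bl := @bdd_lam _ _ _ _ _ _ HC Hg x Cx.
have br : bddr (res k x y) by exact: bdd_residual.
apply: (mean_ge0 p0 pc) => [|i].
  apply: bdd_pr => a; last by have [M HM] := br a; exists M => i; rewrite mxE.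
  have [M HM] := bdd_sum (index_enum 'I_m) (fun b => bddM (br b)
    (bdd_cst (Mzz (term k x y) (zeta x1 g y) b a))).
  by exists M => i; rewrite mxE.
rewrite -(mean_zz p0 pc _ _ bz).
apply: (mean_ge0 p0 pc) => [|j]; last by rewrite -expr2 sqr_ge0.
by apply: bddM; exact: (bdd_pr (bddr_cst _) bz).
Qed.

(** [saddle_residual] rearranged so that for vanishing mean of lam_i(z_i) only a positive multiple
    of n - 1 - 2 k is left. *)
Lemma res_mean_le k x y : 0 < k -> tau_summable y1 x1 g k -> saddle k x y ->
  res_mean k x y <= ((n + 1) * (n - 1 - 2 * k) +
    (2 * k * n + 4 * k + 2) *
     mean (term k x y) (fun i => pr (lam y1 g x i) (zeta x1 g y i))) / (n * (2 * k + 1)).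
Proof.
move=> k0 sk Hs; have [[Cx _ _] posy] := (saddle_core Hs, saddle_pos Hs).
apply: le_trans (saddle_residual HC Hg k0 sk Cx posy (saddle_yx Hs)
  (saddle_min Hs) (saddle_max Hs) n0 nE) _.
rewrite le_eqVlt; apply/orP; left; apply/eqP.
by field; rewrite !gt_eqF// ltr_wpDl// mulr_ge0 ?ltW.
Qed.

Lemma critical_le : 2 * kc <= n - 1.
Proof.
rewrite leNgt; apply/negP => h.
(* Half of the negative main term outweighs the contribution of a mean of lam_i(z_i) below ep. *)
pose ep := (n + 1) * (2 * kc - (n - 1)) / (2 * (2 * (kc + 1) * n + 4 * (kc + 1) + 2)).
have q0 : 0 < 2 * (kc + 1) * n + 4 * (kc + 1) + 2.
  by rewrite ltr_wpDl// addr_ge0// !mulr_ge0 ?addr_ge0// ltW.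
have ep0 : 0 < ep.
  by apply: divr_gt0; rewrite mulr_gt0// ?subr_gt0// addr_gt0.
have [k1 kk1 Hk1] := dbar_small kc0 nkc ks ep0.
pose k := Num.min ((kc + k1) / 2) (kc + 1).
have kck : kc < k by rewrite lt_min; move: kk1; clra.
have kk : k < k1 by rewrite gt_min; apply/orP; left; move: kk1; clra.
have k2 : k <= kc + 1 by rewrite ge_min lexx orbT.
have k0 : 0 < k by exact: le_lt_trans kck.
have [[x y] /= Hs] := saddle_of k0 (ks kck).
have := le_trans (res_mean_ge0 k0 (ks kck) Hs) (res_mean_le k0 (ks kck) Hs).
have D0 : 0 < n * (2 * k + 1) by rewrite mulr_gt0// ltr_wpDl// mulr_ge0 ?ltW.
rewrite pmulr_lge0 ?invr_gt0//.
have d1 := Hk1 k kck kk x y Hs.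
have d0 := dbar_ge0 k0 (ks kck) Hs.
move: d0 d1; set d := mean _ _ => d0 d1.
have h1 : (2 * k * n + 4 * k + 2) * d <= (2 * (kc + 1) * n + 4 * (kc + 1) + 2) * ep.
  apply: ler_pM => //.
    by rewrite !addr_ge0// !mulr_ge0// ltW.
  have := ler_wpM2r (ltW n0) k2; move: k2; clra.
have h2 : (2 * (kc + 1) * n + 4 * (kc + 1) + 2) * ep = (n + 1) * (2 * kc - (n - 1)) / 2.
  by rewrite /ep; field; rewrite gt_eqF.
rewrite h2 in h1 => h3.
have h4 : 0 < (n + 1) * (2 * kc - (n - 1)) by rewrite mulr_gt0 ?subr_gt0 ?addr_gt0.
have h5 : 0 <= (n + 1) * (k - kc) by rewrite mulr_ge0 ?subr_ge0 ?addr_ge0 ?ltW.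
by move: h1 h3 h4 h5; clra.
Qed.

Lemma critical_residual ep : 2 * kc = n - 1 -> 0 < ep ->
  exists k x y, [/\ 0 < k <= kc + 1, tau_summable y1 x1 g k, saddle k x y,
    mean (term k x y) (fun i => pr (lam y1 g x i) (zeta x1 g y i)) <= ep
   & res_mean k x y <= ep].
Proof.
(* At 2 kc = n - 1 the main term is at most 0 for k > kc, and the rest is at most (n + 2) / n times
   the mean of lam_i(z_i). *)
move=> kn ep0; pose ep' := Num.min ep (ep * n / (n + 2)).
have n2 : 0 < n + 2 by rewrite addr_gt0.
have ep'0 : 0 < ep' by rewrite lt_min ep0 divr_gt0// mulr_gt0.
have [k1 kk1 Hk1] := dbar_small kc0 nkc ks ep'0.
have [k2 kk2 /andP[k12 kc2]] : exists2 k2, kc < k2 & (k2 <= k1) && (k2 <= kc + 1).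
  by exists (Num.min k1 (kc + 1)); [rewrite lt_min kk1 ltrDl ltr01|rewrite !ge_min !lexx orbT].
pose k := (kc + k2) / 2.
have kck : kc < k by move: kk2; rewrite /k; clra.
have kk : k < k1 by move: kk2 k12; rewrite /k; clra.
have kc1 : k <= kc + 1 by move: kk2 kc2; rewrite /k; clra.
have k0 : 0 < k by exact: le_lt_trans kck.
have [[x y] /= Hs] := saddle_of k0 (ks kck).
have d1 := Hk1 k kck kk x y Hs; have d0 := dbar_ge0 k0 (ks kck) Hs.
exists k, x, y; split => //; [by rewrite k0|exact: ks|by rewrite (le_trans d1)// ge_min lexx|].
apply: (le_trans (res_mean_le k0 (ks kck) Hs)).
have D1 : 0 < 2 * k + 1 by rewrite ltr_wpDl// mulr_ge0 ?ltW.
have D0 : 0 < n * (2 * k + 1) by rewrite mulr_gt0.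
rewrite ler_pdivrMr//.
move: d0 d1; set d := mean _ _ => d0 d1.
have d2 : (n + 2) * d <= ep * n.
  rewrite mulrC -ler_pdivlMr// (le_trans d1)// ge_min lexx orbT//.
have h1 : (n + 1) * (n - 1 - 2 * k) <= 0.
  by rewrite pmulr_rle0 ?addr_gt0//; move: kck kn; clra.
have h2 : (2 * k + 1) * ((n + 2) * d) <= (2 * k + 1) * (ep * n) by rewrite ler_pM2l.
have h3 : 0 <= n * d by rewrite mulr_ge0// ltW.
by move: h1 h2 h3; clra.
Qed.

End near_critical.

Lemma ler_norm_sqr {R : realType} (a b : R) : 0 <= b -> a ^+ 2 <= b ^+ 2 -> `|a| <= b.
Proof. by move=> b0 h; rewrite -(ger0_norm b0) -!sqrtr_sqr ler_wsqrtr. Qed.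

(** * Bounds at a nearly critical minimax point *)

Section truncation.
Context {R : realType} (p : nat -> R).
Hypothesis p_gt0 : forall i, 0 < p i.
Hypothesis p_cvg : cvgn (series p).
Notation E := (mean p).

Lemma mean_abs_le (f : nat -> R) : bdd f -> (forall i, -1 <= f i) -> E f = 0 ->
  E (fun i => `|f i|) <= 2.
Proof.
move=> bf f1 Ef.
have -> : 2 = E (fun i => f i + 2) :> R.
  rewrite (meanD p_gt0 p_cvg)//; last exact: bdd_cst.
  by rewrite Ef (mean_cst p_gt0 p_cvg) add0r.
apply: ler_mean => //; [by bdd|by apply: bddD => //; exact: bdd_cst|move=> i].
have := f1 i; have [h|h] := leP 0 (f i); [rewrite ger0_norm//; clra|].
by rewrite ltr0_norm//; clra.
Qed.

(* Almost all the mass sits where w is close to n, so a function f dominated by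
   w cannot have a large second moment and a small first moment. *)
Lemma second_moment_le (f w : nat -> R) (n M kap : R) : 0 < n -> bdd f -> bdd w ->
  0 <= M -> 0 <= kap -> E (fun i => `|f i|) <= kap ->
  (forall i, f i ^+ 2 <= M * w i) -> M <= E (fun i => f i ^+ 2) ->
  E (fun i => `|w i - n|) <= 4^-1 -> M <= 8 * n * kap ^+ 2.
Proof.
move=> n0 bf bw M0 kap0 Ef fw ME Ew.
(* Where w <= 2 n, the domination gives |f| <= q; where w > 2 n, w is at most 2 |w - n|. *)
pose q := Num.sqrt (2 * n * M).
have nM : 0 <= 2 * n * M by rewrite !mulr_ge0// ltW.
have q0 : 0 <= q by exact: sqrtr_ge0.
have q2 : q ^+ 2 = 2 * n * M by rewrite sqr_sqrtr.
have H i : f i ^+ 2 <= q * `|f i| + 2 * M * `|w i - n|.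
  have [h|h] := leP (w i) (2 * n).
    have fq : `|f i| <= q.
      rewrite -sqrtr_sqr ler_wsqrtr// (le_trans (fw i))// [leRHS]mulrC.
      by rewrite ler_wpM2l.
    rewrite -[leLHS]real_normK ?num_real// expr2 -[leLHS]addr0 lerD//.
      by rewrite ler_wpM2r.
    by rewrite !mulr_ge0.
  have h2 : w i <= 2 * `|w i - n|.
    by rewrite ger0_norm; [move: h|move: h n0]; clra.
  have := ler_wpM2l M0 h2; have := mulr_ge0 q0 (normr_ge0 (f i)); have := fw i.
  clra.
have bfa := bdd_norm bf.
have bwa : bdd (fun i => `|w i - n|).
  by apply: bdd_norm; apply: bddD => //; exact: bdd_cst.
have bf2 := bddX 2 bf.
have := ler_mean p_gt0 p_cvg bf2 (bddD (bddM (bdd_cst q) bfa)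
  (bddM (bdd_cst (2 * M)) bwa)) H.
rewrite (meanD p_gt0 p_cvg); [|by apply: bddM => //; exact: bdd_cst|
  by apply: bddM => //; exact: bdd_cst].
rewrite !(meanZ p_gt0 p_cvg)// => h.
have h1 : M <= 2 * (q * kap).
  have := ler_wpM2l q0 Ef.
  have M2 : 0 <= 2 * M by rewrite mulr_ge0.
  have := ler_wpM2l M2 Ew; move: ME h; clra.
have h2 : M ^+ 2 <= M * (8 * n * kap ^+ 2).
  have : M ^+ 2 <= (2 * (q * kap)) ^+ 2.
    by rewrite ler_sqr ?nnegrE// !mulr_ge0.
  rewrite !exprMn q2 => /le_trans; apply.
  by rewrite le_eqVlt; apply/orP; left; apply/eqP; ring.
have [->|Mn0] := eqVneq M 0; first by rewrite !mulr_ge0 ?sqr_ge0// ltW.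
have Mpos : 0 < M by rewrite lt_neqAle eq_sym Mn0.
by rewrite -(ler_pM2l Mpos) -expr2.
Qed.

End truncation.

Section small_residual.
Context {R : realType} {m : nat} (C : set 'cV[R]_m) (y1 : 'rV[R]_m)
  (x1 : 'cV[R]_m) (g : nat -> 'M[R]_m).
Hypothesis HC : based_cone C y1 x1.
Hypothesis Hg : cocompact_family C y1 x1 g.
Notation lf := (lf y1 g).
Notation vf := (vf x1 g).
Notation pos := (dual_pos C y1).
Notation term := (term y1 x1 g).
Variable K : R.
Hypothesis K0 : 0 < K.
Notation core := (core C y1 x1 K).
Variables (n : R).
Hypothesis n0 : 0 < n.
Hypothesis nE : n = m%:R - 1.
Variables (k : R) (x : 'cV[R]_m) (y : 'rV[R]_m).
Hypothesis k0 : 0 < k.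
Hypothesis ks : tau_summable y1 x1 g k.
Hypothesis Hs : saddle C y1 x1 g K k x y.
Notation E := (mean (term k x y)).
Notation zeta := (zeta x1 g y).
Notation lam := (lam y1 g x).
Notation S := (Mzz (term k x y) zeta).
Notation W := (W y1 x1 g k x y).
Notation r := (res y1 x1 g n k x y).
Variable s : R.
Hypothesis s0 : 0 < s.
Hypothesis Hd : E (fun i => pr (lam i) (zeta i)) <= s ^+ 2.
Hypothesis Hr : res_mean y1 x1 g n k x y <= s ^+ 2.

Let Cx : C x. Proof. by case: Hs => -[]. Qed.
Let y1x : pr y1 x = 1. Proof. by case: Hs => -[]. Qed.
Let posy := saddle_pos Hs.
Let yx := saddle_yx Hs.
Let p0 := @weight_gt0 _ _ _ _ _ _ HC Hg k x y Cx posy.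
Let pc := @weight_cvg _ _ _ _ _ _ HC Hg k x y k0 ks Cx posy.
Let bz := @bdd_zeta _ _ _ _ _ _ HC Hg y posy.
Let bl := @bdd_lam _ _ _ _ _ _ HC Hg x Cx.
Let yz := @y_zeta _ _ _ _ _ _ HC Hg y posy.
Let lx := @lam_x _ _ _ _ _ _ HC Hg x Cx.
Let Ez := @mean_zeta _ _ _ _ _ _ HC Hg k x y k0 ks Cx posy yx (saddle_min Hs).
Let El := @mean_lam _ _ _ _ _ _ HC Hg k x y k0 ks Cx posy yx (saddle_min Hs) (saddle_max Hs).
Let SW := @SW _ _ _ _ _ _ HC Hg k x y k0 ks Cx posy.
Let WS : W *m S = 1%:M. Proof. exact: mulmx1C. Qed.
Let Cz i : C (zeta i) := @Czeta _ _ _ _ _ _ HC Hg y posy i.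
Let Wsym : W^T = W := W_sym SW.
Let xWE : x^T *m W = y := xW p0 pc bz yz Ez SW.
Let WxE : W *m x = y^T := Wx p0 pc bz yz Ez SW.
Let CS w u : pr w u ^+ 2 <= pr (w *m S) w^T * pr (u^T *m W) u :=
  @pr_CS _ _ _ _ _ _ HC Hg k x y k0 ks Cx posy w u.
Let bzW := @bdd_zWz _ _ _ _ _ _ HC Hg k x y posy.
Let bpz w : bdd (fun i => pr w (zeta i)) := bdd_pr (bddr_cst w) bz.
Let bpl u : bdd (fun i => pr (lam i) u) := bdd_pr bl (bddc_cst u).

Lemma W_ge0 u : 0 <= pr (u^T *m W) u.
Proof.
have -> : pr (u^T *m W) u = E (fun i => pr (u^T *m W) (zeta i) * pr (u^T *m W) (zeta i)).
  by rewrite mean_zz// trmx_mul trmxK Wsym -prM -!mulmxA SW mulmx1.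
by apply: (mean_ge0 p0 pc) => [|i]; [exact: bddM|rewrite -expr2 sqr_ge0].
Qed.

Lemma S_ge0 w : 0 <= pr (w *m S) w^T.
Proof.
rewrite -mean_zz//.
by apply: (mean_ge0 p0 pc) => [|i]; [exact: bddM|rewrite -expr2 sqr_ge0].
Qed.

Lemma res_pr i u : pr (r i) u =
  pr (lam i) u + n^-1 * pr ((zeta i)^T *m W) u - (1 + n^-1) * pr y u.
Proof. by rewrite /res /residual prBl prDl !prZl. Qed.

Lemma bdd_res : bddr r. Proof. exact: bdd_residual. Qed.

Lemma bdd_resS : bdd (fun i => pr (r i *m S) (r i)^T).
Proof.
have br := bdd_res; apply: bdd_pr => a.
  have [M HM] := bdd_sum (index_enum 'I_m) (fun b => bddM (br b) (bdd_cst (S b a))).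
  by exists M => i; rewrite mxE.
by have [M HM] := br a; exists M => i; rewrite mxE.
Qed.

(* w i is the squared W-norm of zeta i - x *)
Notation w := (fun i => pr ((zeta i)^T *m W) (zeta i) - 1).

Lemma w_shift u : pr y u = 1 -> pr ((u - x)^T *m W) (u - x) = pr (u^T *m W) u - 1.
Proof.
move=> yu; rewrite linearB mulmxBl xWE !prBl !prBr yx yu subrr subr0.
by rewrite [pr _ x]prM WxE prT yu.
Qed.

(** w - n = n (r(z) - lam(z)) by the definition of the residual. The pairing r(z) is split by
    Cauchy-Schwarz and the inequality of means with weight s, using that z^T W z has mean tr(W S) =
    n + 1. *)
Lemma w_mean : s <= 1 -> E (fun i => `|w i - n|) <= n * s * (n + 4) / 2.
Proof.
move=> s1; have mE : m%:R = n + 1 by rewrite nE subrK.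
have n1 : 0 <= n by exact: ltW.
have bd : bdd (fun i => pr (lam i) (zeta i)) by exact: bdd_pr.
have H i : `|w i - n| <= n * (2^-1 * s^-1) * pr (r i *m S) (r i)^T +
    n * (2^-1 * s) * pr ((zeta i)^T *m W) (zeta i) + n * pr (lam i) (zeta i).
  have d0 : 0 <= pr (lam i) (zeta i) by rewrite ltW// (lam_pos HC Hg).
  have -> : w i - n = n * (pr (r i) (zeta i) - pr (lam i) (zeta i)).
    by rewrite res_pr yz; field; rewrite gt_eqF.
  rewrite normrM (ger0_norm n1).
  set A := pr (r i *m S) (r i)^T; set B := pr ((zeta i)^T *m W) (zeta i).
  have hCS : pr (r i) (zeta i) ^+ 2 <= A * B by exact: CS.
  have A0 : 0 <= A by exact: S_ge0.
  have B0 : 0 <= B by exact: W_ge0.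
  have q0 : 0 <= 2^-1 * (s^-1 * A) + 2^-1 * (s * B).
    by rewrite addr_ge0// !mulr_ge0 ?invr_ge0// ltW.
  have h1 : `|pr (r i) (zeta i)| <= 2^-1 * (s^-1 * A) + 2^-1 * (s * B).
    apply: ler_norm_sqr => //; apply: (le_trans hCS).
    have -> : (2^-1 * (s^-1 * A) + 2^-1 * (s * B)) ^+ 2 =
       A * B + (2^-1 * (s^-1 * A) - 2^-1 * (s * B)) ^+ 2 by field; rewrite gt_eqF.
    by rewrite lerDl sqr_ge0.
  have h2 := le_trans (ler_normB (pr (r i) (zeta i)) (pr (lam i) (zeta i)))
    (lerD h1 (lexx _)).
  have := ler_wpM2l n1 h2; rewrite (ger0_norm d0) => /le_trans; apply.
  by rewrite le_eqVlt; apply/orP; left; apply/eqP; ring.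
have b1 c : bdd (fun i => c * pr (r i *m S) (r i)^T).
  by apply: bddM; [exact: bdd_cst|exact: bdd_resS].
have b2 c : bdd (fun i => c * pr ((zeta i)^T *m W) (zeta i)).
  by apply: bddM; [exact: bdd_cst|exact: bzW].
have b3 c : bdd (fun i => c * pr (lam i) (zeta i)).
  by apply: bddM => //; exact: bdd_cst.
apply: (le_trans (ler_mean p0 pc _ (bddD (bddD (b1 _) (b2 _)) (b3 _)) H)).
  apply: bdd_norm; apply: bddD; last exact: bdd_cst.
  by apply: bddD; [exact: bzW|exact: bdd_cst].
rewrite (meanD p0 pc); [|exact: bddD|by []].
rewrite (meanD p0 pc)// !(meanZ p0 pc)//; [|exact: bdd_resS].
rewrite mean_qf_z// WS mxtrace1 mE.
have c0 : 0 <= n * (2^-1 * s^-1) by rewrite !mulr_ge0 ?invr_ge0// ltW.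
have := ler_wpM2l c0 Hr; have := ler_wpM2l n1 Hd.
rewrite /res_mean.
have -> : n * (2^-1 * s^-1) * s ^+ 2 = n * (s / 2) by field; rewrite gt_eqF.
have : n * s ^+ 2 <= n * s by rewrite ler_wpM2l// expr2 ler_piMl// ltW.
move=> h1 h2 h3; rewrite (le_trans (lerD (lerD h3 (lexx _)) h2))//.
by move: h1; clra.
Qed.

Hypothesis s1 : s <= 1.
Hypothesis s2 : n * s * (n + 4) / 2 <= 4^-1.
Hypothesis s3 : 16 * n ^+ 3 * s ^+ 2 <= 2^-1.

Let bw : bdd w. Proof. by apply: bddD; [exact: bzW|exact: bdd_cst]. Qed.
Let Ew : E (fun i => `|w i - n|) <= 4^-1 := le_trans (w_mean s1) s2.

Let y1_y_x : pr (y1 - y) x = 0. Proof. by rewrite prBl y1x yx subrr. Qed.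

(** On the z_i the functional y1 - y is at least - 1 and has mean 0, hence first absolute moment at
    most 2; [second_moment_le] then gives 8 n times 2^2. *)
Lemma base_functional_bound : pr ((y1 - y) *m S) (y1 - y)^T <= 32 * n.
Proof.
have -> : 32 * n = 8 * n * 2 ^+ 2 by ring.
apply: (second_moment_le p0 pc n0 (bpz (y1 - y)) bw (S_ge0 _)) => // [|i|].
- apply: (mean_abs_le p0 pc) => // [i|]; last by rewrite Ez.
  by rewrite prBl yz lerBDl addrN ltW// (cone_pos HC (Cz i)).
- have := CS (y1 - y) (zeta i - x); rewrite w_shift//.
  by rewrite [pr (y1 - y) (zeta i - x)]prBr y1_y_x subr0.
- by rewrite -mean_zz//; under eq_mean do rewrite -expr2.
Qed.

(** The function f = W(u - x, z) equals n (r - lam)(u - x). Here lam(u - x) is at least - 1 with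
    mean 0, and r(u - x) is small, so f has first moment at most n (2 + s sqrt M), where M is its
    second moment. [second_moment_le] yields M <= 64 n^3 + 16 n^3 s^2 M, and the smallness of s
    absorbs the last term. *)
Lemma section_bound u : C u -> pr y u = 1 ->
  pr ((u - x)^T *m W) (u - x) <= 128 * n ^+ 3.
Proof.
move=> Cu yu; set M := pr _ _.
have M0 : 0 <= M by exact: W_ge0.
have yc : pr y (u - x) = 0 by rewrite prBr yu yx subrr.
pose f i := pr ((u - x)^T *m W) (zeta i).
have cx : pr ((u - x)^T *m W) x = 0 by rewrite prM WxE prT yc.
have SM : pr (((u - x)^T *m W) *m S) ((u - x)^T *m W)^T = M.
  by rewrite trmx_mul trmxK Wsym -mulmxA WS mulmx1 /M prM.
have n1 : 0 <= n by exact: ltW.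
have q0 : 0 <= Num.sqrt M by exact: sqrtr_ge0.
have kap0 : 0 <= n * (2 + s * Num.sqrt M).
  by rewrite mulr_ge0// addr_ge0// mulr_ge0// ltW.
have Ef : E (fun i => `|f i|) <= n * (2 + s * Num.sqrt M).
  have H i : `|f i| <= n * `|pr (lam i) (u - x)| +
      n * (Num.sqrt M * 2^-1 * s^-1) * pr (r i *m S) (r i)^T
      + n * (Num.sqrt M * 2^-1 * s).
    set A := pr (r i *m S) (r i)^T.
    have -> : f i = n * (pr (r i) (u - x) - pr (lam i) (u - x)).
      rewrite res_pr yc /f (pr_sym _ _ Wsym); field; rewrite gt_eqF//.
    rewrite normrM (ger0_norm n1).
    have A0 : 0 <= A by exact: S_ge0.
    have hCS : pr (r i) (u - x) ^+ 2 <= A * M by exact: CS.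
    have h1 : `|pr (r i) (u - x)| <= Num.sqrt M * (2^-1 * (s^-1 * A) + 2^-1 * s).
      apply: ler_norm_sqr.
        by rewrite mulr_ge0// addr_ge0// !mulr_ge0 ?invr_ge0// ltW.
      apply: (le_trans hCS); rewrite exprMn sqr_sqrtr// mulrC ler_wpM2l//.
      have -> : (2^-1 * (s^-1 * A) + 2^-1 * s) ^+ 2 =
         A + (2^-1 * (s^-1 * A) - 2^-1 * s) ^+ 2 by field; rewrite gt_eqF.
      by rewrite lerDl sqr_ge0.
    have h2 := le_trans (ler_normB (pr (r i) (u - x)) (pr (lam i) (u - x)))
      (lerD h1 (lexx _)).
    have := ler_wpM2l n1 h2 => /le_trans; apply.
    by rewrite le_eqVlt; apply/orP; left; apply/eqP; ring.
  have ba := bdd_norm (bpl (u - x)).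
  have b1 : bdd (fun i => n * `|pr (lam i) (u - x)|) by apply: bddM => //; exact: bdd_cst.
  have b2 : bdd (fun i => n * (Num.sqrt M * 2^-1 * s^-1) * pr (r i *m S) (r i)^T).
    by apply: bddM; [exact: bdd_cst|exact: bdd_resS].
  apply: (le_trans (ler_mean p0 pc (bdd_norm (bpz _)) (bddD (bddD b1 b2) (bdd_cst _)) H)).
  rewrite (meanD p0 pc); [|exact: bddD|exact: bdd_cst].
  rewrite (meanD p0 pc)// (mean_cst p0 pc) !(meanZ p0 pc)//; [|exact: bdd_resS].
  have e1 : E (fun i => `|pr (lam i) (u - x)|) <= 2.
    apply: (mean_abs_le p0 pc) => // [i|]; last by rewrite El.
    by rewrite prBr lx lerBDl addrN ltW// (lam_pos HC Hg).
  have c0 : 0 <= n * (Num.sqrt M * 2^-1 * s^-1).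
    by rewrite !mulr_ge0 ?invr_ge0// ltW.
  have := ler_wpM2l c0 Hr; have := ler_wpM2l n1 e1; rewrite /res_mean.
  have -> : n * (Num.sqrt M * 2^-1 * s^-1) * s ^+ 2 = n * (Num.sqrt M * 2^-1 * s).
    by field; rewrite gt_eqF.
  by clra.
have := second_moment_le p0 pc n0 (bpz ((u - x)^T *m W)) bw M0 kap0 Ef.
have H2 i : f i ^+ 2 <= M * w i.
  have := CS ((u - x)^T *m W) (zeta i - x); rewrite SM w_shift//.
  by rewrite [pr ((u - x)^T *m W) (zeta i - x)]prBr cx subr0.
have H3 : M <= E (fun i => f i ^+ 2).
  by rewrite -SM -mean_zz//; under [leRHS]eq_mean do rewrite expr2.
move=> /(_ H2 H3 Ew) h.
have h4 : (2 + s * Num.sqrt M) ^+ 2 <= 2 * (4 + s ^+ 2 * M).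
  have := sqr_ge0 (2 - s * Num.sqrt M).
  have -> : s ^+ 2 * M = (s * Num.sqrt M) ^+ 2 by rewrite exprMn sqr_sqrtr.
  by clra.
have n3 : 0 <= 8 * n ^+ 3 by rewrite mulr_ge0// exprn_ge0.
have := ler_wpM2l n3 h4; have := ler_wpM2r M0 s3.
have E8 : 8 * n * (n * (2 + s * Num.sqrt M)) ^+ 2 =
   8 * n ^+ 3 * (2 + s * Num.sqrt M) ^+ 2 by ring.
by rewrite E8 in h; move: h; clra.
Qed.

Lemma section_W_bound u : C u -> pr (u^T *m W) u <= (128 * n ^+ 3 + 1) * pr y u ^+ 2.
Proof.
move=> Cu; have yu := dual_pos_gt0 HC posy Cu.
pose u' := (pr y u)^-1 *: u.
have yu' : pr y u' = 1 by rewrite prZr mulVf// gt_eqF.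
have Cu' : C u' by apply: (cone_scale HC) => //; rewrite invr_gt0.
have := section_bound Cu' yu'; rewrite w_shift// lerBlDr.
have -> : pr (u'^T *m W) u' = (pr y u)^-1 ^+ 2 * pr (u^T *m W) u.
  by rewrite linearZ/= -scalemxAl prZl prZr; ring.
by rewrite exprVn ler_pdivrMl ?exprn_gt0// mulrC.
Qed.

(** Duality of the norms S and W combines the two previous bounds: 64 n^2 is the root of 32 n times
    128 n^3. *)
Lemma section_lower u : C u -> pr y1 u <= (1 + 64 * n ^+ 2) * pr y u.
Proof.
move=> Cu; have yu := dual_pos_gt0 HC posy Cu.
pose u' := (pr y u)^-1 *: u.
have yu' : pr y u' = 1 by rewrite prZr mulVf// gt_eqF.
have Cu' : C u' by apply: (cone_scale HC) => //; rewrite invr_gt0.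
have h := CS (y1 - y) (u' - x).
have a0 := S_ge0 (y1 - y); have m0 := W_ge0 (u' - x).
have n1 : 0 <= n by exact: ltW.
have h2 : pr (y1 - y) (u' - x) ^+ 2 <= (64 * n ^+ 2) ^+ 2.
  apply: (le_trans h).
  have := ler_pM a0 m0 base_functional_bound (section_bound Cu' yu') => /le_trans; apply.
  by rewrite le_eqVlt; apply/orP; left; apply/eqP; ring.
have h3 : 0 <= 64 * n ^+ 2 by rewrite mulr_ge0// exprn_ge0.
have := ler_norm_sqr h3 h2 => /(le_trans (ler_norm _)).
rewrite [pr (y1 - y) (u' - x)]prBr y1_y_x subr0 prBl yu' prZr lerBlDr.
by rewrite ler_pdivrMl// [in leRHS]mulrC [64 * _ + 1]addrC.
Qed.

End small_residual.

(** * The limiting quadratic form *)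

Lemma sqrD_le2 {R : realDomainType} (a b : R) :
  (a + b) ^+ 2 <= 2 * a ^+ 2 + 2 * b ^+ 2.
Proof. by have := sqr_ge0 (a - b); lra. Qed.

Lemma weighted_sqrB_le {R : realDomainType} (n P Q d e a b : R) :
  d ^+ 2 <= P -> e ^+ 2 <= Q ->
  (n * d * a - n * e * b) ^+ 2 <= 2 * (n ^+ 2 * P) * a ^+ 2 + 2 * (n ^+ 2 * Q) * b ^+ 2.
Proof.
move=> h1 h2.
have k1 : 0 <= n ^+ 2 * a ^+ 2 by rewrite mulr_ge0 ?sqr_ge0.
have k2 : 0 <= n ^+ 2 * b ^+ 2 by rewrite mulr_ge0 ?sqr_ge0.
have := ler_wpM2r k1 h1; have := ler_wpM2r k2 h2.
have := sqr_ge0 (n * d * a + n * e * b); lra.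
Qed.

(** * Almost invariance of the polar form *)

Section conformal.
Context {R : realType} (p : nat -> R) {m : nat}.
Hypothesis p_gt0 : forall i, 0 < p i.
Hypothesis p_cvg : cvgn (series p).
Notation E := (mean p).
Variables (z : nat -> 'cV[R]_m) (l : nat -> 'rV[R]_m) (x : 'cV[R]_m)
  (y : 'rV[R]_m) (W : 'M[R]_m) (n : R).
Hypotheses (bz : bddc z) (bl : bddr l).
Hypothesis yz : forall i, pr y (z i) = 1.
Hypothesis Ez : forall w, E (fun i => pr w (z i)) = pr w x.
Local Notation S := (Mzz p z).
Hypothesis SW : S *m W = 1%:M.
Hypothesis CS : forall w u, pr w u ^+ 2 <= pr (w *m S) w^T * pr (u^T *m W) u.
Hypothesis n0 : 0 < n.
Notation r := (residual z l y W n^-1).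

Let WS : W *m S = 1%:M. Proof. exact: mulmx1C. Qed.
Let Wsym : W^T = W := W_sym SW.
Let xWE : x^T *m W = y := xW p_gt0 p_cvg bz yz Ez SW.
Let WxE : W *m x = y^T := Wx p_gt0 p_cvg bz yz Ez SW.
Let yx : pr y x = 1 := yx1 p_gt0 p_cvg yz Ez.

Definition polar : 'M[R]_m := (n + 1) *: (y^T *m y) - W.
Notation q := polar.

Lemma polar_sym : q^T = q.
Proof. by rewrite /polar linearB linearZ/= trmx_mul trmxK Wsym. Qed.

Lemma polarE u v : pr (u^T *m q) v = (n + 1) * (pr y u * pr y v) - pr (u^T *m W) v.
Proof.
rewrite /polar mulmxBr prBl -scalemxAr prZl; congr (_ * _ - _).
by rewrite -(prT y u) /pr mulmxA -(mulmxA (u^T *m y^T)) mxE big_ord1.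
Qed.

Lemma polar_x u : pr (u^T *m q) x = n * pr y u.
Proof. by rewrite polarE yx [pr _ x]prM WxE prT; ring. Qed.

Lemma lE i u : pr (l i) u = pr (r i) u + n^-1 * pr ((z i)^T *m q) u.
Proof.
rewrite /residual polarE yz prBl prDl !prZl; field; by rewrite gt_eqF.
Qed.

Variables (s A : R) (G : 'M[R]_m) (sg : nat -> nat) (c1 c2 : nat -> R).
Hypothesis s0 : 0 < s.
Hypothesis s1 : s <= 1.
Hypothesis Hr : E (fun i => pr (r i *m S) (r i)^T) <= s ^+ 2.
Hypothesis A1 : 1 <= A.
Hypothesis zA : forall i, `|z i| <= A.
Hypothesis xA : `|x| <= A.
Hypothesis qA : `|q| <= A.
Hypothesis WA : `|W| <= A.
Hypothesis GA : `|G| <= A.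
Hypothesis sg_inj : injective sg.
Hypothesis p_sg : forall i, p i <= A * p (sg i).
Hypothesis c1A : forall i, A^-1 <= c1 i <= A.
Hypothesis c2A : forall i, A^-1 <= c2 i <= A.
Hypothesis Gz : forall i, G *m z i = c2 i *: z (sg i).
Hypothesis lG : forall i, c1 i *: (l (sg i) *m G) = l i.

Notation c := (fun i => c2 i / c1 i).
Notation B := (G^T *m q *m G).

Let A0 : 0 < A. Proof. exact: lt_le_trans A1. Qed.
Let Ai0 : 0 < A^-1. Proof. by rewrite invr_gt0. Qed.
Let c10 i : 0 < c1 i. Proof. by have /andP[+ _] := c1A i; apply: lt_le_trans. Qed.
Let c20 i : 0 < c2 i. Proof. by have /andP[+ _] := c2A i; apply: lt_le_trans. Qed.

Lemma factor_bound i : (A ^+ 2)^-1 <= c i <= A ^+ 2.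
Proof.
have /andP[h1 h2] := c1A i; have /andP[h3 h4] := c2A i.
have e1 : (c1 i)^-1 <= A by rewrite -[A]invrK lef_pV2 ?posrE.
have e2 : A^-1 <= (c1 i)^-1 by rewrite lef_pV2 ?posrE.
rewrite -exprVn !expr2 !ler_pM// ?invr_ge0; exact: ltW.
Qed.

Let bc : bdd c.
Proof.
exists (A ^+ 2) => i; have /andP[h1 h2] := factor_bound i.
by rewrite ger0_norm// divr_ge0// ltW.
Qed.

(** How far the pulled-back form [B] is, at z i, from the multiple c i of q. The ratio c i depends
    on i and is compared with its mean later. *)
Definition defect i : 'rV[R]_m := (z i)^T *m B - c i *: ((z i)^T *m q).
Notation f := defect.

(** The functionals l and the points z transform exactly under G; only their polarity through q is
    approximate, so the defect consists of two residuals. *)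
Lemma defectE i u : pr (f i) u = n * c i * pr (r i) u - n * c2 i * pr (r (sg i)) (G *m u).
Proof.
have h1 := lE i u; have h2 := lE (sg i) (G *m u).
have h3 : c1 i * pr (l (sg i)) (G *m u) = pr (l i) u.
  by rewrite -(lG i) prZl prM.
have h4 : pr ((z i)^T *m B) u = c2 i * pr ((z (sg i))^T *m q) (G *m u).
  have -> : (z i)^T *m B = c2 i *: ((z (sg i))^T *m q *m G).
    by rewrite !mulmxA -trmx_mul Gz linearZ/= -!scalemxAl.
  by rewrite prZl prM.
rewrite /defect prBl prZl h4.
have -> : pr (r i) u = c1 i * (pr (r (sg i)) (G *m u) +
    n^-1 * pr ((z (sg i))^T *m q) (G *m u)) - n^-1 * pr ((z i)^T *m q) u.
  by rewrite -h2 h3 h1; ring.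
by field; rewrite !gt_eqF.
Qed.

Let br : bddr r. Proof. exact: bdd_residual. Qed.
Let brS : bdd (fun i => pr (r i *m S) (r i)^T).
Proof.
apply: bdd_pr => a.
  have [M HM] := bdd_sum (index_enum 'I_m) (fun b => bddM (br b) (bdd_cst (S b a))).
  by exists M => i; rewrite mxE.
by have [M HM] := br a; exists M => i; rewrite mxE.
Qed.
Let bpr (h : nat -> 'rV[R]_m) u : bddr h -> bdd (fun i => pr (h i) u).
Proof. by move=> bh; exact: bdd_pr bh (bddc_cst u). Qed.

Lemma qf_norm (D : 'M[R]_m) u v : `|pr (u^T *m D) v| <= m%:R ^+ 2 * (`|D| * `|u| * `|v|).
Proof.
rewrite (le_trans (pr_norm _ _))// expr2 -mulrA ler_wpM2l// mulrA mulrA.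
rewrite ler_wpM2r// (le_trans (mx_norm_mul _ _))// mx_norm_tr -mulrA.
by rewrite [`|u| * _]mulrC.
Qed.

Lemma res_sqr u : E (fun i => pr (r i) u ^+ 2) <= s ^+ 2 * (m%:R ^+ 2 * A * `|u| ^+ 2).
Proof.
have u0 : 0 <= m%:R ^+ 2 * A * `|u| ^+ 2.
  by rewrite !mulr_ge0// ?exprn_ge0// ltW.
have H i : pr (r i) u ^+ 2 <= (m%:R ^+ 2 * A * `|u| ^+ 2) * pr (r i *m S) (r i)^T.
  rewrite (le_trans (CS _ _))// mulrC ler_wpM2r//.
    rewrite -mean_zz//; apply: (mean_ge0 p_gt0 p_cvg) => [|j].
      by apply: bddM; exact: bdd_pr (bddr_cst _) bz.
    by rewrite -expr2 sqr_ge0.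
  rewrite (le_trans (ler_norm _))// (le_trans (qf_norm _ _ _))//.
  rewrite -[leRHS]mulrA ler_wpM2l ?exprn_ge0// -mulrA -expr2.
  by rewrite ler_wpM2r// exprn_ge0.
apply: (le_trans (ler_mean p_gt0 p_cvg _ _ H)).
- by apply: bddX; exact: bpr.
- by apply: bddM => //; exact: bdd_cst.
- by rewrite (meanZ p_gt0 p_cvg)// mulrC ler_wpM2r.
Qed.

Let bc2 : bdd c2.
Proof.
by exists A => i; have /andP[_ h] := c2A i; rewrite ger0_norm// ltW.
Qed.

Let bsg (h : nat -> R) : bdd h -> bdd (fun i => h (sg i)).
Proof. by move=> [M HM]; exists M => i. Qed.

Let bfu u : bdd (fun i => pr (f i) u).
Proof.
have bd v : bdd (fun i => pr (r i) v) by exact: bpr.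
have [M HM] := bddD (bddM (bddM (bdd_cst n) bc) (bd u))
  (bddN (bddM (bddM (bdd_cst n) bc2) (bsg (bd (G *m u))))).
by exists M => i; rewrite defectE.
Qed.

Definition defect_const : R := 2 * (n ^+ 2 * A ^+ 4 * (m%:R ^+ 2 * A)) +
  2 * (n ^+ 2 * A ^+ 2 * (A * (m%:R ^+ 2 * A * (m%:R * A) ^+ 2))).
Notation D1 := defect_const.

Lemma defect_const_ge0 : 0 <= D1.
Proof. by rewrite addr_ge0// !mulr_ge0 ?exprn_ge0 ?mulr_ge0// ltW. Qed.

Lemma defect_sqr u : E (fun i => pr (f i) u ^+ 2) <= s ^+ 2 * (D1 * `|u| ^+ 2).
Proof.
have bd v : bdd (fun i => pr (r i) v) by exact: bpr.
have H i : pr (f i) u ^+ 2 <= 2 * (n ^+ 2 * A ^+ 4) * pr (r i) u ^+ 2 +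
    2 * (n ^+ 2 * A ^+ 2) * pr (r (sg i)) (G *m u) ^+ 2.
  rewrite defectE; apply: weighted_sqrB_le.
    have /andP[_ h] := factor_bound i.
    have -> : A ^+ 4 = (A ^+ 2) ^+ 2 by rewrite -exprM.
    by rewrite lerXn2r ?nnegrE ?divr_ge0 ?exprn_ge0// ltW.
  have /andP[_ h] := c2A i.
  by rewrite lerXn2r ?nnegrE//; exact: ltW.
apply: (le_trans (ler_mean p_gt0 p_cvg _ _ H)).
- by apply: bddX.
- apply: bddD; apply: bddM; try exact: bdd_cst; apply: bddX => //.
  exact: (bsg (bd _)).
have b2 v : bdd (fun i => pr (r i) v ^+ 2) by apply: bddX.
rewrite (meanD p_gt0 p_cvg); [|by apply: bddM => //; exact: bdd_cst|
  by apply: bddM; [exact: bdd_cst|exact: (bsg (b2 _))]].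
rewrite !(meanZ p_gt0 p_cvg)//; last exact: (bsg (b2 _)).
have n2 : 0 <= n ^+ 2 by rewrite exprn_ge0// ltW.
have q1 : 0 <= 2 * (n ^+ 2 * A ^+ 4).
  by rewrite mulr_ge0// mulr_ge0// exprn_ge0// ltW.
have q2 : 0 <= 2 * (n ^+ 2 * A ^+ 2).
  by rewrite mulr_ge0// mulr_ge0// exprn_ge0// ltW.
have h1 := ler_wpM2l q1 (res_sqr u).
have h2 : E (fun i => pr (r (sg i)) (G *m u) ^+ 2) <=
    A * (s ^+ 2 * (m%:R ^+ 2 * A * ((m%:R * A) ^+ 2 * `|u| ^+ 2))).
  apply: (le_trans (mean_shift p_gt0 p_cvg sg_inj p_sg (b2 (G *m u)) _)) => [i|].
    exact: sqr_ge0.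
  have A0' := ltW A0.
  rewrite ler_wpM2l// (le_trans (res_sqr _))// ler_wpM2l ?sqr_ge0//.
  rewrite ler_wpM2l ?mulr_ge0 ?exprn_ge0// -exprMn.
  rewrite lerXn2r ?nnegrE ?mulr_ge0// (le_trans (mx_norm_mul _ _))//.
  by rewrite -mulrA ler_wpM2l// ler_wpM2r.
have := lerD h1 (ler_wpM2l q2 h2) => /le_trans; apply.
rewrite /D1 le_eqVlt; apply/orP; left; apply/eqP; ring.
Qed.

Let M : 'cV[R]_m := \col_a E (fun i => c i * z i a 0).

Let bpz w : bdd (fun i => pr w (z i)) := bdd_pr (bddr_cst w) bz.

Lemma pr_factor_mean w : pr w M = E (fun i => c i * pr w (z i)).
Proof.
rewrite prE; under eq_bigr do rewrite mxE -(meanZ p_gt0 p_cvg _ (bddM bc (bz _))).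
rewrite -(mean_sum p_gt0 p_cvg); last first.
  by move=> a; apply: bddM; [exact: bdd_cst|exact: bddM].
apply: eq_mean => i; rewrite prE mulr_sumr; apply: eq_bigr => a _; ring.
Qed.

Notation cb := (E c).

Lemma factor_mean_bound : (A ^+ 2)^-1 <= cb <= A ^+ 2.
Proof.
apply/andP; split.
  rewrite -[leLHS](mean_cst p_gt0 p_cvg); apply: ler_mean => //.
    exact: bdd_cst.
  by move=> i; have /andP[] := factor_bound i.
rewrite -[leRHS](mean_cst p_gt0 p_cvg); apply: ler_mean => //.
  exact: bdd_cst.
by move=> i; have /andP[] := factor_bound i.
Qed.

Let MA : `|M| <= A ^+ 3.
Proof.
apply: mx_norm_le => [|a b]; first by rewrite exprn_ge0// ltW.
have bcz := bddM bc (bz a).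
rewrite mxE (le_trans (ler_norm_mean p_gt0 p_cvg bcz))//.
rewrite -[leRHS](mean_cst p_gt0 p_cvg); apply: ler_mean => //.
- exact: bdd_norm.
- exact: bdd_cst.
move=> i; have /andP[h1 h2] := factor_bound i.
rewrite normrM [A ^+ 3]exprSr; apply: ler_pM => //.
  by rewrite ger0_norm// divr_ge0// ltW.
by rewrite (le_trans _ (zA i))// mx_norm_coord.
Qed.

Lemma defect_mean u (h : nat -> R) H : bdd h -> 0 <= H -> (forall i, `|h i| <= H) ->
  E (fun i => h i * pr (f i) u) ^+ 2 <= H ^+ 2 * (s ^+ 2 * (D1 * `|u| ^+ 2)).
Proof.
move=> bh H0 hH; apply: (le_trans (mean_CS p_gt0 p_cvg bh (bfu u))).
apply: ler_pM.
- by apply: (mean_ge0 p_gt0 p_cvg) => [|i]; [exact: bddX|exact: sqr_ge0].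
- by apply: (mean_ge0 p_gt0 p_cvg) => [|i]; [exact: bddX|exact: sqr_ge0].
- rewrite -[leRHS](mean_cst p_gt0 p_cvg); apply: ler_mean => //; [exact: bddX|exact: bdd_cst|].
  by move=> i; rewrite -real_normK ?num_real// lerXn2r ?nnegrE.
- exact: defect_sqr.
Qed.

(** Let M be the mean of c z. Averaging the definition of the defect gives B(x, .) = q(M, .) + E f.
    Pairing with c z and averaging again gives n E c^2 = q(M, M) up to small terms. Since y(M) is
    the mean [cb] of c, Cauchy-Schwarz yields W(M, M) >= cb^2 and thus q(M, M) <= n cb^2, which
    bounds the variance. *)
Lemma factor_variance : E (fun i => (c i - cb) ^+ 2) <= n^-1 * (2 * (D1 + 1) * A ^+ 3) * s.
Proof.
have bcz : bdd (fun i => c i * pr (f i) x) by exact: bddM.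
have bM : bdd (fun i => pr (f i) M) by [].
have Bsym : B^T = B by rewrite !trmx_mul trmxK polar_sym mulmxA.
have avg u : pr (x^T *m B) u = pr (M^T *m q) u + E (fun i => pr (f i) u).
  have -> : pr (x^T *m B) u = E (fun i => pr ((z i)^T *m B) u).
    by rewrite pr_sym// -Ez; apply: eq_mean => i; exact: pr_sym.
  have -> : pr (M^T *m q) u = E (fun i => c i * pr ((z i)^T *m q) u).
    rewrite pr_sym ?polar_sym// pr_factor_mean.
    by apply: eq_mean => i; congr (_ * _); apply: pr_sym; rewrite polar_sym.
  rewrite -(meanD p_gt0 p_cvg)//; last first.
    by apply: bddM => //; apply: bdd_pr (bddc_cst u) => a;
     have [M' HM] := bdd_sum (index_enum 'I_m) (fun b => bddM (bz b) (bdd_cst (q b a)));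
     exists M' => i; rewrite mxE; under eq_bigr do rewrite mxE.
  by apply: eq_mean => i; rewrite /defect prBl prZl; ring.
have H j : c j * (n * c j) + c j * pr (f j) x = c j * pr (x^T *m B) (z j).
  have -> : pr (x^T *m B) (z j) = pr ((z j)^T *m B) x by exact: pr_sym.
  rewrite /defect [pr (_ - _) x]prBl prZl polar_x yz; ring.
have bxB : bdd (fun j => pr (x^T *m B) (z j)) by [].
have key : n * E (fun i => c i ^+ 2) + E (fun i => c i * pr (f i) x) =
   pr (M^T *m q) M + E (fun i => pr (f i) M).
  rewrite -avg pr_factor_mean -(meanZ p_gt0 p_cvg); last exact: bddX.
  rewrite -(meanD p_gt0 p_cvg)//; last by apply: bddM; [exact: bdd_cst|exact: bddX].
  by apply: eq_mean => j; rewrite -H; ring.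
have yM : pr y M = cb.
  by rewrite pr_factor_mean; apply: eq_mean => i; rewrite yz mulr1.
have qM : pr (M^T *m q) M <= n * cb ^+ 2.
  rewrite polarE yM; have := CS y M; rewrite yM.
  have -> : pr (y *m S) y^T = 1.
    by rewrite prM (Sy p_gt0 p_cvg bz yz Ez).
  have -> : (n + 1) * (cb * cb) = n * cb ^+ 2 + cb ^+ 2 by ring.
  by rewrite mul1r lerBlDr lerD2l.
have D0 := defect_const_ge0.
have D1s : D1 <= (D1 + 1) ^+ 2.
  have -> : (D1 + 1) ^+ 2 = D1 + (D1 ^+ 2 + D1 + 1) by ring.
  by rewrite lerDl; exact: addr_ge0 (addr_ge0 (sqr_ge0 _) D0) ler01.
have D2 : 0 <= D1 + 1 by exact: addr_ge0 D0 ler01.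
have A0' := ltW A0; have s0' := ltW s0.
have fM : `|E (fun i => pr (f i) M)| <= (D1 + 1) * A ^+ 3 * s.
  apply: ler_norm_sqr; first by rewrite mulr_ge0// mulr_ge0// exprn_ge0.
  have := @defect_mean M (fun=> 1) 1 (bdd_cst 1) ler01.
  under eq_mean do rewrite mul1r; rewrite normr1 expr1n mul1r => /(_ (fun=> lexx _)).
  move=> /le_trans; apply; rewrite mulrC exprMn ler_wpM2r ?sqr_ge0//.
  rewrite exprMn; apply: ler_pM => //.
  by rewrite lerXn2r ?nnegrE ?exprn_ge0// ltW.
have fx : `|E (fun i => c i * pr (f i) x)| <= (D1 + 1) * A ^+ 3 * s.
  apply: ler_norm_sqr; first by rewrite mulr_ge0// mulr_ge0// exprn_ge0.
  have := @defect_mean x c (A ^+ 2) bc (exprn_ge0 _ (ltW A0)).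
  move=> /(_ _)/le_trans; apply => [i|].
    have /andP[h1 h2] := factor_bound i.
    by rewrite ger0_norm// divr_ge0// ltW.
  have -> : (A ^+ 2) ^+ 2 * (s ^+ 2 * (D1 * `|x| ^+ 2)) =
    s ^+ 2 * (D1 * (A ^+ 4 * `|x| ^+ 2)) by ring.
  have -> : ((D1 + 1) * A ^+ 3 * s) ^+ 2 = s ^+ 2 * ((D1 + 1) ^+ 2 * (A ^+ 4 * A ^+ 2)).
    by ring.
  rewrite ler_wpM2l ?sqr_ge0//; apply: ler_pM => //.
    by rewrite mulr_ge0 ?sqr_ge0// exprn_ge0.
  rewrite ler_wpM2l ?exprn_ge0//.
  by rewrite lerXn2r ?nnegrE.
have var : E (fun i => (c i - cb) ^+ 2) = E (fun i => c i ^+ 2) - cb ^+ 2.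
  transitivity (E (fun i => c i ^+ 2 - 2 * cb * c i + cb ^+ 2)).
    by apply: eq_mean => i; ring.
  have b2 : bdd (fun i => c i ^+ 2) by exact: bddX.
  have b3 : bdd (fun i => 2 * cb * c i) by apply: bddM => //; exact: bdd_cst.
  rewrite (meanD p_gt0 p_cvg); [|by apply: bddD => //; exact: bddN|exact: bdd_cst].
  rewrite (meanB p_gt0 p_cvg)// (mean_cst p_gt0 p_cvg) (meanZ p_gt0 p_cvg)//.
  ring.
rewrite var -mulrA ler_pdivlMl// mulrBr.
have h1 := le_trans (ler_norm _) fM.
have h2 : - E (fun i => c i * pr (f i) x) <= (D1 + 1) * A ^+ 3 * s.
  by apply: le_trans fx; rewrite -normrN ler_norm.
move: h1 h2 key qM; set e1 := E _; set e2 := E _; set e3 := mean _ _.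
set e4 := n * cb ^+ 2; set e5 := pr _ M; set e6 := (D1 + 1) * A ^+ 3 * s => h1 h2 h3 h4.
have -> : 2 * (D1 + 1) * A ^+ 3 * s = e6 + e6 by rewrite /e6; ring.
have -> : n * e3 - e4 = e5 + e1 - e2 - e4 by rewrite -h3; ring.
have := lerD (lerD h4 (lexx (- e4))) (lerD h1 h2); rewrite subrr add0r.
by move=> h5; rewrite (_ : e5 + e1 - e2 - e4 = e5 - e4 + (e1 - e2))//; ring.
Qed.

Definition conformal_const : R := 2 * ((m%:R * A) ^+ 2 * defect_const) +
  2 * (n^-1 * (2 * (defect_const + 1) * A ^+ 3) * ((m%:R * A) * (m%:R ^+ 2 * A ^+ 2)) ^+ 2).

(** Pairing with w S is averaging against w(z): the left side is the mean of w(z) f(u) plus that of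
    (c - cb) w(z) q(z, u), the first small by [defect_mean], the second by [factor_variance]. *)
Lemma conformal_approx w u : pr (w *m S) ((B - cb *: q) *m u) ^+ 2 <=
  conformal_const * s * (`|w| * `|u|) ^+ 2.
Proof.
have A0' := ltW A0; have s0' := ltW s0; have D0 := defect_const_ge0.
have Bsym : B^T = B by rewrite !trmx_mul trmxK polar_sym mulmxA.
have NT : (B - cb *: q)^T = B - cb *: q.
  by rewrite linearB [X in _ - X]linearZ/= polar_sym; congr (_ - _).
have NE : (B - cb *: q) *m u = (u^T *m (B - cb *: q))^T.
  by rewrite trmx_mul trmxK NT.
rewrite NE -mean_zz//.
pose h1 i := pr w (z i) * pr (f i) u.
pose h2 i := (c i - cb) * (pr w (z i) * pr ((z i)^T *m q) u).
have zq : bdd (fun i => pr ((z i)^T *m q) u).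
  have [M' HM] := bpz (u^T *m q); exists M' => i.
  by rewrite pr_sym ?polar_sym.
have bccb : bdd (fun i => c i - cb) by apply: bddD => //; exact: bdd_cst.
have b1 : bdd h1 by apply: bddM.
have b2 : bdd h2 by apply: bddM => //; apply: bddM.
have -> : E (fun i => pr w (z i) * pr (u^T *m (B - cb *: q)) (z i)) = E h1 + E h2.
  rewrite -(meanD p_gt0 p_cvg)//; apply: eq_mean => i.
  rewrite /h1 /h2 /defect mulmxBr -scalemxAr !prBl !prZl.
  rewrite (pr_sym u (z i) Bsym) (pr_sym u (z i) polar_sym); ring.
have hw i : `|pr w (z i)| <= m%:R * A * `|w|.
  rewrite (le_trans (pr_norm _ _))// -mulrA ler_wpM2l// mulrC ler_wpM2r//.
have hq i : `|pr ((z i)^T *m q) u| <= m%:R ^+ 2 * A ^+ 2 * `|u|.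
  rewrite (le_trans (qf_norm _ _ _))// -[leRHS]mulrA ler_wpM2l ?exprn_ge0//.
  by rewrite ler_wpM2r// expr2 ler_pM.
have e1 : E h1 ^+ 2 <= (m%:R * A * `|w|) ^+ 2 * (s ^+ 2 * (defect_const * `|u| ^+ 2)).
  by apply: defect_mean => //; rewrite !mulr_ge0.
have e2 : E h2 ^+ 2 <= n^-1 * (2 * (defect_const + 1) * A ^+ 3) * s *
    ((m%:R * A * `|w|) * (m%:R ^+ 2 * A ^+ 2 * `|u|)) ^+ 2.
  apply: (le_trans (mean_CS p_gt0 p_cvg bccb (bddM (bpz w) zq))).
  apply: ler_pM.
  - by apply: (mean_ge0 p_gt0 p_cvg) => [|i]; [exact: bddX|exact: sqr_ge0].
  - apply: (mean_ge0 p_gt0 p_cvg) => [|i]; last exact: sqr_ge0.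
    by apply: bddX; apply: bddM.
  - exact: factor_variance.
  - rewrite -[leRHS](mean_cst p_gt0 p_cvg); apply: ler_mean => //.
    + by apply: bddX; apply: bddM.
    + exact: bdd_cst.
    + move=> i; rewrite -real_normK ?num_real// lerXn2r ?nnegrE//.
        by rewrite !mulr_ge0 ?exprn_ge0.
      by rewrite normrM ler_pM.
have e3 : (E h1 + E h2) ^+ 2 <= 2 * E h1 ^+ 2 + 2 * E h2 ^+ 2.
  exact: sqrD_le2.
apply: (le_trans e3).
have ss : s ^+ 2 <= s by rewrite expr2 ler_piMl.
have e4 : (m%:R * A * `|w|) ^+ 2 * (s ^+ 2 * (defect_const * `|u| ^+ 2)) <=
   (m%:R * A * `|w|) ^+ 2 * (s * (defect_const * `|u| ^+ 2)).
  rewrite ler_wpM2l ?sqr_ge0// ler_wpM2r//.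
  by rewrite mulr_ge0 ?sqr_ge0.
have {}e1 := le_trans e1 e4.
have l2 : 0 <= 2 :> R by [].
have := lerD (ler_wpM2l l2 e1) (ler_wpM2l l2 e2) => /le_trans; apply.
by rewrite /conformal_const le_eqVlt; apply/orP; left; apply/eqP; ring.
Qed.

End conformal.

Lemma dual_norm_bound {R : realType} {m : nat} (C : set 'cV[R]_m) y1 x1 :
  based_cone C y1 x1 -> exists2 r, 0 < r & forall y : 'rV[R]_m,
    (forall u, C u -> 0 <= pr y u) -> r * `|y| <= pr y x1.
Proof.
move=> HC; have [r r0 Hr] := cone_open HC (cone_base HC).
exists r => // y yC; rewrite -ler_pdivlMl//; apply: mx_norm_le => [|a b].
  by rewrite mulr_ge0 ?invr_ge0 ?(ltW r0)// yC//; exact: cone_base HC.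
rewrite ord1 ler_pdivlMl//.
pose e : 'cV[R]_m := delta_mx b 0.
have ye : pr y e = y 0 b.
  rewrite prE (bigD1 b)//= mxE !eqxx mulr1 big1 ?addr0// => c cb.
  by rewrite mxE (negbTE cb) mulr0.
have en : `|e| <= 1.
  by apply: mx_norm_le => // p q; rewrite mxE; case: (_ && _); rewrite ?normr1 ?normr0.
have Ce s : `|s| = 1 -> C (x1 + (s * r) *: e).
  by move=> s1; apply: Hr; rewrite normrZ normrM s1 mul1r gtr0_norm// ler_piMr// ltW.
have := yC _ (Ce 1 (normr1 _)); have := yC _ (Ce (-1) (normrN1 _)).
rewrite !prDr !prZr ye mul1r mulN1r mulNr => h1 h2.
have [h|h] := leP 0 (y 0 b).
  by rewrite ger0_norm// -subr_ge0.
by rewrite ltr0_norm// mulrN -subr_ge0 opprK.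
Qed.

Lemma delta_norm {R : realType} {m n : nat} (a : 'I_m) (b : 'I_n) :
  `|delta_mx a b : 'M[R]_(m, n)| <= 1.
Proof.
by apply: mx_norm_le => // p q; rewrite mxE; case: (_ && _); rewrite ?normr1 ?normr0.
Qed.

Lemma pr_delta {R : realType} {m : nat} (W : 'M[R]_m) a b :
  pr (delta_mx 0 a) (W *m delta_mx b 0) = W a b.
Proof. by rewrite -prM /pr -rowE -colE !mxE. Qed.

(** The values at x1 + r e and x1 - r e add up to 2 W(x1, x1) + 2 r^2 W(e, e), which bounds the
    diagonal entries; positivity bounds the others by them. *)
Lemma psd_norm_bound {R : realType} {m : nat} (C : set 'cV[R]_m) y1 x1 :
  based_cone C y1 x1 -> exists2 b, 0 < b & forall (W : 'M[R]_m) M,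
    W^T = W -> (forall u, 0 <= pr (u^T *m W) u) ->
    (forall u, C u -> pr (u^T *m W) u <= M * pr y1 u ^+ 2) -> `|W| <= b * M.
Proof.
move=> HC; have [r r0 Hr] := cone_open HC (cone_base HC).
pose Y := m%:R * (`|y1| * (`|x1| + r)).
have Y0 : 0 <= Y by rewrite !mulr_ge0// addr_ge0// ltW.
exists (2 * (Y + 1) ^+ 2 / r ^+ 2).
  by rewrite divr_gt0 ?mulr_gt0 ?exprn_gt0// ltr_wpDl.
move=> W M Wsym W0 HW.
have M0 : 0 <= M.
  have := le_trans (W0 x1) (HW _ (cone_base HC)).
  by rewrite (cone_base1 HC) expr1n mulr1.
have qe (u v : 'cV[R]_m) : pr ((u + v)^T *m W) (u + v) =
    pr (u^T *m W) u + 2 * pr (u^T *m W) v + pr (v^T *m W) v.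
  rewrite linearD mulmxDl !prDl !prDr (pr_sym v u Wsym); ring.
have qN (u v : 'cV[R]_m) : pr ((u - v)^T *m W) (u - v) =
    pr (u^T *m W) u - 2 * pr (u^T *m W) v + pr (v^T *m W) v.
  rewrite linearB mulmxBl !prBl !prBr (pr_sym v u Wsym); ring.
have diag a : pr ((delta_mx a 0 : 'cV[R]_m)^T *m W) (delta_mx a 0) <=
    2 * (Y + 1) ^+ 2 / r ^+ 2 * M.
  set e : 'cV[R]_m := delta_mx a 0.
  have Ce s : `|s| = 1 -> C (x1 + (s * r) *: e).
    move=> s1; apply: Hr; rewrite normrZ normrM s1 mul1r gtr0_norm// ler_piMr ?(ltW r0)//.
    exact: delta_norm.
  have be s : `|s| = 1 -> pr ((x1 + (s * r) *: e)^T *m W) (x1 + (s * r) *: e) <=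
      M * (Y + 1) ^+ 2.
    move=> s1; apply: (le_trans (HW _ (Ce s s1))); rewrite ler_wpM2l//.
    have p0 := cone_pos HC (Ce s s1).
    rewrite lerXn2r ?nnegrE ?(ltW p0) ?addr_ge0//.
    rewrite (le_trans (ler_norm _))// (le_trans (pr_norm _ _))//.
    apply: (@le_trans _ _ Y); last by rewrite lerDl.
    rewrite ler_wpM2l// ler_wpM2l// (le_trans (ler_normD _ _))// lerD2l.
    by rewrite normrZ normrM s1 mul1r gtr0_norm// ler_piMr ?(ltW r0)// delta_norm.
  have := be 1 (normr1 _); have := be (-1) (normrN1 _).
  rewrite !qe !linearZ/= -!scalemxAl !prZl !prZr mul1r mulN1r => h1 h2.
  have h3 := W0 x1.
  rewrite mulrAC ler_pdivlMr ?exprn_gt0//.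
  have h4 : 0 <= M * (Y + 1) ^+ 2 by rewrite mulr_ge0 ?sqr_ge0.
  by clear -h1 h2 h3 h4; lra.
have dl a : (delta_mx a 0 : 'cV[R]_m)^T = delta_mx 0 a by rewrite trmx_delta.
apply: mx_norm_le => [|a b].
  by rewrite mulr_ge0// divr_ge0 ?exprn_ge0 ?mulr_ge0 ?exprn_ge0 ?addr_ge0// ltW.
have h1 := diag a; have h2 := diag b.
have := W0 (delta_mx a 0 + delta_mx b 0); have := W0 (delta_mx a 0 - delta_mx b 0).
rewrite qN qe; move: h1 h2; rewrite !dl !prM !pr_delta => h1 h2 h3 h4.
rewrite ler_norml; apply/andP; split; [clear -h1 h2 h4|clear -h1 h2 h3]; lra.
Qed.

(** * Constants uniform over nearly critical minimax points *)

Section uniform.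
Context {R : realType} {m : nat} (C : set 'cV[R]_m) (y1 : 'rV[R]_m)
  (x1 : 'cV[R]_m) (g : nat -> 'M[R]_m).
Hypothesis HC : based_cone C y1 x1.
Hypothesis Hg : cocompact_family C y1 x1 g.
Notation lf := (lf y1 g).
Notation vf := (vf x1 g).
Notation pos := (dual_pos C y1).
Notation term := (term y1 x1 g).
Variable K : R.
Hypothesis K0 : 0 < K.
Variables (n : R).
Hypothesis n0 : 0 < n.
Hypothesis nE : n = m%:R - 1.
Notation zeta := (zeta x1 g).
Notation lam := (lam y1 g).
Notation S k x y := (Mzz (term k x y) (zeta y)).
Notation W := (W y1 x1 g).

Record small_saddle (s k : R) (x : 'cV[R]_m) (y : 'rV[R]_m) := SmallSaddle {
  ss_k : 0 < k;
  ss_sum : tau_summable y1 x1 g k;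
  ss_saddle : saddle C y1 x1 g K k x y;
  ss_s0 : 0 < s;
  ss_delta : mean (term k x y) (fun i => pr (lam x i) (zeta y i)) <= s ^+ 2;
  ss_res : res_mean y1 x1 g n k x y <= s ^+ 2;
  ss_s1 : s <= 1;
  ss_s2 : n * s * (n + 4) / 2 <= 4^-1;
  ss_s3 : 16 * n ^+ 3 * s ^+ 2 <= 2^-1 }.

(** One constant for all s, k, x, y; this is the compactness behind the passage to the limit. *)
Lemma saddle_bounds : exists2 A, 1 <= A & forall s k x y, small_saddle s k x y ->
  [/\ [/\ forall i, `|zeta y i| <= A, `|x| <= A, `|y| <= A,
        `|W k x y| <= A & `|S k x y| <= A],
    `|polar y (W k x y) n| <= A,
    forall u, C u -> pr y1 u <= A * pr y u,
    forall u, C u -> pr y u <= A * pr y1 u &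
    forall i, pr (lf i) x1 <= A * pr (lf i) x].
Proof.
have [cb cb0 Hcb] := cone_bound HC.
have [a a1 Ha] := core_dom HC Hg K0.
have [r r0 Hr] := dual_norm_bound HC.
have [b b0 Hb] := psd_norm_bound HC.
pose Z := 1 + 64 * n ^+ 2.
have Z0 : 0 < Z by rewrite ltr_wpDr// mulr_ge0 ?exprn_ge0// ltW.
have a0 : 0 < a by exact: lt_le_trans a1.
pose w := b * ((128 * n ^+ 3 + 1) * a ^+ 2).
have w0 : 0 <= w.
  by rewrite mulr_ge0 ?(ltW b0)// mulr_ge0 ?exprn_ge0 ?(ltW a0)// addr_ge0// mulr_ge0 ?exprn_ge0// ltW.
pose Yb := a / r.
have Yb0 : 0 <= Yb by rewrite divr_ge0// ltW.
pose q := (n + 1) * Yb ^+ 2 + w.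
have q0 : 0 <= q.
  by rewrite addr_ge0// mulr_ge0 ?exprn_ge0// addr_ge0// ltW.
have cZ0 : 0 <= cb * Z by rewrite mulr_ge0// ltW.
pose A := 1 + cb * Z + cb + Yb + w + (cb * Z) ^+ 2 + q + Z + a.
have A1 t : [|| t <= 1, t <= cb * Z, t <= cb, t <= Yb, t <= w, t <= (cb * Z) ^+ 2,
    t <= q, t <= Z | t <= a] -> t <= A.
  have := sqr_ge0 (cb * Z) => sZ.
  have hle (p e : R) : t <= p -> p + e = A -> 0 <= e -> t <= A.
    by move=> h <- e0; rewrite (le_trans h)// lerDl.
  have := ltW Z0; have := ltW cb0; have := ltW a0 => ha hc hz.
  rewrite /A; do 8?[case/orP => [h|]]; last move=> h;
    by clear -h ha hc hz sZ q0 w0 Yb0 cZ0; lra.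
exists A; first by apply: A1; rewrite lexx.
move=> s k x y [k0 ks Hs s0 Hd Hrs s1 s2 s3].
have [Cx y1x _] := saddle_core Hs; have posy := saddle_pos Hs.
have [_ h2 h3] := Ha x y (saddle_core Hs) posy (saddle_yx Hs).
have yC u : C u -> 0 <= pr y u by move=> Cu; rewrite ltW// (dual_pos_gt0 HC posy).
have yn : `|y| <= Yb.
  rewrite /Yb ler_pdivlMr// mulrC (le_trans (Hr y yC))//.
  by rewrite (le_trans (h2 _ (cone_base HC)))// (cone_base1 HC) mulr1.
have SWk : S k x y *m W k x y = 1%:M by exact: (SW HC Hg k0 ks Cx posy).
have Wn : `|W k x y| <= w.
  apply: Hb; first exact: W_sym SWk.
    exact: (W_ge0 HC Hg k0 ks Hs).
  move=> u Cu.
  apply: (le_trans (section_W_bound HC Hg n0 nE k0 ks Hs s0 Hd Hrs s1 s2 s3 Cu)).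
  rewrite -mulrA ler_wpM2l//; first by rewrite addr_ge0// mulr_ge0// exprn_ge0// ltW.
  rewrite -exprMn lerXn2r ?nnegrE ?yC ?mulr_ge0 ?(ltW a0) ?(ltW (cone_pos HC Cu))//.
  exact: h2.
have y1y u : C u -> pr y1 u <= Z * pr y u.
  exact: (section_lower HC Hg n0 nE k0 ks Hs s0 Hd Hrs s1 s2 s3).
have zn i : `|zeta y i| <= cb * Z.
  have Cz := Czeta HC Hg posy i.
  rewrite (le_trans (Hcb _ Cz))// ler_wpM2l ?(ltW cb0)//.
  by rewrite (le_trans (y1y _ Cz))// (y_zeta HC Hg posy) mulr1.
split.
- split.
  + by move=> i; apply: A1; rewrite zn orbT.
  + by apply: A1; have := Hcb x Cx; rewrite y1x mulr1 => ->; rewrite !orbT.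
  + by apply: A1; rewrite yn !orbT.
  + by apply: A1; rewrite Wn !orbT.
  + apply: A1; rewrite (_ : _ <= (cb * Z) ^+ 2) ?orbT//.
    apply: mx_norm_le => [|c d]; first exact: sqr_ge0.
    have bz := bdd_zeta HC Hg posy.
    have p0 := @weight_gt0 _ _ _ _ _ _ HC Hg k x y Cx posy.
    have pc := weight_cvg HC Hg k0 ks Cx posy.
    rewrite mxE (le_trans (ler_norm_mean p0 pc (bddM (bz _) (bz _))))//.
    rewrite -[leRHS](mean_cst p0 pc); apply: (ler_mean p0 pc).
    * by apply: bdd_norm; apply: bddM.
    * exact: bdd_cst.
    * by move=> i; rewrite normrM expr2 ler_pM// (le_trans (mx_norm_coord _ _ _)).
- apply: A1; rewrite (_ : _ <= q) ?orbT//.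
  rewrite (le_trans (ler_normB _ _))// lerD// normrZ gtr0_norm ?addr_gt0//.
  rewrite ler_wpM2l ?addr_ge0 ?(ltW n0)//; apply: mx_norm_le => [|c d].
    exact: sqr_ge0.
  rewrite mxE big_ord1 mxE normrM expr2 ler_pM//;
    by rewrite (le_trans (mx_norm_coord _ _ _)).
- move=> u Cu; rewrite (le_trans (y1y u Cu))// ler_wpM2r ?yC//.
  by apply: A1; rewrite lexx !orbT.
- move=> u Cu; rewrite (le_trans (h2 u Cu))// ler_wpM2r ?(ltW (cone_pos HC Cu))//.
  by apply: A1; rewrite lexx !orbT.
- move=> i; rewrite (le_trans (h3 i))// ler_wpM2r ?(ltW (lf_pos HC Hg i Cx))//.
  by apply: A1; rewrite lexx !orbT.
Qed.

Lemma preserving_growth (M : 'M[R]_m) : exists2 b, 1 <= b &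
  forall u, C u -> pr y1 (M *m u) <= b * pr y1 u.
Proof.
have [cb cb0 Hcb] := cone_bound HC.
have h0 : 0 <= m%:R * `|y1 *m M| * cb by rewrite !mulr_ge0// ltW.
exists (1 + m%:R * `|y1 *m M| * cb); first by rewrite lerDl.
move=> u Cu; rewrite -prM (le_trans (ler_norm _))// (le_trans (pr_norm _ _))//.
rewrite mulrDl mul1r -[leLHS]add0r lerD ?(ltW (cone_pos HC Cu))//.
by rewrite -!mulrA ler_wpM2l// ler_wpM2l// Hcb.
Qed.

(** Both constants depend on the group element and on [kmax] only, and the first keeps the conformal
    factor away from 0. *)
Lemma conformal_step l kmax : exists AD : R * R, 0 < AD.1 /\
  forall s k x y, small_saddle s k x y -> k <= kmax ->
  exists2 c, AD.1 <= c & forall w u,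
   pr (w *m S k x y) (((g l)^T *m polar y (W k x y) n *m g l -
      c *: polar y (W k x y) n) *m u) ^+ 2 <= AD.2 * s * (`|w| * `|u|) ^+ 2.
Proof.
have [A A1 HA] := saddle_bounds.
have [b1 b11 Hb1] := preserving_growth (g l).
have [b2 b21 Hb2] := preserving_growth (invmx (g l)).
have [a a0 Ha] := cone_dom HC (cone_base HC).
have /choice[sc Hsc] := fam_mul Hg l.
pose sg i := (sc i).1; pose cc i := (sc i).2.
have cc0 i : 0 < cc i by have [] := Hsc i.
have gsg i : g l *m g i = cc i *: g (sg i) by have [] := Hsc i.
have sg_inj : injective sg.
  move=> i j ij; apply: (@fam_inj _ _ C y1 x1 g Hg i j (cc i / cc j)).
    by rewrite divr_gt0.
  have gE k : g k = cc k *: (invmx (g l) *m g (sg k)).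
    by rewrite scalemxAr -gsg mulKmx// (fam_unit Hg).
  by rewrite (gE i) (gE j) -ij scalerA -mulrA mulVf ?mulr1// gt_eqF.
have vfsg i : g l *m vf i = cc i *: vf (sg i).
  by rewrite /vf mulmxA gsg -scalemxAl.
have lfsg i : lf (sg i) *m g l = cc i *: lf i.
  apply: (can_inj (mulmxK (fam_unit Hg i))).
  rewrite -mulmxA gsg -scalemxAr -scalemxAl /lf mulmxKV ?(fam_unit Hg)//.
  by rewrite mulmxKV ?(fam_unit Hg).
have A0 : 0 < A by exact: lt_le_trans A1.
have b10 : 0 < b1 by exact: lt_le_trans b11.
have b20 : 0 < b2 by exact: lt_le_trans b21.
pose Bd := A + A * b1 * A + A * b2 * A + a * b1 * A + a * b2 * A + `|g l|.
(* The second summand bounds the ratio of the weights of i and sg i, a k-th power of a number at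
   most Bd^2. *)
pose A' := Bd + (Bd ^+ 2) `^ kmax.
have Bdle t : [|| t <= A, t <= A * b1 * A, t <= A * b2 * A, t <= a * b1 * A,
    t <= a * b2 * A | t <= `|g l| ] -> t <= Bd.
  have h1 : 0 <= A * b1 * A by rewrite !mulr_ge0// ltW.
  have h2 : 0 <= A * b2 * A by rewrite !mulr_ge0// ltW.
  have h3 : 0 <= a * b1 * A by rewrite !mulr_ge0// ltW.
  have h4 : 0 <= a * b2 * A by rewrite !mulr_ge0// ltW.
  have h5 := normr_ge0 (g l); have h6 := ltW A0.
  rewrite /Bd; do 5?[case/orP => [h|]]; last move=> h;
    by clear -h h1 h2 h3 h4 h5 h6; lra.
have BdA : A <= Bd by apply: Bdle; rewrite lexx.
have Bd1 : 1 <= Bd by exact: le_trans A1 BdA.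
have Bd0 : 0 < Bd by exact: lt_le_trans Bd1.
have BA' : Bd <= A' by rewrite lerDl powR_ge0.
have A'1 : 1 <= A' by exact: le_trans Bd1 BA'.
exists ((A' ^+ 2)^-1, @conformal_const R m n A'); split => /=.
  by rewrite invr_gt0 exprn_gt0// (lt_le_trans _ A'1).
move=> s k x y Hss kk; have [[zA xA yA WA SA] qA y1y yy1 lx1] := HA _ _ _ _ Hss.
have [k0 ks Hs s0 Hd Hr s1 s2 s3] := Hss.
have [Cx y1x _] := saddle_core Hs; have posy := saddle_pos Hs.
have yx := saddle_yx Hs.
have AA' : A <= A' by exact: le_trans BA'.
have p0 := @weight_gt0 _ _ _ _ _ _ HC Hg k x y Cx posy.
have pc := weight_cvg HC Hg k0 ks Cx posy.
have bz := bdd_zeta HC Hg posy.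
have bl := bdd_lam HC Hg Cx.
have yz := y_zeta HC Hg posy.
have Ez := mean_zeta HC Hg k0 ks Cx posy yx (saddle_min Hs).
have SWk : S k x y *m W k x y = 1%:M by exact: (SW HC Hg k0 ks Cx posy).
have CS := pr_CS HC Hg k0 ks Cx posy.
have Cz i : C (zeta y i) by exact: (Czeta HC Hg posy).
have U := fam_unit Hg l.
have CG u : C u -> C (g l *m u) by exact: (fam_C Hg).
have CGi u : C u -> C (invmx (g l) *m u) by exact: (fam_invC Hg).
have lp i u : C u -> 0 < pr (lf i) u by exact: (lf_pos HC Hg).
have yp u : C u -> 0 < pr y u by exact: (dual_pos_gt0 HC posy).
have Cv i : C (vf i) by exact: (Cv HC Hg).
pose c1 i := pr (lf (sg i)) x / (cc i * pr (lf i) x).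
pose c2 i := pr y (g l *m zeta y i).
have c1e i : c1 i = pr (lf i) (invmx (g l) *m x) / pr (lf i) x.
  rewrite /c1 -{1}[x](mulKVmx U) -(prM (lf (sg i))) lfsg prZl.
  by rewrite invfM mulrACA divff ?mul1r// gt_eqF.
have lfdom i v : C v -> pr (lf i) v <= a * pr y1 v * pr (lf i) x1.
  by move=> Cv'; have := lp i _ (Ha _ Cv'); rewrite prBr prZr subr_gt0 => /ltW.
have lfdom2 i v : C v -> pr (lf i) v <= a * pr y1 v * A * pr (lf i) x.
  move=> Cv'; rewrite (le_trans (lfdom i v Cv'))// -!mulrA.
  by rewrite !ler_wpM2l ?(ltW a0) ?(ltW (cone_pos HC Cv')).
have c1b i : Bd^-1 <= c1 i <= Bd.
  apply/andP; split.
    rewrite /c1 ler_pdivlMr ?mulr_gt0 ?lp// ler_pdivrMl// -prZl -lfsg prM.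
    rewrite (le_trans (lfdom2 (sg i) _ (CG _ Cx)))// ler_wpM2r ?(ltW (lp _ _ Cx))//.
    apply: Bdle; rewrite (_ : _ <= a * b1 * A) ?orbT// ler_wpM2r ?(ltW A0)//.
    rewrite ler_wpM2l ?(ltW a0)// (le_trans (Hb1 _ Cx))// y1x mulr1//.
  rewrite c1e ler_pdivrMr ?lp// (le_trans (lfdom2 i _ (CGi _ Cx)))//.
  rewrite ler_wpM2r ?(ltW (lp _ _ Cx))//.
  apply: Bdle; rewrite (_ : _ <= a * b2 * A) ?orbT// ler_wpM2r ?(ltW A0)//.
  rewrite ler_wpM2l ?(ltW a0)// (le_trans (Hb2 _ Cx))// y1x mulr1//.
have c2b i : Bd^-1 <= c2 i <= Bd.
  have Cgz := CG _ (Cz i).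
  apply/andP; split.
    rewrite -div1r ler_pdivrMr// -(yz i).
    rewrite -{1}[zeta y i](mulKmx U) (le_trans (yy1 _ (CGi _ Cgz)))//.
    rewrite (le_trans (ler_wpM2l (ltW A0) (Hb2 _ Cgz)))//.
    rewrite (le_trans (ler_wpM2l (ltW A0) (ler_wpM2l (ltW b20) (y1y _ Cgz))))//.
    rewrite [leRHS]mulrC /c2 !mulrA ler_wpM2r ?(ltW (yp _ Cgz))//.
    by apply: Bdle; rewrite lexx !orbT.
  rewrite /c2 (le_trans (yy1 _ Cgz))//.
  rewrite (le_trans (ler_wpM2l (ltW A0) (Hb1 _ (Cz i))))//.
  rewrite (le_trans (ler_wpM2l (ltW A0) (ler_wpM2l (ltW b10) (y1y _ (Cz i)))))//.
  rewrite yz mulr1; apply: Bdle; by rewrite mulrA lexx !orbT.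
have lfn j : pr (lf j) x != 0 by rewrite gt_eqF// lp.
have yvn j : pr y (vf j) != 0 by rewrite gt_eqF// yp.
have ccn j : cc j != 0 by rewrite gt_eqF.
have Gz i : g l *m zeta y i = c2 i *: zeta y (sg i).
  rewrite /c2 /Submission.zeta -!scalemxAr vfsg !prZr !scalerA; congr (_ *: _).
  by field; rewrite ?lfn ?yvn ?ccn.
have lG i : c1 i *: (lam x (sg i) *m g l) = lam x i.
  rewrite /c1 /Submission.lam -scalemxAl lfsg !scalerA; congr (_ *: _).
  by field; rewrite ?lfn ?yvn ?ccn.
have prodsg i : pr (lf (sg i)) x * pr y (vf (sg i)) =
    c1 i * c2 i * (pr (lf i) x * pr y (vf i)).
  rewrite /c1 /c2 /Submission.zeta -scalemxAr vfsg !prZr.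
  by field; rewrite ?lfn ?yvn ?ccn.
have psg i : term k x y i <= A' * term k x y (sg i).
  have t0 j : 0 < pr (lf j) x * pr y (vf j) by rewrite mulr_gt0 ?lp// yp.
  have B2 : 1 <= Bd ^+ 2 by exact: exprn_ege1.
  have B20 : 0 < Bd ^+ 2 by exact: lt_le_trans B2.
  have h1 : pr (lf (sg i)) x * pr y (vf (sg i)) <= Bd ^+ 2 * (pr (lf i) x * pr y (vf i)).
    rewrite prodsg ler_wpM2r ?(ltW (t0 i))// expr2.
    have /andP[u1 u2] := c1b i; have /andP[u3 u4] := c2b i.
    have Bi : 0 <= Bd^-1 by rewrite invr_ge0 ltW.
    by apply: ler_pM => //; [exact: le_trans u1|exact: le_trans u3].
  have h2 := powRN_le (ltW k0) (t0 (sg i)) h1.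
  rewrite (powRM (- k) (ltW B20) (ltW (t0 i))) in h2.
  have h3 : (Bd ^+ 2) `^ k <= A'.
    apply: (@le_trans _ _ ((Bd ^+ 2) `^ kmax)); first by rewrite ler_powR.
    by rewrite lerDr ltW.
  have h4 : (Bd ^+ 2) `^ (- k) = ((Bd ^+ 2) `^ k)^-1 by rewrite powRN.
  rewrite h4 ler_pdivrMl ?powR_gt0// in h2.
  by rewrite (le_trans h2)// ler_wpM2r// powR_ge0.
have le' t : t <= A -> t <= A' by move=> h; exact: le_trans h AA'.
have inv' : A'^-1 <= Bd^-1 by rewrite lef_pV2 ?posrE// (lt_le_trans Bd0).
have c1A i : A'^-1 <= c1 i <= A'.
  by have /andP[u1 u2] := c1b i; rewrite (le_trans inv' u1) (le_trans u2 BA').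
have c2A i : A'^-1 <= c2 i <= A'.
  by have /andP[u1 u2] := c2b i; rewrite (le_trans inv' u1) (le_trans u2 BA').
have GA : `|g l| <= A'.
  by apply: le_trans BA'; apply: Bdle; rewrite lexx !orbT.
have zA' i : `|zeta y i| <= A' by exact: le'.
exists (mean (term k x y) (fun i => c2 i / c1 i)).
  by have /andP[] := factor_mean_bound p0 pc A'1 c1A c2A.
move=> w u; exact: (conformal_approx p0 pc bz bl yz Ez SWk CS n0 s0 s1 Hr A'1 zA'
  (le' _ xA) (le' _ qA) (le' _ WA) GA sg_inj psg c1A c2A Gz lG).
Qed.

End uniform.

(** * Convergence of matrices *)

Section matrix_limits.
Context {R : realType}.

Definition cvgmx {m n} (u : nat -> 'M[R]_(m, n)) (z : 'M[R]_(m, n)) :=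
  forall (a : 'I_m) (b : 'I_n), (fun j => u j a b) @ \oo --> z a b.

Lemma cvgmx_cst m n (z : 'M[R]_(m, n)) : cvgmx (fun=> z) z.
Proof. by move=> a b; exact: cvg_cst. Qed.

Lemma cvgmxB m n (u v : nat -> 'M[R]_(m, n)) z w :
  cvgmx u z -> cvgmx v w -> cvgmx (fun j => u j - v j) (z - w).
Proof.
move=> cu cv a b; rewrite !mxE.
under eq_cvg do rewrite !mxE.
by apply: cvgB; [exact: cu|exact: cv].
Qed.

Lemma cvgmxZ m n (c : nat -> R) (u : nat -> 'M[R]_(m, n)) (d : R) z :
  c @ \oo --> d -> cvgmx u z -> cvgmx (fun j => c j *: u j) (d *: z).
Proof.
move=> cc cu a b; rewrite !mxE.
under eq_cvg do rewrite !mxE.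
by apply: cvgM => //; exact: cu.
Qed.

Lemma cvg_sumr (I : Type) (r : seq I) (F : I -> nat -> R) (l : I -> R) :
  (forall i, F i @ \oo --> l i) ->
  (fun j => \sum_(i <- r) F i j) @ \oo --> \sum_(i <- r) l i.
Proof.
move=> Fl; elim: r => [|i r IH].
  by rewrite big_nil; under eq_cvg do rewrite big_nil; exact: cvg_cst.
rewrite big_cons; under eq_cvg do rewrite big_cons.
by apply: cvgD => //; exact: Fl.
Qed.

Lemma cvgmx_mul m n q (u : nat -> 'M[R]_(m, n)) (v : nat -> 'M[R]_(n, q)) z w :
  cvgmx u z -> cvgmx v w -> cvgmx (fun j => u j *m v j) (z *m w).
Proof.
move=> cu cv a b; rewrite !mxE.
under eq_cvg do rewrite !mxE.
by apply: cvg_sumr => k; apply: cvgM; [exact: cu|exact: cv].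
Qed.

Lemma cvgmx_tr m n (u : nat -> 'M[R]_(m, n)) z :
  cvgmx u z -> cvgmx (fun j => (u j)^T) z^T.
Proof.
move=> cu a b; rewrite !mxE.
by under eq_cvg do rewrite !mxE; exact: cu.
Qed.

Lemma cvgmx_unique m n (u : nat -> 'M[R]_(m, n)) z w :
  cvgmx u z -> cvgmx u w -> z = w.
Proof.
move=> cz cw; apply/matrixP => a b.
exact: (cvg_unique (@norm_hausdorff _ R) (cz a b) (cw a b)).
Qed.

Lemma cvgmx_ext m n (u v : nat -> 'M[R]_(m, n)) z :
  (forall j, u j = v j) -> cvgmx u z -> cvgmx v z.
Proof. by move=> e cu a b; under eq_cvg do rewrite -e; exact: cu. Qed.

Lemma cvg_pr m (y : nat -> 'rV[R]_m) u y' u' : cvgmx y y' -> cvgmx u u' ->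
  (fun j => pr (y j) (u j)) @ \oo --> pr y' u'.
Proof. by move=> cy cu; exact: (cvgmx_mul cy cu). Qed.

(** Of a subsequence only j <= phi j is recorded; this already lets limits be inherited. *)
Lemma cvgmx_subseq m n (u : nat -> 'M[R]_(m, n)) M : (forall j, `|u j| <= M) ->
  exists2 phi : nat -> nat, (forall j, (j <= phi j)%N) &
    exists z, cvgmx (u \o phi) z.
Proof.
move=> uM; have [z Hz] := mx_seq_cluster uM.
have H j : exists k, (j <= k)%N /\ `|u k - z| <= j.+1%:R^-1.
  have j0 : 0 < j.+1%:R^-1 :> R by rewrite invr_gt0.
  by have [k jk hk] := Hz j.+1%:R^-1 j0 j; exists k.
have [phi Hphi] := choice H.
exists phi => [j|]; first by have [] := Hphi j.
exists z => a b; apply/subr_cvg0.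
apply: (squeeze_cvgr _ (f := fun j => - (j.+1%:R^-1)) (h := fun j => j.+1%:R^-1)).
- apply: nearW => j; rewrite -ler_norml.
  have [_] := Hphi j; apply: le_trans.
  by have := mx_norm_coord (u (phi j) - z) a b; rewrite !mxE.
- by rewrite -oppr0; apply: cvgN; exact: cvg_harmonic.
- exact: cvg_harmonic.
Qed.

Lemma cvg_subseq (f : nat -> R) (phi : nat -> nat) (l : R) : (forall j, (j <= phi j)%N) ->
  f @ \oo --> l -> (f \o phi) @ \oo --> l.
Proof.
move=> Hphi; apply: cvg_comp.
move=> P [N _ HN]; exists N => // j /= Nj; apply: HN => /=.
exact: leq_trans (Hphi j).
Qed.

Lemma cvgmx_sub m n (u : nat -> 'M[R]_(m, n)) (phi : nat -> nat) z :
  (forall j, (j <= phi j)%N) -> cvgmx u z -> cvgmx (u \o phi) z.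
Proof. by move=> Hphi cu a b; exact: (cvg_subseq Hphi (cu a b)). Qed.

End matrix_limits.

(** * Passage to the limit *)

Section limit.
Context {R : realType} {m : nat} (C : set 'cV[R]_m) (y1 : 'rV[R]_m)
  (x1 : 'cV[R]_m) (g : nat -> 'M[R]_m).
Hypothesis HC : based_cone C y1 x1.
Hypothesis Hg : cocompact_family C y1 x1 g.
Notation term := (term y1 x1 g).
Variables (kc n : R).
Hypothesis kc0 : 0 <= kc.
Hypothesis nkc : ~ tau_summable y1 x1 g kc.
Hypothesis ks : forall k, kc < k -> tau_summable y1 x1 g k.
Hypothesis n0 : 0 < n.
Hypothesis nE : n = m%:R - 1.
Hypothesis kcn : 2 * kc = n - 1.

(* polar y W n has signature (1, n), and the family preserves it up to scalars. *)
Lemma invariant_form : exists (x : 'cV[R]_m) (y : 'rV[R]_m) (W : 'M[R]_m),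
  [/\ [/\ C x, pr y x = 1, W^T = W & W *m x = y^T],
    W \in unitmx,
    forall u, 0 <= pr (u^T *m W) u,
    (exists2 c, 0 < c & forall u, C u -> pr y1 u <= c * pr y u) &
    forall i, exists2 c, 0 < c & (g i)^T *m polar y W n *m g i = c *: polar y W n].
Proof.
have [K K0 HK] := fam_cocpt Hg.
have n1 := ltW n0.
have [s [s0 s1 s2 s3]] : exists s, [/\ 0 < s, s <= 1, n * s * (n + 4) / 2 <= 4^-1 &
   16 * n ^+ 3 * s ^+ 2 <= 2^-1].
  (* s = 1 / d; each of the three summands takes care of one condition on s. *)
  pose d := 1 + 2 * n * (n + 4) + 32 * n ^+ 3.
  have n3 : 0 <= n ^+ 3 by exact: exprn_ge0.
  have n4 : 0 <= n * (n + 4) by rewrite mulr_ge0// addr_ge0.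
  have d1 : 1 <= d by rewrite /d; move: n3 n4; clra.
  have d0 : 0 < d by exact: lt_le_trans d1.
  have di : 0 <= d^-1 by rewrite invr_ge0 ltW.
  have di1 : d^-1 <= 1 by rewrite invf_le1.
  exists d^-1; split; rewrite ?invr_gt0//.
    have -> : n * d^-1 * (n + 4) / 2 = n * (n + 4) / 2 / d by ring.
    by rewrite ler_pdivrMr//; move: n3 n4; rewrite /d; clra.
  apply: (@le_trans _ _ (16 * n ^+ 3 * d^-1)).
    by rewrite ler_wpM2l ?mulr_ge0// expr2 ler_piMr.
  by rewrite ler_pdivrMr//; move: n3 n4; rewrite /d; clra.
pose sj (j : nat) := s / j.+1%:R.
have sj0 j : 0 < sj j by rewrite divr_gt0.
have sjs j : sj j <= s by rewrite ler_pdivrMr// ler_peMr ?ler1n// ltW.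
have Hj j : exists kxy : R * ('cV[R]_m * 'rV[R]_m), kxy.1 <= kc + 1 /\
   small_saddle C y1 x1 g K n (sj j) kxy.1 kxy.2.1 kxy.2.2.
  have e0 : 0 < sj j ^+ 2 by rewrite exprn_gt0.
  have [k [x [y [/andP[k0 k1] ksum Hs Hd Hr]]]] :=
    critical_residual HC Hg K0 HK kc0 nkc ks n0 nE kcn e0.
  exists (k, (x, y)); split => //; split => //.
  - exact: le_trans s1.
  - by apply: le_trans s2; rewrite ler_pM2r// ler_pM2r ?addr_gt0// ler_pM2l.
  - apply: le_trans s3; rewrite ler_wpM2l ?mulr_ge0 ?exprn_ge0//.
    by rewrite lerXn2r ?nnegrE ?(ltW s0) ?(ltW (sj0 j)).
have [f Hf] := choice Hj.
pose k j := (f j).1; pose x j := (f j).2.1; pose y j := (f j).2.2.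
have Hss j : small_saddle C y1 x1 g K n (sj j) (k j) (x j) (y j) by have [] := Hf j.
have kk j : k j <= kc + 1 by have [] := Hf j.
pose W j := W y1 x1 g (k j) (x j) (y j).
pose S j := Mzz (term (k j) (x j) (y j)) (zeta x1 g (y j)).
have [A A1 HA] := saddle_bounds HC Hg K0 n0 nE.
have bounds j : [/\ `|x j| <= A, `|y j| <= A, `|W j| <= A & `|S j| <= A].
  by have [[]] := HA _ _ _ _ (Hss j).
have [j|phi1 Hphi1 [xx Hxx]] := @cvgmx_subseq _ _ _ x A.
  by have [] := bounds j.
have [j|phi2 Hphi2 [yy Hyy]] := @cvgmx_subseq _ _ _ (y \o phi1) A.
  by have [] := bounds (phi1 j).
have [j|phi3 Hphi3 [WW HWW]] := @cvgmx_subseq _ _ _ (W \o phi1 \o phi2) A.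
  by have [] := bounds (phi1 (phi2 j)).
have [j|phi4 Hphi4 [SS HSS]] := @cvgmx_subseq _ _ _ (S \o phi1 \o phi2 \o phi3) A.
  by have [] := bounds (phi1 (phi2 (phi3 j))).
pose phi j := phi1 (phi2 (phi3 (phi4 j))).
have jphi j : (j <= phi j)%N.
  apply: leq_trans (Hphi1 _); apply: leq_trans (Hphi2 _).
  by apply: leq_trans (Hphi3 _); exact: Hphi4.
have cx : cvgmx (x \o phi) xx.
  exact: (cvgmx_sub Hphi4 (cvgmx_sub Hphi3 (cvgmx_sub Hphi2 Hxx))).
have cy : cvgmx (y \o phi) yy.
  exact: (cvgmx_sub Hphi4 (cvgmx_sub Hphi3 Hyy)).
have cW : cvgmx (W \o phi) WW by exact: (cvgmx_sub Hphi4 HWW).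
have cS : cvgmx (S \o phi) SS by exact: HSS.
have cq : cvgmx (fun j => polar (y (phi j)) (W (phi j)) n) (polar yy WW n).
  apply: cvgmxB => //; apply: cvgmxZ; first exact: cvg_cst.
  by apply: cvgmx_mul => //; exact: cvgmx_tr.
have SWj j : S j *m W j = 1%:M.
  have [k0 ksum Hs _ _ _ _ _ _] := Hss j; have [Cx _ _] := saddle_core Hs.
  exact: (SW HC Hg k0 ksum Cx (saddle_pos Hs)).
have SW : SS *m WW = 1%:M.
  apply: (cvgmx_unique (cvgmx_mul cS cW)).
  by apply: (cvgmx_ext (fun j => esym (SWj (phi j)))); exact: cvgmx_cst.
have Wsym j : (W j)^T = W j by exact: W_sym (SWj j).
have Wxj j : W j *m x j = (y j)^T.
  have [k0 ksum Hs _ _ _ _ _ _] := Hss j; have [Cx _ _] := saddle_core Hs.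
  have posy := saddle_pos Hs.
  apply: (Wx (@weight_gt0 _ _ _ _ _ _ HC Hg (k j) (x j) (y j) Cx posy)
    (weight_cvg HC Hg k0 ksum Cx posy) (bdd_zeta HC Hg posy)
    (y_zeta HC Hg posy) _ (SWj j)).
  exact: (mean_zeta HC Hg k0 ksum Cx posy (saddle_yx Hs) (saddle_min Hs)).
have yxj j : pr (y j) (x j) = 1.
  by have [_ _ Hs _ _ _ _ _ _] := Hss j; exact: saddle_yx Hs.
have yx : pr yy xx = 1.
  have h := cvg_pr cy cx.
  have e : (fun j => pr ((y \o phi) j) ((x \o phi) j)) = fun=> 1.
    by apply/funext => j /=; rewrite yxj.
  rewrite e in h; exact: (cvg_unique (@norm_hausdorff _ R) h (cvg_cst _)).
have Wx : WW *m xx = yy^T.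
  apply: (cvgmx_unique (cvgmx_mul cW cx)).
  by apply: (cvgmx_ext (fun j => esym (Wxj (phi j)))); exact: cvgmx_tr.
have cpr (u : nat -> 'rV[R]_m) w v : cvgmx u w -> (fun j => pr (u j) v) @ \oo --> pr w v.
  by move=> cu; apply: cvg_pr => //; exact: cvgmx_cst.
exists xx, yy, WW; split.
- split => //; last first.
    apply: (cvgmx_unique (cvgmx_tr cW)).
    by apply: (cvgmx_ext (fun j => esym (Wsym (phi j)))).
  have [] // := @core_closed _ _ _ _ _ HC K K0 (x \o phi) xx.
    by move=> j; have [_ _ Hs _ _ _ _ _ _] := Hss (phi j); exact: saddle_core Hs.
  move=> e e0 N.
  have H (a : 'I_m) : \forall j \near \oo, `|(x \o phi) j a 0 - xx a 0| <= e.
    have /subr_cvg0/cvgr0_norm_le/(_ e e0) := cx a 0; apply: filterS => j //.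
  have H' : \forall j \near \oo, forall a : 'I_m, `|(x \o phi) j a 0 - xx a 0| <= e.
    exact: filter_forall.
  have [N1 _ HN1] := H'.
  pose N' := maxn N N1; have h1 : (N <= N')%N by exact: leq_maxl.
  have h2 := HN1 N' (leq_maxr _ _).
  exists N' => //; apply: mx_norm_le => [|a b]; first exact: ltW.
  by rewrite !mxE ord1; exact: h2.
- by have /mulmx1_unit[] := SW.
- move=> u.
  have h1 : (fun j => pr (u^T *m W (phi j)) u) @ \oo --> pr (u^T *m WW) u.
    by apply: cpr; apply: cvgmx_mul => //; exact: cvgmx_cst.
  have h2 : (fun=> 0 : R) @ \oo --> (0 : R) by exact: cvg_cst.
  apply: (ler_cvg_to h2 h1); apply: nearW => j.
  have [k0 ksum Hs _ _ _ _ _ _] := Hss (phi j).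
  exact: (W_ge0 HC Hg k0 ksum Hs).
- exists A => [|u Cu]; first exact: lt_le_trans A1.
  have h1 : (fun j => A * pr (y (phi j)) u) @ \oo --> A * pr yy u.
    by apply: cvgM; [exact: cvg_cst|exact: cpr].
  have h2 : (fun=> pr y1 u) @ \oo --> pr y1 u by exact: cvg_cst.
  apply: (ler_cvg_to h2 h1); apply: nearW => j.
  by have [_ _ h _ _] := HA _ _ _ _ (Hss (phi j)); exact: h.
- move=> i; have [[a D] /= [a0 HAD]] := conformal_step HC Hg K0 n0 nE i (kc + 1).
  have {HAD} Hc j : exists c, a <= c /\ forall w u,
      pr (w *m S (phi j)) (((g i)^T *m polar (y (phi j)) (W (phi j)) n *m g i -
      c *: polar (y (phi j)) (W (phi j)) n) *m u) ^+ 2 <= D * sj (phi j) * (`|w| * `|u|) ^+ 2.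
    by have [c ac Hc] := HAD _ _ _ _ (Hss (phi j)) (kk (phi j)); exists c.
  have [c Hcc] := choice Hc.
  pose q j := polar (y (phi j)) (W (phi j)) n.
  pose B j := (g i)^T *m q j *m g i.
  pose N j := B j - c j *: q j.
  have D0 : 0 <= D.
    have [_ H] := Hcc 0%N; have := H y1 x1.
    have := sqr_ge0 (pr (y1 *m S (phi 0%N)) (N 0%N *m x1)).
    move=> h1 /(le_trans h1).
    have x1n : 0 < `|x1|.
      rewrite normr_gt0; apply: contraNneq (oner_neq0 R) => x0.
      by rewrite -(cone_base1 HC) x0 pr0r.
    have y1n : 0 < `|y1|.
      rewrite normr_gt0; apply: contraNneq (oner_neq0 R) => y0.
      by rewrite -(cone_base1 HC) y0 pr0l.
    by rewrite pmulr_lge0 ?exprn_gt0 ?mulr_gt0// pmulr_lge0.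
  (* The estimate controls S N only; multiplying by the convergent inverses W gives N -> 0. *)
  have cSN : cvgmx (fun j => S (phi j) *m N j) 0.
    move=> al be; rewrite mxE.
    have cs : (fun j => Num.sqrt (D * s * (j.+1%:R^-1))) @ \oo --> (0 : R).
      have -> : (0 : R) = Num.sqrt (D * s * 0) by rewrite mulr0 sqrtr0.
      apply: continuous_cvg; first exact: sqrt_continuous.
      by apply: cvgM; [exact: cvg_cst|exact: cvg_harmonic].
    apply: (squeeze_cvgr (f := fun j => - Num.sqrt (D * s * (j.+1%:R^-1)))
      (h := fun j => Num.sqrt (D * s * (j.+1%:R^-1)))) => //; last first.
      by rewrite -oppr0; apply: cvgN.
    apply: nearW => j; rewrite -ler_norml -sqrtr_sqr ler_wsqrtr//.
    have [_ H] := Hcc j.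
    have := H (delta_mx 0 al) (delta_mx be 0); rewrite prM mulmxA pr_delta.
    move=> /le_trans; apply; rewrite -[leRHS]mulr1; apply: ler_pM.
    + by rewrite mulr_ge0// ltW.
    + exact: sqr_ge0.
    + rewrite -mulrA ler_wpM2l// /sj ler_pM2l// lef_pV2 ?posrE ?ltr0n//.
      by rewrite ler_nat ltnS.
    + by rewrite exprn_ile1 ?mulr_ge0// mulr_ile1// delta_norm.
  have cN : cvgmx N 0.
    have -> : 0 = WW *m 0 :> 'M[R]_m by rewrite mulmx0.
    apply: cvgmx_ext (cvgmx_mul cW cSN) => j /=.
    by rewrite mulmxA (mulmx1C (SWj (phi j))) mul1mx.
  have cB : cvgmx B ((g i)^T *m polar yy WW n *m g i).
    by apply: cvgmx_mul; [apply: cvgmx_mul => //|]; exact: cvgmx_cst.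
  have ccq : cvgmx (fun j => c j *: q j) ((g i)^T *m polar yy WW n *m g i).
    rewrite -[X in cvgmx _ X]subr0; apply: cvgmx_ext (cvgmxB cB cN) => j.
    by rewrite /N opprB addrC subrK.
  (* The form has the value n at x, so evaluating at x recovers the factors c j and shows that they
     converge. *)
  have qx j : pr ((x (phi j))^T *m q j) (x (phi j)) = n.
    rewrite /q /polar mulmxBr prBl -scalemxAr prZl.
    have -> : pr ((x (phi j))^T *m ((y (phi j))^T *m y (phi j))) (x (phi j)) = 1.
      by rewrite mulmxA /pr -mulmxA mxE big_ord1 -[X in X * _]/(pr _ _) prT
        -[X in _ * X]/(pr _ _) yxj mulr1.
    by rewrite [pr _ (x _)]prM Wxj prT yxj; ring.
  have cc : c @ \oo --> pr (xx^T *m ((g i)^T *m polar yy WW n *m g i)) xx / n.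
    have H : (fun j => pr ((x (phi j))^T *m (c j *: q j)) (x (phi j)) / n) @ \oo -->
        pr (xx^T *m ((g i)^T *m polar yy WW n *m g i)) xx / n.
      apply: cvgM; last exact: cvg_cst.
      by apply: cvg_pr => //; apply: cvgmx_mul => //; exact: cvgmx_tr.
    apply: cvg_trans H; apply: near_eq_cvg; apply: nearW => j.
    by rewrite -scalemxAr prZl qx mulfK// gt_eqF.
  exists (pr (xx^T *m ((g i)^T *m polar yy WW n *m g i)) xx / n).
    apply: (lt_le_trans a0).
    have h2 : (fun=> a) @ \oo --> a by exact: cvg_cst.
    by apply: (ler_cvg_to h2 cc); apply: nearW => j; have [] := Hcc j.
  exact: (cvgmx_unique ccq (cvgmxZ cc cq)).
Qed.

End limit.

(** * Invariant quadrics *)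

Section positive_forms.
Context {R : realType}.

Lemma sqr_sum_eq0 m (u : 'cV[R]_m) : pr u^T u = 0 -> u = 0.
Proof.
rewrite prE => /eqP; rewrite psumr_eq0 => [/allP H|a _]; last first.
  by rewrite mxE -expr2 sqr_ge0.
apply/matrixP => a b; rewrite ord1 mxE; apply/eqP.
by have := H a (mem_index_enum _); rewrite mxE -expr2 sqrf_eq0.
Qed.

(** A null vector u of a semidefinite form is in its kernel: moving from u against v = W u by b / (e
    + 1), where the 1 avoids dividing by 0, would make the form negative unless v = 0. *)
Lemma psd_pos m (W : 'M[R]_m) u : W^T = W -> W \in unitmx ->
  (forall v, 0 <= pr (v^T *m W) v) -> u != 0 -> 0 < pr (u^T *m W) u.
Proof.
move=> Ws WU W0 u0; rewrite lt_neqAle W0 andbT eq_sym; apply: contraNneq u0 => a0.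
pose v := W *m u; pose b := pr v^T v; pose e := pr (v^T *m W) v.
have e0 : 0 <= e by exact: W0.
have b0 : 0 <= b.
  by rewrite /b prE sumr_ge0// => a _; rewrite mxE -expr2 sqr_ge0.
have vWu : pr (v^T *m W) u = b by rewrite prM.
have E t : pr ((u - t *: v)^T *m W) (u - t *: v) = - 2 * t * b + t ^+ 2 * e.
  rewrite linearB/= linearZ/= mulmxBl -scalemxAl !prBl !prZl !prBr !prZr a0.
  by rewrite (pr_sym u v Ws) vWu -/e; ring.
have e1 : 0 < e + 1 by rewrite ltr_wpDl.
have := W0 (u - (b / (e + 1)) *: v); rewrite E.
have -> : - 2 * (b / (e + 1)) * b + (b / (e + 1)) ^+ 2 * e =
   - (b ^+ 2 * (e + 2)) / (e + 1) ^+ 2 by field; rewrite gt_eqF.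
rewrite pmulr_lge0 ?invr_gt0 ?exprn_gt0// oppr_ge0 pmulr_lle0; last first.
  by rewrite ltr_wpDl.
move=> b2; have /eqP : b ^+ 2 = 0 by apply/le_anti; rewrite b2 sqr_ge0.
rewrite sqrf_eq0 => /eqP/sqr_sum_eq0 v0; apply/eqP.
by rewrite -(mulKmx WU u) -/v v0 mulmx0.
Qed.

(** Induction on the size, through the Schur complement [D'] of the upper left entry. *)
Lemma cholesky m (W : 'M[R]_m) : W^T = W ->
  (forall u, u != 0 -> 0 < pr (u^T *m W) u) ->
  exists G : 'M[R]_m, G^T *m W *m G = 1%:M.
Proof.
elim: m W => [|m IH] W Ws Wp.
  by exists 1%:M; apply/matrixP => -[].
pose W' : 'M[R]_(1 + m) := W.
have Ws' : W'^T = W' by exact: Ws.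
pose a := W' 0 0; pose b := dlsubmx W'; pose D := drsubmx W'.
have W'E : W' = block_mx a%:M b^T b D.
  rewrite -[LHS]submxK; congr block_mx.
    by rewrite [ulsubmx _]mx11_scalar !mxE; congr ((W' _ _)%:M); exact: val_inj.
  by rewrite /b trmx_dlsub Ws'.
have Wp' (u : 'cV[R]_(1 + m)) : u != 0 -> 0 < pr (u^T *m W') u by exact: Wp.
have a0 : 0 < a.
  have := Wp' (col_mx 1%:M 0); rewrite W'E tr_col_mx mul_row_block /pr mul_row_col.
  rewrite trmx1 trmx0 !mul1mx !mul0mx !addr0 mulmx1 mulmx0 addr0 mxE eqxx mulr1n.
  apply; apply/eqP => /matrixP/(_ (lshift m 0) 0).
  by rewrite col_mxEu !mxE => /eqP; rewrite oner_eq0.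
have Ds : D^T = D by rewrite /D trmx_drsub Ws'.
pose D' := D - a^-1 *: (b *m b^T).
have D's : D'^T = D'.
  by rewrite /D' linearB/= linearZ/= trmx_mul trmxK Ds.
have D'p u : u != 0 -> 0 < pr (u^T *m D') u.
  move=> u0; pose s := - a^-1 *: (b^T *m u).
  have := Wp' (col_mx s u); rewrite W'E tr_col_mx mul_row_block /pr mul_row_col.
  have -> : ((s^T *m a%:M + u^T *m b) *m s + (s^T *m b^T + u^T *m D) *m u) =
     u^T *m D' *m u.
    have sT : s^T = - a^-1 *: (u^T *m b) by rewrite /s linearZ/= trmx_mul trmxK.
    rewrite sT /D' mul_mx_scalar scalerA mulrN mulfV ?gt_eqF//.
    rewrite scaleN1r addNr mul0mx add0r mulmxBr mulmxBl mulmxDl addrC.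
    by rewrite -!scalemxAr -!scalemxAl scaleNr !mulmxA.
  apply; apply: contra_neq u0 => /(congr1 dsubmx).
  by rewrite col_mxKd => ->; apply/matrixP => i j; rewrite !mxE.
have [G' HG'] := IH D' D's D'p.
pose sa := (Num.sqrt a)^-1.
have sa2 : sa * a * sa = 1.
  have sq : Num.sqrt a != 0 by rewrite gt_eqF// sqrtr_gt0.
  by rewrite /sa -{2}(sqr_sqrtr (ltW a0)); field.
have cT : (- a^-1 *: (b^T *m G'))^T = - a^-1 *: (G'^T *m b).
  by rewrite linearZ/= trmx_mul trmxK.
pose G : 'M[R]_(1 + m) := block_mx sa%:M (- a^-1 *: (b^T *m G')) 0 G'.
exists G; change (G^T *m W' *m G = 1%:M :> 'M[R]_(1 + m)).
rewrite W'E /G tr_block_mx !mulmx_block.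
rewrite trmx0 !tr_scalar_mx !mul0mx !addr0 !mulmx0 !addr0.
rewrite [RHS](_ : _ = block_mx (1%:M : 'M[R]_1) 0 0 (1%:M : 'M[R]_m)); last first.
  by rewrite -scalar_mx_block.
congr block_mx.
- by rewrite -!scalar_mxM sa2.
- rewrite -scalar_mxM !mul_scalar_mx scalerA mulrN -mulrA mulfV ?gt_eqF//.
  by rewrite mulr1 -scalemxAl scaleNr addNr.
- rewrite cT [_ *m a%:M]mul_mx_scalar scalerA mulrN mulfV ?gt_eqF// scaleN1r addNr mul0mx//.
rewrite cT -HG' /D'.
rewrite [_ *m a%:M]mul_mx_scalar scalerA mulrN mulfV ?gt_eqF// scaleN1r addNr mul0mx add0r.
rewrite mulmxDl mulmxBr mulmxBl addrC; congr (_ + _).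
by rewrite -!scalemxAl -!scalemxAr -!scalemxAl scaleNr !mulmxA.
Qed.

(** The reflection along w = e - xi exchanges the unit vectors e and xi, because 2 (w, e) = (w,
    w). *)
Lemma householder m (xi : 'cV[R]_m.+1) : pr xi^T xi = 1 ->
  exists2 O : 'M[R]_m.+1, O^T *m O = 1%:M & O *m delta_mx 0 0 = xi.
Proof.
move=> x1; pose e : 'cV[R]_m.+1 := delta_mx 0 0; pose w := e - xi.
have ee : pr e^T e = 1.
  by rewrite trmx_delta -[e]mul1mx pr_delta mxE eqxx.
pose b := pr w^T w.
have [b0|b0] := eqVneq b 0.
  exists 1%:M; first by rewrite trmx1 mul1mx.
  by rewrite mul1mx; apply/eqP; rewrite -subr_eq0; apply/eqP; exact: sqr_sum_eq0.
have ww : w^T *m w = b%:M by rewrite [LHS]mx11_scalar.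
have ex : pr xi^T e = pr e^T xi by rewrite -prT trmxK.
have we : 2 * pr w^T e = b.
  by rewrite /b /w linearB/= !prBl !prBr ee x1 ex; ring.
exists (1%:M - (2 / b) *: (w *m w^T)).
  have OT : (1%:M - (2 / b) *: (w *m w^T))^T = 1%:M - (2 / b) *: (w *m w^T).
    by rewrite linearB [X in _ - X]linearZ/= trmx1 trmx_mul trmxK.
  rewrite OT mulmxBl mulmxBr mulmx1 mul1mx mulmxBr mulmx1.
  rewrite -scalemxAl -scalemxAr scalerA mulmxA -(mulmxA w) ww mul_mx_scalar -scalemxAl scalerA.
  have -> : 2 / b * (2 / b) * b = 2 / b + 2 / b by field.
  by rewrite scalerDl opprB addrK subrK.
rewrite mulmxBl mul1mx -scalemxAl -mulmxA [w^T *m _]mx11_scalar mul_mx_scalar scalerA.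
rewrite -[(_ *m _) 0 0]/(pr w^T e).
have -> : 2 / b * pr w^T e = 1 by rewrite -{1}we; field; move: b0; rewrite -we mulf_eq0 pnatr_eq0.
by rewrite scale1r /w opprB addrC subrK.
Qed.

End positive_forms.

(** * The cone is one half of a quadratic cone *)

Section quadric.
Context {R : realType} {m : nat} (C : set 'cV[R]_m) (y1 : 'rV[R]_m)
  (x1 : 'cV[R]_m) (g : nat -> 'M[R]_m).
Hypothesis HC : based_cone C y1 x1.
Hypothesis Hg : cocompact_family C y1 x1 g.
Variables (n : R) (x : 'cV[R]_m) (y : 'rV[R]_m) (W : 'M[R]_m).
Hypothesis n0 : 0 < n.
Hypothesis Cx : C x.
Hypothesis yx : pr y x = 1.
Hypothesis Wsym : W^T = W.
Hypothesis Wx : W *m x = y^T.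
Hypothesis WU : W \in unitmx.
Hypothesis W0 : forall u, 0 <= pr (u^T *m W) u.
Hypothesis y1y : exists2 c, 0 < c & forall u, C u -> pr y1 u <= c * pr y u.
Notation q := (polar y W n).
Hypothesis Hq : forall i, exists2 c, 0 < c & (g i)^T *m q *m g i = c *: q.

Let Q u v := pr (u^T *m q) v.

Let QE u v : Q u v = (n + 1) * (pr y u * pr y v) - pr (u^T *m W) v.
Proof.
rewrite /Q /polar mulmxBr prBl -scalemxAr prZl; congr (_ * _ - _).
by rewrite -(prT y u) /pr mulmxA -(mulmxA (u^T *m y^T)) mxE big_ord1.
Qed.

Let Qsym u v : Q u v = Q v u.
Proof. by rewrite !QE (pr_sym u v Wsym) (mulrC (pr y u)). Qed.

Let QDr u v w : Q u (v + w) = Q u v + Q u w. Proof. exact: prDr. Qed.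
Let QZr u c v : Q u (c *: v) = c * Q u v. Proof. exact: prZr. Qed.
Let QDl u v w : Q (v + w) u = Q v u + Q w u.
Proof. by rewrite Qsym QDr !(Qsym u). Qed.
Let QZl u c v : Q (c *: v) u = c * Q v u.
Proof. by rewrite Qsym QZr (Qsym u). Qed.

Let Qx u : Q u x = n * pr y u.
Proof. by rewrite QE yx [pr _ x]prM Wx prT; ring. Qed.

Let W_pos u : u != 0 -> 0 < pr (u^T *m W) u.
Proof. exact: psd_pos. Qed.

(** Rank-one update of an inverse, with W x = y^T and y(x) = 1. It makes q nondegenerate, so an
    element scaling q has an explicit inverse. *)
Lemma polar_inv : q *m ((n + 1) / n *: (x *m x^T) - invmx W) = 1%:M.
Proof.
have WxT : x^T *m W = y by rewrite -(trmxK W) -trmx_mul Wsym Wx trmxK.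
have yWi : y *m invmx W = x^T by rewrite -WxT mulmxK.
have yx1 : y *m x = 1%:M by rewrite [LHS]mx11_scalar -[_ 0 0]/(pr y x) yx.
rewrite /polar mulmxBl !mulmxBr mulmxV// -!scalemxAl -!scalemxAr !scalerA.
rewrite -(mulmxA y^T y (invmx W)) yWi (mulmxA W) Wx.
rewrite mulmxA -(mulmxA y^T y x) yx1 mulmx1 opprB.
rewrite -scalerBl (_ : _ - (n + 1) = (n + 1) / n).
  by rewrite addrC subrK.
by field; rewrite gt_eqF.
Qed.

(* Along a ray converging to a boundary point, the elements bringing the points
   back to a compact part contract the form. *)
Lemma boundary_null v : clC C x1 v -> ~ C v -> Q v v = 0.
Proof.
move=> clv nCv.
have [K K0 HK] := fam_cocpt Hg; have [cb cb0 Hcb] := cone_bound HC.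
have [B B0 HB] := preserving_bound HC.
have [r r0 Hr] := cone_open HC (cone_base HC).
have [Bq Bq0 HBq] : exists2 b, 0 < b & forall u, C u -> pr y1 u = 1 -> `|Q u u| <= b.
  exists (m%:R * (m%:R * (cb * `|q|) * cb) + 1).
    by rewrite ltr_wpDl// !mulr_ge0// ltW.
  move=> u Cu y1u; have un : `|u| <= cb by have := Hcb u Cu; rewrite y1u mulr1.
  rewrite (le_trans (pr_norm _ _))// (@le_trans _ _ (m%:R * (m%:R * (cb * `|q|) * cb)))//.
    rewrite ler_wpM2l// ler_pM// (le_trans (mx_norm_mul _ _))// ler_wpM2l//.
    by rewrite ler_wpM2r// mx_norm_tr.
  by rewrite lerDl.
pose iq := (n + 1) / n *: (x *m x^T) - invmx W.
have qiq : q *m iq = 1%:M by exact: polar_inv.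
have iqq : iq *m q = 1%:M by exact: mulmx1C.
pose p t := v + t *: x1.
have Cp t : 0 < t -> C (p t) by move=> t0; exact: clv.
pose P := pr y1 v + 1.
have y1v := clC_ge0 HC clv.
have P0 : 0 < P by rewrite ltr_wpDl.
pose Hb := B * (K * P).
have Hb0 : 0 < Hb by rewrite !mulr_gt0.
have x1n : 0 < `|x1|.
  rewrite normr_gt0; apply: contraNneq (oner_neq0 R) => x0.
  by rewrite -(cone_base1 HC) x0 pr0r.
(* th is the factor by which the form shrinks *)
have step th0 : 0 < th0 -> exists2 t0, 0 < t0 & forall t, 0 < t -> t < t0 ->
    `|Q (p t) (p t)| <= th0 * Bq.
  move=> th00.
  (* Bounds the inverse of h as soon as h scales q by more than th0, because that inverse is th^-1
     q^-1 h^T q. *)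
  pose L := m%:R * (m%:R * (`|iq| * Hb) * `|q|) / th0 + 1.
  have L1 : 0 < L.
    apply: ltr_wpDl => //; apply: divr_ge0; last exact: ltW.
    by rewrite !mulr_ge0// ltW.
  (* For t < t0 and an inverse of h bounded by L, the vector K t h^-1 x1 fits into the ball about x1
     contained in C. *)
  pose t0 := Num.min 1 (r / K / (m%:R * L + 1) / `|x1|).
  have mL : 0 < m%:R * L + 1 by rewrite ltr_wpDl// mulr_ge0// ltW.
  exists t0; first by rewrite lt_min ltr01 !divr_gt0.
  move=> t tp; rewrite lt_min => /andP[t1 tr].
  have [[i c] /= [c0 y1k CK]] := HK _ (Cp t tp).
  have [ci ci0 Hci] := Hq i.
  pose h := c^-1 *: g i; pose kap := c *: (invmx (g i) *m p t).
  have cn : c != 0 by rewrite gt_eqF.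
  have gU : g i \in unitmx by exact: (fam_unit Hg).
  have hk : h *m kap = p t.
    by rewrite /h /kap -scalemxAl -scalemxAr scalerA mulVf// scale1r mulKVmx.
  have Ck : C kap by apply: (cone_scale HC) => //; apply: (fam_invC Hg); exact: Cp.
  pose th := c^-1 ^+ 2 * ci.
  have th_gt0 : 0 < th by rewrite mulr_gt0// exprn_gt0// invr_gt0.
  have hqh : h^T *m q *m h = th *: q.
    have hT : h^T = c^-1 *: (g i)^T by rewrite /h linearZ.
    rewrite hT /h -!scalemxAl -scalemxAr !scalerA -expr2.
    by rewrite -[(g i)^T *m q *m _]/((g i)^T *m q *m g i) Hci scalerA.
  have Qh u : Q (h *m u) (h *m u) = th * Q u u.
    rewrite /Q trmx_mul -prM -!mulmxA (mulmxA h^T) hqh.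
    by rewrite -scalemxAr prZl.
  have hC u : C u -> C (h *m u).
    move=> Cu; rewrite -scalemxAl; apply: (cone_scale HC); first by rewrite invr_gt0.
    exact: (fam_C Hg).
  have y1p : pr y1 (p t) <= P.
    by rewrite /p prDr prZr (cone_base1 HC) mulr1 lerD2l ltW.
  have hn : `|h| <= Hb.
    rewrite (le_trans (HB h hC))// ler_wpM2l ?(ltW B0)//.
    have := cone_pos HC (hC _ CK); rewrite mulmxBr -scalemxAr hk prBr prZr subr_gt0.
    by move=> /ltW/le_trans; apply; rewrite ler_wpM2l// ltW.
  rewrite -hk Qh normrM (gtr0_norm th_gt0).
  have [thle|thge] := leP th th0; first by apply: ler_pM => //; [exact: ltW|exact: HBq].
  case: nCv.
  (* otherwise the inverse of h is bounded, and v is well inside C *)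
  pose hi := th^-1 *: (iq *m h^T *m q).
  have hih : hi *m h = 1%:M.
    rewrite /hi -scalemxAl -!mulmxA (mulmxA h^T) hqh -scalemxAr scalerA mulVf ?gt_eqF//.
    by rewrite scale1r.
  have hhi : h *m hi = 1%:M by exact: mulmx1C.
  have hin : `|hi| <= L.
    rewrite /hi normrZ gtr0_norm ?invr_gt0//.
    apply: (@le_trans _ _ (th0^-1 * (m%:R * (m%:R * (`|iq| * Hb) * `|q|)))).
      apply: ler_pM => //; first by rewrite invr_ge0 ltW.
        by rewrite lef_pV2 ?posrE// ltW.
      rewrite (le_trans (mx_norm_mul _ _))// ler_wpM2l// ler_wpM2r//.
      rewrite (le_trans (mx_norm_mul _ _))// ler_wpM2l// ler_wpM2l//.
      by rewrite mx_norm_tr.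
    by rewrite /L mulrC lerDl.
  have -> : v = h *m (kap - t *: (hi *m x1)).
    rewrite mulmxBr hk -scalemxAr mulmxA hhi mul1mx /p.
    by rewrite addrK.
  apply: hC.
  have -> : kap - t *: (hi *m x1) = K^-1 *: ((K *: kap - x1) + (x1 - (K * t) *: (hi *m x1))).
    have KK : K^-1 * K = 1 by rewrite mulVf// gt_eqF.
    by rewrite addrA subrK scalerBr (scalerA K^-1 K kap) (scalerA K^-1 (K * t)) (mulrA K^-1) KK mul1r scale1r.
  apply: (cone_scale HC); first by rewrite invr_gt0.
  apply: (cone_add HC CK); apply: Hr.
  rewrite normrN normrZ gtr0_norm ?mulr_gt0//.
  apply: (@le_trans _ _ (K * t * (m%:R * (L * `|x1|)))).
    rewrite ler_wpM2l ?mulr_ge0 ?(ltW K0) ?(ltW tp)// (le_trans (mx_norm_mul _ _))//.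
    by rewrite ler_wpM2l// ler_wpM2r.
  apply: (@le_trans _ _ (K * t * ((m%:R * L + 1) * `|x1|))).
    rewrite ler_wpM2l ?mulr_ge0 ?(ltW K0) ?(ltW tp)// mulrA ler_wpM2r//.
    by rewrite lerDl.
  move: tr; rewrite ltr_pdivlMr// ltr_pdivlMr// ltr_pdivlMr// => /ltW.
  by move=> tr; apply: le_trans tr; rewrite le_eqVlt; apply/orP; left; apply/eqP; ring.
have lim th0 : 0 < th0 -> `|Q v v| <= th0 * Bq.
  move=> th00; have [t0 t00 Ht0] := step th0 th00.
  apply: (@ler_small_slack _ _ _ (2 * `|Q v x1| + `|Q x1 x1|) (Num.min 1 t0)).
    by rewrite lt_min ltr01.
  move=> t tp; rewrite lt_min => /andP[t1 tt0].
  have := Ht0 t tp tt0; rewrite /p QDr !QDl !QZr !QZl (Qsym x1 v) => H1.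
  have -> : Q v v = Q v v + t * Q v x1 + (t * Q v x1 + t * (t * Q x1 x1)) -
     (2 * t * Q v x1 + t * (t * Q x1 x1)) by ring.
  rewrite (le_trans (ler_normB _ _))// lerD//.
  rewrite (le_trans (ler_normD _ _))// !normrM (gtr0_norm tp) ger0_norm//.
  have h : t * (t * `|Q x1 x1|) <= t * `|Q x1 x1|.
    by rewrite ler_wpM2l ?(ltW tp)// ler_piMl// ltW.
  by rewrite [leRHS]mulrC mulrDr lerD// mulrCA mulrA.
apply/eqP; rewrite -normr_eq0 eq_le normr_ge0 andbT.
apply: (@ler_small_slack _ _ _ Bq 1) => // t tp _.
by rewrite add0r mulrC; exact: lim.
Qed.

Let yC u : C u -> 0 < pr y u.
Proof.
move=> Cu; have [c c0 Hc] := y1y.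
by rewrite -(pmulr_rgt0 _ c0) (lt_le_trans (cone_pos HC Cu))// Hc.
Qed.

(** The ray from x in direction d leaves the bounded section y = 1 of C at a boundary point, where q
    vanishes; there q is n - s^2 W(d, d), as q(x, d) = n y(d) = 0. *)
Lemma exit_time d : pr y d = 0 -> d != 0 -> exists s, [/\ 0 < s,
  forall t, 0 <= t -> C (x + t *: d) <-> t < s & s ^+ 2 * pr (d^T *m W) d = n].
Proof.
move=> yd dn; have [cy cy0 Hcy] := y1y; have [cb cb0 Hcb] := cone_bound HC.
have dn0 : 0 < `|d| by rewrite normr_gt0.
pose A := [set t : R | 0 <= t /\ C (x + t *: d)].
have A0 : A 0 by split => //; rewrite scale0r addr0.
pose M := (cb * cy + `|x|) / `|d|.
have ubA : ubound A M.
  move=> t [t0 Ct]; rewrite /M ler_pdivlMr//.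
  have := Hcb _ Ct => h; have := Hcy _ Ct; rewrite (prDr y) yx (prZr t y) yd mulr0 addr0 mulr1 => h2.
  have h3 := le_trans h (ler_wpM2l (ltW cb0) h2).
  have : `|t *: d| <= `|x + t *: d| + `|x|.
    by rewrite -{1}[t *: d](addrK x) [t *: d + x]addrC (le_trans (ler_normB _ _)).
  by rewrite normrZ ger0_norm// => /le_trans; apply; rewrite lerD2r.
have supA : has_sup A by split; [exists 0|exists M].
pose s := sup A.
have opn t : C (x + t *: d) -> exists2 e, 0 < e & forall t', `|t' - t| <= e -> C (x + t' *: d).
  move=> Ct; have [r r0 Hr] := cone_open HC Ct.
  exists (r / `|d|); first by rewrite divr_gt0.
  move=> t' tt; have -> : x + t' *: d = x + t *: d + (t' - t) *: d.
    by rewrite -addrA -scalerDl (addrC t) subrK.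
  by apply: Hr; rewrite normrZ -ler_pdivlMr.
have down t t' : 0 <= t' -> t' <= t -> C (x + t *: d) -> C (x + t' *: d).
  move=> t'0 t't Ct; have [t0|t0] := eqVneq t 0.
    have -> : t' = 0 by apply/le_anti; rewrite -{1}t0 t't.
    by rewrite scale0r addr0.
  have tp : 0 < t by rewrite lt_neqAle eq_sym t0 (le_trans t'0).
  have [->//|tt] := eqVneq t' t.
  have [->|t'n] := eqVneq t' 0; first by rewrite scale0r addr0.
  have -> : x + t' *: d = (1 - t' / t) *: x + (t' / t) *: (x + t *: d).
    by rewrite scalerDr addrA -scalerDl subrK scale1r scalerA divfK.
  apply: (cone_add HC); apply: (cone_scale HC) => //.
    by rewrite subr_gt0 ltr_pdivrMr// mul1r lt_neqAle tt.
  by rewrite divr_gt0// lt_neqAle eq_sym t'n.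
have s0 : 0 < s.
  have [e e0 He] := opn 0 A0.2.
  apply: (lt_le_trans e0); apply: (ub_le_sup supA.2); split; first exact: ltW.
  by apply: He; rewrite subr0 gtr0_norm.
have lts t : 0 <= t -> t < s -> C (x + t *: d).
  move=> t0 ts; have [t' [t'0 Ct'] tt'] := sup_gt supA.1 ts.
  exact: (down t' t t0 (ltW tt') Ct').
have nCs : ~ C (x + s *: d).
  move=> Cs; have [e e0 He] := opn s Cs.
  have : s + e <= s.
    apply: (ub_le_sup supA.2); split; first by rewrite addr_ge0// ltW.
    by apply: He; rewrite addrAC subrr add0r gtr0_norm.
  by rewrite gerDl leNgt e0.
have clb : clC C x1 (x + s *: d).
  move=> dl dl0; have [r r0 Hr] := cone_open HC (cone_base HC).
  pose e := Num.min s (dl * r / `|d|).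
  have e0 : 0 < e by rewrite lt_min s0 divr_gt0// mulr_gt0.
  have es : e <= s by rewrite ge_min lexx.
  have -> : x + s *: d + dl *: x1 = (x + (s - e) *: d) + dl *: (x1 + (e / dl) *: d).
    rewrite scalerDr scalerA mulrCA divff ?gt_eqF// mulr1 scalerBl.
    by rewrite [dl *: x1 + _]addrC addrA -[x + (_ - _) + _]addrA subrK.
  apply: (cone_add HC).
    by apply: lts; rewrite ?subr_ge0// ltrBlDr ltrDl.
  apply: (cone_scale HC) => //; apply: Hr.
  rewrite normrZ gtr0_norm ?divr_gt0// -ler_pdivlMr// ler_pdivrMr//.
  rewrite mulrAC [r * _]mulrC -mulrA; apply: (@le_trans _ _ (dl * r / `|d|)).
    by rewrite ge_min lexx orbT.
  by rewrite mulrA.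
exists s; split => // [t t0|].
  split; last exact: lts.
  move=> Ct; rewrite ltNge; apply/negP => st; apply: nCs.
  exact: (down t s (ltW s0) st Ct).
have := boundary_null clb nCs; rewrite QDr !QDl !QZr !QZl (Qsym x d) !Qx yd yx QE yd.
move=> h; move: h; set w := pr _ d => h.
by rewrite -[RHS]subr0 -h; ring.
Qed.

(** On the section y = 1, write u = x + d: membership in C means exit time s > 1, and q(u, u) = n -
    W(d, d) = (s^2 - 1) W(d, d). *)
Lemma cone_quadric u : C u <-> 0 < pr y u /\ 0 < Q u u.
Proof.
wlog yu1 : u / pr y u = 1 => [H|].
  have scal : 0 < pr y u -> (C u <-> 0 < pr y u /\ 0 < Q u u).
    move=> yu; pose u' := (pr y u)^-1 *: u.
    have yi : 0 < (pr y u)^-1 by rewrite invr_gt0.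
    have yu' : pr y u' = 1 by rewrite prZr mulVf// gt_eqF.
    have uE : u = pr y u *: u' by rewrite scalerA mulfV ?scale1r// gt_eqF.
    have QQ : Q u u = pr y u ^+ 2 * Q u' u' by rewrite {1 2}uE QZr QZl; ring.
    have CC : C u <-> C u'.
      by split=> [Cu|Cu']; [|rewrite uE]; exact: (cone_scale HC).
    rewrite CC (H u' yu') yu' QQ pmulr_rgt0 ?exprn_gt0//.
    by split => -[].
  by split=> [Cu|[h1 h2]]; [apply/(scal (yC Cu))|apply/(scal h1)].
have [d dE] : exists d, d = u - x by exists (u - x).
have yd : pr y d = 0 by rewrite dE prBr yu1 yx subrr.
have uE : u = x + 1 *: d by rewrite scale1r dE addrC subrK.
have QE' : Q u u = n - pr (d^T *m W) d.
  rewrite uE scale1r QDr !QDl (Qsym x d) !Qx yd yx QE yd. ring.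
have [d0|d0] := eqVneq d 0.
  have -> : u = x by rewrite uE d0 scaler0 addr0.
  by split => // _; rewrite Qx yx mulr1.
have [s [s0 Hs Hn]] := exit_time yd d0.
have dW := W_pos d0.
have -> : C u <-> 1 < s by rewrite uE; apply: Hs.
rewrite QE' subr_gt0 yu1 -Hn -{1}[pr (d^T *m W) d]mul1r ltr_pM2r//.
have -> : (1 < s ^+ 2) = (1 < s) by rewrite expr_gt1// ltW.
by split=> [h|[]].
Qed.

End quadric.

(** F is a Cholesky factor, then a reflection taking the first basis vector e to x, then a scaling.
    It makes y the first coordinate and q the form n (2 v_0^2 - v.v). *)
Lemma cone_standard_form {R : realType} {m : nat} (C : set 'cV[R]_m.+1) (n : R)
  (x : 'cV[R]_m.+1) (y : 'rV[R]_m.+1) (W : 'M[R]_m.+1) : 0 < n ->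
  pr y x = 1 -> W^T = W -> W *m x = y^T -> W \in unitmx ->
  (forall u, 0 <= pr (u^T *m W) u) ->
  (forall u, C u <-> 0 < pr y u /\ 0 < pr (u^T *m polar y W n) u) ->
  exists2 F : 'M[R]_m.+1, F \in unitmx &
    forall v, C (F *m v) <-> 0 < v 0 0 /\ pr v^T v < 2 * v 0 0 ^+ 2.
Proof.
move=> n0 yx Ws Wx WU W0 HCq.
have [G HG] := cholesky Ws (fun u u0 => psd_pos Ws WU W0 u0).
have [_ GU] := mulmx1_unit HG.
pose xi := invmx G *m x.
have xG : G *m xi = x by rewrite mulKVmx.
have xi1 : pr xi^T xi = 1.
  have : pr (x^T *m W) x = 1 by rewrite prM Wx prT.
  by rewrite -{1 2}xG trmx_mul -(prM _ G) -!mulmxA (mulmxA G^T) HG mulmx1.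
have [Om HO Oe] := householder xi1.
have [_ OmU] := mulmx1_unit HO.
pose e : 'cV[R]_m.+1 := delta_mx 0 0.
pose sn := Num.sqrt n.
have sn0 : 0 < sn by rewrite sqrtr_gt0.
have sn2 : sn ^+ 2 = n by rewrite sqr_sqrtr// ltW.
(* Fixes e and multiplies its orthogonal complement by sqrt n, compensating for the value n of q at
   x against - 1 on the complement. *)
pose D : 'M[R]_m.+1 := sn%:M + (1 - sn) *: (e *m e^T).
have ee : e^T *m e = 1%:M.
  by rewrite [LHS]mx11_scalar trmx_delta mul_delta_mx mxE !eqxx.
have Ds : D^T = D.
  by rewrite /D linearD [X in _ + X]linearZ/= tr_scalar_mx trmx_mul trmxK.
have DD : D *m D = n%:M + (1 - n) *: (e *m e^T).
  rewrite /D mulmxDl !mulmxDr -scalar_mxM -!scalemxAl -!scalemxAr mul_scalar_mx mul_mx_scalar.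
  rewrite !scalerA mulmxA -(mulmxA e) ee mulmx1 -expr2 sn2 -addrA; congr (_ + _).
  by rewrite -!scalerDl; congr (_ *: _); rewrite -sn2; ring.
have DU : D \in unitmx.
  have := mulmx1_unit (_ : D *m (sn^-1%:M + (1 - sn^-1) *: (e *m e^T)) = 1%:M).
  case=> //; rewrite /D mulmxDl !mulmxDr -scalar_mxM -!scalemxAl -!scalemxAr.
  rewrite mul_scalar_mx mul_mx_scalar !scalerA mulmxA -(mulmxA e) ee mulmx1.
  rewrite mulfV ?gt_eqF// -addrA -!scalerDl.
  rewrite -[RHS]addr0; congr (_ + _); rewrite -[RHS](scale0r (e *m e^T)).
  by congr (_ *: _); field; rewrite gt_eqF.
pose F := G *m Om *m D.
have FWF : F^T *m W *m F = n%:M + (1 - n) *: (e *m e^T).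
  rewrite /F !trmx_mul Ds -!mulmxA (mulmxA W) (mulmxA G^T) (mulmxA G^T) HG mul1mx.
  by rewrite (mulmxA Om^T) HO mul1mx DD.
have Fe : F *m e = x.
  rewrite /F -!mulmxA -[RHS]xG -Oe -/e; congr (G *m (Om *m _)).
  rewrite /D mulmxDl -scalemxAl -mulmxA ee mulmx1 mul_scalar_mx -scalerDl.
  by rewrite addrC subrK scale1r.
have yF : y *m F = e^T.
  have yE : y = e^T *m (F^T *m W) by rewrite mulmxA -trmx_mul Fe -{1}Ws -trmx_mul Wx trmxK.
  rewrite yE -mulmxA FWF.
  rewrite mulmxDr mul_mx_scalar -scalemxAr mulmxA ee mul1mx -scalerDl.
  by rewrite addrC subrK scale1r.
exists F; first by rewrite !unitmx_mul GU OmU DU.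
move=> v; rewrite HCq.
have v0 : pr e^T v = v 0 0 by rewrite trmx_delta -[v]mul1mx /pr -rowE mul1mx !mxE.
have ev : e^T *m v = (v 0 0)%:M by rewrite [LHS]mx11_scalar -v0.
have -> : pr y (F *m v) = v 0 0 by rewrite -prM yF v0.
have -> : pr ((F *m v)^T *m polar y W n) (F *m v) = n * (2 * v 0 0 ^+ 2 - pr v^T v).
  rewrite /polar mulmxBr prBl -scalemxAr prZl.
  have -> : pr ((F *m v)^T *m (y^T *m y)) (F *m v) = v 0 0 ^+ 2.
    rewrite /pr (mulmxA _ y^T y) -trmx_mul -(mulmxA _ y) (mulmxA y) yF ev.
    by rewrite tr_scalar_mx -scalar_mxM mxE eqxx mulr1n expr2.
  have -> : pr ((F *m v)^T *m W) (F *m v) = n * pr v^T v + (1 - n) * v 0 0 ^+ 2.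
    rewrite trmx_mul -prM -!mulmxA (mulmxA F^T) FWF mulmxDr mul_mx_scalar -scalemxAr.
    rewrite prDl !prZl; congr (_ + _ * _).
    rewrite /pr (mulmxA v^T e) -[v^T *m e]trmxK trmx_mul trmxK -mulmxA ev.
    by rewrite tr_scalar_mx -scalar_mxM mxE eqxx mulr1n expr2.
  by ring.
by rewrite pmulr_rgt0// subr_gt0.
Qed.

(** * Hilbert geometry in homogeneous coordinates *)

Section lifts.
Context {R : realType} {n : nat}.
Notation P := (projective R n.+1).
Notation V := 'cV[R]_n.+1.

(* v is a homogeneous coordinate vector of p *)
Definition rp (p : P) (v : V) := exists2 c : R, c != 0 & v = c *: srepr p.

Lemma rp_srepr p : rp p (srepr p).
Proof. by exists 1; rewrite ?oner_neq0 ?scale1r. Qed.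

Lemma rp_neq0 p v : rp p v -> v != 0.
Proof.
move=> [c c0 ->]; rewrite scaler_eq0 negb_or c0/=.
exact: (sreprP (p : scalar_quotient [set v : V | v != 0])).
Qed.

Lemma rp_scaled p v c : c != 0 -> rp p v -> rp p (c *: v).
Proof. by move=> c0 [d d0 ->]; exists (c * d); rewrite ?mulf_neq0 ?scalerA. Qed.

Lemma rp_scale p v w : rp p v -> rp p w -> exists2 c, c != 0 & w = c *: v.
Proof.
move=> [c c0 ->] [d d0 ->]; exists (d / c); first by rewrite mulf_neq0 ?invr_neq0.
by rewrite scalerA divfK.
Qed.

Lemma rp_eq p q v : rp p v -> rp q v -> p = q.
Proof.
move=> [c c0 vE] [d d0 vE'].
rewrite -[p](sclassK (U := [set v : V | v != 0])) -[q](sclassK (U := [set v : V | v != 0])).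
apply/sclassP; exists (c / d); first by rewrite mulf_neq0 ?invr_neq0.
by rewrite mulrC -scalerA -vE vE' scalerA mulVf// scale1r.
Qed.

Lemma rp_sclass v (v0 : v != 0) : rp (sclass (U := [set v : V | v != 0]) v0) v.
Proof.
have [c c0 E] := srepr_sclass (U := [set v : V | v != 0]) v0.
by exists c^-1; rewrite ?invr_neq0// E scalerA mulVf// scale1r.
Qed.

Lemma rp_ex v : v != 0 -> exists p, rp p v.
Proof. by move=> v0; exists (sclass (U := [set v : V | v != 0]) v0); exact: rp_sclass. Qed.

Lemma rp_act (g : PGL R n.+1) p v : rp p v -> rp (pgl_act g p) (srepr g *m v).
Proof.
move=> [c c0 ->]; rewrite -scalemxAr; apply: rp_scaled => //.
exact: rp_sclass.
Qed.

Lemma rp_act_inv (g : PGL R n.+1) p v : rp (pgl_act g p) (srepr g *m v) -> rp p v.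
Proof.
move=> H; have gU := PGL_unit g.
have [c c0 E] := rp_scale H (rp_act g (rp_srepr p)).
exists c^-1; first by rewrite invr_neq0.
apply: (can_inj (mulKmx gU)).
by rewrite -scalemxAr E scalerA mulVf// scale1r.
Qed.

Definition hom (x : 'cV[R]_n) : V := col_mx (1 : 'M[R]_1) x.

Lemma hom00 x : hom x 0 0 = 1.
Proof.
have -> : 0 = lshift n (0 : 'I_1) :> 'I_(1 + n) by exact: val_inj.
by rewrite /hom (@col_mxEu _ 1) mxE.
Qed.

Lemma rp_chart (g : PGL R n.+1) x : rp (affine_chart g x) (srepr g *m hom x).
Proof. by apply: rp_act; exact: rp_sclass. Qed.

Lemma hom_scale x y c : hom y = c *: hom x -> y = x.
Proof.
move=> E; have : hom y 0 0 = (c *: hom x) 0 0 by rewrite E.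
rewrite [RHS]mxE !hom00 mulr1 => c1; move: E; rewrite -c1 scale1r => /(congr1 (@dsubmx _ 1 n 1)).
by rewrite !col_mxKd.
Qed.

Lemma chart_inj (g : PGL R n.+1) x y : affine_chart g x = affine_chart g y -> x = y.
Proof.
move=> E; have := rp_chart g y; rewrite -E => H.
have [c c0] := rp_scale H (rp_chart g x).
rewrite scalemxAr => /(can_inj (mulKmx (PGL_unit g))).
exact: hom_scale.
Qed.

Definition colv (a : R) (x : 'cV[R]_n) : V := col_mx (a%:M : 'M[R]_1) x.

Lemma colvD a b x y : colv a x + colv b y = colv (a + b) (x + y).
Proof.
apply/matrixP => i j; rewrite /colv !mxE.
by case: splitP => k _; rewrite !mxE ?mulrnDl.
Qed.

Lemma colvZ c a x : c *: colv a x = colv (c * a) (c *: x).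
Proof.
apply/matrixP => i j; rewrite /colv !mxE.
by case: splitP => k _; rewrite !mxE ?mulrnAr.
Qed.

Lemma homE x : hom x = colv 1 x. Proof. by []. Qed.

Lemma colvK (u : V) : u = colv (u 0 0) (@dsubmx _ 1 n 1 u).
Proof.
apply/matrixP => i j; rewrite /colv [RHS]mxE.
case: splitP => k ik; rewrite !mxE.
  by rewrite !ord1 /= mulr1n; congr (u _ _); apply: val_inj; rewrite /= ik ord1.
by congr (u _ _); apply: val_inj.
Qed.

Definition lift_cone (Om : set P) (C : set V) :=
  (exists y1 x1, based_cone C y1 x1) /\ forall p, Om p <-> exists2 u, C u & rp p u.

Lemma based_cone_mx m (C : set 'cV[R]_m) y1 x1 (M : 'M[R]_m) : M \in unitmx ->
  based_cone C y1 x1 ->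
  based_cone [set w | C (invmx M *m w)] (y1 *m invmx M) (M *m x1).
Proof.
move=> MU HC; split => /=.
- move=> u Cu; have [r r0 Hr] := cone_open HC Cu.
  have d0 : 0 < m%:R * `|invmx M| + 1 :> R by rewrite ltr_wpDl// mulr_ge0.
  exists (r / (m%:R * `|invmx M| + 1)); first by rewrite divr_gt0.
  move=> w hw; rewrite mulmxDr; apply: Hr; rewrite (le_trans (mx_norm_mul _ _))//.
  rewrite ler_pdivlMr// mulrC in hw; apply: le_trans hw.
  by rewrite mulrA ler_wpM2r// lerDl.
- by move=> u v Cu Cv; rewrite mulmxDr; exact: (cone_add HC).
- by move=> c u c0 Cu; rewrite -scalemxAr; exact: (cone_scale HC).
- by move=> u Cu; rewrite prM; exact: (cone_pos HC).
- have [c c0 Hc] := cone_bound HC.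
  exists (m%:R * `|M| * c + 1); first by rewrite ltr_wpDl// !mulr_ge0// ltW.
  move=> u Cu; rewrite prM -{1}[u](mulKVmx MU) (le_trans (mx_norm_mul _ _))//.
  have p0 := cone_pos HC Cu.
  apply: (@le_trans _ _ (m%:R * `|M| * c * pr y1 (invmx M *m u))).
    by rewrite -!mulrA ler_wpM2l// ler_wpM2l// Hc.
  by rewrite ler_wpM2r ?(ltW p0)// lerDl.
- by rewrite mulKmx//; exact: (cone_base HC).
- by rewrite prM mulKmx//; exact: (cone_base1 HC).
Qed.

Lemma lift_cone_act (Om : set P) C (g : PGL R n.+1) : lift_cone Om C ->
  lift_cone (pgl_act g @` Om) [set w | C (invmx (srepr g) *m w)].
Proof.
move=> [[y1 [x1 HC]] H]; have gU := PGL_unit g; split.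
  by exists (y1 *m invmx (srepr g)), (srepr g *m x1); exact: based_cone_mx.
move=> p; split => [[q /H[u Cu qu] <-]|[u /= Cu pu]].
  by exists (srepr g *m u); [rewrite /= mulKmx|exact: rp_act].
exists (pgl_act g^-1%g p); last by rewrite -pgl_actM mulgV pgl_act1.
apply/H; exists (invmx (srepr g) *m u) => //.
by apply: (@rp_act_inv g); rewrite mulKVmx// -pgl_actM mulgV pgl_act1.
Qed.

(** Each vector of C lies in C' or in - C', on which y' has opposite nonzero signs. If both
    occurred, a positive combination in C would have y' = 0. *)
Lemma lift_cone_unique (Om : set P) C C' : lift_cone Om C -> lift_cone Om C' ->
  (forall u, C u <-> C' u) \/ (forall u, C u <-> C' (- u)).
Proof.
have half (D D' : set V) w : lift_cone Om D -> lift_cone Om D' -> D w ->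
    D' w \/ D' (- w).
  move=> [[y [x HD]] hD] [[y' [x' HD']] hD'] Dw.
  have w0 : w != 0.
    apply/eqP => w0; have := cone_pos HD Dw; by rewrite w0 pr0r ltxx.
  have [p pw] := rp_ex w0; have /hD' [u Du pu] : Om p by apply/hD; exists w.
  have [c c0 ->] := rp_scale pu pw.
  have [cp|cn] := ltP 0 c; first by left; exact: (cone_scale HD').
  right; rewrite -scaleNr; apply: (cone_scale HD') => //.
  by rewrite oppr_gt0 lt_neqAle c0.
move=> L L'; have [[y [x HC]] hC] := L; have [[y' [x' HC']] hC'] := L'.
have nz w : C w -> pr y' w != 0.
  move=> /(half _ _ w L L')[/(cone_pos HC')|/(cone_pos HC')]; first by move/gt_eqF ->.
  by rewrite prNr oppr_gt0 => /lt_eqF ->.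
have same w1 w2 : C w1 -> C w2 -> 0 < pr y' w1 -> 0 < pr y' w2.
  move=> C1 C2 p1; rewrite ltNge; apply/negP => p2.
  have p2' : pr y' w2 < 0 by rewrite lt_neqAle nz.
  have := nz (- pr y' w2 *: w1 + pr y' w1 *: w2).
  rewrite prDr !prZr mulNr mulrC addNr eqxx => /(_ _)/negP; apply => //.
  by apply: (cone_add HC); apply: (cone_scale HC) => //; rewrite oppr_gt0.
have Cx := cone_base HC.
have [px|px] := ltP 0 (pr y' x).
  left => u; split => [Cu|Cu'].
    have [//|/(cone_pos HC')] := half _ _ u L L' Cu.
    by rewrite prNr oppr_gt0 ltNge ltW// (same x u Cx Cu px).
  have [//|Cnu] := half _ _ u L' L Cu'.
  have := same x _ Cx Cnu px; rewrite prNr oppr_gt0 ltNge ltW//.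
  exact: (cone_pos HC').
right => u; split => [Cu|Cu'].
  have [Cu'|//] := half _ _ u L L' Cu.
  have := same u x Cu Cx (cone_pos HC' Cu'); by rewrite ltNge px.
have [Cnu|] := half _ _ _ L' L Cu'; last by rewrite opprK.
have := same _ x Cnu Cx (cone_pos HC' Cu'); by rewrite ltNge px.
Qed.

Definition hcone (D : set 'cV[R]_n) : set V :=
  [set u : V | 0 < u 0 0 /\ D ((u 0 0)^-1 *: @dsubmx _ 1 n 1 u)].

Lemma hcone_hom (D : set 'cV[R]_n) l x : 0 < l -> hcone D (l *: hom x) <-> D x.
Proof.
move=> l0; rewrite /hcone/= mxE hom00 mulr1 linearZ/= col_mxKd scalerA mulVf ?gt_eqF//.
by rewrite scale1r; split => [[]|].
Qed.

Lemma hconeE (u : V) : 0 < u 0 0 -> u = u 0 0 *: hom ((u 0 0)^-1 *: @dsubmx _ 1 n 1 u).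
Proof.
by move=> u0; rewrite homE colvZ mulr1 scalerA mulfV ?gt_eqF// scale1r -colvK.
Qed.

Definition nice (D : set 'cV[R]_n) := [/\ open D, bounded_set D
  & convex_set (D : set (convex_lmodType 'cV[R]_n))].

Lemma nice_open D x : nice D -> D x -> exists2 r, 0 < r & forall w, `|w| <= r -> D (x + w).
Proof.
move=> [oD _ _] Dx; have /nbhs_ballP[e /= e0 He] := open_nbhs_nbhs (conj oD Dx).
exists (e / 2) => [|w we]; first by rewrite divr_gt0.
apply: He; rewrite -ball_normE /ball_/= opprD addrA subrr sub0r normrN.
by rewrite (le_lt_trans we)// ltr_pdivrMr// ltr_pMr// ltr1n.
Qed.

Lemma nice_convex D x y t : nice D -> D x -> D y -> 0 <= t <= 1 ->
  D (t *: x + (1 - t) *: y).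
Proof.
move=> [_ _ cD] Dx Dy /andP[t0 t1].
have := cD x y (Itv01 t0 t1) (mem_set Dx) (mem_set Dy) => /set_mem.
by [].
Qed.

Lemma nice_bounded D : nice D -> exists2 b, 0 < b & forall x, D x -> `|x| <= b.
Proof.
move=> [_ [M [_ HM]] _]; exists (`|M| + 1); first by rewrite ltr_wpDl.
by move=> x Dx; apply: HM => //; rewrite (le_lt_trans (ler_norm _))// ltrDl.
Qed.

Lemma based_hcone D x : nice D -> D x -> based_cone (hcone D) (delta_mx 0 0) (hom x).
Proof.
move=> nD Dx; have p0 (u : V) : pr (delta_mx 0 0) u = u 0 0.
  by rewrite -[u]mul1mx /pr -rowE mul1mx !mxE.
have hs (c : R) (u : V) : 0 < c -> hcone D u -> hcone D (c *: u).
  move=> c0 [u0 Du]; rewrite (hconeE u0) scalerA hcone_hom// mulr_gt0//.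
split.
- move=> u [u0 Du]; set d := _ *: _ in Du.
  have [r r0 Hr] := nice_open nD Du.
  pose a := u 0 0; have a0 : 0 < a by [].
  pose e := Num.min (a / 2) (r * a / 2 / (1 + `|d|)).
  have e0 : 0 < e.
    by rewrite lt_min divr_gt0// !divr_gt0// ?mulr_gt0// ltr_wpDr.
  exists e => // w we.
  have w0 : `|w 0 0| <= e by rewrite (le_trans (mx_norm_coord _ _ _)).
  have wd : `|@dsubmx _ 1 n 1 w| <= e.
    by apply: mx_norm_le => [|i j]; [exact: ltW|rewrite mxE (le_trans (mx_norm_coord _ _ _))].
  have ea : e <= a / 2 by rewrite ge_min lexx.
  have a'0 : a / 2 <= (u + w) 0 0.
    rewrite mxE -/a; have := ler_norm (- w 0 0); rewrite normrN.
    by move: w0 ea; clra.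
  have a2 : 0 < a / 2 by rewrite divr_gt0.
  have a'p : 0 < (u + w) 0 0 by exact: lt_le_trans a'0.
  split => //.
  have -> : ((u + w) 0 0)^-1 *: @dsubmx _ 1 n 1 (u + w) =
     d + ((u + w) 0 0)^-1 *: (@dsubmx _ 1 n 1 w - w 0 0 *: d).
    apply: (@scalerI _ _ ((u + w) 0 0)); first by rewrite gt_eqF.
    have s : (u + w) 0 0 = a + w 0 0 by rewrite mxE.
    have du : @dsubmx _ 1 n 1 u = a *: d by rewrite /d scalerA mulfV ?gt_eqF// scale1r.
    have sn : a + w 0 0 != 0 by rewrite -s gt_eqF.
    have gen (X Y Z : 'cV[R]_n) : X + Y = X + Z + (Y - Z).
      by rewrite -addrA (addrCA Z) subrr addr0.
    rewrite s linearD/= du [LHS](scalerA _ _ _) mulfV// scale1r.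
    rewrite [RHS]scalerDr (scalerA _ (a + w 0 0)^-1) mulfV// scale1r scalerDl.
    exact: gen.
  apply: Hr; rewrite normrZ gtr0_norm ?invr_gt0// ler_pdivrMl//.
  rewrite (le_trans (ler_normB _ _))// normrZ.
  apply: (@le_trans _ _ (e + e * `|d|)); first by rewrite lerD// ler_wpM2r.
  rewrite -{1}[e]mulr1 -mulrDr.
  apply: (@le_trans _ _ (r * a / 2)).
    by rewrite -ler_pdivlMr ?ltr_wpDr// ge_min lexx orbT.
  by rewrite -mulrA mulrC ler_wpM2r// ltW.
- move=> u v [u0 Du] [v0 Dv]; rewrite (hconeE u0) (hconeE v0).
  set a := u 0 0 in Du *; set b := v 0 0 in Dv *.
  set x' := _ *: _ in Du *; set y' := _ *: _ in Dv *.
  have ab : 0 < a + b by rewrite addr_gt0.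
  have -> : a *: hom x' + b *: hom y' =
      (a + b) *: hom ((a / (a + b)) *: x' + (1 - a / (a + b)) *: y').
    rewrite !homE !colvZ colvD !mulr1; congr (colv _ _).
    rewrite scalerDr !scalerA; congr (_ *: _ + _ *: _); field; rewrite /= !lt0r_neq0//.
  apply/(@hcone_hom D (a + b) _ ab); apply: nice_convex => //.
  apply/andP; split; first by rewrite divr_ge0// ltW.
  by rewrite ler_pdivrMr// mul1r lerDl ltW.
- exact: hs.
- by move=> u [u0 _]; rewrite p0.
- have [b b0 Hb] := nice_bounded nD.
  exists (1 + b); first by rewrite addr_gt0.
  move=> u [u0 Du]; rewrite p0 {1}(hconeE u0) normrZ gtr0_norm// mulrC ler_pM2r//.
  apply: mx_norm_le => [|i j]; first by rewrite addr_ge0// ltW.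
  rewrite /hom mxE; case: splitP => k _.
    by rewrite mxE; case: (_ == _); rewrite ?normr1 ?normr0 ?addr_ge0 ?lerDl// ltW.
  by rewrite (le_trans (mx_norm_coord _ _ _))// (le_trans (Hb _ Du))// lerDr.
- by rewrite -[hom x]scale1r; apply/hcone_hom.
- by rewrite p0 hom00.
Qed.

Definition chart_cone (g : PGL R n.+1) D : set V := [set u | hcone D (invmx (srepr g) *m u)].

Lemma chart_lift Om (g : PGL R n.+1) D : nice D -> Om = affine_chart g @` D -> Om !=set0 ->
  lift_cone Om (chart_cone g D).
Proof.
move=> nD -> [_ [x Dx _]]; have gU := PGL_unit g; split.
  by do 2!eexists; apply: based_cone_mx => //; exact: based_hcone nD Dx.
move=> p; split => [[z Dz <-]|[u [u0 Du] pu]].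
  exists (srepr g *m hom z); last exact: rp_chart.
  by rewrite /chart_cone/= mulKmx// -[hom z]scale1r; apply/hcone_hom.
set u' := invmx _ *m u in u0 Du.
exists ((u' 0 0)^-1 *: @dsubmx _ 1 n 1 u') => //.
have := rp_chart g ((u' 0 0)^-1 *: @dsubmx _ 1 n 1 u') => /rp_eq; apply.
have -> : hom ((u' 0 0)^-1 *: @dsubmx _ 1 n 1 u') = (u' 0 0)^-1 *: u'.
  have E := hconeE u0; apply: (@scalerI _ _ (u' 0 0)); first by rewrite gt_eqF.
  by rewrite -E scalerA mulfV ?scale1r// gt_eqF.
rewrite -scalemxAr mulKVmx//; apply: rp_scaled => //.
by rewrite invr_neq0// gt_eqF.
Qed.

End lifts.

(** * Gauges of cones and the Hilbert metric *)

Section threshold.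
Context {R : realType} {m : nat}.
Implicit Types (C : set 'cV[R]_m) (u v : 'cV[R]_m).

(** For an open cone, the least l with l u - v in its closure. The logarithm of the product of the
    thresholds of (u, v) and (v, u) is twice the Hilbert distance, in any homogeneous
    coordinates. *)
Definition thr C u v (l : R) :=
  (forall l', l < l' -> C (l' *: u - v)) /\ ~ C (l *: u - v).

Lemma thr_unique C u v l l' : thr C u v l -> thr C u v l' -> l = l'.
Proof.
move=> [h1 n1] [h2 n2]; apply/le_anti/andP; split; rewrite leNgt; apply/negP => h.
  by apply: n1; exact: h2.
by apply: n2; exact: h1.
Qed.

Lemma thr_le C u v l l' : thr C u v l -> C (l' *: u - v) -> (forall d : R, 0 < d -> C (d *: u)) ->
  (forall w w', C w -> C w' -> C (w + w')) -> l <= l'.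
Proof.
move=> [h n] Cl Cu Ca; rewrite leNgt; apply/negP => ll; apply: n.
have -> : l *: u - v = (l' *: u - v) + (l - l') *: u.
  by rewrite scalerBl [RHS]addrC addrA subrK.
by apply: Ca => //; apply: Cu; rewrite subr_gt0.
Qed.

Lemma thr_exists C y1 x1 u v : based_cone C y1 x1 -> C u -> C v ->
  exists2 l, 0 < l & thr C u v l.
Proof.
move=> HC Cu Cv; pose A := [set l : R | C (l *: u - v)].
have yu := cone_pos HC Cu; have yv := cone_pos HC Cv.
have [c c0 Hc] := cone_dom HC Cu.
have A0 : A !=set0 by exists (c * pr y1 v); exact: Hc.
have lb : lbound A (pr y1 v / pr y1 u).
  move=> l /(cone_pos HC); rewrite prBr prZr subr_gt0 => h.
  by rewrite ler_pdivrMr// ltW.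
have iA : has_inf A by split => //; exists (pr y1 v / pr y1 u).
exists (inf A).
  by apply: (@lt_le_trans _ _ (pr y1 v / pr y1 u)); [exact: divr_gt0|exact: lb_le_inf].
split.
  move=> l' hl; have [l Al ll'] := inf_lt A0 hl.
  have -> : l' *: u - v = (l *: u - v) + (l' - l) *: u.
    by rewrite scalerBl [RHS]addrC addrA subrK.
  by apply: (cone_add HC) => //; apply: (cone_scale HC) => //; rewrite subr_gt0.
move=> Ci; have [r r0 Hr] := cone_open HC Ci.
have un : 0 < `|u| + 1 by rewrite ltr_wpDl.
pose e := r / (`|u| + 1).
have e0 : 0 < e by rewrite divr_gt0.
have : A (inf A - e).
  rewrite /A/= scalerBl addrAC; apply: Hr.
  rewrite normrN normrZ gtr0_norm// /e mulrAC -mulrA ler_piMr ?(ltW r0)//.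
  by rewrite ler_pdivrMr// mul1r lerDl.
by move=> /(ge_inf iA.2); rewrite lerBrDl gerDr leNgt e0.
Qed.

Lemma thr_scale C u v l a b : (forall c w, 0 < c -> C w -> C (c *: w)) ->
  0 < a -> 0 < b -> thr C u v l -> thr C (a *: u) (b *: v) (l * b / a).
Proof.
move=> Cs a0 b0 [h n].
have E t : t *: (a *: u) - b *: v = b *: ((t * a / b) *: u - v).
  by rewrite scalerBr !scalerA mulrCA divff ?gt_eqF// mulr1.
split => [l' hl|].
  rewrite E; apply: Cs => //; apply: h.
  by rewrite ltr_pdivlMr// -ltr_pdivrMr.
rewrite E => Cb; apply: n.
have bi : 0 < b^-1 by rewrite invr_gt0.
have := Cs _ _ bi Cb; rewrite scalerA mulVf ?gt_eqF// scale1r divfK ?gt_eqF// mulfK ?gt_eqF//.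
Qed.

Lemma thr_mx C u v l (M : 'M[R]_m) : M \in unitmx -> thr C u v l ->
  thr [set w | C (invmx M *m w)] (M *m u) (M *m v) l.
Proof.
move=> MU [h n]; have E t : invmx M *m (t *: (M *m u) - M *m v) = t *: u - v.
  by rewrite mulmxBr -scalemxAr !mulKmx.
by split => [l' /h|] /=; rewrite E.
Qed.

End threshold.

Section endpoints.
Context {R : realType} {n : nat}.
Implicit Types (D : set 'cV[R]_n) (x y a : 'cV[R]_n).

Lemma nice_closure D x a t : nice D -> D x -> closure D a -> 0 <= t < 1 ->
  D ((1 - t) *: x + t *: a).
Proof.
move=> nD Dx ca /andP[t0 t1]; have [r r0 Hr] := nice_open nD Dx.
have t1' : 0 < 1 - t by rewrite subr_gt0.
have e0 : 0 < (1 - t) * r by rewrite mulr_gt0.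
have [a' [Da' Ba']] := ca _ (nbhsx_ballx a _ e0).
have -> : (1 - t) *: x + t *: a = (1 - t) *: (x + (t / (1 - t)) *: (a - a')) +
    (1 - (1 - t)) *: a'.
  rewrite scalerDr scalerA mulrCA divff ?gt_eqF// mulr1 opprB addrCA subrr addr0.
  by rewrite -addrA -scalerDr subrK.
apply: nice_convex => //; last by rewrite ltW//= gerBl.
apply: Hr; rewrite normrZ ger0_norm ?divr_ge0 ?(ltW t1')// mulrAC ler_pdivrMr//.
move: Ba'; rewrite -ball_normE /ball_/= => /ltW h.
by rewrite mulrC [r * _]mulrC -[leRHS]mulr1 ler_pM// ltW.
Qed.

(** l hom(x) - hom(y) is l - 1 times the lift of the point with parameter - 1 / (l - 1) on the line,
    behind x as seen from y. Hence the endpoint with parameter s corresponds to the threshold 1 - 1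
    / s. *)
Lemma hcone_ray D x y l : 1 < l ->
  hcone D (l *: hom x - hom y) <-> D (x + (- (l - 1)^-1) *: (y - x)).
Proof.
move=> l1; have l0 : 0 < l - 1 by rewrite subr_gt0.
have -> : l *: hom x - hom y = (l - 1) *: hom (x + (- (l - 1)^-1) *: (y - x)).
  rewrite -scaleN1r !homE !colvZ colvD !mulr1; congr (colv _ _).
  rewrite scalerDr scalerA mulrN mulfV ?gt_eqF// !scaleN1r opprB.
  by rewrite scalerBl scale1r addrA subrK.
exact: hcone_hom.
Qed.

Lemma thr_of_endpoint D x y s : nice D -> D x -> s < 0 ->
  (closure D `\` interior D) (x + s *: (y - x)) ->
  thr (hcone D) (hom x) (hom y) (1 - s^-1).
Proof.
move=> nD Dx s0 [ca nia]; have l1 : 1 < 1 - s^-1 by rewrite ltrBrDl gtrDr invr_lt0.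
split => [l' hl|].
  have l'1 : 1 < l' by exact: lt_trans hl.
  apply/hcone_ray => //.
  have l0 : 0 < l' - 1 by rewrite subr_gt0.
  pose t := - (l' - 1)^-1 / s.
  have -> : x + - (l' - 1)^-1 *: (y - x) = (1 - t) *: x + t *: (x + s *: (y - x)).
      move: (y - x) => d; rewrite scalerDr scalerA /t divfK ?lt_eqF// addrA -scalerDl.
    by rewrite subrK scale1r.
  apply: nice_closure => //; apply/andP; split.
    by rewrite /t mulNr oppr_ge0 mulr_ge0_le0 ?invr_ge0 ?invr_le0// ltW.
  rewrite /t ltr_ndivrMr// mul1r ltrNr -ltf_pV2 ?posrE ?invr_gt0 ?oppr_gt0// invrK.
  by rewrite invrN ltrBrDl.
move=> /(hcone_ray _ _ _ l1); have -> : - (1 - s^-1 - 1)^-1 = s.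
  by rewrite addrAC subrr add0r invrN invrK opprK.
move=> Da; apply: nia; have [r r0 Hr] := nice_open nD Da.
apply/nbhs_ballP; exists r => //= w; rewrite -ball_normE /ball_/= => hw.
rewrite -[w](subrK (x + s *: (y - x))) addrC; apply: Hr.
by rewrite distrC ltW.
Qed.

Lemma endpoint_of_thr D x y l : nice D -> D x -> x != y ->
  thr (hcone D) (hom x) (hom y) l ->
  1 < l /\ (closure D `\` interior D) (x + (- (l - 1)^-1) *: (y - x)).
Proof.
move=> nD Dx xy [h nl].
have d0 : 0 < `|y - x| by rewrite normr_gt0 subr_eq0 eq_sym.
have [b b0 Hb] := nice_bounded nD.
have l1 : 1 < l.
  rewrite ltNge; apply/negP => l1.
  (* With l <= 1, the number 1 + e would be above the threshold, placing in D a point at distance 2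
     b + 1 from x. *)
  pose e := `|y - x| / (2 * b + 1).
  have b1 : 0 < 2 * b + 1 by rewrite addr_gt0// mulr_gt0.
  have e0 : 0 < e by rewrite divr_gt0.
  have le1 : 1 < 1 + e by rewrite ltrDl.
  have := h (1 + e) (le_lt_trans l1 le1) => /(hcone_ray _ _ _ le1).
  rewrite (addrC 1) addrK => /Hb hb.
  have : `|e^-1 *: (y - x)| <= 2 * b.
    have -> : e^-1 *: (y - x) = x - (x + - e^-1 *: (y - x)).
      by rewrite scaleNr opprD addrA subrr add0r opprK.
    rewrite (le_trans (ler_normB _ _))//.
    by rewrite mulr_natl mulr2n lerD// Hb.
  rewrite normrZ gtr0_norm ?invr_gt0// /e invf_div divfK ?gt_eqF//.
  by rewrite leNgt ltrDl ltr01.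
split => //; have lm : 0 < l - 1 by rewrite subr_gt0.
split; last first.
  by move=> /interior_subset Da; apply: nl; apply/hcone_ray.
move=> B /nbhs_ballP[e /= e0 He].
pose et := (l - 1) ^+ 2 * e / (2 * `|y - x|).
have et0 : 0 < et by rewrite divr_gt0 ?mulr_gt0 ?exprn_gt0.
have l'1 : 1 < l + et by rewrite (lt_trans l1)// ltrDl.
exists (x + (- (l + et - 1)^-1) *: (y - x)); split.
  by apply/(hcone_ray _ _ _ l'1); apply: h; rewrite ltrDl.
apply: He; rewrite -ball_normE /ball_/= opprD addrACA subrr add0r -scalerBl normrZ.
rewrite opprK addrC.
have lm' : 0 < l + et - 1 by rewrite subr_gt0.
have -> : (l + et - 1)^-1 - (l - 1)^-1 = - (et / ((l - 1) * (l + et - 1))).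
  by field; rewrite !gt_eqF.
rewrite normrN gtr0_norm ?divr_gt0 ?mulr_gt0//.
apply: (@le_lt_trans _ _ (et / (l - 1) ^+ 2 * `|y - x|)).
  rewrite ler_wpM2r// ler_wpM2l ?(ltW et0)// lef_pV2 ?posrE ?exprn_gt0 ?mulr_gt0//.
  by rewrite expr2 ler_pM2l// lerD2r lerDl ltW.
have -> : et / (l - 1) ^+ 2 * `|y - x| = e / 2 by rewrite /et; field; rewrite !gt_eqF.
by rewrite ltr_pdivrMr// ltr_pMr// ltr1n.
Qed.

Lemma euclidean_normZ (c : R) x : euclidean_norm (c *: x) = `|c| * euclidean_norm x.
Proof.
rewrite /euclidean_norm; under eq_bigr do rewrite mxE exprMn.
by rewrite -mulr_sumr sqrtrM ?sqr_ge0// sqrtr_sqr.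
Qed.

Lemma euclidean_norm_gt0 x : x != 0 -> 0 < euclidean_norm x.
Proof.
move=> x0; rewrite sqrtr_gt0 lt_neqAle sumr_ge0 ?andbT => [|i _]; last exact: sqr_ge0.
apply: contra_neq x0 => /esym/eqP; rewrite psumr_eq0 => [/allP H|i _]; last exact: sqr_ge0.
apply/matrixP => i j; rewrite ord1 mxE; apply/eqP.
by have := H i (mem_index_enum _); rewrite sqrf_eq0.
Qed.

(** The cross-ratio splits into the two thresholds; seen from y, the endpoint b has parameter 1 -
    t. *)
Lemma cross_ratioE x y (s t : R) : x != y -> s < 0 -> 1 < t ->
  (euclidean_norm (x - (x + t *: (y - x))) * euclidean_norm (y - (x + s *: (y - x)))) /
  (euclidean_norm (x - (x + s *: (y - x))) * euclidean_norm (y - (x + t *: (y - x)))) =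
  (1 - s^-1) * (1 - (1 - t)^-1).
Proof.
move=> xy s0 t1; pose d := y - x; pose N := euclidean_norm d.
have N0 : 0 < N by rewrite euclidean_norm_gt0// subr_eq0 eq_sym.
have e1 (c : R) : euclidean_norm (x - (x + c *: d)) = `|c| * N.
  by rewrite opprD addrA subrr add0r -scaleNr euclidean_normZ normrN.
have e2 (c : R) : euclidean_norm (y - (x + c *: d)) = `|1 - c| * N.
  by rewrite opprD addrA -/d -{1}[d]scale1r -scalerBl euclidean_normZ.
rewrite !e1 !e2 (gtr0_norm (lt_trans ltr01 t1)) (ltr0_norm s0).
rewrite (ltr0_norm (_ : 1 - t < 0)) ?subr_lt0// gtr0_norm ?subr_gt0 ?(lt_trans s0)//.
have h1 : N != 0 by rewrite gt_eqF.
have h2 : s != 0 by rewrite lt_eqF.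
have h3 : 1 - t != 0 by rewrite lt_eqF// subr_lt0.
have h4 : t - 1 != 0 by rewrite gt_eqF// subr_gt0.
by field; rewrite ?oppr_eq0 ?h1 ?h2 ?h3 ?h4.
Qed.

End endpoints.

Lemma exists_between {R : realFieldType} (a b : R) : a < b -> exists2 f, a < f & f < b.
Proof. by move=> ab; exists ((a + b) / 2); lra. Qed.

Section hilbert.
Context {R : realType} {n : nat}.
Notation P := (projective R n.+1).
Notation V := 'cV[R]_n.+1.
Variables (Om : set P) (C : set V).
Hypothesis chart : exists g : PGL R n.+1, bounded_convex_in_chart Om g.
Hypothesis LC : lift_cone Om C.

Lemma chart_data (g : PGL R n.+1) : bounded_convex_in_chart Om g ->
  exists D, [/\ nice D, Om = affine_chart g @` D & affine_chart g @^-1` Om = D].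
Proof.
move=> [D [oD bD cD E]]; exists D; split => //.
apply/seteqP; split => x /=; rewrite E.
  by move=> [y Dy /chart_inj <-].
by move=> Dx; exists x.
Qed.

Let Cs c w : 0 < c -> C w -> C (c *: w).
Proof. by case: LC => -[y1 [x1 HC]] _; exact: (cone_scale HC). Qed.

(** The cone of a chart and C agree up to sign, and rescaling u and v multiplies the two thresholds
    by inverse factors; their product is therefore the same in all charts. *)
Lemma thr_chart (g : PGL R n.+1) D x y u v l l' k k' :
  nice D -> Om = affine_chart g @` D -> D x -> D y ->
  rp (affine_chart g x) u -> rp (affine_chart g y) v -> C u -> C v ->
  thr (hcone D) (hom x) (hom y) l -> thr (hcone D) (hom y) (hom x) l' ->
  thr C u v k -> thr C v u k' -> l * l' = k * k'.
Proof.
move=> nD E Dx Dy pu qv Cu Cv tl tl' tk tk'.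
have gU := PGL_unit g; set G := srepr g in gU.
have Om0 : Om !=set0 by rewrite E; exists (affine_chart g x); exists x.
have LD := chart_lift nD E Om0.
have HD z : D z -> chart_cone g D (G *m hom z).
  by move=> Dz; rewrite /chart_cone/= mulKmx// -[hom z]scale1r; apply/(@hcone_hom _ _ D 1 z ltr01).
have T z w t : thr (hcone D) (hom z) (hom w) t ->
    thr (chart_cone g D) (G *m hom z) (G *m hom w) t.
  by move=> h; exact: (thr_mx gU h).
have [a a0 ua] := rp_scale (rp_chart g x) pu.
have [b b0 vb] := rp_scale (rp_chart g y) qv.
have main (e : R) : e != 0 -> (forall w, C w <-> chart_cone g D (e *: w)) ->
    0 < a * e -> 0 < b * e -> l * l' = k * k'.
  move=> e0 CE ae be.
  have sc z w t (s s' : R) : 0 < s -> 0 < s' -> thr (chart_cone g D) (G *m hom z) (G *m hom w) t ->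
      thr (chart_cone g D) (s *: (G *m hom z)) (s' *: (G *m hom w)) (t * s' / s).
    move=> s0 s'0; apply: thr_scale => // c w' c0.
    by have [[y1 [x1 HC]] _] := LD; exact: (cone_scale HC).
  have tr z w t (s s' : R) : 0 < s * e -> 0 < s' * e ->
      thr (hcone D) (hom z) (hom w) t ->
      thr C (s *: (G *m hom z)) (s' *: (G *m hom w)) (t * (s' * e) / (s * e)).
    move=> se s'e /T/(sc _ _ _ _ _ se s'e) [h nh].
    have EE t' : e *: (t' *: (s *: (G *m hom z)) - s' *: (G *m hom w)) =
        t' *: ((s * e) *: (G *m hom z)) - (s' * e) *: (G *m hom w).
      by rewrite scalerBr !scalerA; congr (_ *: _ - _ *: _); ring.
    split => [t' /h|/CE] h'; first by apply/CE; rewrite EE.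
    by apply: nh; rewrite EE in h'.
  have E1 := thr_unique (tr _ _ _ _ _ ae be tl); have E2 := thr_unique (tr _ _ _ _ _ be ae tl').
  rewrite -ua -vb in E1 E2; rewrite -(E1 _ tk) -(E2 _ tk').
  have h1 := lt0r_neq0 ae; have h2 := lt0r_neq0 be.
  by field; rewrite ?h1 ?h2; move: h1 h2; rewrite !mulf_eq0 !negb_or => /andP[-> ->] /andP[-> _].
have [[y1 [x1 HD1]] hD1] := LD.
have sgn (c : R) z : c != 0 -> D z -> chart_cone g D (c *: (G *m hom z)) -> 0 < c.
  move=> c0 Dz /(cone_pos HD1); rewrite prZr pmulr_lgt0//.
  exact: (cone_pos HD1 (HD z Dz)).
have [H|H] := lift_cone_unique LC LD.
  apply: (main 1) => [|w||]; rewrite ?oner_neq0 ?mulr1 ?scale1r//.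
    by apply: (sgn _ x) => //; rewrite -ua; apply/H.
  by apply: (sgn _ y) => //; rewrite -vb; apply/H.
apply: (main (-1)) => [|w||]; rewrite ?oppr_eq0 ?oner_neq0 ?scaleN1r// ?mulrN1.
  by apply: (sgn _ x) => //; rewrite ?oppr_eq0// scaleNr -ua; apply/H.
by apply: (sgn _ y) => //; rewrite ?oppr_eq0// scaleNr -vb; apply/H.
Qed.

(** The metric is picked by [xget], so an admissible value has to exist and all admissible values
    have to agree; both follow by expressing endpoints through thresholds in the chart at hand. *)
Lemma hilbert_thr p q u v k k' : C u -> C v -> rp p u -> rp q v ->
  thr C u v k -> thr C v u k' -> hilbert_metric Om p q = 2^-1 * ln (k * k').
Proof.
move=> Cu Cv pu qv tk tk'.
have [[y1 [x1 HC]] HO] := LC.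
have Op : Om p by apply/HO; exists u.
have Oq : Om q by apply/HO; exists v.
suff [ex un] : (exists d, is_hilbert_distance Om p q d) /\
    (forall d, is_hilbert_distance Om p q d -> d = 2^-1 * ln (k * k')).
  by rewrite /hilbert_metric; apply: un; apply: (@xgetPex _ 0 [set d | is_hilbert_distance Om p q d]).
have [pq|pq] := pselect (p = q).
  have [c c0 vE] : exists2 c, c != 0 & v = c *: u by apply: rp_scale qv; rewrite -pq.
  have cp : 0 < c.
    by have := cone_pos HC Cv; rewrite vE prZr pmulr_lgt0// (cone_pos HC Cu).
  have C0 : ~ C 0 by move=> /(cone_pos HC); rewrite pr0r ltxx.
  have t1 : thr C u v c.
    rewrite vE; split => [l' hl|]; last by rewrite subrr.
    by rewrite -scalerBl; apply: (cone_scale HC) => //; rewrite subr_gt0.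
  have t2 : thr C v u c^-1.
    rewrite vE; split => [l' hl|]; last by rewrite scalerA mulVf// scale1r subrr.
    rewrite scalerA -{2}[u]scale1r -scalerBl; apply: (cone_scale HC) => //.
    by rewrite subr_gt0 -ltr_pdivrMr// div1r.
  rewrite (thr_unique tk t1) (thr_unique tk' t2) mulfV// ln1 mulr0.
  split; first by exists 0; left.
  by move=> d [[_ ->//]|[]].
have key g x y a b : bounded_convex_in_chart Om g -> p = affine_chart g x ->
   q = affine_chart g y -> hilbert_endpoints (affine_chart g @^-1` Om) x y a b ->
   (euclidean_norm (x - b) * euclidean_norm (y - a)) /
   (euclidean_norm (x - a) * euclidean_norm (y - b)) = k * k'.
  move=> /chart_data[D [nD E ->]] px qy [ca cb [s s0 aE] [t t1 bE]].
  have Dx : D x by move: Op; rewrite E px => -[z Dz /chart_inj <-].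
  have Dy : D y by move: Oq; rewrite E qy => -[z Dz /chart_inj <-].
  have xy : x != y by apply/eqP => xy; apply: pq; rewrite px qy xy.
  rewrite aE bE cross_ratioE//.
  rewrite aE in ca; rewrite bE in cb.
  have tl := thr_of_endpoint nD Dx s0 ca.
  have t0 : 1 - t < 0 by rewrite subr_lt0.
  have cb' : (closure D `\` interior D) (y + (1 - t) *: (x - y)).
    have -> // : y + (1 - t) *: (x - y) = x + t *: (y - x).
    rewrite scalerBl scale1r addrA addrCA subrr addr0; congr (_ + _).
    by rewrite -scalerN opprB.
  have tl' := thr_of_endpoint nD Dy t0 cb'.
  rewrite px in pu; rewrite qy in qv.
  exact: (thr_chart nD E Dx Dy pu qv Cu Cv tl tl' tk tk').
split.
  have [g Hg] := chart; have [D [nD E ED]] := chart_data Hg.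
  have [x Dx px] : exists2 x, D x & affine_chart g x = p by move: Op; rewrite E => -[x]; exists x.
  have [y Dy qy] : exists2 y, D y & affine_chart g y = q by move: Oq; rewrite E => -[y]; exists y.
  have xy : x != y by apply/eqP => xy; apply: pq; rewrite -px -qy xy.
  have yx : y != x by rewrite eq_sym.
  have h1 z : D z -> hcone D (hom z).
    by move=> Dz; rewrite -[hom z]scale1r; apply/(@hcone_hom _ _ D 1 z ltr01).
  have [l _ tl] := thr_exists (based_hcone nD Dx) (h1 x Dx) (h1 y Dy).
  have [l' _ tl'] := thr_exists (based_hcone nD Dx) (h1 y Dy) (h1 x Dx).
  have [l1 ca] := endpoint_of_thr nD Dx xy tl.
  have [l'1 cb] := endpoint_of_thr nD Dy yx tl'.
  exists (2^-1 * ln (k * k')); right; split => //.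
  exists g, x, y, (x + (- (l - 1)^-1) *: (y - x)), (y + (- (l' - 1)^-1) *: (x - y)).
  have he : hilbert_endpoints (affine_chart g @^-1` Om) x y
     (x + (- (l - 1)^-1) *: (y - x)) (y + (- (l' - 1)^-1) *: (x - y)).
    rewrite ED; split => //.
      by exists (- (l - 1)^-1) => //; rewrite oppr_lt0 invr_gt0 subr_gt0.
    exists (1 + (l' - 1)^-1); first by rewrite ltrDl invr_gt0 subr_gt0.
    have e1 : x + (y - x) = y by rewrite addrC subrK.
    by rewrite scalerDl scale1r [RHS]addrA e1 scaleNr -scalerN opprB.
  split => //; congr (_ * ln _); apply/esym.
  by apply: (key g) => //; exact: esym.
move=> d [[/pq//]|[_ [g [x [y [a [b [hg px qy he ->]]]]]]]].
by congr (_ * ln _); exact: key hg px qy he.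
Qed.

Lemma hilbert_lt p q u v rho : C u -> C v -> rp p u -> rp q v ->
  hilbert_metric Om p q < rho -> exists l l', [/\ 0 < l, 0 < l',
    C (l *: u - v), C (l' *: v - u) & l * l' < expR (2 * rho)].
Proof.
move=> Cu Cv pu qv; have [[y1 [x1 HC]] _] := LC.
have [k k0 tk] := thr_exists HC Cu Cv; have [k' k'0 tk'] := thr_exists HC Cv Cu.
rewrite (hilbert_thr Cu Cv pu qv tk tk') => h.
have kk : k * k' < expR (2 * rho).
  rewrite -[k * k']lnK ?posrE ?mulr_gt0// ltr_expR.
  by rewrite -(ltr_pM2l (_ : 0 < 2^-1 :> R)) ?invr_gt0// mulrA mulVf ?mul1r.
pose e := Num.sqrt (expR (2 * rho) / (k * k')).
have q1 : 1 < expR (2 * rho) / (k * k') by rewrite ltr_pdivlMr ?mulr_gt0// mul1r.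
have e1 : 1 < e by rewrite -[1]sqrtr1 ltr_sqrt// (lt_trans ltr01).
have e0 : 0 < e by exact: lt_trans e1.
have [f f1 fe] : exists2 f, 1 < f & f < e.
  exact: exists_between.
have f0 : 0 < f by exact: lt_trans f1.
exists (k * f), (k' * f); split; rewrite ?mulr_gt0//.
- by apply: tk.1; rewrite ltr_pMr.
- by apply: tk'.1; rewrite ltr_pMr.
- rewrite mulrACA -ltr_pdivlMl ?mulr_gt0// [ltRHS]mulrC.
  have <- : e * e = expR (2 * rho) / (k * k').
    by rewrite -expr2 sqr_sqrtr// ltW// (lt_trans ltr01).
  by rewrite ltr_pM// ltW.
Qed.

Lemma hilbert_le p q u v l l' : C u -> C v -> rp p u -> rp q v ->
  C (l *: u - v) -> C (l' *: v - u) -> hilbert_metric Om p q <= 2^-1 * ln (l * l').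
Proof.
move=> Cu Cv pu qv Cl Cl'; have [[y1 [x1 HC]] _] := LC.
have [k k0 tk] := thr_exists HC Cu Cv; have [k' k'0 tk'] := thr_exists HC Cv Cu.
rewrite (hilbert_thr Cu Cv pu qv tk tk') ler_pM2l ?invr_gt0//.
have kl : k <= l.
  apply: (thr_le tk Cl) => [d d0|]; [exact: (cone_scale HC)|exact: (cone_add HC)].
have kl' : k' <= l'.
  apply: (thr_le tk' Cl') => [d d0|]; [exact: (cone_scale HC)|exact: (cone_add HC)].
have l0 := lt_le_trans k0 kl; have l'0 := lt_le_trans k'0 kl'.
by rewrite ler_ln ?posrE ?mulr_gt0// ler_pM// ltW.
Qed.

End hilbert.

Lemma hilbert_isometry {R : realType} {n : nat} (Om : set (projective R n.+1)) (phi : PGL R n.+1) :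
  proper_convex Om -> isometric Om (hilbert_metric Om)
    (pgl_act phi @` Om) (hilbert_metric (pgl_act phi @` Om)).
Proof.
move=> [_ [g Hg]]; have [D [nD E _]] := chart_data Hg.
exists (pgl_act phi).
  split; [by move=> p Op; exists p| |by []].
  by move=> p q _ _ H; rewrite -[p]pgl_act1 -[q]pgl_act1 -(mulVg phi) !pgl_actM H.
move=> p q Op Oq.
have LC := chart_lift nD E (ex_intro _ p Op).
have LC' := lift_cone_act phi LC.
have Hc : exists g, bounded_convex_in_chart Om g by exists g.
have Hc' : exists g, bounded_convex_in_chart (pgl_act phi @` Om) g.
  exists (phi * g)%g; have [oD bD cD] := nD; exists D; split => //.
  rewrite E; apply/seteqP; split=> [_ [_ [x Dx <-] <-]|_ [x Dx <-]].
    by exists x => //; rewrite /affine_chart pgl_actM.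
  by exists (affine_chart g x); [exists x|rewrite /affine_chart pgl_actM].
have [[y1 [x1 HC]] HO] := LC.
have [u Cu pu] := (HO p).1 Op; have [v Cv qv] := (HO q).1 Oq.
have [k k0 tk] := thr_exists HC Cu Cv; have [k' k'0 tk'] := thr_exists HC Cv Cu.
have gU := PGL_unit phi.
rewrite (hilbert_thr Hc LC Cu Cv pu qv tk tk').
apply: (hilbert_thr Hc' LC' _ _ (rp_act phi pu) (rp_act phi qv) (thr_mx gU tk) (thr_mx gU tk'));
  by rewrite /= mulKmx.
Qed.

(** * Groups of projective automorphisms *)

Section group_lifts.
Context {R : realType} {n : nat}.
Notation G := (PGL R n.+1).
Notation V := 'cV[R]_n.+1.

Definition rg (a : G) (N : 'M[R]_n.+1) := exists2 c : R, c != 0 & N = c *: srepr a.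

Lemma rg_srepr a : rg a (srepr a).
Proof. by exists 1; rewrite ?oner_neq0 ?scale1r. Qed.

Lemma rg_scaled a N c : c != 0 -> rg a N -> rg a (c *: N).
Proof. by move=> c0 [d d0 ->]; exists (c * d); rewrite ?mulf_neq0 ?scalerA. Qed.

Lemma rg_unit a N : rg a N -> N \in unitmx.
Proof. by move=> [c c0 ->]; rewrite unitmxZ ?unitfE// PGL_unit. Qed.

Lemma rg_scale a N N' : rg a N -> rg a N' -> exists2 c, c != 0 & N' = c *: N.
Proof.
move=> [c c0 ->] [d d0 ->]; exists (d / c); first by rewrite mulf_neq0 ?invr_neq0.
by rewrite scalerA divfK.
Qed.

Lemma rg_pgl_of N (NU : N \in unitmx) : rg (pgl_of NU) N.
Proof.
have [c c0 E] := srepr_sclass (U := [set g : 'M[R]_n.+1 | g \in unitmx]) NU.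
by exists c^-1; rewrite ?invr_neq0// E scalerA mulVf// scale1r.
Qed.

Lemma rg_eq a b N : rg a N -> rg b N -> a = b.
Proof.
move=> [c c0 NE] [d d0 NE'].
rewrite -[a](sclassK (U := [set g : 'M[R]_n.+1 | g \in unitmx]))
  -[b](sclassK (U := [set g : 'M[R]_n.+1 | g \in unitmx])).
apply/sclassP; exists (c / d); first by rewrite mulf_neq0 ?invr_neq0.
by rewrite mulrC -scalerA -NE NE' scalerA mulVf// scale1r.
Qed.

Lemma rg1 : rg 1%g 1%:M.
Proof. exact: rg_pgl_of. Qed.

Lemma rgM a b N N' : rg a N -> rg b N' -> rg (a * b)%g (N *m N').
Proof.
move=> [c c0 ->] [d d0 ->]; rewrite -scalemxAl -scalemxAr scalerA.
by apply: rg_scaled; [exact: mulf_neq0|exact: rg_pgl_of].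
Qed.

Lemma rgV a N : rg a N -> rg a^-1%g (invmx N).
Proof.
move=> aN; have NU := rg_unit aN; have [c c0 E] := rg_scale (rgM (rg_srepr a^-1%g) aN) (eq_ind_r (rg^~ _) rg1 (mulVg a)).
exists c => //; apply: (can_inj (mulmxK NU)).
by rewrite mulVmx// E -scalemxAl.
Qed.

Lemma rg_act a N p v : rg a N -> rp p v -> rp (pgl_act a p) (N *m v).
Proof. by move=> [c c0 ->] pv; rewrite -scalemxAl; apply: rp_scaled => //; exact: rp_act. Qed.

End group_lifts.

(** * From the group to a cocompact family *)

Section enumeration.
Local Open Scope quotient_scope.
Context {R : realType} {n : nat}.
Notation P := (projective R n.+1).
Notation G := (PGL R n.+1).
Notation V := 'cV[R]_n.+1.
Variables (Om : set P) (C : set V) (y1 : 'rV[R]_n.+1) (x1 : V) (Gamma : set G).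
Hypothesis n0 : (0 < n)%N.
Hypothesis HC : based_cone C y1 x1.
Hypothesis LC : lift_cone Om C.
Hypothesis Gsub : is_subgroup Gamma.
Hypothesis Gaut : Gamma `<=` Aut Om.
Hypothesis Gdisc : discrete_subset Gamma.
Hypothesis Gcoc : acts_cocompactly Gamma Om.

Let G1 : Gamma 1%g. Proof. by case: Gsub => h _; exact: set_mem. Qed.
Let GV a : Gamma a -> Gamma a^-1%g.
Proof.
case: Gsub => _ h /mem_set aG; apply/set_mem.
by have := h 1%g a (mem_set G1) aG; rewrite mul1g.
Qed.
Let GM a b : Gamma a -> Gamma b -> Gamma (a * b)%g.
Proof.
case: Gsub => _ h /mem_set aG /GV /mem_set bG; apply/set_mem.
by have := h a b^-1%g aG bG; rewrite invgK.
Qed.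

(** A representative of a maps C to a lift of the same set, that is to C or - C; in the second case
    its sign is changed. *)
Lemma positive_lift a : Gamma a -> exists N, [/\ rg a N, forall u, C u -> C (N *m u) &
  forall u, C u -> C (invmx N *m u)].
Proof.
move=> aG; have aE : pgl_act a @` Om = Om by exact: Gaut.
have aU := PGL_unit a.
have := lift_cone_act a LC; rewrite aE => LC'.
have [H|H] := lift_cone_unique LC LC'.
  exists (srepr a); split; first exact: rg_srepr.
    by move=> u Cu; apply/H; rewrite /= mulKmx.
  by move=> u /H.
exists (- srepr a); split.
- by rewrite -scaleN1r; apply: rg_scaled; [rewrite oppr_eq0 oner_neq0|exact: rg_srepr].
- by move=> u Cu; apply/H; rewrite /= mulNmx opprK mulKmx.
- move=> u /H/=; have -> // : invmx (- srepr a) = - invmx (srepr a).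
    have NU : - srepr a \in unitmx by rewrite -scaleN1r unitmxZ ?unitrN1.
    by apply: (can_inj (mulKmx NU)); rewrite mulmxV// mulNmx mulmxN opprK mulmxV.
  by rewrite mulmxN mulNmx.
Qed.

(** An open set isolating the identity in the quotient pulls back to an open set of invertible
    matrices, which contains a ball about the identity matrix. *)
Lemma discrete_at_one : exists2 e : R, 0 < e & forall a N, Gamma a -> rg a N ->
  `|N - 1%:M| < e -> a = 1%g.
Proof.
have [_ [W]] := Gdisc G1; rewrite nbhsE => -[Oo [oO O1] OW] WG.
have [B oB BE] : exists2 B : set 'M[R]_n.+1, open B &
    set_val @^-1` B = \pi_(scalar_quotient [set g : 'M[R]_n.+1 | g \in unitmx]) @^-1` Oo.
  exact: oO.
have B1 : B 1%:M.
  pose w : [set g : 'M[R]_n.+1 | g \in unitmx] := exist _ 1%:M (mem_set (unitmx1 R n.+1)).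
  have E : \pi_(scalar_quotient [set g : 'M[R]_n.+1 | g \in unitmx]) w = pgl_of (unitmx1 R n.+1).
    by congr (\pi _); exact: val_inj.
  have : (set_val @^-1` B) w by rewrite BE /= E; exact: O1.
  by [].
have /nbhs_ballP[e /= e0 He] := open_nbhs_nbhs (conj oB B1).
exists e => // a N aG aN Ne; have NU := rg_unit aN.
have BN : B N by apply: He; rewrite -ball_normE /ball_/= distrC.
have : Oo a.
  have -> : a = pgl_of NU by exact: rg_eq aN (rg_pgl_of NU).
  pose w : [set g : 'M[R]_n.+1 | g \in unitmx] := exist _ N (mem_set NU).
  have E : \pi_(scalar_quotient [set g : 'M[R]_n.+1 | g \in unitmx]) w = pgl_of NU.
    by congr (\pi _); exact: val_inj.
  have : (set_val @^-1` B) w by exact: BN.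
  by rewrite BE /= E.
move=> /OW Wa; have : (W `&` Gamma) a by [].
by rewrite WG.
Qed.

(** Each element is coded by a bound for the inverse of its matrix and a rational approximation
    whose precision depends on that bound. Equal codes give a quotient close to the identity, hence
    equal elements. *)
Lemma Gamma_countable : countable Gamma.
Proof.
have [e e0 He] := discrete_at_one.
have /choice[M HM] : forall a, exists N, Gamma a -> rg a N.
  by move=> a; exists (srepr a) => _; exact: rg_srepr.
have dense (A : 'M[R]_n.+1) (t : R) : 0 < t -> exists Q : 'M[rat]_n.+1,
    `|A - map_mx (@ratr R) Q| <= t.
  move=> t0; have H (ij : 'I_n.+1 * 'I_n.+1) : exists q : rat, `|A ij.1 ij.2 - ratr q| <= t.
    have : A ij.1 ij.2 - t < A ij.1 ij.2 + t by rewrite ltrD2l gtrN.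
    move=> /rat_in_itvoo[q]; rewrite in_itv/= => /andP[h1 h2].
    by exists q; rewrite ler_norml; apply/andP; split; [move: h2|move: h1]; clra.
  have [f Hf] := choice H.
  exists (\matrix_(i, j) f (i, j)); apply: mx_norm_le => [|i j]; first exact: ltW.
  by rewrite !mxE (Hf (i, j)).
pose eta (k : nat) : R := e / (4 * (n.+1%:R * k.+1%:R)).
have eta0 k : 0 < eta k by rewrite divr_gt0// !mulr_gt0.
have H a : exists kQ : nat * 'M[rat]_n.+1, `|invmx (M a)| <= kQ.1.+1%:R /\
    `|M a - map_mx (@ratr R) kQ.2| <= eta kQ.1.
  have [Q HQ] := dense (M a) (eta (Num.truncn `|invmx (M a)|)) (eta0 _).
  exists (Num.truncn `|invmx (M a)|, Q); split => //=.
  by rewrite ltW// truncnS_gt.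
have [f Hf] := choice H.
apply/countable_injP; exists (fun a => pickle (f a)) => a b /set_mem aG /set_mem bG.
move=> /(pcan_inj pickleK) fab.
have [h1 h2] := Hf a; have [_ h3] := Hf b; rewrite -fab in h3.
have aU := rg_unit (HM a aG).
have : (a^-1 * b)%g = 1%g.
  apply: (He _ (invmx (M a) *m M b)); first by apply: GM => //; exact: GV.
    by apply: rgM; [apply: rgV|]; exact: HM.
  have -> : invmx (M a) *m M b - 1%:M = invmx (M a) *m (M b - M a).
    by rewrite mulmxBr mulVmx.
  have hab : `|M b - M a| <= 2 * eta (f a).1.
    have -> : M b - M a = (M b - map_mx (@ratr R) (f a).2) - (M a - map_mx (@ratr R) (f a).2).
      by rewrite opprB addrA subrK.
    by rewrite (le_trans (ler_normB _ _))// mulr_natl mulr2n lerD.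
  rewrite (le_lt_trans (mx_norm_mul _ _))//.
  apply: (@le_lt_trans _ _ (n.+1%:R * ((f a).1.+1%:R * (2 * eta (f a).1)))).
    by rewrite ler_wpM2l// ler_pM.
  have -> : n.+1%:R * ((f a).1.+1%:R * (2 * eta (f a).1)) = e / 2.
    by rewrite /eta; field; rewrite !gt_eqF ?ltr0n.
  by rewrite ltr_pdivrMr// ltr_pMr// ltr1n.
by move=> ab; rewrite -[b]mul1g -(mulgV a) -mulgA ab mulg1.
Qed.

(** A homogeneous open condition keeping w away from the boundary; as j grows these sets exhaust
    C. *)
Let good (j : R) (w : V) := C w /\ C (j *: w - pr y1 w *: x1).

Let good_scale j w c : 0 < c -> good j w -> good j (c *: w).
Proof.
move=> c0 [Cw Cg]; split; first exact: (cone_scale HC).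
have -> : j *: (c *: w) - pr y1 (c *: w) *: x1 = c *: (j *: w - pr y1 w *: x1).
  by rewrite prZr scalerBr !scalerA mulrC.
exact: (cone_scale HC).
Qed.

Let good_open j w : good j w -> exists2 r, 0 < r & forall d, `|d| <= r -> good j (w + d).
Proof.
move=> [Cw Cg]; have [r1 r10 H1] := cone_open HC Cw; have [r2 r20 H2] := cone_open HC Cg.
pose L := `|j| + n.+1%:R * `|y1| * `|x1| + 1.
have L0 : 0 < L by rewrite ltr_wpDl// addr_ge0// !mulr_ge0.
exists (Num.min r1 (r2 / L)); first by rewrite lt_min r10 divr_gt0.
move=> d; rewrite le_min => /andP[d1 d2]; split; first exact: H1.
have -> : j *: (w + d) - pr y1 (w + d) *: x1 =
   (j *: w - pr y1 w *: x1) + (j *: d - pr y1 d *: x1).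
  by rewrite prDr scalerDr scalerDl opprD addrACA.
apply: H2; move: d2; rewrite ler_pdivlMr// mulrC => d2; apply: le_trans d2.
rewrite (le_trans (ler_normB _ _))// !normrZ.
apply: (@le_trans _ _ (`|j| * `|d| + n.+1%:R * `|y1| * `|x1| * `|d|)).
  by rewrite lerD2l mulrAC ler_wpM2r// -mulrA pr_norm.
by rewrite -mulrDl ler_wpM2r// lerDl.
Qed.

(** The compact set with translates filling Omega lies in a single member of the exhaustion by
    [good], so each u is brought by some group element into that member. *)
Lemma core_cover : exists2 J : R, 0 < J & forall u, C u ->
  exists aN : G * 'M[R]_n.+1, exists c : R, [/\ Gamma aN.1 /\ rg aN.1 aN.2, 0 < c,
     pr y1 (c *: (invmx aN.2 *m u)) = 1, C (J *: (c *: (invmx aN.2 *m u)) - x1) &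
     (forall u, C u -> C (aN.2 *m u)) /\ (forall u, C u -> C (invmx aN.2 *m u))].
Proof.
have [KK [cK KO Kcov]] := Gcoc; have [_ HO] := LC.
pose U (j : nat) : set P := [set p | exists2 w, rp p w & good j.+1%:R w].
have goodS j j' w : (j <= j')%N -> good j.+1%:R w -> good j'.+1%:R w.
  move=> jj [Cw Cg]; split => //.
  have [->//|njj] := eqVneq j' j.
  have -> : j'.+1%:R *: w - pr y1 w *: x1 =
     (j.+1%:R *: w - pr y1 w *: x1) + (j'.+1%:R - j.+1%:R) *: w.
    by rewrite scalerBl [RHS]addrC addrA subrK.
  apply: (cone_add HC) => //; apply: (cone_scale HC) => //.
  by rewrite subr_gt0 ltr_nat ltnS ltn_neqAle eq_sym njj.
have oU j : open (U j).
  pose B := [set v : V | good j.+1%:R v \/ good j.+1%:R (- v)].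
  have oB : open B.
    rewrite openE => v [] /good_open[r r0 Hr]; apply/nbhs_ballP; exists r => //= w;
      rewrite -ball_normE /ball_/= => /ltW vw.
      by left; rewrite -[w](subrK v) addrC; apply: Hr; rewrite distrC.
    right; have -> : - w = - v + (v - w) by rewrite addrA addNr add0r.
    exact: Hr.
  exists B => //; apply/seteqP; split => v /=.
    have v0 : set_val v != 0 by exact: set_valP v.
    have E : \pi_(scalar_quotient [set v : V | v != 0]) v = sclass (U := [set v : V | v != 0]) v0.
      by congr (\pi _); exact: val_inj.
    rewrite E => -[gv|gv].
      by exists (set_val v) => //; exact: rp_sclass.
    by exists (- set_val v) => //; rewrite -scaleN1r; apply: rp_scaled;
      [rewrite oppr_eq0 oner_neq0|exact: rp_sclass].
  have v0 : set_val v != 0 by exact: set_valP v.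
  have -> : \pi_(scalar_quotient [set v : V | v != 0]) v = sclass (U := [set v : V | v != 0]) v0.
    by congr (\pi _); exact: val_inj.
  move=> [w pw gw]; have [c c0 ->] := rp_scale pw (rp_sclass v0).
  have [cp|cn] := ltP 0 c; first by left; exact: good_scale.
  right; rewrite -scaleNr; apply: good_scale => //.
  by rewrite oppr_gt0 lt_neqAle c0.
have [J HJ] : exists J, KK `<=` U J.
  have /compact_near_coveringP/(_ nat \oo U) [] // := cK.
    move=> p /KO/HO[w Cw pw].
    have [c c0 Hc] := cone_dom HC Cw; have Cx := cone_base HC.
    have yw := cone_pos HC Cw.
    have Up : U (Num.truncn (c * pr y1 w)) p.
      exists w => //; split => //.
      have := Hc _ Cx; rewrite (cone_base1 HC) mulr1 => h.
      have -> : (Num.truncn (c * pr y1 w)).+1%:R *: w - pr y1 w *: x1 =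
         ((Num.truncn (c * pr y1 w)).+1%:R - c * pr y1 w) *: w + pr y1 w *: (c *: w - x1).
        by rewrite scalerBr scalerA scalerBl addrA mulrC subrK.
      by apply: (cone_add HC); apply: (cone_scale HC) => //; rewrite subr_gt0 truncnS_gt.
    exists (U (Num.truncn (c * pr y1 w)), [set j | (Num.truncn (c * pr y1 w) <= j)%N]).
      split => /=; first exact: open_nbhs_nbhs.
      exact: nbhs_infty_ge.
    by move=> [p' j] [/= [w' pw' gw'] jj]; exists w' => //; exact: goodS gw'.
  by move=> N _ HN; exists N; apply: HN => /=.
exists J.+1%:R => // u Cu.
have [p pu] : exists p, rp p u.
  by apply: rp_ex; apply/eqP => u0; have := cone_pos HC Cu; rewrite u0 pr0r ltxx.
have : Om p by apply/HO; exists u.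
rewrite -Kcov => -[a aG [q /HJ[w qw [Cw Cg]] ap]].
have [N [aN NC NiC]] := positive_lift aG.
have [c c0 E] : exists2 c, c != 0 & u = c *: (N *m w).
  by apply: rp_scale pu; rewrite -ap; exact: rg_act.
have NU := rg_unit aN.
have wE : invmx N *m u = c *: w by rewrite E -scalemxAr mulKmx.
have cp : 0 < c.
  have := cone_pos HC (NiC _ Cu); rewrite wE prZr pmulr_lgt0//.
  exact: (cone_pos HC Cw).
have yw := cone_pos HC Cw.
exists (a, N), ((c * pr y1 w)^-1); split => //=; first by rewrite invr_gt0 mulr_gt0.
  by rewrite wE !prZr mulVf// gt_eqF// mulr_gt0.
rewrite wE; have -> : J.+1%:R *: ((c * pr y1 w)^-1 *: (c *: w)) - x1 =
   (pr y1 w)^-1 *: (J.+1%:R *: w - pr y1 w *: x1).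
  rewrite scalerBr !scalerA mulVf ?gt_eqF// scale1r; congr (_ *: _ - _).
  by field; rewrite !gt_eqF.
by apply: (cone_scale HC) => //; rewrite invr_gt0.
Qed.

(* A finite group would bound the cone away from its boundary. *)
Lemma Gamma_infinite : infinite_set Gamma.
Proof.
move=> /finite_seqP[s Gs]; have [J J0 HJ] := core_cover.
have [A A0 HA] : exists2 A : R, 0 < A & forall u, C u -> pr y1 u = 1 -> C (A *: u - x1).
  have /choice[F HF] : forall a, exists A : R, 0 <= A /\ (Gamma a -> forall u, C u -> pr y1 u = 1 ->
      forall N c, rg a N -> 0 < c -> (forall u, C u -> C (N *m u)) ->
      (forall u, C u -> C (invmx N *m u)) ->
      pr y1 (c *: (invmx N *m u)) = 1 -> C (J *: (c *: (invmx N *m u)) - x1) ->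
      C (A *: u - x1)).
    move=> a; have [aG|naG] := pselect (Gamma a); last by exists 0; split.
    have [N0 [aN0 N0C N0iC]] := positive_lift aG.
    have [b b1 Hb] := preserving_growth HC N0.
    have b0 : 0 < b by exact: lt_le_trans b1.
    have [d d0 Hd] := cone_dom HC (N0C _ (cone_base HC)).
    have dd0 : 0 < d * (J * b) by rewrite !mulr_gt0.
    exists (d * (J * b)); split; first exact: ltW.
    move=> _ u Cu yu N c aN c0 NC NiC y1w Cw; have NU := rg_unit aN; have N0U := rg_unit aN0.
    have [f f0 NE] := rg_scale aN0 aN.
    have fp : 0 < f.
      have := cone_pos HC (NC _ (cone_base HC)); rewrite NE -scalemxAl prZr pmulr_lgt0//.
      exact: (cone_pos HC (N0C _ (cone_base HC))).
    pose w := c *: (invmx N *m u).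
    have Cww : C w by apply: (cone_scale HC) => //; exact: NiC.
    have uw : (c * f) *: u = f *: (N *m w) by rewrite /w -scalemxAr mulKVmx// scalerA mulrC.
    have uw0 : u = (f / c) *: (N0 *m w).
      have -> : u = c^-1 *: (N *m w) by rewrite /w -scalemxAr mulKVmx// scalerA mulVf ?scale1r// gt_eqF.
      by rewrite NE -scalemxAl scalerA mulrC.
    have fc0 : 0 < f / c by rewrite divr_gt0.
    have fcb : (f / c)^-1 <= b.
      have := Hb _ Cww; rewrite y1w mulr1 => hb; apply: le_trans hb.
      move: yu; rewrite uw0 prZr => yu; rewrite -[leLHS]mulr1 -yu mulKf ?gt_eqF//.
    have h1 : C ((J * (f / c)^-1) *: u - N0 *m x1).
      have := N0C _ Cw; rewrite -/w mulmxBr -scalemxAr.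
      by rewrite {1}uw0 scalerA -mulrA mulVf ?gt_eqF// mulr1.
    have h2 : C ((J * b) *: u - N0 *m x1).
      have [->|nb] := eqVneq b (f / c)^-1; first exact: h1.
      have -> : (J * b) *: u - N0 *m x1 = ((J * (f / c)^-1) *: u - N0 *m x1) + (J * (b - (f / c)^-1)) *: u.
        by rewrite mulrBr scalerBl [RHS]addrC addrA subrK.
      apply: (cone_add HC) => //; apply: (cone_scale HC) => //.
      by rewrite mulr_gt0// subr_gt0 lt_neqAle eq_sym nb.
    have h3 := Hd _ (cone_base HC); rewrite (cone_base1 HC) mulr1 in h3.
    have -> : (d * (J * b)) *: u - x1 = d *: ((J * b) *: u - N0 *m x1) + (d *: (N0 *m x1) - x1).
      by rewrite scalerBr scalerA addrA subrK.
    by apply: (cone_add HC) => //; exact: (cone_scale HC).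
  exists (1 + \sum_(a <- s) F a).
    by rewrite ltr_wpDr// sumr_ge0// => a _; have [] := HF a.
  move=> u Cu yu; have [[a N] [c [/= [aG aN] c0 y1w Cw [NC NiC]]]] := HJ u Cu.
  have [Fa0 HFa] := HF a.
  have h := HFa aG u Cu yu N c aN c0 NC NiC y1w Cw.
  have as_ : a \in s by move: aG; rewrite Gs.
  have -> : (1 + \sum_(a0 <- s) F a0) *: u - x1 =
     (F a *: u - x1) + (1 + \sum_(a0 <- rem a s) F a0) *: u.
    have SE : \sum_(a0 <- s) F a0 = F a + \sum_(a0 <- rem a s) F a0 by rewrite (big_rem a as_).
    by rewrite SE addrCA [X in X - _]scalerDl addrAC.
  apply: (cone_add HC) => //; apply: (cone_scale HC) => //.
  by rewrite ltr_wpDr// sumr_ge0// => b _; have [] := HF b.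
have [d d0 yd] : exists2 d : V, d != 0 & pr y1 d = 0.
  have Cx := cone_base HC; have y1x := cone_base1 HC.
  have ed (i : 'I_n.+1) : delta_mx i 0 - pr y1 (delta_mx i 0) *: x1 = 0 -> delta_mx i 0 = pr y1 (delta_mx i 0) *: x1.
    by move=> /eqP; rewrite subr_eq0 => /eqP.
  have yz i : pr y1 (delta_mx i 0 - pr y1 (delta_mx i 0) *: x1) = 0.
    by rewrite prBr prZr y1x mulr1 subrr.
  have [e0|e0] := eqVneq (delta_mx 0 0 - pr y1 (delta_mx 0 0) *: x1) 0; last by eexists; [exact: e0|].
  have [e1|e1] := eqVneq (delta_mx ord_max 0 - pr y1 (delta_mx ord_max 0) *: x1) 0; last by eexists; [exact: e1|].
  have := ed _ e0; have := ed _ e1; set b := pr y1 _; set c := pr y1 _ => E1 E0.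
  have nm : ord_max != 0 :> 'I_n.+1 by rewrite -val_eqE/= -lt0n.
  have := congr1 (fun M : V => M 0 0) E1; have := congr1 (fun M : V => M ord_max 0) E1.
  have := congr1 (fun M : V => M 0 0) E0.
  rewrite !mxE !eqxx (eq_sym 0) (negbTE nm)/= => h1 h2 h3.
  have : b = 0.
    apply/eqP; move/eqP: h3; rewrite eq_sym mulf_eq0 => /orP[//|/eqP x0].
    by move: h1; rewrite x0 mulr0 => /eqP; rewrite oner_eq0.
  by move=> b0; move: h2; rewrite b0 mul0r => /eqP; rewrite oner_eq0.
have [cb cb0 Hcb] := cone_bound HC; have [r r0 Hr] := cone_open HC (cone_base HC).
have dn0 : 0 < `|d| by rewrite normr_gt0.
have yx t : pr y1 (x1 + t *: d) = 1 by rewrite prDr prZr yd mulr0 addr0 (cone_base1 HC).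
(* Since A p - x1 is in C for all p of the section, every p can be moved by del d inside C;
   repeating this contradicts boundedness of the section. *)
pose del := r / A / `|d|.
have del0 : 0 < del by rewrite !divr_gt0.
have step t : C (x1 + t *: d) -> C (x1 + (t + del) *: d).
  move=> Ct; have := HA _ Ct (yx t) => h.
  have -> : x1 + (t + del) *: d = A^-1 *: ((A *: (x1 + t *: d) - x1) + (x1 + (A * del) *: d)).
    rewrite addrA subrK scalerDr !scalerA mulrA mulVf ?gt_eqF// mul1r scale1r.
    by rewrite -addrA -scalerDl.
  apply: (cone_scale HC); first by rewrite invr_gt0.
  apply: (cone_add HC) => //; apply: Hr.
  have -> : A * del = r / `|d| by rewrite /del; field; rewrite !gt_eqF.
  by rewrite normrZ gtr0_norm ?divr_gt0// divfK// gt_eqF.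
have all k : C (x1 + (k%:R * del) *: d).
  elim: k => [|k IH]; first by rewrite mul0r scale0r addr0; exact: cone_base HC.
  by rewrite mulrSr mulrDl mul1r; exact: step.
pose k := (Num.truncn ((cb + `|x1|) / (del * `|d|))).+1.
have : (cb + `|x1|) / (del * `|d|) < k%:R by exact: truncnS_gt.
have dd : 0 < del * `|d| by rewrite mulr_gt0.
rewrite (ltr_pdivrMr _ _ dd) ltNge => /negP; apply.
have -> : k%:R * (del * `|d|) = `|(k%:R * del) *: d|.
  rewrite normrZ gtr0_norm; first by rewrite (mulrA k%:R del).
  by apply: mulr_gt0 => //; rewrite ltr0n.
have -> : (k%:R * del) *: d = x1 + (k%:R * del) *: d - x1 by rewrite addrAC subrr add0r.
rewrite (le_trans (ler_normB _ _))// lerD2r.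
by rewrite (le_trans (Hcb _ (all k)))// yx mulr1.
Qed.

Lemma family_exists : exists g, cocompact_family C y1 x1 g.
Proof.
have /card_set_bijP[f [_ finj fsurj]] := eq_card_nat Gamma_countable Gamma_infinite.
have /choice[h Hh] : forall j : nat, exists a, Gamma a /\ f a = j.
  by move=> j; have [a aG fa] := fsurj j Logic.I; exists a.
have hG j : Gamma (h j) by have [] := Hh j.
have fh j : f (h j) = j by have [] := Hh j.
have hf a : Gamma a -> h (f a) = a.
  by move=> aG; apply: finj; rewrite ?inE// fh.
have /choice[g Hg] : forall j, exists N, [/\ rg (h j) N, forall u, C u -> C (N *m u) &
    forall u, C u -> C (invmx N *m u)].
  by move=> j; exact: positive_lift.
have gr j : rg (h j) (g j) by have [] := Hg j.
have gC j u : C u -> C (g j *m u) by have [_ H _] := Hg j; exact: H.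
have giC j u : C u -> C (invmx (g j) *m u) by have [_ _ H] := Hg j; exact: H.
have Cx := cone_base HC.
have lift a N : Gamma a -> rg a N -> (forall u, C u -> C (N *m u)) ->
    exists kc : nat * R, 0 < kc.2 /\ N = kc.2 *: g kc.1.
  move=> aG aN NC; have [c c0 E] : exists2 c, c != 0 & N = c *: g (f a).
    by apply: rg_scale aN; have := gr (f a); rewrite hf.
  exists (f a, c); split => //=.
  have := cone_pos HC (NC _ Cx); rewrite E -scalemxAl prZr pmulr_lgt0//.
  exact: (cone_pos HC (gC _ _ Cx)).
exists g; split.
- by move=> i; exact: rg_unit (gr i).
- exact: gC.
- exact: giC.
- move=> i j; apply: (lift ((h i)^-1 * h j)%g).
  + by apply: GM => //; exact: GV.
  + by apply: rgM => //; exact: rgV.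
  + by move=> u Cu; rewrite -mulmxA; apply: (giC i); apply: (gC j).
- move=> i j; apply: (lift (h i * h j)%g).
  + exact: GM.
  + exact: rgM.
  + by move=> u Cu; rewrite -mulmxA; apply: (gC i); apply: (gC j).
- have [e e0 He] := discrete_at_one.
  (* The bound 1 excludes c = 0. *)
  exists (Num.min e 1); first by rewrite lt_min e0 ltr01.
  move=> i j c; rewrite lt_min => /andP[he h1].
  have c0 : c != 0.
    apply: contraTneq h1 => ->; rewrite scale0r sub0r normrN -leNgt.
    by have := mx_norm_coord (1%:M : 'M[R]_n.+1) 0 0; rewrite mxE eqxx normr1.
  have ij : ((h i)^-1 * h j)%g = 1%g.
    apply: (He _ _ _ _ he); first by apply: GM => //; exact: GV.
    by apply: rg_scaled => //; apply: rgM => //; exact: rgV.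
  have hij : h i = h j by rewrite -[h j]mul1g -(mulgV (h i)) -mulgA ij mulg1.
  by rewrite -(fh i) -(fh j) hij.
- have [J J0 HJ] := core_cover; exists J => // u Cu.
  have [[a N] [c [/= [aG aN] c0 y1w Cw [NC NiC]]]] := HJ u Cu.
  have [[k d] /= [d0 NE]] := lift a N aG aN NC.
  have NU := rg_unit aN; have gU := rg_unit (gr k).
  have iE : invmx (g k) = d *: invmx N.
    apply: (can_inj (mulKmx gU)); rewrite mulmxV// -scalemxAr scalemxAl -NE.
    by rewrite mulmxV.
  have dn : d != 0 by rewrite gt_eqF.
  exists (k, c / d) => /=; rewrite iE -scalemxAl scalerA divfK//.
  by split => //; exact: divr_gt0.
Qed.

End enumeration.

(** * Volume growth *)

Lemma unit_ball_volume_gt0 {R : realType} (n : nat) : 0 < unit_ball_volume n :> R.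
Proof.
suff : 0 < unit_ball_volume n :> R /\ 0 < unit_ball_volume n.+1 :> R by case.
elim: n => [|n [IH1 IH2]]; first by [].
by split => //=; rewrite mulr_gt0// divr_gt0// mulr_gt0// pi_gt0.
Qed.

(** * Covers by translates and the upper bound for the entropy *)

Section premeasure.
Context {R : realType} {T : Type}.
Implicit Types (d : T -> T -> R) (A : set T).

Lemma diameter_fin d A e : (diameter d A <= e%:E)%E ->
  exists r, [/\ diameter d A = r%:E, 0 <= r, r <= e & forall x y, A x -> A y -> d x y <= r].
Proof.
move=> h; have h0 : (0%:E <= diameter d A)%E by apply: ereal_sup_ubound; left.
have [r E] : exists r, diameter d A = r%:E.
  move: h h0; case: (diameter d A) => [r _ _|//|//]; by exists r.
exists r; rewrite E !lee_fin in h h0; split => // x y Ax Ay.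
by rewrite -lee_fin -E; apply: ereal_sup_ubound; right; exists (x, y).
Qed.

Lemma diameter_le d A (e : R) : 0 <= e -> (forall x y, A x -> A y -> d x y <= e) ->
  (diameter d A <= e%:E)%E.
Proof.
move=> e0 H; apply: ge_ereal_sup => _ [->|[[x y] [Ax Ay] <-]]; rewrite lee_fin//.
exact: H.
Qed.

(** The finite cover is continued by empty sets, which have diameter 0 and contribute nothing
    because n > 0. *)
Lemma premeasure_le (n : nat) (X : set T) d (delta e : R) A (s : seq (set T)) :
  (0 < n)%N -> 0 <= e -> e <= delta ->
  (forall F, List.In F s -> F `<=` X /\ forall x y, F x -> F y -> d x y <= e) ->
  (forall x, A x -> exists2 F, List.In F s & F x) ->
  (hausdorff_premeasure n X d delta A <=
    (unit_ball_volume n / 2 ^+ n * ((size s)%:R * e ^+ n))%:E)%E.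
Proof.
move=> n0 e0 ed Hs HA; set c := unit_ball_volume n / 2 ^+ n.
have c0 : 0 <= c by rewrite divr_ge0 ?exprn_ge0// ltW// unit_ball_volume_gt0.
pose F k := nth (set0 : set T) s k.
have inF k : (k < size s)%N -> List.In (F k) s.
  rewrite /F; elim: s k {Hs HA F} => [//|a s IH] [|k] /= ks; first by left.
  by right; apply: IH.
have F0 k : (size s <= k)%N -> F k = set0 by move=> ks; rewrite /F nth_default.
have dF k : (diameter d (F k) <= (if (k < size s)%N then e else 0)%:E)%E.
  case: ltnP => ks; last by rewrite F0//; apply: diameter_le.
  by have [_ h] := Hs _ (inF k ks); exact: diameter_le.
have dE k : exists r, [/\ diameter d (F k) = r%:E, 0 <= r &
    r <= if (k < size s)%N then e else 0].
  by have [r [E r0 re _]] := diameter_fin (dF k); exists r.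
have [r Hr] := choice dE.
apply: (@le_trans _ _ (\sum_(0 <= k <oo) (c%:E * diameter d (F k) ^+ n))%E).
  apply: ereal_inf_lbound; exists F => //; split.
  - move=> k x Fx; have [ks|ks] := ltnP k (size s).
      by have [h _] := Hs _ (inF k ks); exact: h.
    by move: Fx; rewrite F0.
  - move=> x /HA[E Es Ex].
    have [k ks Fk] : exists2 k, (k < size s)%N & F k = E.
      rewrite /F; elim: s Es {Hs HA F inF F0 dF dE r Hr} => [//|a s IH] /= [->|/IH[k ks kE]].
        by exists 0%N.
      by exists k.+1.
    by exists k => //; rewrite Fk.
  - move=> k; apply: (le_trans (dF k)); rewrite lee_fin; case: ifP => // _.
    exact: le_trans ed.
have tE k : (c%:E * diameter d (F k) ^+ n)%E = (c * r k ^+ n)%:E.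
  by have [-> _ _] := Hr k; rewrite -EFin_expe -EFinM.
under eq_eseriesr do rewrite tE.
have t0 k : 0 <= c * r k ^+ n.
  by have [_ h _] := Hr k; rewrite mulr_ge0// exprn_ge0.
have tle k : c * r k ^+ n <= if (k < size s)%N then c * e ^+ n else 0.
  have [_ h1 h2] := Hr k; move: h2; case: ifP => _ h2.
    by rewrite ler_wpM2l// lerXn2r// nnegrE.
  have -> : r k = 0 by apply/le_anti; rewrite h1 h2.
  by rewrite expr0n eqn0Ngt n0 mulr0.
apply: lime_le; first by apply: is_cvg_nneseries => k _ _; rewrite lee_fin.
apply: nearW => N; rewrite sumEFin lee_fin.
apply: (@le_trans _ _ (\sum_(0 <= k < N) if (k < size s)%N then c * e ^+ n else 0)).
  by apply: ler_sum => k _; exact: tle.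
have ce : 0 <= c * e ^+ n by rewrite mulr_ge0// exprn_ge0.
rewrite mulrCA mulr_natl; elim: N => [|N IH]; first by rewrite big_nil mulrn_wge0.
have : \sum_(0 <= k < N) (if (k < size s)%N then c * e ^+ n else 0) <= (c * e ^+ n) *+ minn N (size s).
  elim: N {IH} => [|N IH]; first by rewrite big_nil min0n.
  rewrite big_nat_recr//=; case: ltnP => Ns.
    by move: IH; rewrite (minn_idPl (ltnW Ns)) (minn_idPl Ns) mulrSr => IH; rewrite lerD2r.
  by move: IH; rewrite (minn_idPr Ns) (minn_idPr (leqW Ns)) addr0.
rewrite big_nat_recr//= => h; case: ltnP => Ns; last by rewrite addr0.
apply: (@le_trans _ _ (c * e ^+ n *+ minn N (size s) + c * e ^+ n)); first by rewrite lerD2r.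
by rewrite (minn_idPl (ltnW Ns)) -mulrSr ler_wpMn2l.
Qed.

End premeasure.

Section limsup.
Context {R : realType}.

Lemma limf_esup_le (f : R -> \bar R) (l : R) :
  (forall e, 0 < e -> exists r0, forall r, r0 < r -> (f r <= (l + e)%:E)%E) ->
  (limf_esup f (pinfty_nbhs R) <= l%:E)%E.
Proof.
move=> H; apply/lee_addgt0Pr => e e0; have [r0 Hr] := H e e0.
apply: (@le_trans _ _ (ereal_sup [set f x | x in [set r | r0 < r]])).
  apply: ereal_inf_lbound; exists [set r | r0 < r] => //.
  by exists r0; split; [exact: num_real|].
by apply: ge_ereal_sup => _ [r /= rr <-]; rewrite -EFinD; exact: Hr.
Qed.

Lemma limf_esup_ge (f : R -> \bar R) (l : R) :
  (forall e, 0 < e -> exists r0, forall r, r0 < r -> ((l - e)%:E <= f r)%E) ->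
  (l%:E <= limf_esup f (pinfty_nbhs R))%E.
Proof.
move=> H; apply: le_ereal_inf_tmp => _ [V [M [_ HM]] <-].
apply/lee_addgt0Pr => e e0; have [r0 Hr] := H e e0.
pose r := Num.max M r0 + 1.
have Mr : M < r by rewrite /r (le_lt_trans (_ : _ <= Num.max M r0)) ?ltrDl// le_max lexx.
have rr : r0 < r by rewrite /r (le_lt_trans (_ : _ <= Num.max M r0)) ?ltrDl// le_max lexx orbT.
rewrite -leeBlDr// -EFinB; apply: (le_trans (Hr r rr)).
by apply: ereal_sup_ubound; exists r => //; exact: HM.
Qed.

End limsup.

Section volume_upper.
Context {R : realType} {n : nat}.
Notation P := (projective R n.+1).
Notation V := 'cV[R]_n.+1.
Variables (Om : set P) (o : P) (h : PGL R n.+1) (D : set 'cV[R]_n) (xo : 'cV[R]_n)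
  (g : nat -> 'M[R]_n.+1).
Hypothesis n0 : (0 < n)%N.
Hypothesis chart : exists g : PGL R n.+1, bounded_convex_in_chart Om g.
Hypothesis nD : nice D.
Notation C := (chart_cone h D).
Notation y1 := (delta_mx 0 0 *m invmx (srepr h)).
Notation x1 := (srepr h *m hom xo).
Hypothesis LC : lift_cone Om C.
Hypothesis oE : rp o x1.
Hypothesis HC : based_cone C y1 x1.
Hypothesis Hg : cocompact_family C y1 x1 g.
Notation tau := (tau y1 x1 g).
Let hU := PGL_unit h.

Let chartE w : C w -> pr y1 w = 1 -> exists2 z, D z & w = srepr h *m hom z.
Proof.
move=> [w0 Dw]; rewrite prM => y1w; set u := invmx _ *m w in w0 Dw y1w.
have u1 : u 0 0 = 1.
  by rewrite -y1w -[u in LHS]mul1mx /pr -rowE mul1mx !mxE.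
have uE := hconeE w0; rewrite u1 scale1r in uE; rewrite u1 in Dw.
by exists (1^-1 *: @dsubmx _ 1 n 1 u) => //; rewrite -uE mulKVmx.
Qed.

(** A point of the ball is a translate by some g i of a point of the compact part, and its distance
    from o bounds tau i by K e^(2 r). Cutting the compact part by a grid of J^n cells of Hilbert
    diameter at most L / J makes the diameters small without changing the mass, as J^n (L / J)^n =
    L^n. *)
Lemma ball_cover : exists K L : R, [/\ 0 < K, 0 < L & forall (r delta : R), 0 < delta ->
  forall s : seq nat, (forall i, tau i <= K * expR (2 * r) -> i \in s) ->
  (hausdorff_premeasure n Om (hilbert_metric Om) delta
    (metric_ball Om (hilbert_metric Om) o r) <=
   (unit_ball_volume n / 2 ^+ n * ((size s)%:R * L ^+ n))%:E)%E].
Proof.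
have [K K0 HK] := fam_cocpt Hg.
have [r r0 Hr] := cone_open HC (cone_base HC).
have [b b0 Hb] := nice_bounded nD.
pose b' := b + 1; have b'0 : 0 < b' by rewrite addr_gt0.
pose NG := n.+1%:R * `|srepr h| + 1.
have NG0 : 0 < NG by rewrite ltr_wpDl// mulr_ge0.
pose L := K / r * NG * (2 * b').
have L0 : 0 < L by rewrite !mulr_gt0// invr_gt0.
exists K, L; split => // rr delta delta0 s Hs.
pose J := (Num.truncn (L / delta)).+1.
have J0 : 0 < J%:R :> R by rewrite ltr0n.
have LJ : L / J%:R <= delta.
  by rewrite ler_pdivrMr// mulrC -ler_pdivrMr// ltW// truncnS_gt.
pose core w := [/\ C w, pr y1 w = 1 & C (K *: w - x1)].
pose inv (z : 'cV[R]_n) (a : 'I_n) := (z a 0 + b') * J%:R / (2 * b').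
pose cell (f : {ffun 'I_n -> 'I_J}) (z : 'cV[R]_n) :=
  forall a, (f a)%:R <= inv z a < (f a)%:R + 1.
have cellP z : D z -> exists f, cell f z.
  move=> Dz; have zb a : `|z a 0| <= b by rewrite (le_trans (mx_norm_coord _ _ _))// Hb.
  have i0 a : 0 <= inv z a.
    rewrite divr_ge0 ?mulr_ge0 ?(ltW b'0)//.
    by have := zb a; rewrite ler_norml => /andP[h1 _]; rewrite /b'; move: h1 b0; clra.
  have iJ a : (Num.truncn (inv z a) < J)%N.
    rewrite truncn_lt_nat// /inv mulrAC -[ltRHS]mul1r ltr_pM2r// ltr_pdivrMr ?mulr_gt0//.
    by have := zb a; rewrite ler_norml mul1r => /andP[_ h1]; rewrite /b'; move: h1 b0; clra.
  exists [ffun a => Ordinal (iJ a)] => a; rewrite ffunE /=.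
  by have := truncn_itv (i0 a); rewrite -natr1.
have celld f z z' : cell f z -> cell f z' -> `|z - z'| <= 2 * b' / J%:R.
  move=> cz cz'; apply: mx_norm_le => [|a j]; first by rewrite divr_ge0// mulr_ge0// ltW.
  rewrite ord1 !mxE; have := cz a; have := cz' a => /andP[h1 h2] /andP[h3 h4].
  have -> : z a 0 - z' a 0 = (inv z a - inv z' a) * (2 * b' / J%:R).
    by rewrite /inv; field; rewrite !gt_eqF.
  have c0 : 0 <= 2 * b' / J%:R by rewrite divr_ge0// mulr_ge0// ltW.
  rewrite normrM (ger0_norm c0) -[leRHS]mul1r ler_wpM2r// ler_norml.
  by apply/andP; split; [move: h1 h2 h3 h4|move: h1 h2 h3 h4]; clra.
pose F i f : set P := [set p | exists z, [/\ cell f z, core (srepr h *m hom z)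
   & rp p (g i *m (srepr h *m hom z))]].
pose S := [seq F i f | i <- s, f <- enum {: {ffun 'I_n -> 'I_J}}].
have HO := LC.2.
have gC i u : C u -> C (g i *m u) by exact: (fam_C Hg).
(* A point w of the compact part dominates x1 / K, so a point at small norm distance from it is
   dominated by (1 + L / J) w. Two such dominations bound the Hilbert distance by ln(1 + L / J) <= L
   / J. *)
have close i w w' : core w -> core w' -> `|w - w'| <= NG * (2 * b' / J%:R) ->
    C ((1 + L / J%:R) *: (g i *m w) - g i *m w').
  move=> [Cw _ Cgw] _ ww.
  have sJ : 0 < L / J%:R by rewrite divr_gt0.
  set t := L / J%:R in sJ *.
  rewrite scalemxAr -mulmxBr; apply: gC.
  have -> : (1 + t) *: w - w' = (t / K) *: ((K *: w - x1) + (x1 + (K / t) *: (w - w'))).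
    rewrite addrA subrK scalerDr !scalerA divfK ?gt_eqF//.
    rewrite (_ : t / K * (K / t) = 1) ?scale1r; last by field; rewrite !gt_eqF.
    by rewrite scalerDl scale1r addrAC addrC.
  apply: (cone_scale HC); first by rewrite divr_gt0.
  apply: (cone_add HC) => //; apply: Hr.
  rewrite normrZ gtr0_norm ?divr_gt0//.
  apply: (le_trans (ler_wpM2l (ltW (divr_gt0 K0 sJ)) ww)).
  by rewrite /t /L le_eqVlt; apply/orP; left; apply/eqP; field; rewrite !gt_eqF.
have -> : (size s)%:R * L ^+ n = (size S)%:R * (L / J%:R) ^+ n.
  rewrite size_allpairs -cardE card_ffun !card_ord natrM natrX expr_div_n.
  by field; rewrite expf_neq0// gt_eqF.
apply: premeasure_le => //; first by rewrite divr_ge0// ltW.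
  move=> E ES; have [i [f ->]] : exists i f, E = F i f.
    move: ES; rewrite /S; elim: (s) => [//|i s' IH] /=.
    move=> hin; case: (List.in_app_or _ _ _ hin) => {hin}[|/IH//].
    elim: (enum _) => [//|f fs IH'] /= [<-|/IH'//]; by exists i, f.
  split=> [p [z [_ [Cz _ _] pz]]|p q [z [cz kz pz]] [z' [cz' kz' qz']]].
    by apply/HO; exists (g i *m (srepr h *m hom z)) => //; exact: gC.
  have [Cz _ _] := kz; have [Cz' _ _] := kz'.
  have zz : `|srepr h *m hom z - srepr h *m hom z'| <= NG * (2 * b' / J%:R).
    rewrite -mulmxBr (le_trans (mx_norm_mul _ _))// mulrA.
    have dh : `|hom z - hom z'| <= 2 * b' / J%:R.
      have := celld f z z' cz cz' => hh.
      rewrite -scaleN1r !homE colvZ colvD mulr1 subrr scaleN1r.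
      apply: mx_norm_le => [|a j]; first exact: le_trans hh.
      rewrite /colv mxE; case: splitP => c _; last by rewrite (le_trans (mx_norm_coord _ _ _)).
      by rewrite mxE mul0rn normr0 (le_trans _ hh).
    by apply: ler_pM => //; rewrite /NG lerDl.
  have zz' : `|srepr h *m hom z' - srepr h *m hom z| <= NG * (2 * b' / J%:R) by rewrite distrC.
  have sJ : 0 < L / J%:R by rewrite divr_gt0.
  apply: (le_trans (hilbert_le chart LC (gC i _ Cz) (gC i _ Cz') pz qz'
    (close i _ _ kz kz' zz) (close i _ _ kz' kz zz'))).
  have t1 : 0 < 1 + L / J%:R by rewrite addr_gt0.
  rewrite lnM ?posrE// -mulr2n -[ln _ *+ 2]mulr_natl mulrA mulVf// mul1r.
  by have := le_ln1Dx (lt_trans (ltrN10 R) sJ).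
move=> p [Op dp]; have [u Cu pu] := (HO p).1 Op.
have Cx := cone_base HC.
have [l [l' [l0 l'0 Cl Cl' ll]]] := hilbert_lt chart LC Cx Cu oE pu dp.
have [[i c] /= [c0 y1w Cw]] := HK u Cu.
have giU := fam_unit Hg i.
set w := c *: (invmx (g i) *m u) in y1w Cw.
have Cww : C w by apply: (cone_scale HC) => //; exact: (fam_invC Hg).
have uE : u = c^-1 *: (g i *m w).
  by rewrite /w -scalemxAr mulKVmx// scalerA mulVf ?scale1r// gt_eqF.
have lfu : pr (lf y1 g i) u = c^-1.
  by rewrite /lf prM -[c^-1]mulr1 -y1w /w prZr mulKf// gt_eqF.
have t1 : pr (lf y1 g i) x1 <= l' * c^-1.
  have := lf_pos HC Hg i Cl'; rewrite prBr prZr lfu subr_gt0; exact: ltW.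
have t2 : pr y1 (vf x1 g i) <= K * (c * l).
  have hh := cone_pos HC (gC i _ Cw); rewrite mulmxBr -scalemxAr prBr prZr subr_gt0 in hh.
  apply: (le_trans (ltW hh)); rewrite ler_pM2l//.
  have -> : g i *m w = c *: u by rewrite uE scalerA mulfV ?scale1r// gt_eqF.
  rewrite prZr ler_pM2l//.
  by have := cone_pos HC Cl; rewrite prBr prZr (cone_base1 HC) mulr1 subr_gt0 => /ltW.
have tT : tau i <= K * expR (2 * rr).
  have := ler_pM (ltW (lf_pos HC Hg i Cx)) (ltW (cone_pos HC (gC i _ Cx))) t1 t2.
  move=> /le_trans; apply.
  have -> : l' * c^-1 * (K * (c * l)) = K * (l * l') by field; rewrite gt_eqF.
  by rewrite ler_pM2l// ltW.
have [z Dz wz] := chartE Cww y1w.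
have [f cf] := cellP z Dz.
exists (F i f); last first.
  exists z; split => //; rewrite -wz//.
  have -> : g i *m w = c *: u by rewrite uE scalerA mulfV ?scale1r// gt_eqF.
  by apply: rp_scaled => //; rewrite gt_eqF.
have is_ := Hs i tT.
rewrite /S; elim: (s) is_ => [//|j s' IH]; rewrite in_cons => /orP[/eqP <-|/IH] /=.
  apply: List.in_or_app; left; apply: List.in_map.
  have : f \in enum {: {ffun 'I_n -> 'I_J}} by rewrite mem_enum.
  by elim: (enum _) => [//|a t IHt]; rewrite in_cons => /orP[/eqP ->|/IHt]; [left|right].
by move=> hin; apply: List.in_or_app; right.
Qed.

(** If the sum of tau^-k is at most M, then at most M T^k indices have tau <= T; with T = K e^(2 r)
    the volume is O(e^(2 k r)). *)
Lemma entropy_le (k : R) : 0 <= k -> tau_summable y1 x1 g k ->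
  (volume_entropy Om (hilbert_metric Om) (busemann_volume Om) o <= (2 * k)%:E)%E.
Proof.
move=> k0 ks; have [K [L [K0 L0 HB]]] := ball_cover.
have [M HM] := tau_summable_seq ks.
have [M0 M1] : 0 < `|M| + 1 /\ M <= `|M| + 1.
  by split; [rewrite ltr_wpDl|rewrite (le_trans (ler_norm _))// lerDl].
pose c := unit_ball_volume n / 2 ^+ n : R.
have c0 : 0 < c by rewrite divr_gt0 ?exprn_gt0// unit_ball_volume_gt0.
pose B := c * ((`|M| + 1) * K `^ k * L ^+ n).
have B0 : 0 < B.
  apply: mulr_gt0 => //; apply: mulr_gt0; last exact: exprn_gt0.
  by apply: mulr_gt0 => //; exact: powR_gt0.
have vol r : (busemann_volume Om (metric_ball Om (hilbert_metric Om) o r) <=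
    (B * expR (2 * k * r))%:E)%E.
  apply: ge_ereal_sup => _ [delta /= d0 <-].
  have [s us Hs] := tau_shell HC Hg (K * expR (2 * r)).
  apply: (le_trans (HB r delta d0 s _)); first by move=> i hi; rewrite Hs.
  rewrite lee_fin -/c /B -(mulrA c) ler_pM2l//.
  have T0 : 0 < K * expR (2 * r) by rewrite mulr_gt0 ?expR_gt0.
  have sz : (size s)%:R <= (`|M| + 1) * (K * expR (2 * r)) `^ k.
    have := le_trans (HM s us) M1.
    have : \sum_(i <- s) (K * expR (2 * r)) `^ (- k) <= \sum_(i <- s) tau i `^ (- k).
      rewrite big_seq [leRHS]big_seq; apply: ler_sum => i; rewrite Hs => hi.
      exact: powRN_le (tau_gt0 HC Hg i) hi.
    move=> /le_trans hh /hh; rewrite big_const_seq count_predT iter_addr_0.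
    by rewrite powRN -[_ *+ _]mulr_natr mulrC ler_pdivrMr ?powR_gt0.
  have -> : (`|M| + 1) * K `^ k * L ^+ n * expR (2 * k * r) =
     (`|M| + 1) * (K * expR (2 * r)) `^ k * L ^+ n.
    rewrite powRM ?(ltW K0) ?expR_ge0//.
    have -> : expR (2 * r) `^ k = expR (2 * k * r).
      by rewrite -expRM; congr expR; ring.
    ring.
  by rewrite ler_pM2r// exprn_gt0.
apply: limf_esup_le => e e0; exists (Num.max 1 (`|ln B| / e)) => r.
rewrite gt_max => /andP[r1 re]; have r0 : 0 < r by exact: lt_trans r1.
have Be : 0 < B * expR (2 * k * r) by rewrite mulr_gt0 ?expR_gt0.
apply: (@le_trans _ _ ((r^-1)%:E * (ln (B * expR (2 * k * r)))%:E)%E).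
  rewrite lee_pmul2l ?lte_fin ?invr_gt0//.
  have := vol r; set mu := busemann_volume _ _ => vr.
  have [mu0|mu0] := leP mu 0%E; first by rewrite le0_lneNy ?leNye.
  rewrite -lne_EFin//; rewrite lee_lne ?in_itv/= ?leey ?andbT//.
  - exact: ltW.
  - by rewrite lee_fin ltW.
rewrite -EFinM lee_fin lnM ?posrE ?expR_gt0// expRK mulrDr.
have -> : r^-1 * (2 * k * r) = 2 * k by field; rewrite gt_eqF.
rewrite addrC lerD2l ler_pdivrMl// (le_trans (ler_norm _))//.
by move: re; rewrite ltr_pdivrMr// => /ltW.
Qed.

End volume_upper.

(** * Lower bound for covers of a box *)

Section box_cover.
Context {R : realType}.

Lemma exprn_incr (n : nat) (rho t : R) : 0 <= rho -> 0 < t ->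
  exists2 eta, 0 < eta & (rho + eta) ^+ n <= rho ^+ n + t.
Proof.
move=> r0 t0.
have [C C0 HC] : exists2 C, 0 <= C & forall eta, 0 <= eta <= 1 ->
    (rho + eta) ^+ n <= rho ^+ n + C * eta.
  elim: n => [|n [C C0 IH]]; first by exists 0 => // eta _; rewrite !expr0 mul0r addr0.
  exists (rho ^+ n + C * rho + C); first by rewrite !addr_ge0 ?mulr_ge0 ?exprn_ge0.
  move=> eta /andP[e0 e1].
  have re : 0 <= rho + eta by rewrite addr_ge0.
  rewrite !exprSr; apply: (le_trans (ler_wpM2r re (IH eta _))); first by rewrite e0.
  have : C * eta * eta <= C * eta by rewrite ler_piMr// mulr_ge0.
  by lra.
have C1 : 0 < C + 1 by rewrite ltr_wpDl.
exists (Num.min 1 (t / (C + 1))); first by rewrite lt_min ltr01 divr_gt0.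
have m0 : 0 <= Num.min 1 (t / (C + 1)) by rewrite le_min ler01 divr_ge0// ltW.
apply: (le_trans (HC _ _)); first by rewrite m0 ge_min lexx.
rewrite lerD2l (@le_trans _ _ (C * (t / (C + 1))))//.
  by rewrite ler_wpM2l// ge_min lexx orbT.
by rewrite mulrA ler_pdivrMr// mulrC ler_wpM2l ?(ltW t0)// lerDl.
Qed.

(** The induction also carries the bound J - t + L, which is what remains below 2 L + 1 after
    counting one more J within L of t. *)
Lemma interval_count (t L : R) (J : nat) : 0 <= L ->
  \sum_(j < J) (`|j%:R - t| < L)%R%:R <= 2 * L + 1 :> R.
Proof.
move=> L0; rewrite -(big_mkord xpredT (fun j => (`|j%:R - t| < L)%R%:R : R)).
have [//] : \sum_(0 <= j < J) (`|j%:R - t| < L)%R%:R <= 2 * L + 1 :> R /\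
  \sum_(0 <= j < J) (`|j%:R - t| < L)%R%:R <= Num.max 0 (J%:R - t + L).
elim: J => [|J [IH1 IH2]].
  by rewrite big_nil le_max lexx; split => //; rewrite addr_ge0// mulr_ge0.
rewrite big_nat_recr//=; set S := \sum_(_ <= _ < _) _ in IH1 IH2 *.
have [h|h] := boolP (`|J%:R - t| < L); last first.
  rewrite addr0; split => //; apply: (le_trans IH2).
  rewrite ge_max le_max lexx/= le_max; apply/orP; right.
  by rewrite -natr1; lra.
move: h; rewrite ltr_norml => /andP[h1 h2] /=.
have S1 : S <= J%:R - t + L by move: IH2; rewrite (max_idPr _)//; lra.
rewrite le_max -natr1; split; first by move: S1 h2; lra.
by apply/orP; right; move: S1; lra.
Qed.

Lemma cvg_prodr (I : Type) (r : seq I) (F : I -> nat -> R) (l : I -> R) :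
  (forall i, F i @ \oo --> l i) ->
  (fun j => \prod_(i <- r) F i j) @ \oo --> \prod_(i <- r) l i.
Proof.
move=> Fl; elim: r => [|i r IH].
  by rewrite big_nil; under eq_cvg do rewrite big_nil; exact: cvg_cst.
rewrite big_cons; under eq_cvg do rewrite big_cons.
by apply: cvgM => //; exact: Fl.
Qed.

(** Volume comparison without integration: count the points of a grid of mesh 1 / (J + 1) in the
    cube and in each box, divide by their number and let J tend to infinity. *)
Lemma grid_count (n N : nat) (e h : nat -> 'I_n -> R) :
  (forall k i, 0 <= h k i) ->
  (forall s : 'I_n -> R, (forall i, 0 <= s i <= 1) ->
    exists2 k, (k < N)%N & forall i, `|s i - e k i| < h k i) ->
  1 <= \sum_(k < N) \prod_(i < n) (2 * h k i).
Proof.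
move=> h0 H.
have key J : 1 <= \sum_(k < N) \prod_(i < n) (2 * h k i + J.+1%:R^-1).
  have J0 : 0 < J.+1%:R :> R by rewrite ltr0n.
  pose ind (k : nat) (i : 'I_n) (j : 'I_J.+1) : R := (`|j%:R / J.+1%:R - e k i| < h k i)%R%:R.
  have ind0 k i j : 0 <= ind k i j by rewrite ler0n.
  have cnt k i : \sum_j ind k i j <= J.+1%:R * (2 * h k i + J.+1%:R^-1).
    have := @interval_count (J.+1%:R * e k i) (J.+1%:R * h k i) J.+1.
    rewrite mulr_ge0 ?(ltW J0)// => /(_ isT); rewrite mulrDr mulfV ?gt_eqF//.
    rewrite mulrCA => hh; apply: le_trans hh; apply: ler_sum => j _.
    have -> : j%:R - J.+1%:R * e k i = J.+1%:R * (j%:R / J.+1%:R - e k i).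
      by rewrite mulrBr mulrCA mulfV ?mulr1// gt_eqF.
    by rewrite normrM (gtr0_norm J0) ltr_pM2l.
  have : \sum_(f : {ffun 'I_n -> 'I_J.+1}) (1 : R) <=
      \sum_(f : {ffun 'I_n -> 'I_J.+1}) \sum_(k < N) \prod_i ind k i (f i).
    apply: ler_sum => f _.
    have fr (i : 'I_n) : 0 <= ((f i)%:R / J.+1%:R : R) <= 1.
      by rewrite divr_ge0//= ler_pdivrMr// mul1r ler_nat ltnW.
    have [k kN Hk] := H (fun i => (f i)%:R / J.+1%:R) fr.
    rewrite (bigD1 (Ordinal kN))//= -[leLHS]addr0 lerD//.
      by rewrite big1// => i _; rewrite /ind Hk.
    by apply: sumr_ge0 => k' _; apply: prodr_ge0 => i _.
  rewrite sumr_const card_ffun !card_ord exchange_big/=.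
  under eq_bigr do rewrite -bigA_distr_bigA/=.
  move=> hle; have {}hle := le_trans hle (_ : _ <= \sum_(k < N) \prod_(i < n) (J.+1%:R * (2 * h k i + J.+1%:R^-1))).
  have : (J.+1 ^ n)%:R <= \sum_(k < N) \prod_(i < n) (J.+1%:R * (2 * h k i + J.+1%:R^-1)) :> R.
    apply: hle; apply: ler_sum => k _; apply: ler_prod => i _.
    by rewrite cnt sumr_ge0.
  under [leRHS]eq_bigr do rewrite big_split/= prodr_const card_ord.
  by rewrite -mulr_sumr natrX -[leLHS]mulr1 ler_pM2l ?exprn_gt0.
have c1 : (fun J => \sum_(k < N) \prod_(i < n) (2 * h k i + J.+1%:R^-1)) @ \oo -->
    \sum_(k < N) \prod_(i < n) (2 * h k i).
  apply: cvg_sumr => k; apply: cvg_prodr => i.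
  rewrite -[X in _ --> X]addr0; apply: cvgD; [exact: cvg_cst|exact: cvg_harmonic].
have c2 : (fun=> 1 : R) @ \oo --> (1 : R) by exact: cvg_cst.
by apply: (ler_cvg_to c2 c1); apply: nearW.
Qed.

(** The sets E k are enlarged to open boxes about one of their points, at a total cost of at most t;
    compactness of the cube then leaves finitely many boxes for [grid_count]. *)
Lemma box_cover_le (n : nat) (a : 'I_n -> R) (rho : nat -> R)
    (E : nat -> set 'rV[R]_n) (M : R) : (forall i, 0 < a i) ->
  (forall k, 0 <= rho k) ->
  (forall k s s', E k s -> E k s' -> forall i, `|s 0 i - s' 0 i| <= a i * rho k) ->
  (forall s : 'rV[R]_n, (forall i, 0 <= s 0 i <= 1) -> exists k, E k s) ->
  (forall N, \sum_(0 <= k < N) rho k ^+ n <= M) ->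
  1 <= 2 ^+ n * (\prod_i a i) * M.
Proof.
move=> a0 rho0 HE Ecov HM; pose A := 2 ^+ n * \prod_i a i.
have A0 : 0 < A by rewrite mulr_gt0 ?exprn_gt0// prodr_gt0.
apply: (@ler_small_slack _ _ _ A 1) => // t t0 _.
have /choice[eta Heta] : forall k, exists eta, 0 < eta /\
    (rho k + eta) ^+ n <= rho k ^+ n + t / 2 ^+ k.+1.
  move=> k; have tk : 0 < t / 2 ^+ k.+1 by rewrite divr_gt0// exprn_gt0.
  by have [eta e0 He] := exprn_incr n (rho0 k) tk; exists eta.
have /choice[e He] : forall k, exists e, E k !=set0 -> E k e.
  by move=> k; have [[s Es]|nE] := pselect (E k !=set0); [exists s|exists 0].
(* A positive number below every a i, which also exists for n = 0. *)
pose am := (1 + \sum_i (a i)^-1)^-1.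
have am0 : 0 < am by rewrite invr_gt0 ltr_wpDr// sumr_ge0// => i _; rewrite invr_ge0 ltW.
have ama i : am <= a i.
  rewrite -[a i]invrK lef_pV2 ?posrE ?invr_gt0//; last first.
    by rewrite ltr_wpDr// sumr_ge0// => j _; rewrite invr_ge0 ltW.
  rewrite (bigD1 i)//= addrCA lerDl addr_ge0// sumr_ge0// => j _.
  by rewrite invr_ge0 ltW.
pose Q := [set s : 'rV[R]_n | forall i, s 0 i \in `[0, 1]%R].
have cQ : compact Q.
  by apply: (@rV_compact R n (fun=> `[0, 1]%classic)) => _; exact: segment_compact.
pose B (k : nat) (s : 'rV[R]_n) := forall i, `|s 0 i - e k 0 i| < a i * (rho k + eta k).
have [N HN] : exists N, forall s, Q s -> exists2 k, (k < N)%N & B k s.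
  have /compact_near_coveringP/(_ nat \oo (fun N s => exists2 k, (k < N)%N & B k s)) [] // := cQ.
    move=> s Qs; have [|k Ek] := Ecov s; first by move=> i; have := Qs i; rewrite in_itv.
    have [ek _] := Heta k.
    exists (ball s (am * eta k), [set j | (k < j)%N]).
      split => /=; first by apply: nbhsx_ballx; rewrite mulr_gt0.
      exact: nbhs_infty_gt.
    move=> [s' j] [/= [_ bs] kj]; exists k => // i.
    have h1 := HE k s _ Ek (He k (ex_intro _ s Ek)) i.
    have h2 : `|s' 0 i - s 0 i| < am * eta k by have := bs 0 i; rewrite /ball/= distrC.
    have -> : s' 0 i - e k 0 i = (s' 0 i - s 0 i) + (s 0 i - e k 0 i) by rewrite addrA subrK.
    rewrite (le_lt_trans (ler_normD _ _))// mulrDr addrC ler_ltD//.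
    by rewrite (lt_le_trans h2)// ler_pM2r.
  by move=> N _ HN; exists N => s Qs; exact: (HN N (leqnn N)).
have h0 (k : nat) i : 0 <= a i * (rho k + eta k).
  by have [ek _] := Heta k; rewrite mulr_ge0 ?(ltW (a0 i))// addr_ge0// ltW.
have := @grid_count n N (fun k i => e k 0 i) (fun k i => a i * (rho k + eta k)) h0.
move=> /(_ _)/le_trans; apply.
  move=> s Hs; have [|k kN Bk] := HN (\row_i s i).
    by move=> i; rewrite mxE in_itv/=; exact: Hs.
  by exists k => // i; have := Bk i; rewrite mxE.
have pE (k : 'I_N) : \prod_(i < n) (2 * (a i * (rho k + eta k))) = A * (rho k + eta k) ^+ n.
  rewrite big_split/= prodr_const card_ord big_split/= prodr_const card_ord.
  by rewrite mulrA.
rewrite (eq_bigr _ (fun k _ => pE k)).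
rewrite -mulr_sumr -mulrDr ler_pM2l//.
apply: (@le_trans _ _ (\sum_(k < N) (rho k ^+ n + t / 2 ^+ k.+1))).
  by apply: ler_sum => k _; have [_ h] := Heta k.
rewrite big_split/= lerD//.
  by have := HM N; rewrite big_mkord.
have geo : \sum_(k < N) t / 2 ^+ k.+1 = t - t / 2 ^+ N.
  elim: N {HN pE} => [|N IH]; first by rewrite big_ord0 expr0 divr1 subrr.
  by rewrite big_ord_recr/= IH exprS; field; rewrite expf_neq0// pnatr_eq0.
by rewrite geo gerBl divr_ge0 ?exprn_ge0// ltW.
Qed.

End box_cover.

(** * The ball *)

Section standard_cone.
Context {R : realType} {n : nat}.
Notation V := 'cV[R]_n.+1.

(** The cone v_0 > 0, v_0^2 > v_1^2 + ... + v_n^2; the factor 2 appears because v.v contains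
    v_0^2. *)
Definition std : set V := [set v : V | 0 < v 0 0 /\ pr v^T v < 2 * v 0 0 ^+ 2].

Lemma dot_ge0 m (u : 'cV[R]_m) : 0 <= pr u^T u.
Proof. by rewrite prE sumr_ge0// => a _; rewrite mxE -expr2 sqr_ge0. Qed.

Lemma dot_coord m (u : 'cV[R]_m) i : u i 0 ^+ 2 <= pr u^T u.
Proof.
rewrite prE (bigD1 i)// [u^T 0 i]mxE -expr2 lerDl sumr_ge0// => a _.
by rewrite mxE -expr2 sqr_ge0.
Qed.

Lemma dot_sym m (u v : 'cV[R]_m) : pr u^T v = pr v^T u.
Proof. by rewrite -prT trmxK. Qed.

Lemma dot_CS m (u v : 'cV[R]_m) : pr u^T v ^+ 2 <= pr u^T u * pr v^T v.
Proof.
have q0 := dot_ge0 v.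
have [v0|vn] := eqVneq (pr v^T v) 0.
  by rewrite (sqr_sum_eq0 v0) !pr0r expr0n/= mulr0.
have vp : 0 < pr v^T v by rewrite lt_neqAle eq_sym vn.
have := dot_ge0 (pr v^T v *: u - pr u^T v *: v).
have -> : pr (pr v^T v *: u - pr u^T v *: v)^T (pr v^T v *: u - pr u^T v *: v) =
   pr v^T v * (pr u^T u * pr v^T v - pr u^T v ^+ 2).
  rewrite linearB [X in X - _]linearZ [X in _ - X]linearZ/=.
  by rewrite !prBl !prBr !prZl !prZr (dot_sym v u); ring.
by rewrite pmulr_rge0// subr_ge0.
Qed.

Lemma std_product u v : std u -> std v -> pr u^T v < 2 * (u 0 0 * v 0 0).
Proof.
move=> [u0 hu] [v0 hv]; rewrite (le_lt_trans (ler_norm _))//.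
have p0 : 0 <= 2 * (u 0 0 * v 0 0) by rewrite !mulr_ge0// ltW.
rewrite -(ger0_norm p0) -!sqrtr_sqr ltr_sqrt; last first.
  by rewrite exprn_gt0// !mulr_gt0.
apply: (le_lt_trans (dot_CS u v)).
have -> : (2 * (u 0 0 * v 0 0)) ^+ 2 = (2 * u 0 0 ^+ 2) * (2 * v 0 0 ^+ 2) by ring.
by rewrite ltr_pM// dot_ge0.
Qed.

Lemma stdD u v : std u -> std v -> std (u + v).
Proof.
move=> su sv; have h := std_product su sv; have [u0 hu] := su; have [v0 hv] := sv.
split; first by rewrite mxE addr_gt0.
rewrite mxE linearD/= !prDl !prDr (dot_sym v u).
by move: h hu hv; clra.
Qed.

Lemma stdZ c u : 0 < c -> std u -> std (c *: u).
Proof.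
move=> c0 [u0 hu]; split; first by rewrite mxE mulr_gt0.
rewrite mxE linearZ/= prZl prZr exprMn mulrA -expr2 mulrCA ltr_pM2l// exprn_gt0//.
Qed.

Lemma based_std : based_cone std (delta_mx 0 0) (delta_mx 0 0).
Proof.
have p0 (u : V) : pr (delta_mx 0 0) u = u 0 0.
  by rewrite -[u]mul1mx /pr -rowE mul1mx !mxE.
split.
- move=> u [u0 hu]; pose f := 2 * u 0 0 ^+ 2 - pr u^T u.
  have f0 : 0 < f by rewrite subr_gt0.
  pose K := 4 * u 0 0 + 2 * (n.+1%:R * `|u|) + n.+1%:R + 1.
  have K0 : 0 < K.
    by rewrite ltr_wpDl// addr_ge0// addr_ge0// mulr_ge0// ?mulr_ge0// ltW.
  exists (Num.min 1 (Num.min (u 0 0 / 2) (f / (2 * K)))).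
    by rewrite !lt_min ltr01 !divr_gt0// mulr_gt0.
  move=> w; rewrite !le_min => /and3P[w1 w2 w3].
  have w00 : `|w 0 0| <= `|w| by exact: mx_norm_coord.
  have hw0 : - `|w| <= w 0 0 by have := w00; rewrite ler_norml => /andP[].
  split; first by rewrite mxE; move: hw0 w2 u0; clra.
  rewrite mxE linearD/= !prDl !prDr (dot_sym w u).
  have h1 : pr u^T w <= n.+1%:R * `|u| * `|w|.
    rewrite (le_trans (ler_norm _))// (le_trans (pr_norm _ _))// mx_norm_tr mulrA//.
  have h2 : pr w^T w <= n.+1%:R * `|w|.
    rewrite (le_trans (ler_norm _))// (le_trans (pr_norm _ _))// mx_norm_tr.
    by rewrite ler_wpM2l// ler_piMl.
  have h3 : u 0 0 * - `|w| <= u 0 0 * w 0 0 by rewrite ler_wpM2l// ltW.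
  have h4 : K * `|w| <= f / 2.
    by rewrite mulrC -ler_pdivlMr// -mulrA -invfM.
  have h5 := sqr_ge0 (w 0 0); have h6 := normr_ge0 w.
  by move: h1 h2 h3 h4 h5 h6 f0; rewrite /f /K; clra.
- exact: stdD.
- exact: stdZ.
- by move=> u [u0 _]; rewrite p0.
- exists 2 => // u [u0 hu]; rewrite p0; apply: mx_norm_le => [|i j].
    by rewrite mulr_ge0// ltW.
  rewrite ord1; apply: ler_norm_sqr; first by rewrite mulr_ge0// ltW.
  have := dot_coord u i.
  have := sqr_ge0 (u 0 0); rewrite exprMn; move: hu; clra.
- by split; rewrite ?trmx_delta ?p0 !mxE !eqxx ?ltr01// expr1n mulr1 ltr1n.
- by rewrite p0 mxE !eqxx.
Qed.

(* The polar form of v_0^2 - (v_1^2 + ... + v_n^2). *)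
Definition lorentz (u v : V) := 2 * (u 0 0 * v 0 0) - pr u^T v.

(** With c = lorentz u v, the quotient c / G is cosh d. The membership conditions force l a and l' b
    to be at least c + s, where s^2 = c^2 - G^2, so L >= (c + s) / G = e^d. The claim is then 2
    (cosh d - 1) = (e^d - 1)^2 / e^d <= (e^d - 1)^2. *)
Lemma std_distance (u v : V) (l l' G L : R) : std u -> std v ->
  std (l *: u - v) -> std (l' *: v - u) -> 0 < G ->
  G ^+ 2 = lorentz u u * lorentz v v -> 0 <= L -> l * l' <= L ^+ 2 ->
  2 * (lorentz u v - G) <= G * (L - 1) ^+ 2.
Proof.
move=> su sv sl sl' G0 GE L0 LE.
pose a := lorentz u u; pose b := lorentz v v; pose c := lorentz u v.
have a0 : 0 < a by have [u0 hu] := su; rewrite /a /lorentz subr_gt0 -expr2.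
have b0 : 0 < b by have [u0 hu] := sv; rewrite /b /lorentz subr_gt0 -expr2.
have csym : lorentz v u = c by rewrite /c /lorentz (dot_sym v u) (mulrC (v 0 0)).
have h1 : c < l * a.
  have := std_product su sl; rewrite -subr_gt0 prBr prZr !mxE.
  rewrite /c /a /lorentz; clra.
have h1' : c < l' * b.
  have := std_product sv sl'; rewrite -subr_gt0 prBr prZr !mxE (dot_sym v u).
  rewrite /c /b /lorentz; clra.
have h2 : 0 <= l ^+ 2 * a - 2 * l * c + b.
  have [_ h] := sl; apply: ltW; move: h; rewrite -subr_gt0 !mxE linearB/= linearZ/=.
  rewrite !prBl !prBr !prZl !prZr (dot_sym v u) /a /b /c /lorentz; clra.
have h2' : 0 <= l' ^+ 2 * b - 2 * l' * c + a.
  have [_ h] := sl'; apply: ltW; move: h; rewrite -subr_gt0 !mxE linearB/= linearZ/=.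
  rewrite !prBl !prBr !prZl !prZr (dot_sym v u) /a /b /c /lorentz; clra.
have [cG|Gc] := leP c G.
  apply: (@le_trans _ _ 0); last by rewrite mulr_ge0 ?sqr_ge0// ltW.
  by rewrite pmulr_rle0// subr_le0.
pose s := Num.sqrt (c ^+ 2 - G ^+ 2).
have c0 : 0 < c by exact: lt_trans Gc.
have d0 : 0 <= c ^+ 2 - G ^+ 2.
  by rewrite subr_ge0 lerXn2r ?nnegrE ?(ltW G0) ?(ltW c0) ?(ltW Gc).
have s2 : s ^+ 2 = c ^+ 2 - G ^+ 2 by rewrite sqr_sqrtr.
have s0 : 0 <= s by exact: sqrtr_ge0.
have la : s <= l * a - c.
  apply: (le_trans (ler_norm _)); apply: ler_norm_sqr; first by rewrite subr_ge0 ltW.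
  rewrite s2 GE -/a -/b -subr_ge0.
  have -> : (l * a - c) ^+ 2 - (c ^+ 2 - a * b) = a * (l ^+ 2 * a - 2 * l * c + b) by ring.
  by rewrite mulr_ge0// ltW.
have lb : s <= l' * b - c.
  apply: (le_trans (ler_norm _)); apply: ler_norm_sqr; first by rewrite subr_ge0 ltW.
  rewrite s2 GE -/a -/b -subr_ge0.
  have -> : (l' * b - c) ^+ 2 - (c ^+ 2 - a * b) = b * (l' ^+ 2 * b - 2 * l' * c + a) by ring.
  by rewrite mulr_ge0// ltW.
have cs0 : 0 <= c + s by rewrite addr_ge0// ltW.
have LG : c + s <= L * G.
  apply: (le_trans (ler_norm _)); apply: ler_norm_sqr; first by rewrite mulr_ge0// ltW.
  have h3 : (c + s) ^+ 2 <= (l * a) * (l' * b).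
    by rewrite expr2; apply: ler_pM => //; [move: la|move: lb]; clra.
  apply: (le_trans h3); rewrite exprMn GE -/a -/b mulrACA ler_wpM2r//.
  by rewrite mulr_ge0// ltW.
rewrite -(ler_pM2l G0).
have -> : G * (G * (L - 1) ^+ 2) = (L * G - G) ^+ 2 by ring.
have cG0 : 0 <= c + s - G by rewrite subr_ge0 (le_trans (ltW Gc))// lerDl.
apply: (@le_trans _ _ ((c + s - G) ^+ 2)).
  have -> : (c + s - G) ^+ 2 = (c ^+ 2 + 2 * c * s + s ^+ 2) + G ^+ 2 - 2 * (c + s) * G by ring.
  have -> : G ^+ 2 = c ^+ 2 - s ^+ 2 by rewrite s2; ring.
  rewrite -subr_ge0.
  have -> : c ^+ 2 + 2 * c * s + s ^+ 2 + (c ^+ 2 - s ^+ 2) - 2 * (c + s) * G -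
     G * (2 * (c - G)) = 2 * ((c - G) * (c + s - G)) by ring.
  by rewrite !mulr_ge0// subr_ge0 ltW.
by rewrite lerXn2r ?nnegrE ?lerD2r// (le_trans cG0)// lerD2r.
Qed.

End standard_cone.

Lemma hom_lift {R : realType} {n : nat} (x : 'cV[R]_n) i : hom x (lift ord0 i) 0 = x i 0.
Proof.
rewrite /hom mxE; case: splitP => k /= ik; first by have := ltn_ord k; rewrite -ik.
by congr (x _ _); apply: val_inj; move: ik => /= [].
Qed.

Section ball_lower.
Context {R : realType} {n' : nat}.
Notation n := n'.+1.
Notation P := (projective R n.+1).
Notation V := 'cV[R]_n.+1.
Variables (Om : set P) (o : P) (C : set V) (F : 'M[R]_n.+1).
Hypothesis chart : exists g : PGL R n.+1, bounded_convex_in_chart Om g.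
Hypothesis LC : lift_cone Om C.
Hypothesis FU : F \in unitmx.
Hypothesis CF : forall v, C (F *m v) <-> std v.
Hypothesis Oo : Om o.

(** Scales the transverse coordinates so that their squares add up to at most 1/4. *)
Let cs : R := (2 * n%:R)^-1.
Let cs0 : 0 < cs. Proof. by rewrite invr_gt0 mulr_gt0. Qed.

(* w theta s is a point of the ball at distance about theta^2 from the sphere. *)
Let q (th : R) (s : 'rV[R]_n) : R := th ^+ 2 * (1 + s 0 0).
Let w (th : R) (s : 'rV[R]_n) : 'cV[R]_n := \col_i
  if i == 0 then Num.sqrt (1 - \sum_(j | j != 0 :> 'I_n) (cs * s 0 j) ^+ 2 - q th s)
  else cs * s 0 i.
Let pt th s : V := hom (w th s).
Let unitbox (s : 'rV[R]_n) := forall i, 0 <= s 0 i <= 1.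

Let q_bounds th s : 0 < th -> unitbox s -> th ^+ 2 <= q th s <= 2 * th ^+ 2.
Proof.
move=> t0 us; have /andP[h1 h2] := us 0; have t2 : 0 < th ^+ 2 by rewrite exprn_gt0.
rewrite /q; apply/andP; split; first by rewrite -{1}[th ^+ 2]mulr1 ler_pM2l// lerDl.
by rewrite mulrC ler_pM2r// -[2]/(1 + 1) lerD2l.
Qed.

Let w_norm th s : 0 < th -> th <= 2^-1 -> unitbox s -> pr (w th s)^T (w th s) = 1 - q th s.
Proof.
move=> t0 t1 us; rewrite prE (bigD1 0)//= !mxE eqxx -expr2.
have /andP[_ hq] := q_bounds t0 us.
have th2 : th ^+ 2 <= 4^-1.
  have -> : 4^-1 = 2^-1 ^+ 2 :> R by rewrite exprVn -natrX.
  by rewrite lerXn2r ?nnegrE// ltW.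
have hs : \sum_(j | j != 0 :> 'I_n) (cs * s 0 j) ^+ 2 <= 4^-1.
  apply: (@le_trans _ _ (\sum_(j : 'I_n) cs ^+ 2)).
    rewrite [leRHS](bigD1 0)//= -[leLHS]add0r lerD ?sqr_ge0//; apply: ler_sum => j _.
    have /andP[h1 h2] := us j.
    by rewrite exprMn -[leRHS]mulr1 ler_wpM2l ?sqr_ge0// expr_le1.
  rewrite sumr_const card_ord -[_ *+ n'.+1]mulr_natl.
  have nn : 1 <= n%:R :> R by rewrite ler1n.
  have n0 : 0 < n%:R :> R by rewrite ltr0n.
  have e : n%:R * cs = 2^-1 by rewrite /cs; field; rewrite gt_eqF.
  have -> : 4^-1 = n%:R * (n%:R * cs ^+ 2) :> R by rewrite mulrA -expr2 -exprMn e exprVn -natrX.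
  by rewrite ler_peMl// mulr_ge0 ?sqr_ge0// ltW.
rewrite sqr_sqrtr; last by move: hq th2 hs; clra.
rewrite [X in _ + X = _](eq_bigr (fun j => (cs * s 0 j) ^+ 2)) => [|j j0]; first by rewrite addrAC subrK.
by rewrite !mxE (negbTE j0) -expr2.
Qed.

Let ptE th s s' : pr (pt th s)^T (pt th s') = 1 + pr (w th s)^T (w th s').
Proof.
rewrite !prE big_ord_recl; congr (_ + _).
  by rewrite mxE /pt hom00 hom00 mulr1.
apply: eq_bigr => i _.
by rewrite [_^T _ _]mxE [(w th s)^T _ _]mxE /pt !hom_lift.
Qed.

Let std_pt th s : 0 < th -> th <= 2^-1 -> unitbox s -> std (pt th s).
Proof.
move=> t0 t1 us; split; rewrite /pt hom00// ptE w_norm// expr1n mulr1.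
have /andP[h _] := q_bounds t0 us; have t2 : 0 < th ^+ 2 by rewrite exprn_gt0.
by move: h t2; clra.
Qed.

Let expR_small (t : R) : 0 <= t -> t <= 2^-1 -> (expR t - 1) ^+ 2 <= 4 * t ^+ 2.
Proof.
move=> t0 t1; have e1 : 1 <= expR t by rewrite -expR0 ler_expR.
have h : expR t <= 1 + 2 * t.
  have := expR_ge1Dx (- t); rewrite expRN => h.
  have ep := expR_gt0 t.
  have h2 : (1 - t) * expR t <= 1 by rewrite -ler_pdivlMr// mul1r.
  have : 1 * expR t <= (1 + 2 * t) * (1 - t) * expR t.
    rewrite ler_pM2r//; have : 0 <= t * (1 - 2 * t) by rewrite mulr_ge0//; move: t1; clra.
    by clra.
  rewrite mul1r -mulrA => /le_trans; apply.
  by rewrite -[leRHS]mulr1 ler_wpM2l// addr_ge0// mulr_ge0.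
have -> : 4 * t ^+ 2 = (2 * t) ^+ 2 by ring.
by rewrite lerXn2r ?nnegrE ?subr_ge0 ?mulr_ge0//; move: h; clra.
Qed.

(** The depth coordinate 0 is resolved at scale 1 and each of the other n - 1 at scale th, as in
    horospherical coordinates; this is the source of the factor th^-(n-1) in the volume. *)
Let coord_close th s s' p p' rho : 0 < th -> th <= 2^-1 -> unitbox s -> unitbox s' ->
  rp p (F *m pt th s) -> rp p' (F *m pt th s') -> 0 <= rho -> rho <= 4^-1 ->
  hilbert_metric Om p p' <= rho ->
  forall i, `|s 0 i - s' 0 i| <= (if i == 0 then 9 else 3 * th / cs) * rho.
Proof.
move=> t0 t1 us us' pp pp' r0 r1 hd.
have su := std_pt t0 t1 us; have su' := std_pt t0 t1 us'.
have /andP[q1 q2] := q_bounds t0 us; have /andP[q1' q2'] := q_bounds t0 us'.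
have t2 : 0 < th ^+ 2 by rewrite exprn_gt0.
have qp : 0 < q th s by exact: lt_le_trans q1.
have qp' : 0 < q th s' by exact: lt_le_trans q1'.
pose al := Num.sqrt (q th s); pose be := Num.sqrt (q th s').
have al2 : al ^+ 2 = q th s by rewrite sqr_sqrtr// ltW.
have be2 : be ^+ 2 = q th s' by rewrite sqr_sqrtr// ltW.
have al0 : 0 < al by rewrite sqrtr_gt0.
have be0 : 0 < be by rewrite sqrtr_gt0.
pose G := al * be; have G0 : 0 < G by rewrite mulr_gt0.
have lq x : unitbox x -> lorentz (pt th x) (pt th x) = q th x.
  by move=> ux; rewrite /lorentz ptE w_norm// /pt hom00; ring.
have GE : G ^+ 2 = lorentz (pt th s) (pt th s) * lorentz (pt th s') (pt th s').
  by rewrite !lq// /G exprMn al2 be2.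
pose N := pr (w th s - w th s')^T (w th s - w th s').
have NE : 2 * lorentz (pt th s) (pt th s') = N + q th s + q th s'.
  rewrite /lorentz ptE /pt !hom00 /N linearB/= !prBl !prBr !w_norm//.
  by rewrite (dot_sym (w th s') (w th s)); ring.
have G2 : G <= 2 * th ^+ 2.
  have e : 2 * th ^+ 2 = Num.sqrt ((2 * th ^+ 2) * (2 * th ^+ 2)).
    by rewrite -expr2 sqrtr_sqr ger0_norm// mulr_ge0// ltW.
  by rewrite e /G -sqrtrM ?(ltW qp)//; apply: ler_wsqrtr; apply: ler_pM => //; exact: ltW.
(* The left side is 2 (lorentz - G), which [std_distance] bounds by G (e^rho - 1)^2, up to a slack t
   that turns hd into a strict inequality. *)
have main : N + (al - be) ^+ 2 <= 8 * th ^+ 2 * rho ^+ 2.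
  apply: (@ler_small_slack _ _ _ (16 * th ^+ 2) 4^-1) => [//|t tp tl].
  have rt1 : rho < rho + t by rewrite ltrDl.
  have [l [l' [l0 l'0 Cl Cl' ll]]] := hilbert_lt chart LC ((CF _).2 su) ((CF _).2 su') pp pp'
    (le_lt_trans hd rt1).
  have sl : std (l *: pt th s - pt th s') by apply/CF; rewrite mulmxBr -scalemxAr.
  have sl' : std (l' *: pt th s' - pt th s) by apply/CF; rewrite mulmxBr -scalemxAr.
  have LL : l * l' <= expR (rho + t) ^+ 2.
    have -> : expR (rho + t) ^+ 2 = expR (2 * (rho + t)) by rewrite expRM_natl.
    exact: ltW.
  have h := std_distance su su' sl sl' G0 GE (expR_ge0 _) LL.
  have rt : rho + t <= 2^-1 by move: r1 tl; clra.
  have rt0 : 0 <= rho + t by rewrite addr_ge0// ltW.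
  have h2 := expR_small rt0 rt.
  have h3 : G * (expR (rho + t) - 1) ^+ 2 <= (2 * th ^+ 2) * (4 * (rho + t) ^+ 2).
    by apply: ler_pM => //; rewrite ?sqr_ge0// ltW.
  have h4 := le_trans h h3.
  have e : N + (al - be) ^+ 2 = 2 * (lorentz (pt th s) (pt th s') - G).
    rewrite mulrBr NE -al2 -be2 /G; ring.
  rewrite e; apply: (le_trans h4).
  have h5 : 2 * rho + t <= 1 by move: r1 tl; clra.
  have h6 : t * (2 * rho + t) <= t by rewrite -[leRHS]mulr1 ler_wpM2l// ltW.
  have h7 : 8 * th ^+ 2 * (t * (2 * rho + t)) <= 8 * th ^+ 2 * t.
    by rewrite ler_wpM2l// mulr_ge0// ltW.
  have h8 : 0 <= 8 * th ^+ 2 * t by rewrite !mulr_ge0// ltW.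
  have -> : 2 * th ^+ 2 * (4 * (rho + t) ^+ 2) =
    8 * th ^+ 2 * rho ^+ 2 + 8 * th ^+ 2 * (t * (2 * rho + t)) by ring.
  by move: h7 h8; clra.
have tr : 8 * th ^+ 2 * rho ^+ 2 <= (3 * th * rho) ^+ 2.
  have -> : (3 * th * rho) ^+ 2 = 9 * th ^+ 2 * rho ^+ 2 by ring.
  by have := mulr_ge0 (sqr_ge0 th) (sqr_ge0 rho); clra.
have tr0 : 0 <= 3 * th * rho by rewrite !mulr_ge0// ltW.
have N0 : 0 <= N by exact: dot_ge0.
have c1 : 0 <= cs by exact: ltW.
move=> i; case: eqVneq => [->|i0].
  have ab : `|al - be| <= 3 * th * rho.
    by apply: ler_norm_sqr => //; apply: le_trans tr; move: main N0; clra.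
  have bnd x : unitbox x -> Num.sqrt (q th x) <= 3 / 2 * th.
    move=> ux; have /andP[_ hx] := q_bounds t0 ux.
    apply: (le_trans (ler_norm _)); apply: ler_norm_sqr; first by rewrite mulr_ge0// ltW.
    rewrite sqr_sqrtr; last by rewrite ltW// (lt_le_trans t2)//; have /andP[] := q_bounds t0 ux.
    by move: hx t2; clra.
  have h1 := bnd s us; have h2 := bnd s' us'; rewrite -/al -/be in h1 h2.
  have e : th ^+ 2 * (s 0 0 - s' 0 0) = (al - be) * (al + be).
    have -> : (al - be) * (al + be) = al ^+ 2 - be ^+ 2 by ring.
    by rewrite al2 be2 /q; ring.
  rewrite -(ler_pM2l t2) -{1}(gtr0_norm t2) -normrM e normrM.
  rewrite (gtr0_norm (addr_gt0 al0 be0)).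
  have -> : th ^+ 2 * (9 * rho) = 3 * th * rho * (3 * th) by ring.
  by apply: ler_pM => //; [rewrite addr_ge0// ltW|move: h1 h2; clra].
have h : `|(w th s - w th s') i 0| <= 3 * th * rho.
  apply: ler_norm_sqr => //; apply: le_trans tr; apply: le_trans main.
  rewrite -[leLHS]addr0 lerD ?sqr_ge0//.
  exact: dot_coord.
have e : (w th s - w th s') i 0 = cs * (s 0 i - s' 0 i).
  by rewrite !mxE (negbTE i0); ring.
rewrite e normrM (gtr0_norm cs0) in h.
by rewrite -(ler_pM2l cs0) (le_trans h)// le_eqVlt; apply/orP; left; apply/eqP;
  field; rewrite gt_eqF.
Qed.

(** The comparison passes through the center e: o and e dominate each other up to constants, while 3
    e dominates the point and 3 / q times the point dominates e. The product of the gauges is of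
    order 1 / q <= 1 / th^2, to be compared with e^(2 r). *)
Let center_dist : exists2 a : R, 0 < a & forall r th s p, 0 < th -> th <= 2^-1 -> unitbox s ->
  rp p (F *m pt th s) -> 4 * a * expR (- r) <= th -> hilbert_metric Om o p < r.
Proof.
have [u Cu ou] := (LC.2 o).1 Oo.
pose vo := invmx F *m u; have voE : F *m vo = u by rewrite mulKVmx.
have svo : std vo by apply/CF; rewrite voE.
have se := cone_base (@based_std R n); set e : V := delta_mx 0 0 in se.
have [a1 a10 Ha1] := cone_dom based_std svo; have [a2 a20 Ha2] := cone_dom based_std se.
have v00 : 0 < pr (delta_mx 0 0) vo by by have := cone_pos based_std svo.
have h1 : std (a1 *: vo - e).
  by have := Ha1 _ se; rewrite (cone_base1 based_std) mulr1.
have h2 := Ha2 _ svo; set b2 := a2 * _ in h2.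
have b20 : 0 < b2 by rewrite mulr_gt0.
pose a := a1 + b2; have a0 : 0 < a by rewrite addr_gt0.
exists a => // r th s p t0 t1 us pp hr.
have su := std_pt t0 t1 us; have /andP[q1 q2] := q_bounds t0 us.
have t2 : 0 < th ^+ 2 by rewrite exprn_gt0.
have qp : 0 < q th s by exact: lt_le_trans q1.
have th2 : th ^+ 2 <= 4^-1.
  have -> : 4^-1 = 2^-1 ^+ 2 :> R by rewrite exprVn -natrX.
  by rewrite lerXn2r ?nnegrE// ltW.
have e00 : e 0 0 = 1 by rewrite /e mxE !eqxx.
have ee : pr e^T e = 1 by rewrite /e trmx_delta -[delta_mx 0 0 in X in pr _ X]mul1mx pr_delta mxE eqxx.
have ew : pr e^T (pt th s) = 1.
  by rewrite /e trmx_delta -[pt _ _]mul1mx /pr -rowE mul1mx mxE /pt hom00.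
have sE (a' b : V) (x : R) : (x *: a' - b) 0 0 = x * a' 0 0 - b 0 0 by rewrite !mxE.
have cE x : (x *: e - pt th s) 0 0 = x - 1.
  by rewrite sE e00 /pt hom00 mulr1.
have cE' x : (x *: pt th s - e) 0 0 = x - 1.
  by rewrite sE e00 /pt hom00 mulr1.
have h3 : std (3 *: e - pt th s).
  split; rewrite cE; first by clra.
  rewrite linearB/= linearZ/= !prBl !prBr !prZl !prZr ee (dot_sym (pt th s)) ew ptE w_norm//.
  by move: qp; clra.
have h4 : std ((3 / q th s) *: pt th s - e).
  have q3 : 1 < 3 / q th s by rewrite ltr_pdivlMr// mul1r; move: q2 th2; clra.
  split; rewrite cE' ?subr_gt0//.
  rewrite linearB/= linearZ/= !prBl !prBr !prZl !prZr ee (dot_sym (pt th s)) ew ptE w_norm//.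
  set x := 3 / q th s in q3 *; have xq : x * q th s = 3 by rewrite /x divfK// gt_eqF.
  rewrite -subr_gt0.
  have -> : 2 * (x - 1) ^+ 2 - (x * (x * (1 + (1 - q th s))) - x * 1 - (x * 1 - 1)) =
     x * (x * q th s) - 2 * x + 1 by ring.
  by rewrite xq; move: q3; clra.
have aE : 0 < a / b2 by rewrite divr_gt0.
have l1 : std ((3 * a1) *: vo - pt th s).
  have -> : (3 * a1) *: vo - pt th s = 3 *: (a1 *: vo - e) + (3 *: e - pt th s).
    by rewrite scalerBr scalerA addrA subrK.
  by apply: stdD => //; apply: stdZ.
have l2 : std ((b2 * (3 / q th s)) *: pt th s - vo).
  have -> : (b2 * (3 / q th s)) *: pt th s - vo =
     b2 *: ((3 / q th s) *: pt th s - e) + (b2 *: e - vo).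
    by rewrite scalerBr scalerA addrA subrK.
  by apply: stdD => //; apply: stdZ.
have Cl1 : C ((3 * a1) *: u - F *m pt th s).
  by have /CF := l1; rewrite mulmxBr -scalemxAr voE.
have Cl2 : C ((b2 * (3 / q th s)) *: (F *m pt th s) - u).
  by have /CF := l2; rewrite mulmxBr -scalemxAr voE.
apply: (le_lt_trans (hilbert_le chart LC Cu ((CF _).2 su) ou pp Cl1 Cl2)).
rewrite ltr_pdivrMl// -[ltRHS]expRK ltr_ln ?posrE ?expR_gt0//; last first.
  by rewrite !mulr_gt0// invr_gt0.
have -> : 3 * a1 * (b2 * (3 / q th s)) = 9 * (a1 * b2) / q th s by ring.
have er : expR (2 * r) * expR (- r) ^+ 2 = 1.
  by rewrite expRN exprVn -expRM_natl mulfV// gt_eqF// expR_gt0.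
rewrite ltr_pdivrMr//.
have h5 : (4 * a * expR (- r)) ^+ 2 <= q th s.
  by apply: le_trans q1; rewrite lerXn2r ?nnegrE ?(ltW t0)// mulr_ge0 ?expR_ge0// mulr_ge0// ltW.
apply: (@lt_le_trans _ _ (expR (2 * r) * (4 * a * expR (- r)) ^+ 2)); last first.
  by rewrite ler_pM2l// expR_gt0.
have -> : expR (2 * r) * (4 * a * expR (- r)) ^+ 2 = 16 * a ^+ 2.
  by rewrite exprMn mulrCA er; ring.
have := mulr_gt0 a10 b20; have := sqr_ge0 a1; have := sqr_ge0 b2; rewrite /a; clra.
Qed.

(** With th proportional to e^-r the whole box lies in the ball of radius r, and [box_cover_le]
    bounds the sum of the n-th powers of the diameters below by a multiple of th^-(n-1). Diameters
    up to 1/4 are allowed, and refining covers only increases the measure. *)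
Lemma premeasure_ge : exists2 B : R, 0 < B & exists r0, forall r, r0 < r ->
  ((B * expR (n'%:R * r))%:E <= hausdorff_premeasure n Om (hilbert_metric Om) 4^-1
     (metric_ball Om (hilbert_metric Om) o r))%E.
Proof.
have [a a0 Ha] := center_dist.
pose c := unit_ball_volume n / 2 ^+ n : R.
have c0 : 0 < c by rewrite divr_gt0 ?exprn_gt0// unit_ball_volume_gt0.
pose ka := (2 ^+ n * (9 * (3 / cs) ^+ n'))%R.
have ka0 : 0 < ka by rewrite !mulr_gt0 ?exprn_gt0// divr_gt0.
pose B := c * (ka * (4 * a) ^+ n')^-1.
have B0 : 0 < B by rewrite mulr_gt0// invr_gt0 mulr_gt0// exprn_gt0// mulr_gt0.
exists B => //; exists (ln (8 * a)) => r rr.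
pose th := 4 * a * expR (- r).
have th0 : 0 < th by rewrite !mulr_gt0 ?expR_gt0.
have th1 : th <= 2^-1.
  have : 8 * a < expR r by rewrite -[8 * a]lnK ?posrE ?mulr_gt0// ltr_expR.
  rewrite /th expRN => h; rewrite ler_pdivrMr ?expR_gt0//; move: h; clra.
pose M0 := (ka * th ^+ n')^-1.
have M00 : 0 < M0 by rewrite invr_gt0 mulr_gt0// exprn_gt0.
have BE : B * expR (n'%:R * r) = c * M0.
  rewrite /B /M0 -mulrA; congr (_ * _); rewrite /th [(4 * a * _) ^+ _]exprMn expRN exprVn expRM_natl.
  have e0 : expR r ^+ n' != 0 by rewrite expf_neq0// gt_eqF// expR_gt0.
  have k0 : ka != 0 by rewrite gt_eqF.
  have a4 : (4 * a) ^+ n' != 0 by rewrite expf_neq0// gt_eqF// mulr_gt0.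
  by field; rewrite e0 k0 a4.
rewrite BE; apply: le_ereal_inf_tmp => _ [E [EO Ecov Ed] <-].
have dE k : exists rho, [/\ diameter (hilbert_metric Om) (E k) = rho%:E, 0 <= rho, rho <= 4^-1 &
    forall x y, E k x -> E k y -> hilbert_metric Om x y <= rho] by exact: diameter_fin.
have [rho Hrho] := choice dE.
have tE k : ((unit_ball_volume n / 2 ^+ n)%:E * diameter (hilbert_metric Om) (E k) ^+ n)%E =
    (c * rho k ^+ n)%:E.
  by have [-> _ _ _] := Hrho k; rewrite -EFin_expe -EFinM.
under eq_eseriesr do rewrite tE.
have t0 k : 0 <= c * rho k ^+ n.
  by have [_ h _ _] := Hrho k; rewrite mulr_ge0 ?exprn_ge0// ltW.
set S := (\sum_(0 <= k <oo) _)%E.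
rewrite leNgt; apply/negP => SM.
have S0 : (0 <= S)%E by apply: nneseries_ge0 => k _ _; rewrite lee_fin.
have [x Sx] : exists x, S = x%:E.
  by move: SM S0; case: S => [x _ _|//|//]; exists x.
have part N : \sum_(0 <= k < N) rho k ^+ n <= x / c.
  rewrite ler_pdivlMr// mulrC mulr_sumr -lee_fin -Sx -sumEFin.
  by apply: nneseries_lim_ge => k _ _; rewrite lee_fin.
pose al (i : 'I_n) : R := if i == 0 then 9 else 3 * th / cs.
pose EE k := [set s : 'rV[R]_n | unitbox s /\ exists2 p, E k p & rp p (F *m pt th s)].
have box := @box_cover_le R n al rho EE (x / c).
have : 1 <= 2 ^+ n * (\prod_i al i) * (x / c).
  apply: box => [i|k|k s s' [us [p Ep pp]] [us' [p' Ep' pp']] i|s us|//].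
  - by rewrite /al; case: ifP => _ //; rewrite divr_gt0// mulr_gt0.
  - by have [_ h _ _] := Hrho k.
  - have [_ h1 h2 h3] := Hrho k.
    exact: (coord_close th0 th1 us us' pp pp' h1 h2 (h3 _ _ Ep Ep')).
  - have su := std_pt th0 th1 us.
    have [p pp] : exists p, rp p (F *m pt th s).
      apply: rp_ex; apply: act_neq0 => //; apply/eqP => p0.
      by case: su => + _; rewrite p0 mxE ltxx.
    have Op : Om p by apply/(LC.2 p); exists (F *m pt th s) => //; apply/CF.
    have [k _ Ek] := Ecov p (conj Op (Ha r th s p th0 th1 us pp (lexx _))).
    by exists k; split => //; exists p.
have alE : \prod_i al i = 9 * (3 / cs) ^+ n' * th ^+ n'.
  rewrite big_ord_recl {1}/al eqxx -mulrA -exprMn; congr (_ * _).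
  rewrite (eq_bigr (fun=> 3 / cs * th)) => [|i _]; last by rewrite /al /= mulrAC.
  by rewrite prodr_const card_ord.
rewrite alE leNgt => /negP; apply.
have -> : 2 ^+ n * (9 * (3 / cs) ^+ n' * th ^+ n') = M0^-1 by rewrite /M0 /ka invrK; ring.
rewrite ltr_pdivrMl// mulr1 ltr_pdivrMr// mulrC -lte_fin -Sx//.
Qed.

Lemma entropy_ge : (n'%:R%:E <= volume_entropy Om (hilbert_metric Om) (busemann_volume Om) o)%E.
Proof.
have [B B0 [r0 Hr]] := premeasure_ge.
apply: limf_esup_ge => e e0; exists (Num.max (Num.max 1 r0) (`|ln B| / e)) => r.
rewrite !gt_max => /andP[/andP[r1 rr0] re]; have rp : 0 < r by exact: lt_trans r1.
have Be : 0 < B * expR (n'%:R * r) by rewrite mulr_gt0 ?expR_gt0.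
apply: (@le_trans _ _ ((r^-1)%:E * (ln (B * expR (n'%:R * r)))%:E)%E).
  rewrite -EFinM lee_fin lnM ?posrE ?expR_gt0// expRK mulrDr.
  have -> : r^-1 * (n'%:R * r) = n'%:R by field; rewrite gt_eqF.
  rewrite addrC lerD2r -lerNl -mulrN ler_pdivrMl//.
  rewrite (le_trans (ler_norm _))// normrN.
  by move: re; rewrite ltr_pdivrMr// => /ltW.
rewrite lee_pmul2l ?lte_fin ?invr_gt0// -lne_EFin//.
have h : ((B * expR (n'%:R * r))%:E <= busemann_volume Om (metric_ball Om (hilbert_metric Om) o r))%E.
  apply: (le_trans (Hr r rr0)); apply: ereal_sup_ubound; exists 4^-1 => //=.
rewrite lee_lne ?in_itv/= ?leey ?andbT// ?lee_fin ?ltW//.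
by apply: (lt_le_trans _ h); rewrite lte_fin.
Qed.

End ball_lower.

Section ball_cone.
Context {R : realType} {n : nat}.
Notation P := (projective R n.+1).
Notation V := 'cV[R]_n.+1.

Lemma srepr1 : exists2 c : R, c != 0 & srepr (1%g : PGL R n.+1) = c%:M.
Proof.
have [c c0 E] := srepr_sclass (U := [set g : 'M[R]_n.+1 | g \in unitmx]) (unitmx1 R n.+1).
by exists c => //; rewrite -scalemx1.
Qed.

Lemma rp_chart1 (x : 'cV[R]_n) : rp (affine_chart 1%g x) (hom x).
Proof.
have [c c0 E] := srepr1; have := rp_chart 1%g x; rewrite E mul_scalar_mx => H.
have := rp_scaled (_ : c^-1 != 0) H; rewrite scalerA mulVf// scale1r; apply.
by rewrite invr_neq0.
Qed.

Lemma std_hom (x : 'cV[R]_n) : std (hom x) <-> euclidean_norm x < 1.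
Proof.
have e : pr (hom x)^T (hom x) = 1 + \sum_i x i 0 ^+ 2.
  rewrite prE big_ord_recl mxE hom00 mulr1; congr (_ + _).
  by apply: eq_bigr => i _; rewrite mxE hom_lift.
have -> : (euclidean_norm x < 1) = (\sum_i x i 0 ^+ 2 < 1).
  by rewrite -[X in _ < X]sqrtr1 ltr_sqrt.
rewrite /std /= hom00 e expr1n mulr1 -[2]/(1 + 1) ltrD2l.
by split => [[]|].
Qed.

Lemma std_ball (p : P) : projective_ball R n p <-> exists2 v, std v & rp p v.
Proof.
split=> [[x /= nx <-]|[v sv pv]].
  by exists (hom x); [apply/std_hom|exact: rp_chart1].
have v0 : 0 < v 0 0 by case: sv.
exists ((v 0 0)^-1 *: @dsubmx _ 1 n 1 v) => /=.
  apply/std_hom; have := stdZ (_ : 0 < (v 0 0)^-1) sv; rewrite invr_gt0 => /(_ v0).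
  by rewrite {2}(hconeE v0) scalerA mulVf ?gt_eqF// scale1r.
apply: (rp_eq (v := v)) => //; have := rp_scaled _ (rp_chart1 ((v 0 0)^-1 *: @dsubmx _ 1 n 1 v)).
by move=> /(_ (v 0 0)); rewrite gt_eqF// -hconeE//; apply.
Qed.

Lemma projectively_isomorphic_ball (Om : set P) (C : set V) (F : 'M[R]_n.+1) :
  lift_cone Om C -> F \in unitmx -> (forall v, C (F *m v) <-> std v) ->
  projectively_isomorphic Om (projective_ball R n).
Proof.
move=> LC FU CF; pose phi : PGL R n.+1 := pgl_of (invmx_unit FU); exists phi.
have [c c0 E] : exists2 c : R, c != 0 & srepr phi = c *: invmx F.
  exact: (srepr_sclass (U := [set g : 'M[R]_n.+1 | g \in unitmx])).
have act p u : rp p u -> rp (pgl_act phi p) (invmx F *m u).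
  move=> pu; have := rp_act phi pu; rewrite E -scalemxAl => H.
  have := rp_scaled (_ : c^-1 != 0) H; rewrite scalerA mulVf// scale1r; apply.
  by rewrite invr_neq0.
apply/seteqP; split => [_ [p /LC.2[u Cu pu] <-]|p /std_ball[v sv pv]].
  apply/std_ball; exists (invmx F *m u); last exact: act.
  by apply/CF; rewrite mulKVmx.
have Fv0 : F *m v != 0 by exact: act_neq0 (rp_neq0 pv).
have [r rF] := rp_ex Fv0; exists r.
  by apply/LC.2; exists (F *m v) => //; apply/CF.
by apply: rp_eq pv; have := act _ _ rF; rewrite mulKmx.
Qed.

Lemma ball_lift (Om : set P) (phi : PGL R n.+1) : pgl_act phi @` Om = projective_ball R n ->
  lift_cone Om [set u | std (srepr phi *m u)].
Proof.
move=> E; have gU := PGL_unit phi; split.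
  exists (delta_mx 0 0 *m srepr phi), (invmx (srepr phi) *m delta_mx 0 0).
  have := based_cone_mx (_ : invmx (srepr phi) \in unitmx) (@based_std R n).
  by rewrite unitmx_inv invmxK; apply.
move=> p; split=> [Op|[u su pu]].
  have /std_ball[v sv pv] : projective_ball R n (pgl_act phi p) by rewrite -E; exists p.
  exists (invmx (srepr phi) *m v); first by rewrite /= mulKVmx.
  by apply: (rp_act_inv (g := phi)); rewrite mulKVmx.
have : projective_ball R n (pgl_act phi p).
  by apply/std_ball; exists (srepr phi *m u) => //; exact: rp_act.
rewrite -E => -[q Oq qp]; suff -> : p = q by [].
have qv := rp_srepr q; have := rp_act phi qv; rewrite qp => /rp_act_inv pq.
exact: rp_eq pq qv.
Qed.

End ball_cone.

Section upper_bound.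
Context {R : realType} {n : nat}.
Notation P := (projective R n.+1).
Notation G := (PGL R n.+1).
Variables (Om : set P) (o : P) (Gamma : set G).
Hypothesis n0 : (0 < n)%N.
Hypothesis POm : proper_convex Om.
Hypothesis Oo : Om o.
Hypothesis Gsub : is_subgroup Gamma.
Hypothesis Gaut : Gamma `<=` Aut Om.
Hypothesis Gdisc : discrete_subset Gamma.
Hypothesis Gcoc : acts_cocompactly Gamma Om.
Notation h_vol := (volume_entropy Om (hilbert_metric Om) (busemann_volume Om) o).

Lemma entropy_critical : exists kc : R, [/\ (h_vol <= (2 * kc)%:E)%E, 2 * kc <= n%:R - 1
  & 2 * kc = n%:R - 1 -> projectively_isomorphic Om (projective_ball R n)].
Proof.
have [_ [g0 Hg0]] := POm; have chart : exists g, bounded_convex_in_chart Om g by exists g0.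
have [D [nD OE _]] := chart_data Hg0.
have [xo Dxo xoE] : exists2 x, D x & affine_chart g0 x = o by move: Oo; rewrite OE => -[x]; exists x.
have LC : lift_cone Om (chart_cone g0 D) by apply: chart_lift nD OE _; exists o.
have HC := based_cone_mx (PGL_unit g0) (based_hcone nD Dxo).
have oE : rp o (srepr g0 *m hom xo) by rewrite -xoE; exact: rp_chart.
have [g Hg] := family_exists n0 HC LC Gsub Gaut Gdisc Gcoc.
have [kc [kc0 nkc ks]] := critical_exponent HC Hg.
have N0 : 0 < n%:R :> R by rewrite ltr0n.
have NE : n%:R = n.+1%:R - 1 :> R by rewrite -addn1 natrD addrK.
have [K K0 HK] := fam_cocpt Hg.
exists kc; split.
- apply/lee_addgt0Pr => e e0.
  have := entropy_le n0 chart nD LC oE HC Hg (_ : 0 <= kc + e / 2) (ks _ _).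
  have -> : 2 * (kc + e / 2) = 2 * kc + e by field.
  by rewrite EFinD; apply; rewrite ?addr_ge0 ?ltrDl ?divr_gt0// ltW ?divr_gt0.
- exact: (critical_le HC Hg K0 HK kc0 nkc ks N0 NE).
- move=> E; have [x [y [W [[Cx yx Ws Wx] WU W0 y1y Hq]]]] := invariant_form HC Hg kc0 nkc ks N0 NE E.
  have CQ := cone_quadric HC Hg N0 Cx yx Ws Wx WU W0 y1y Hq.
  have [F FU CF] := cone_standard_form N0 yx Ws Wx WU W0 CQ.
  exact: projectively_isomorphic_ball LC FU CF.
Qed.

Lemma ball_entropy_ge : projectively_isomorphic Om (projective_ball R n) ->
  ((n%:R - 1)%:E <= h_vol)%E.
Proof.
move=> [phi E]; have [_ [g0 Hg0]] := POm.
have chart : exists g, bounded_convex_in_chart Om g by exists g0.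
have LC := ball_lift E; have gU := PGL_unit phi.
have FU : invmx (srepr phi) \in unitmx by rewrite unitmx_inv.
have CF v : [set u | std (srepr phi *m u)] (invmx (srepr phi) *m v) <-> std v.
  by rewrite /= mulKVmx.
move: (n0) Om o Oo chart phi E LC gU FU CF; clear.
case: n => // n' _ Om o Oo chart phi E LC gU FU CF.
have -> : n'.+1%:R - 1 = n'%:R :> R by rewrite -addn1 natrD addrK.
exact: entropy_ge chart LC FU CF Oo.
Qed.

End upper_bound.

Theorem theorem1p7 (R : realType) (n : nat) (Omega : set (projective R n.+1))
    (o : projective R n.+1) :
  (0 < n)%N ->
  proper_convex Omega ->
  Omega o ->
  (exists Gamma : set (PGL R n.+1),
    [/\ is_subgroup Gamma, Gamma `<=` Aut Omega, discrete_subset Gamma,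
        acts_properly Gamma Omega
      & acts_freely Gamma Omega /\ acts_cocompactly Gamma Omega]) ->
  let h_vol := volume_entropy Omega (hilbert_metric Omega)
                 (busemann_volume Omega) o in
  [/\ (h_vol <= (n%:R - 1)%:E)%E,
      h_vol = (n%:R - 1)%:E <->
        projectively_isomorphic Omega (projective_ball R n)
    & h_vol = (n%:R - 1)%:E ->
        isometric Omega (hilbert_metric Omega)
          (projective_ball R n) (hilbert_metric (projective_ball R n))].
Proof.
move=> n0 POm Oo [Gamma [Gsub Gaut Gdisc _ [_ Gcoc]]] h_vol.
have [kc [hk kn keq]] := entropy_critical n0 POm Oo Gsub Gaut Gdisc Gcoc.
have iso : h_vol = (n%:R - 1)%:E -> projectively_isomorphic Omega (projective_ball R n).
  (* Equality squeezes 2 kc between h_vol and n - 1. *)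
  move=> hE; apply: keq; apply/eqP; rewrite eq_le kn/= -lee_fin -hE; exact: hk.
have le_n : (h_vol <= (n%:R - 1)%:E)%E by apply: (le_trans hk); rewrite lee_fin.
split=> // [|/iso[phi <-]]; last exact: hilbert_isometry.
split=> // /(ball_entropy_ge n0 POm Oo) h.
by apply/eqP; rewrite eq_le le_n.
Qed.
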